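(* Let $K$ be an algebraic number field of degree $n > 3$ over $\mathbb{Q}$ such that the absolute value of its discriminant satisfies $|d_K| \in \mathbb{R} \setminus [(44.763)^{n}, (215.333)^{n}]$. Then $$\zeta_K(1/2) = 0 \iff \zeta_K'(1/2) = 0.$$
   Context: For a number field $K$, $d_K$ denotes its discriminant and $\zeta_K(s)$ denotes the Dedekind zeta function of $K$, i.e. the meromorphic continuation to $\mathbb{C}$ (holomorphic except for a simple pole at $s=1$) of $\sum_{I \neq 0} N(I)^{-s}$, $\Re(s)>1$, the sum being over the nonzero ideals of the ring of integers of $K$. $\zeta_K'$ denotes its derivative in $s$. The numbers $44.763$ and $215.333$ are exact decimals. *)

(* Defs.v *)
From mathcomp Require Import all_boot all_order all_algebra all_field.
From mathcomp Require Import finmap complex.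
From mathcomp Require Import all_classical all_reals all_analysis.
From mathcomp Require Import summability.

Set Implicit Arguments.
Unset Strict Implicit.
Unset Printing Implicit Defensive.

Import Order.TTheory GRing.Theory Num.Theory numFieldNormedType.Exports.

Local Open Scope classical_set_scope.
Local Open Scope ring_scope.
Local Open Scope complex_scope.

(* A number field is a [K : fieldExtType rat], i.e. a field of finite degree
   [\dim {:K}] over the rationals. *)

Section NumberField.
Variable K : fieldExtType rat.

Definition ring_of_integers : set K :=
  [set x | integralOver (intr : int -> K) x].

(* Additive inverses are obtained by absorbing multiplication by -1. *)
Definition is_ideal (I : set K) : Prop :=
  [/\ I `<=` ring_of_integers, I 0,
      forall x y, I x -> I y -> I (x + y) &
      forall a x, ring_of_integers a -> I x -> I (a * x)].

Definition nonzero_ideals : set (set K) :=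
  [set I | is_ideal I /\ I <> [set 0]].

(* The number of cosets x + I with x integral.  This number is finite when I is
   a nonzero ideal; [fset_set] returns the empty set on an infinite set. *)
Definition ideal_norm (I : set K) : nat :=
  #|` fset_set [set [set x + y | y in I] | x in ring_of_integers]|.

Definition field_trace (x : K) : rat :=
  \tr (passmx.mxof (vbasis {:K}) (vbasis {:K}) (amulr x)).

Definition integral_basis (b : (\dim {:K}).-tuple K) : Prop :=
  basis_of {:K} b /\ (forall x, ring_of_integers x <-> inIntSpan b x).

(* Integral bases exist, and the determinant does not depend on the basis, so
   the default value 0 is never used. *)
Definition discriminant : rat :=
  xget 0 [set d | exists2 b : (\dim {:K}).-tuple K, integral_basis b &
    d = \det (\matrix_(i, j) field_trace (tnth b i * tnth b j))].

End NumberField.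

Arguments ring_of_integers : clear implicits.
Arguments nonzero_ideals : clear implicits.

Section DedekindZeta.
Variable R : realType.

Definition cexp (z : R[i]) : R[i] :=
  (expR (complex.Re z))%:C * (cos (complex.Im z) +i* sin (complex.Im z)).

(* n ^ s for n > 0 *)
Definition nat_cpow (n : nat) (s : R[i]) : R[i] := cexp (s * (ln n%:R)%:C).

(* The regular module structure [R[i]^o] carries the topology of the complex
   norm, and differentiability over it is complex differentiability.  The
   series is summed along the filter of finite sets of ideals; the function is
   determined by the conditions below, except for its (irrelevant) value at the
   pole. *)
Definition is_dedekind_zeta (K : fieldExtType rat)
    (zeta : R[i]^o -> R[i]^o) : Prop :=
  [/\ forall s : R[i]^o, 1 < complex.Re s ->
        partial_sum (fun I : set_type (nonzero_ideals K) =>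
          nat_cpow (ideal_norm (set_val I)) (- s) : R[i]^o) @ totally --> zeta s,
      forall s : R[i]^o, s != 1 -> derivable zeta s 1 &
      exists2 c : R[i]^o, c != 0 &
        (s - 1) * zeta s @[s --> (1 : R[i]^o)^'] --> c].

End DedekindZeta.

(* Main.v *)
(* Let n = [K : Q], d = |d_K|, and let the archimedean places v of K have local
   degrees m_v, so that their sum is n.  The plan is to find an entire function L with
   L(1 - s) = L(s) and L(s) = p(s) d^(s/2) G(s) zeta_K(s), where G is the product over
   v of the integrals of exp(- pi m_v e^(2t) + s m_v t) dt and
   p(s) = 2 cosh(n (s - 1/2)) - 2 cosh(n/2) cancels the poles at 0 and 1.  Then
   L'(1/2) = 0, p'(1/2) = 0 and p(1/2) <> 0, whence
   zeta_K'(1/2) + S zeta_K(1/2) = 0 with S = (ln d)/2 + (G'/G)(1/2).  The claim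
   follows as soon as S <> 0; but S = 0 would force
   ln d = r_1 ln(8 pi e^(gamma + pi/2)) + 2 r_2 ln(8 pi e^gamma), and
   44.763 < 8 pi e^gamma, 8 pi e^(gamma + pi/2) < 215.333 would put d in the
   excluded interval.

   L is obtained without class groups or units.  For a fractional ideal M and u in
   R^places let theta(M, u) be the sum of the Gaussians exp(- pi sum_v m_v |x|_v^2 e^(2 u_v))
   over the nonzero x in M, and let y(M, u) be the logarithm of the covolume of M
   rescaled by e^u.  Both are invariant under K^*, so theta e^(sy) can be integrated
   over (fractional ideals x R^places) / K^*, by means of any weight W >= 0 whose
   K^*-translates add up to 1.  Choosing for W the term x = 1 of the theta series
   divided by theta, supported on the M containing 1, gives d^(s/2) G(s) zeta_K(s),
   since the M containing 1 are the inverses of the integral ideals.  Poisson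
   summation relates theta(M, u) to theta at the dual lattice and - u, which yields
   the symmetry; the pole terms disappear because only a linear combination of
   translates of theta annihilating them is integrated. *)
Require Import Defs.
From HB Require Import structures.
From mathcomp Require Import all_boot all_order all_algebra all_field.
From mathcomp Require Import finmap complex.
From mathcomp Require Import all_classical all_reals all_analysis.
From mathcomp Require Import summability measurable_realfun.
From mathcomp Require Import ring lra zify.

Set Implicit Arguments.
Unset Strict Implicit.
Unset Printing Implicit Defensive.

Import Order.TTheory GRing.Theory Num.Theory numFieldNormedType.Exports.
Local Open Scope classical_set_scope.
Local Open Scope ring_scope.
Local Open Scope complex_scope.

Local Notation normc := ComplexField.Normc.normc.
Local Notation Re := complex.Re.
Local Notation Im := complex.Im.

(** * Cauchy's theorem on rectangles and the identity theorem *)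

(** Two obstacles shape the proof. The zeta function is known through its series for Re s > 1 and
    through holomorphy only. Its series is therefore used at real s, where all terms are
    nonnegative: sums and integrals are exchanged by Tonelli in [0, +oo], twisted Gaussians carry
    the weight 1 + cos instead of cos, and L is the difference of two Laplace transforms of
    nonnegative densities, entire because all exponential moments are finite. Each identity found on
    a real interval is spread by the identity theorem. The other obstacle is numerical. Since 8 pi
    e^gamma = 44.7632... and 8 pi e^(gamma + pi/2) = 215.3325..., the two decimals leave a relative
    margin of a few millionths. The constant gamma is never computed: what is estimated are the
    values of the digamma function at 1/2, - gamma - 2 ln 2, and at 1/4, - gamma - pi/2 - 3 ln 2,
    and this function is obtained as a logarithmic derivative of the Gaussian integrals over t in R,
    controlled by its recurrence and by a convexity inequality. *)

Section SegmentIntegral.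
Context {R : realType}.
Implicit Types (f g : R -> R) (a b c M : R).
Local Notation mu := (@lebesgue_measure R).

(** Continuity relative to the segment, one-sided at its ends: it can be checked along a single edge
    of a contour and restricts at once to smaller segments. *)
Definition cts_on (a b : R) (f : R -> R) :=
  forall x, a <= x <= b -> forall e, 0 < e -> exists2 d, 0 < d &
    forall y, a <= y <= b -> `|y - x| < d -> `|f y - f x| <= e.

Lemma cts_on_within a b f : cts_on a b f -> {within `[a, b], continuous f}.
Proof.
move=> cf; apply/subspace_continuousP => x; rewrite /= in_itv /= => xab.
apply/cvgrPdist_le => e e0; have [d d0 H] := cf x xab e e0.
apply/nbhs_ballP; exists d => // y /= xy yab.
by rewrite distrC; apply: H => //; rewrite distrC.
Qed.

Lemma cts_on_integrable a b f : cts_on a b f ->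
  mu.-integrable `[a, b] (EFin \o f).
Proof.
move=> /cts_on_within cf; apply: continuous_compact_integrable => //.
exact: segment_compact.
Qed.

(** Not oriented: the value is 0 for [b < a]. The orientation of contours is put in by hand through
    the signs in [rect]. *)
Definition rint a b f := (\int[mu]_(x in `[a, b]) f x)%R.

Lemma rint_ext a b f g : (forall x, a <= x <= b -> f x = g x) ->
  rint a b f = rint a b g.
Proof.
by move=> H; apply: eq_Rintegral => x; rewrite inE /= in_itv /= => /H.
Qed.

Lemma cts_on_sub a b a' b' f : a <= a' -> b' <= b -> cts_on a b f ->
  cts_on a' b' f.
Proof.
move=> aa bb cf x /andP[x1 x2] e e0.
have [|d d0 H] := cf x _ e e0; first by rewrite (le_trans aa x1) (le_trans x2 bb).
exists d => // y /andP[y1 y2]; apply: H.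
by rewrite (le_trans aa y1) (le_trans y2 bb).
Qed.

Lemma cts_onD a b f g : cts_on a b f -> cts_on a b g ->
  cts_on a b (fun x => f x + g x).
Proof.
move=> cf cg x xab e e0; have e2 : 0 < e / 2 by rewrite divr_gt0.
have [d1 d10 H1] := cf x xab _ e2; have [d2 d20 H2] := cg x xab _ e2.
exists (Num.min d1 d2); first by rewrite lt_min d10.
move=> y yab; rewrite lt_min => /andP[y1 y2].
have -> : f y + g y - (f x + g x) = (f y - f x) + (g y - g x) by ring.
rewrite (le_trans (ler_normD _ _)) // [leRHS](splitr e).
by rewrite lerD ?H1 ?H2.
Qed.

Lemma cts_onZ a b k f : cts_on a b f -> cts_on a b (fun x => k * f x).
Proof.
move=> cf x xab e e0; have e2 : 0 < e / (`|k| + 1) by rewrite divr_gt0 ?ltr_wpDl.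
have [d1 d10 H1] := cf x xab _ e2; exists d1 => // y yab yd.
rewrite -mulrBr normrM; have k1 : 0 < `|k| + 1 by rewrite ltr_wpDl.
have h := H1 y yab yd; rewrite ler_pdivlMr // in h.
by have := normr_ge0 (f y - f x); have := normr_ge0 k; nra.
Qed.

Lemma cts_onN a b f : cts_on a b f -> cts_on a b (fun x => - f x).
Proof.
move=> /(@cts_onZ _ _ (-1)) H x xab e e0; have [d d0 {}H] := H x xab e e0.
by exists d => // y yab yd; have := H y yab yd; rewrite !mulN1r.
Qed.

Lemma cts_on_cst a b k : cts_on a b (fun=> k).
Proof. by move=> x _ e e0; exists 1 => // y _ _; rewrite subrr normr0 ltW. Qed.

Lemma cts_onM a b f g : cts_on a b f -> cts_on a b g ->
  cts_on a b (fun x => f x * g x).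
Proof.
move=> cf cg x xab e e0.
have k1 : 0 < `|g x| + 1 by rewrite ltr_wpDl. have k2 : 0 < `|f x| + 1 by rewrite ltr_wpDl.
have e1 : 0 < e / 2 / (`|g x| + 1) by rewrite !divr_gt0.
have e2 : 0 < Num.min 1 (e / 2 / (`|f x| + 1)) by rewrite lt_min ltr01 !divr_gt0.
have [d1 d10 H1] := cf x xab _ e1; have [d2 d20 H2] := cg x xab _ e2.
exists (Num.min d1 d2); first by rewrite lt_min d10.
move=> y yab; rewrite lt_min => /andP[y1 y2].
have h1 := H1 y yab y1; rewrite (ler_pdivlMr _ _ k1) in h1.
have := H2 y yab y2; rewrite le_min (ler_pdivlMr _ _ k2) => /andP[h2 h3].
rewrite (_ : _ - _ = (f y - f x) * g y + f x * (g y - g x)); last by ring.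
rewrite (le_trans (ler_normD _ _)) // !normrM [leRHS](splitr e).
have gy : `|g y| <= `|g x| + 1.
  by rewrite -(subrK (g x) (g y)) (le_trans (ler_normD _ _)) // addrC lerD2l.
have := normr_ge0 (f y - f x); have := normr_ge0 (g y - g x); have := normr_ge0 (f x).
move=> p1 p2 p3; apply: lerD.
  by rewrite (le_trans (ler_wpM2l p3 gy) h1).
by rewrite (le_trans _ h3) // mulrC ler_wpM2l // lerDl.
Qed.

Lemma cts_on_continuous a b f : continuous f -> cts_on a b f.
Proof.
move=> cf x _ e e0; have /cvgrPdist_le /(_ e e0) /nbhs_ballP [d d0 H] := cf x.
by exists d => // y _ xy; rewrite distrC; apply: H; rewrite /ball /= distrC.
Qed.

Lemma cts_on_id a b : cts_on a b id.
Proof. by move=> x _ e e0; exists e => // y _ /ltW. Qed.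

Lemma rintD a b f g : cts_on a b f -> cts_on a b g ->
  rint a b (fun x => f x + g x) = rint a b f + rint a b g.
Proof.
move=> cf cg; rewrite /rint.
exact: (RintegralD _ (cts_on_integrable cf) (cts_on_integrable cg)).
Qed.

Lemma rintZ a b k f : cts_on a b f ->
  rint a b (fun x => k * f x) = k * rint a b f.
Proof. by move=> cf; apply: RintegralZl => //; exact: cts_on_integrable. Qed.

Lemma rint_cst a b k : a <= b -> rint a b (fun=> k) = k * (b - a).
Proof.
move=> ab; rewrite /rint Rintegral_cst //= lebesgue_measure_itv /= lte_fin.
by move: ab; rewrite le_eqVlt => /predU1P[->|->]; rewrite ?ltxx ?subrr ?mulr0.
Qed.

Lemma rint_le a b f g : cts_on a b f -> cts_on a b g ->
  (forall x, a <= x <= b -> f x <= g x) -> rint a b f <= rint a b g.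
Proof.
move=> cf cg H; apply: le_Rintegral => //; try exact: cts_on_integrable.
Qed.

Lemma rint_norm_le a b f M : a <= b -> cts_on a b f ->
  (forall x, a <= x <= b -> `|f x| <= M) -> `|rint a b f| <= M * (b - a).
Proof.
move=> ab cf H; rewrite ler_norml; apply/andP; split.
  rewrite -mulNr -(@rint_cst a b (- M)) //; apply: rint_le => //.
    exact: cts_on_cst.
  by move=> x /H; rewrite ler_norml => /andP[].
rewrite -(@rint_cst a b M) //; apply: rint_le => //.
  exact: cts_on_cst.
by move=> x /H; rewrite ler_norml => /andP[].
Qed.

Lemma rint_split a m b f : a <= m <= b -> cts_on a b f ->
  rint a b f = rint a m f + rint m b f.
Proof.
move=> /andP[am mb] cf; rewrite /rint.
have fi := cts_on_integrable cf.
have H := @Rintegral_itvB _ f (BLeft a) (BRight b) m fi.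
rewrite -[X in _ = _ + X]Rintegral_itv_obnd_cbnd; last first.
  apply: (integrableS _ _ _ fi) => // x; rewrite /= !in_itv /=.
  by case/andP => /ltW h ->; rewrite (le_trans am h).
rewrite -H ?bnd_simp //; last by rewrite addrC subrK.
Qed.

Lemma rint_id a b : a <= b -> rint a b id = (b ^+ 2 - a ^+ 2) / 2.
Proof.
rewrite le_eqVlt => /predU1P[->|ab].
  by rewrite /rint set_itv1 Rintegral_set1 subrr mul0r.
rewrite /rint /Rintegral (@continuous_FTC2 _ id (fun x => x ^+ 2 / 2)) //.
- by rewrite -EFinB /= mulrBl.
- exact/cts_on_within/cts_on_id.
- split; first by [].
  + by apply: cvg_at_right_filter; apply: cvgM; [exact: exprn_continuous|exact: cvg_cst].
  + by apply: cvg_at_left_filter; apply: cvgM; [exact: exprn_continuous|exact: cvg_cst].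
- move=> x _; rewrite derive1E.
  have h : is_derive x 1 (fun x : R => x ^+ 2 / 2) x.
    apply: is_derive_eq; rewrite /GRing.scale /=; lra.
  by rewrite derive_val.
Qed.

End SegmentIntegral.

Lemma le_of_eq {R : numDomainType} (x y : R) : x = y -> x <= y.
Proof. by move->. Qed.

Lemma quarter_contra {R : realDomainType} (t p1 p2 p3 p4 : R) :
  t <= p1 + p2 + (p3 + p4) -> 4 * p1 < t -> 4 * p2 < t -> 4 * p3 < t -> 4 * p4 < t -> False.
Proof. lra. Qed.

Lemma half_lo {R : realDomainType} (a b x v v2 : R) : a <= x -> x + v <= b -> v = v2 + v2 -> 0 <= v2 ->
  [/\ a <= x, x + v2 <= b, x <= x & x + v2 <= x + v].
Proof. by move=> p1 p2 p3 p4; split=> //; lra. Qed.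

Lemma half_hi {R : realDomainType} (a b x v v2 : R) : a <= x -> x + v <= b -> v = v2 + v2 -> 0 <= v2 ->
  [/\ a <= x + v2, x + v2 + v2 <= b, x <= x + v2 & x + v2 + v2 <= x + v].
Proof. by move=> p1 p2 p3 p4; split=> //; lra. Qed.

Lemma in_segment_dist {R : realDomainType} (x w u v : R) :
  x <= u <= x + w -> x <= v <= x + w -> `|u - v| <= w.
Proof. by move=> /andP[? ?] /andP[? ?]; rewrite ler_norml; apply/andP; split; lra. Qed.

Section ComplexNorm.
Context {R : realType}.
Local Notation C := R[i].
Implicit Types z w : C.

Lemma normc_ge0 z : 0 <= normc z.
Proof. by case: z => x y /=; rewrite sqrtr_ge0. Qed.

Lemma Re_le_normc z : `|Re z| <= normc z.
Proof.
by case: z => x y /=; rewrite -sqrtr_sqr ler_sqrt ?lerDl ?addr_ge0 ?sqr_ge0.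
Qed.

Lemma Im_le_normc z : `|Im z| <= normc z.
Proof.
by case: z => x y /=; rewrite -sqrtr_sqr ler_sqrt ?lerDr ?addr_ge0 ?sqr_ge0.
Qed.

Lemma normcR (x : R) : normc x%:C = `|x|.
Proof. by rewrite /= expr0n addr0 sqrtr_sqr. Qed.

Lemma normci : normc ('i : C) = 1.
Proof. by rewrite /= expr0n add0r expr1n sqrtr1. Qed.

Lemma normc_le_ReIm z : normc z <= `|Re z| + `|Im z|.
Proof.
have -> : z = (Re z)%:C + 'i * (Im z)%:C by rewrite -complexE.
rewrite (le_trans (le_normcD _ _)) // ComplexField.Normc.normcM normci mul1r.
by rewrite !normcR /= !mul0r !mul1r !subr0 !addr0 !add0r.
Qed.

Lemma normcX z n : normc (z ^+ n) = normc z ^+ n.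
Proof.
elim: n => [|n IH]; first by rewrite !expr0 ComplexField.Normc.normc1.
by rewrite !exprS ComplexField.Normc.normcM IH.
Qed.

Lemma normc_eq0 z : (normc z == 0) = (z == 0).
Proof.
apply/eqP/eqP => [/ComplexField.Normc.eq0_normc//|->].
exact: ComplexField.Normc.normc0.
Qed.

Lemma normc_gt0 z : (0 < normc z) = (z != 0).
Proof. by rewrite lt_neqAle normc_ge0 eq_sym normc_eq0 andbT. Qed.

Lemma normc_triB z w : normc (z - w) <= normc z + normc w.
Proof. by rewrite (le_trans (le_normcD _ _)) // normcN. Qed.

Lemma normc_tri_sub z w : normc z - normc w <= normc (z - w).
Proof.
rewrite lerBlDr -{1}(subrK w z); exact: le_normcD.
Qed.

Lemma complexRe_D z w : Re (z + w) = Re z + Re w. Proof. by case: z; case: w. Qed.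
Lemma complexIm_D z w : Im (z + w) = Im z + Im w. Proof. by case: z; case: w. Qed.
Lemma complexRe_B z w : Re (z - w) = Re z - Re w. Proof. by case: z; case: w. Qed.
Lemma complexIm_B z w : Im (z - w) = Im z - Im w. Proof. by case: z; case: w. Qed.
Lemma complexRe_M z w : Re (z * w) = Re z * Re w - Im z * Im w.
Proof. by case: z; case: w. Qed.
Lemma complexIm_M z w : Im (z * w) = Re z * Im w + Im z * Re w.
Proof. by case: z => a b; case: w => c d /=; rewrite addrC addrC. Qed.
Lemma complexReC (x : R) : Re x%:C = x. Proof. by []. Qed.
Lemma complexImC (x : R) : Im x%:C = 0. Proof. by []. Qed.

Lemma complex_ext z w : Re z = Re w -> Im z = Im w -> z = w.
Proof. by case: z => a b; case: w => c d /= -> ->. Qed.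

End ComplexNorm.

(** * Contour integrals over rectangles and Goursat's theorem *)

Section LineIntegral.
Context {R : realType}.
Local Notation C := R[i].
Implicit Types (f g : C -> C) (u v : R -> C) (a b c d x y : R) (z w : C).

Definition ccts_on a b u := cts_on a b (fun x => Re (u x)) /\ cts_on a b (fun x => Im (u x)).

Definition cint a b u : C := rint a b (fun x => Re (u x)) +i* rint a b (fun x => Im (u x)).

Lemma cint_ext a b u v : (forall x, a <= x <= b -> u x = v x) -> cint a b u = cint a b v.
Proof.
by move=> H; rewrite /cint; congr (_ +i* _); apply: rint_ext => x /H ->.
Qed.

Lemma ccts_onZ a b k u : ccts_on a b u -> ccts_on a b (fun x => k * u x).
Proof.
move=> [u1 u2]; split.
  have := cts_onD (cts_onZ (Re k) u1) (cts_onZ (- Im k) u2).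
  by under [X in cts_on _ _ X -> _]eq_fun do rewrite mulNr -complexRe_M.
have := cts_onD (cts_onZ (Re k) u2) (cts_onZ (Im k) u1).
by under [X in cts_on _ _ X -> _]eq_fun do rewrite -complexIm_M.
Qed.

Lemma cintD a b u v : ccts_on a b u -> ccts_on a b v ->
  cint a b (fun x => u x + v x) = cint a b u + cint a b v.
Proof.
move=> [u1 u2] [v1 v2]; apply: complex_ext; rewrite ?complexRe_D ?complexIm_D /= -rintD //.
  by apply: rint_ext => x _; rewrite complexRe_D.
by apply: rint_ext => x _; rewrite complexIm_D.
Qed.

Lemma cintZ a b k u : ccts_on a b u ->
  cint a b (fun x => k * u x) = k * cint a b u.
Proof.
move=> [u1 u2]; apply: complex_ext; rewrite ?complexRe_M ?complexIm_M /= -!rintZ //.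
  rewrite (_ : - _ = rint a b (fun x => - Im k * Im (u x))); last by rewrite !rintZ // mulNr.
  rewrite -rintD; [|exact: cts_onZ..].
  by apply: rint_ext => x _; rewrite complexRe_M mulNr.
rewrite -rintD; [|exact: cts_onZ..].
by apply: rint_ext => x _; rewrite complexIm_M.
Qed.

Lemma cint_cst a b k : a <= b -> cint a b (fun=> k) = k * (b - a)%:C.
Proof.
move=> ab; rewrite /cint !rint_cst //.
by apply: complex_ext; rewrite ?complexRe_M ?complexIm_M /= ?mulr0 ?subr0 ?add0r.
Qed.

Lemma cint_split a m b u : a <= m <= b -> ccts_on a b u ->
  cint a b u = cint a m u + cint m b u.
Proof.
by move=> amb [u1 u2]; apply: complex_ext; rewrite ?complexRe_D ?complexIm_D /= -rint_split.
Qed.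

(** Real and imaginary parts are bounded separately, at the cost of a factor 2; only the order of
    magnitude of the bound matters later. *)
Lemma cint_norm_le a b u M : a <= b -> ccts_on a b u ->
  (forall x, a <= x <= b -> normc (u x) <= M) -> normc (cint a b u) <= 2 * M * (b - a).
Proof.
move=> ab [u1 u2] H; rewrite (le_trans (normc_le_ReIm _)) //= -mulrA mulr_natl mulr2n.
rewrite lerD // rint_norm_le // => x /H; apply: le_trans.
  exact: Re_le_normc.
exact: Im_le_normc.
Qed.

Definition inrect a b c d z := (a <= Re z <= b) && (c <= Im z <= d).

Definition rcont f a b c d := forall z, inrect a b c d z -> forall e, 0 < e ->
  exists2 r, 0 < r & forall w, inrect a b c d w -> normc (w - z) < r -> normc (f w - f z) <= e.

Lemma rcont_sub a b c d a' b' c' d' f : a <= a' -> b' <= b -> c <= c' -> d' <= d ->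
  rcont f a b c d -> rcont f a' b' c' d'.
Proof.
move=> h1 h2 h3 h4 H.
have sub z : inrect a' b' c' d' z -> inrect a b c d z.
  by move=> /andP[/andP[p q] /andP[r s]]; rewrite /inrect (le_trans h1 p) (le_trans q h2) (le_trans h3 r) (le_trans s h4).
move=> z /sub zi e e0; have [r r0 {}H] := H z zi e e0.
by exists r => // w /sub; exact: H.
Qed.

Lemma rcontD f g a b c d : rcont f a b c d -> rcont g a b c d ->
  rcont (fun z => f z + g z) a b c d.
Proof.
move=> cf cg x xab e e0; have e2 : 0 < e / 2 by rewrite divr_gt0.
have [d1 d10 H1] := cf x xab _ e2; have [d2 d20 H2] := cg x xab _ e2.
exists (Num.min d1 d2); first by rewrite lt_min d10.
move=> y yab; rewrite lt_min => /andP[y1 y2].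
have -> : f y + g y - (f x + g x) = (f y - f x) + (g y - g x) by ring.
rewrite (le_trans (le_normcD _ _)) // [leRHS](splitr e).
by rewrite lerD ?H1 ?H2.
Qed.

Lemma rcontZ k f a b c d : rcont f a b c d -> rcont (fun z => k * f z) a b c d.
Proof.
move=> cf x xab e e0; have k1 : 0 < normc k + 1 by rewrite ltr_wpDl ?normc_ge0.
have e2 : 0 < e / (normc k + 1) by rewrite divr_gt0.
have [d1 d10 H1] := cf x xab _ e2; exists d1 => // y yab yd.
rewrite -mulrBr ComplexField.Normc.normcM.
have h := H1 y yab yd; rewrite ler_pdivlMr // in h.
by have := normc_ge0 (f y - f x); have := normc_ge0 k; nra.
Qed.

Lemma rcont_cst k a b c d : rcont (fun=> k) a b c d.
Proof. by move=> z _ e e0; exists 1 => // w _ _; rewrite subrr ComplexField.Normc.normc0 ltW. Qed.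

Lemma rcont_id a b c d : rcont id a b c d.
Proof. by move=> x _ e e0; exists e => // y _ /ltW. Qed.

Lemma rcont_h f a b c d y : c <= y <= d -> rcont f a b c d ->
  ccts_on a b (fun x => f (x +i* y)).
Proof.
move=> cyd H; split=> x xab e e0.
  have [|r r0 {}H] := H (x +i* y) _ e e0; first by rewrite /inrect /= xab.
  exists r => // x' x'ab xx; rewrite -complexRe_B (le_trans (Re_le_normc _)) //.
  by apply: H; rewrite /inrect /= ?x'ab // subrr expr0n addr0 sqrtr_sqr.
have [|r r0 {}H] := H (x +i* y) _ e e0; first by rewrite /inrect /= xab.
exists r => // x' x'ab xx; rewrite -complexIm_B (le_trans (Im_le_normc _)) //.
by apply: H; rewrite /inrect /= ?x'ab // subrr expr0n addr0 sqrtr_sqr.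
Qed.

Lemma rcont_v f a b c d x : a <= x <= b -> rcont f a b c d ->
  ccts_on c d (fun y => f (x +i* y)).
Proof.
move=> cyd H; split=> y xab e e0.
  have [|r r0 {}H] := H (x +i* y) _ e e0; first by rewrite /inrect /= cyd.
  exists r => // x' x'ab xx; rewrite -complexRe_B (le_trans (Re_le_normc _)) //.
  by apply: H; rewrite /inrect /= ?cyd // subrr expr0n add0r sqrtr_sqr.
have [|r r0 {}H] := H (x +i* y) _ e e0; first by rewrite /inrect /= cyd.
exists r => // x' x'ab xx; rewrite -complexIm_B (le_trans (Im_le_normc _)) //.
by apply: H; rewrite /inrect /= ?cyd // subrr expr0n add0r sqrtr_sqr.
Qed.

Definition hs f a b y := cint a b (fun x => f (x +i* y)).
Definition vs f c d x := cint c d (fun y => f (x +i* y)).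

(** The contour integral along the boundary of the rectangle, counterclockwise. *)
Definition rect f a b c d : C :=
  hs f a b c - hs f a b d + 'i * (vs f c d b - vs f c d a).

Lemma rect_ext f g a b c d : a <= b -> c <= d ->
  (forall z, inrect a b c d z -> f z = g z) -> rect f a b c d = rect g a b c d.
Proof.
move=> ab cd H; rewrite /rect /hs /vs.
have h y : c <= y <= d -> hs f a b y = hs g a b y.
  by move=> yd; apply: cint_ext => x xab; apply: H; rewrite /inrect /= xab.
have v x : a <= x <= b -> vs f c d x = vs g c d x.
  by move=> xd; apply: cint_ext => y yab; apply: H; rewrite /inrect /= xd.
by rewrite -/(hs f a b c) -/(hs f a b d) -/(vs f c d a) -/(vs f c d b) !h ?v ?lexx ?ab ?cd.
Qed.

(** Continuity is asked on the four edges only, since the integrands of Cauchy's formula have a pole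
    inside. *)
Definition sides_cts f a b c d :=
  [/\ ccts_on a b (fun x => f (x +i* c)), ccts_on a b (fun x => f (x +i* d)),
   ccts_on c d (fun y => f (a +i* y)) & ccts_on c d (fun y => f (b +i* y))].

Lemma rcont_sides f a b c d : a <= b -> c <= d -> rcont f a b c d -> sides_cts f a b c d.
Proof.
by move=> ab cd cf; split; [apply: (rcont_h _ cf)|apply: (rcont_h _ cf)|apply: (rcont_v _ cf)|apply: (rcont_v _ cf)];
   rewrite lexx ?ab ?cd.
Qed.

Definition onbd a b c d z :=
  inrect a b c d z && [|| Re z == a, Re z == b, Im z == c | Im z == d].

Section RectCts.
Variables (f : C -> C) (a b c d : R).
Hypotheses (ab : a <= b) (cd : c <= d) (cf : sides_cts f a b c d).

Lemma rectZ k : rect (fun z => k * f z) a b c d = k * rect f a b c d.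
Proof. by have [h1 h2 h3 h4] := cf; rewrite /rect /hs /vs !cintZ //; ring. Qed.

Lemma rect_norm_le M : (forall z, onbd a b c d z -> normc (f z) <= M) ->
  normc (rect f a b c d) <= 4 * M * ((b - a) + (d - c)).
Proof.
move=> H; have [h1 h2 h3 h4] := cf.
have Hh y : y = c \/ y = d -> ccts_on a b (fun x => f (x +i* y)) -> normc (hs f a b y) <= 2 * M * (b - a).
  move=> yd ch; apply: cint_norm_le => // x xab; apply: H; rewrite /onbd /inrect /= xab.
  by case: yd => ->; rewrite lexx cd eqxx !orbT.
have Hv x : x = a \/ x = b -> ccts_on c d (fun y => f (x +i* y)) -> normc (vs f c d x) <= 2 * M * (d - c).
  move=> yd ch; apply: cint_norm_le => // y xab; apply: H; rewrite /onbd /inrect /= xab.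
  by case: yd => ->; rewrite lexx ab eqxx ?orbT.
rewrite (le_trans (le_normcD _ _)) // ComplexField.Normc.normcM normci mul1r.
have := normc_triB (hs f a b c) (hs f a b d); have := normc_triB (vs f c d b) (vs f c d a).
move: (Hh c (or_introl erefl) h1) (Hh d (or_intror erefl) h2) (Hv a (or_introl erefl) h3) (Hv b (or_intror erefl) h4).
set A := normc (hs f a b c); set B := normc (hs f a b d).
set A' := normc (vs f c d a); set B' := normc (vs f c d b).
by move=> p1 p2 p3 p4 p5 p6; lra.
Qed.

(** The integrals along the cut cancel formally, whatever [f] does there; continuity on the outer
    edges suffices. *)
Lemma rect_splitx m : a <= m <= b -> rect f a b c d = rect f a m c d + rect f m b c d.
Proof.
move=> amb; have [h1 h2 h3 h4] := cf.
by rewrite /rect /hs /vs (cint_split amb h1) (cint_split amb h2); ring.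
Qed.

Lemma rect_splity m : c <= m <= d -> rect f a b c d = rect f a b c m + rect f a b m d.
Proof.
move=> amb; have [h1 h2 h3 h4] := cf.
by rewrite /rect /hs /vs (cint_split amb h3) (cint_split amb h4); ring.
Qed.

End RectCts.

Lemma sides_ctsZ k f a b c d : sides_cts f a b c d -> sides_cts (fun z => k * f z) a b c d.
Proof. by move=> [f1 f2 f3 f4]; split; exact: ccts_onZ. Qed.

Lemma rectD f g a b c d : sides_cts f a b c d -> sides_cts g a b c d ->
  rect (fun z => f z + g z) a b c d = rect f a b c d + rect g a b c d.
Proof.
move=> [f1 f2 f3 f4] [g1 g2 g3 g4].
by rewrite /rect /hs /vs !cintD //; ring.
Qed.

Lemma rect_cst k a b c d : a <= b -> c <= d -> rect (fun=> k) a b c d = 0.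
Proof. by move=> ab cd; rewrite /rect /hs /vs !cint_cst // !subrr mulr0 addr0. Qed.

Lemma rect_id a b c d : a <= b -> c <= d -> rect id a b c d = 0.
Proof.
move=> ab cd; rewrite /rect /hs /vs /cint /= !rint_cst // !rint_id //.
by apply: complex_ext; rewrite ?(complexRe_D, complexIm_D, complexRe_B, complexIm_B, complexRe_M, complexIm_M) /=; lra.
Qed.

Lemma rect_affine k l a b c d : a <= b -> c <= d -> rect (fun z => k + l * z) a b c d = 0.
Proof.
move=> ab cd; have ci := @rcont_id a b c d.
have si := rcont_sides ab cd ci.
rewrite rectD //; [|apply: rcont_sides => //; exact: rcont_cst|exact: sides_ctsZ].
by rewrite rect_cst // rectZ // rect_id // mulr0 addr0.
Qed.

(** The derivative as a first-order error estimate, without quotient and without exception at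
    [h = 0]. This is the form in which Goursat's theorem and the Laplace transform use or produce
    it. *)
Definition cdiff f z (l : C) := forall e, 0 < e -> exists2 r, 0 < r &
  forall h, normc h < r -> normc (f (z + h) - f z - l * h) <= e * normc h.

Definition cdiffable f z := exists l, cdiff f z l.

Lemma cdiff_cont f z l : cdiff f z l -> forall e, 0 < e ->
  exists2 r, 0 < r & forall h, normc h < r -> normc (f (z + h) - f z) <= e.
Proof.
move=> H e e0; have [r r0 Hr] := H 1 ltr01.
have l1 : 0 < normc l + 1 by rewrite ltr_wpDl ?normc_ge0.
exists (Num.min r (e / (normc l + 1))); first by rewrite lt_min r0 divr_gt0.
move=> h; rewrite lt_min => /andP[/Hr h1]; rewrite ltr_pdivlMr // => h2.
have := le_normcD (f (z + h) - f z - l * h) (l * h); rewrite subrK ComplexField.Normc.normcM.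
by nra.
Qed.

Lemma holo_rcont f a b c d : (forall z, inrect a b c d z -> cdiffable f z) ->
  rcont f a b c d.
Proof.
move=> H z /H[l /cdiff_cont fz] e /fz[r r0 Hr]; exists r => // w _ wz.
by have := Hr (w - z) wz; rewrite [z + _]addrC subrK.
Qed.

Section Goursat.
Variables (f : C -> C) (a b c d : R).
Hypotheses (ab : a <= b) (cd : c <= d).
Hypothesis hf : forall z, inrect a b c d z -> cdiffable f z.
(** A rectangle obtained after [n] bisections is recorded by its lower left corner alone; its sides
    are [w n] and [h n]. *)
Let w n := (b - a) / 2 ^+ n.
Let h n := (d - c) / 2 ^+ n.
Let F n (p : R * R) := rect f p.1 (p.1 + w n) p.2 (p.2 + h n).
Let inr n (p : R * R) := [/\ a <= p.1, p.1 + w n <= b, c <= p.2 & p.2 + h n <= d].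

Let w_half n : w n = w n.+1 + w n.+1.
Proof. by rewrite /w exprS; field; rewrite expf_neq0. Qed.
Let h_half n : h n = h n.+1 + h n.+1.
Proof. by rewrite /h exprS; field; rewrite expf_neq0. Qed.
Let w_ge0 n : 0 <= w n. Proof. by rewrite divr_ge0 ?subr_ge0 ?exprn_ge0. Qed.
Let h_ge0 n : 0 <= h n. Proof. by rewrite divr_ge0 ?subr_ge0 ?exprn_ge0. Qed.

Let step n p : inr n p -> exists q, inr n.+1 q /\ [/\ normc (F n p) <= 4 * normc (F n.+1 q),
  p.1 <= q.1, q.1 + w n.+1 <= p.1 + w n, p.2 <= q.2 & q.2 + h n.+1 <= p.2 + h n].
Proof.
case: p => x y [/= i1 i2 i3 i4]; have cf := holo_rcont hf.
have ew := w_half n; have eh := h_half n; have wp := w_ge0 n.+1; have hp := h_ge0 n.+1.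
have {}cf : rcont f x (x + w n) y (y + h n) by apply: rcont_sub cf.
set x' := x + w n.+1; set y' := y + h n.+1.
have E : F n (x, y) = F n.+1 (x, y) + F n.+1 (x, y') + (F n.+1 (x', y) + F n.+1 (x', y')).
  rewrite /F /= (@rect_splitx _ _ _ _ _ (rcont_sides _ _ cf) x') ?ew ?eh; [|rewrite /x'; lra..].
  rewrite (@rect_splity _ x x' _ _ (rcont_sides _ _ _) y'); [|rewrite /x' /y'; try lra..]; last first.
    by apply: rcont_sub cf; rewrite /x'; lra.
  rewrite (@rect_splity _ x' _ _ _ (rcont_sides _ _ _) y'); [|rewrite /x' /y'; try lra..]; last first.
    by apply: rcont_sub cf; rewrite /x'; lra.
  by rewrite -!addrA.
have [q qs Hq] : exists2 q, q \in [:: (x, y); (x, y'); (x', y); (x', y')] & normc (F n (x, y)) <= 4 * normc (F n.+1 q).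
  apply: contrapT => H.
  have H' q : q \in [:: (x, y); (x, y'); (x', y); (x', y')] -> 4 * normc (F n.+1 q) < normc (F n (x, y)).
    by move=> qs; rewrite ltNge; apply/negP => hq; apply: H; exists q.
  have p1 := H' (x, y); have p2 := H' (x, y'); have p3 := H' (x', y); have p4 := H' (x', y').
  rewrite !inE !eqxx ?orbT in p1 p2 p3 p4.
  move: {p1}(p1 isT) {p2}(p2 isT) {p3}(p3 isT) {p4}(p4 isT) => p1 p2 p3 p4.
  apply: (quarter_contra _ p1 p2 p3 p4).
  have : normc (F n (x, y)) <= normc (F n.+1 (x, y)) + normc (F n.+1 (x, y')) + (normc (F n.+1 (x', y)) + normc (F n.+1 (x', y'))).
    by rewrite {1}E (le_trans (le_normcD _ _)) // lerD ?le_normcD.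
  by [].
exists q; move: qs; rewrite !inE => /or4P[] /eqP E'; rewrite E' in Hq *; rewrite /inr /=. 
- have [a1 a2 a3 a4] := half_lo i1 i2 ew wp; have [b1 b2 b3 b4] := half_lo i3 i4 eh hp.
  by split=> //; split.
- have [a1 a2 a3 a4] := half_lo i1 i2 ew wp; have [b1 b2 b3 b4] := half_hi i3 i4 eh hp.
  by split=> //; split.
- have [a1 a2 a3 a4] := half_hi i1 i2 ew wp; have [b1 b2 b3 b4] := half_lo i3 i4 eh hp.
  by split=> //; split.
- have [a1 a2 a3 a4] := half_hi i1 i2 ew wp; have [b1 b2 b3 b4] := half_hi i3 i4 eh hp.
  by split=> //; split.
Qed.

Let seqx : exists p : nat -> R * R, p 0%N = (a, c) /\ forall n, inr n (p n) /\ 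
   [/\ normc (F 0 (a, c)) <= 4 ^+ n * normc (F n (p n)),
   (p n).1 <= (p n.+1).1, (p n.+1).1 + w n.+1 <= (p n).1 + w n, (p n).2 <= (p n.+1).2 & (p n.+1).2 + h n.+1 <= (p n).2 + h n].
Proof.
have H (u : nat * (R * R)) : exists q, inr u.1 u.2 -> inr u.1.+1 q /\ [/\ normc (F u.1 u.2) <= 4 * normc (F u.1.+1 q),
  u.2.1 <= q.1, q.1 + w u.1.+1 <= u.2.1 + w u.1, u.2.2 <= q.2 & q.2 + h u.1.+1 <= u.2.2 + h u.1].
  have [i|i] := pselect (inr u.1 u.2); last by exists (0, 0).
  by have [q Hq] := step i; exists q.
have [g Hg] := choice H.
pose p := fix p n := if n is m.+1 then g (m, p m) else (a, c).
exists p; split => // n; elim: n => [|n [i1 [i2 i3 i4 i5 i6]]].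
  have i0 : inr 0 (p 0%N) by rewrite /inr /= /w /h expr0 !divr1 !lexx; split=> //; lra.
  have [_ [_ k3 k4 k5 k6]] := Hg (0%N, p 0%N) i0.
  by split => //; rewrite expr0 mul1r.
have [j1 [j2 _ _ _ _]] := Hg (n, p n) i1.
have [_ [_ k3 k4 k5 k6]] := Hg (n.+1, p n.+1) j1.
split => //; rewrite (le_trans i2) // exprS [4 * _]mulrC -mulrA ler_wpM2l // exprn_ge0 //.
Qed.

Lemma nested_limit (x e : nat -> R) : (forall n, 0 <= e n) -> (forall n, x n <= x n.+1) -> (forall n, x n.+1 + e n.+1 <= x n + e n) ->
  exists l, forall n, x n <= l <= x n + e n.
Proof.
move=> e0 x1 x2.
have up m n : (m <= n)%N -> x m <= x n.
  by elim: n => [|n IH]; [rewrite leqn0 => /eqP-> | rewrite leq_eqVlt => /predU1P[->//|/IH/le_trans]; apply].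
have dn m n : (m <= n)%N -> x n + e n <= x m + e m.
  elim: n => [|n IH]; [by rewrite leqn0 => /eqP-> | rewrite leq_eqVlt => /predU1P[->//|/IH]; exact: le_trans].
have ub n : ubound (range x) (x n + e n).
  move=> _ [m _ <-]; case: (leqP m n) => mn.
    by rewrite (le_trans (up _ _ mn)) // lerDl.
  by rewrite (le_trans _ (dn _ _ (ltnW mn))) // lerDl.
exists (sup (range x)) => n; apply/andP; split.
  by apply: ub_le_sup; [exists (x 0%N + e 0%N); exact: ub | exists n].
by apply: ge_sup; [exists (x n); exists n|exact: ub].
Qed.

(** Bisection: some quarter carries at least a quarter of the integral, so the n-th nested rectangle
    has an integral of norm at least [rho / 4 ^+ n]. Near the limit point [f] differs from an affine
    function by o(distance), and affine functions integrate to 0; the same integral is therefore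
    o(4^-n). *)
Lemma goursat : rect f a b c d = 0.
Proof.
have [p [p0 Hp]] := seqx.
have [X HX] : exists l, forall n, (p n).1 <= l <= (p n).1 + w n.
  by apply: nested_limit => // n; have [_ []] := Hp n.
have [Y HY] : exists l, forall n, (p n).2 <= l <= (p n).2 + h n.
  by apply: nested_limit => // n; have [_ []] := Hp n.
have F0 : F 0 (a, c) = rect f a b c d.
  by rewrite /F /w /h /= expr0 !divr1 ![_ + (_ - _)]addrC !subrK.
apply/eqP; rewrite -normc_eq0 -F0 eq_le normc_ge0 andbT.
set rho := normc _; rewrite leNgt; apply/negP => rho0.
set s := (b - a) + (d - c); have s0 : 0 <= s by rewrite addr_ge0 ?subr_ge0.
have inXY n : inrect (p n).1 ((p n).1 + w n) (p n).2 ((p n).2 + h n) (X +i* Y).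
  by rewrite /inrect /= HX HY.
have [l Hl] : cdiffable f (X +i* Y).
  apply: hf; have [[i1 i2 i3 i4] _] := Hp 0%N; have := HX 0%N; have := HY 0%N.
  by rewrite /inrect /= => /andP[? ?] /andP[? ?]; apply/andP; split; apply/andP; split; lra.
(* The estimate reached below is [rho <= 4 * e * s ^+ 2]; with this denominator in [e] it
   contradicts [0 < rho]. *)
have K : 0 < 4 * s ^+ 2 + 1 by rewrite ltr_wpDl // mulr_ge0 // sqr_ge0.
have e0 : 0 < rho / (4 * s ^+ 2 + 1) by rewrite divr_gt0.
have [r r0 Hr] := Hl _ e0; set e := rho / _ in e0 Hr.
have [n hn] : exists n, s / 2 ^+ n < r.
  have [n hn] : exists n : nat, s / r < n%:R by exists (Num.bound (s / r)); rewrite archi_boundP // divr_ge0 // ltW.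
  exists n; rewrite ltr_pdivrMr ?exprn_gt0 // mulrC.
  rewrite ltr_pdivrMr // in hn; rewrite (lt_le_trans hn) // ler_pM2r //.
  by rewrite -natrX ler_nat ltnW // ltn_expl.
have wh : w n + h n = s / 2 ^+ n by rewrite /w /h -mulrDl.
have [[i1 i2 i3 i4] [hF _ _ _ _]] := Hp n.
have wn := w_ge0 n; have hn0 := h_ge0 n.
set k := f (X +i* Y) - l * (X +i* Y).
set x1 := (p n).1 in i1 i2 *; set y1 := (p n).2 in i3 i4 *.
have cf : rcont f x1 (x1 + w n) y1 (y1 + h n) by apply: rcont_sub (holo_rcont hf).
have ca : rcont (fun z => (-1) * (k + l * z)) x1 (x1 + w n) y1 (y1 + h n).
  by apply: rcontZ; apply: rcontD; [exact: rcont_cst|apply: rcontZ; exact: rcont_id].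
have EF : F n (p n) = rect (fun z => f z + (-1) * (k + l * z)) x1 (x1 + w n) y1 (y1 + h n).
  have wx : x1 <= x1 + w n by rewrite lerDl.
  have hy : y1 <= y1 + h n by rewrite lerDl.
  rewrite rectD; [|exact: rcont_sides..].
  have E0 := rect_affine k l wx hy.
  rewrite rectZ; first by rewrite E0 mulr0 addr0.
  by apply: rcont_sides => //; apply: rcontD; [exact: rcont_cst|apply: rcontZ; exact: rcont_id].
have bd : normc (F n (p n)) <= 4 * (e * (s / 2 ^+ n)) * (s / 2 ^+ n).
  rewrite EF; apply: le_trans (_ : 4 * (e * (s / 2 ^+ n)) * ((x1 + w n - x1) + (y1 + h n - y1)) <= _); last first.
    by rewrite -wh; apply: le_of_eq; congr (_ * _); ring.
  have wx : x1 <= x1 + w n by rewrite lerDl.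
  have hy : y1 <= y1 + h n by rewrite lerDl.
  apply: (rect_norm_le wx hy (rcont_sides wx hy (rcontD cf ca))).
  move=> z /andP[zi _]; have zz : normc (z - (X +i* Y)) <= s / 2 ^+ n.
    rewrite -wh (le_trans (normc_le_ReIm _)) // complexRe_B complexIm_B /=.
    by move: zi (inXY n) => /andP[zx zy] /andP[/= xx yy]; rewrite lerD // (in_segment_dist zx xx, in_segment_dist zy yy).
  have := Hr (z - (X +i* Y)) (le_lt_trans zz hn).
  rewrite [X in f X](_ : _ = z); last by rewrite addrC subrK.
  rewrite (_ : f z + -1 * (k + l * z) = f z - f (X +i* Y) - l * (z - (X +i* Y))); last by rewrite /k; ring.
  by move=> /le_trans; apply; rewrite ler_wpM2l // ltW.
have p4 : 0 < 4 ^+ n :> R by rewrite exprn_gt0.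
have E4 : 4 ^+ n = 2 ^+ n * 2 ^+ n :> R by rewrite -exprMn; congr (_ ^+ _); ring.
have : rho <= 4 * e * s ^+ 2.
  rewrite (le_trans hF) // (le_trans (ler_wpM2l (ltW p4) bd)) // E4.
  by apply: le_of_eq; field; rewrite expf_neq0.
have : e * (4 * s ^+ 2 + 1) = rho by rewrite /e divfK // gt_eqF.
lra.
Qed.

End Goursat.

End LineIntegral.

(** * Rules of complex differentiation *)

Section CdiffCalculus.
Context {R : realType}.
Local Notation C := R[i].
Implicit Types (f g : C -> C) (z l m : C).

Lemma normcM (u v : C) : normc (u * v) = normc u * normc v.
Proof. exact: ComplexField.Normc.normcM. Qed.

Lemma normcV (u : C) : normc u^-1 = (normc u)^-1.
Proof. exact: ComplexField.Normc.normcV. Qed.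

Lemma cdiff_ext f g z l : (exists2 r, 0 < r & forall h, normc h < r -> f (z + h) = g (z + h)) ->
  cdiff f z l -> cdiff g z l.
Proof.
move=> [s s0 H] Hf e /Hf[r r0 Hr]; exists (Num.min r s); first by rewrite lt_min r0.
move=> h; rewrite lt_min => /andP[hr hs]; rewrite -H // -[g z]/(g z) -[z in g z]addr0 -H ?addr0; first exact: Hr.
by rewrite ComplexField.Normc.normc0.
Qed.

Lemma cdiff_lip f z l : cdiff f z l -> exists2 r, 0 < r &
  forall h, normc h < r -> normc (f (z + h) - f z) <= (normc l + 1) * normc h.
Proof.
move=> /(_ 1 ltr01)[r r0 Hr]; exists r => // h /Hr.
have := le_normcD (f (z + h) - f z - l * h) (l * h); rewrite subrK normcM.
lra.
Qed.

Lemma cdiff_cst k z : cdiff (fun=> k) z 0.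
Proof.
move=> e e0; exists 1 => // h _.
by rewrite subrr mul0r subr0 ComplexField.Normc.normc0 mulr_ge0 ?normc_ge0 ?ltW.
Qed.

Lemma cdiff_id z : cdiff id z 1.
Proof.
move=> e e0; exists 1 => // h _.
rewrite (_ : _ - _ = 0); last by ring.
by rewrite ComplexField.Normc.normc0 mulr_ge0 ?normc_ge0 ?ltW.
Qed.

Lemma cdiffD f g z l m : cdiff f z l -> cdiff g z m ->
  cdiff (fun w => f w + g w) z (l + m).
Proof.
move=> Hf Hg e e0; have e2 : 0 < e / 2 by rewrite divr_gt0.
have [r r0 Hr] := Hf _ e2; have [s s0 Hs] := Hg _ e2.
exists (Num.min r s); first by rewrite lt_min r0.
move=> h; rewrite lt_min => /andP[/Hr hr /Hs hs].
rewrite (_ : _ - _ = (f (z + h) - f z - l * h) + (g (z + h) - g z - m * h)); last by ring.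
rewrite (le_trans (le_normcD _ _)) // (_ : e * _ = e / 2 * normc h + e / 2 * normc h); last by field.
exact: lerD.
Qed.

Lemma cdiff_comp f g z l m : cdiff g z m -> cdiff f (g z) l ->
  cdiff (f \o g) z (l * m).
Proof.
move=> Hg Hf e e0.
have K0 : 0 < normc m + 1 by rewrite ltr_wpDl ?normc_ge0.
have L0 : 0 < normc l + 1 by rewrite ltr_wpDl ?normc_ge0.
have e1 : 0 < e / 2 / (normc m + 1) by rewrite !divr_gt0.
have e2 : 0 < e / 2 / (normc l + 1) by rewrite !divr_gt0.
have [r r0 Hr] := Hf _ e1; have [s s0 Hs] := Hg _ e2; have [t t0 Ht] := cdiff_lip Hg.
exists (Num.min (Num.min s t) (r / (normc m + 1))); first by rewrite !lt_min s0 t0 divr_gt0.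
move=> h; rewrite !lt_min => /andP[/andP[/Hs hs /Ht ht] hr].
rewrite ltr_pdivlMr // mulrC in hr.
have {}Hr := Hr _ (le_lt_trans ht hr); rewrite [g z + _]addrC subrK in Hr.
rewrite /= (_ : _ - _ = (f (g (z + h)) - f (g z) - l * (g (z + h) - g z)) + l * (g (z + h) - g z - m * h)); last by ring.
rewrite (le_trans (le_normcD _ _)) // normcM.
rewrite (_ : e * normc h = e / 2 / (normc m + 1) * ((normc m + 1) * normc h) + (normc l + 1) * (e / 2 / (normc l + 1) * normc h)); last first.
  by field; rewrite !gt_eqF.
apply: lerD; first by rewrite (le_trans Hr) // ler_wpM2l // ltW.
by rewrite ler_pM ?normc_ge0 // lerDl.
Qed.

Lemma cdiff_sqr z : cdiff (fun w => w * w) z (2 * z).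
Proof.
move=> e e0; exists e => // h he; rewrite (_ : _ - _ = h * h); last by ring.
by rewrite normcM ler_wpM2r ?normc_ge0 // ltW.
Qed.

Lemma cdiffZ k f z l : cdiff f z l -> cdiff (fun w => k * f w) z (k * l).
Proof.
move=> Hf; apply: (@cdiff_comp (fun w => k * w) f) => // e e0; exists 1 => // h _.
rewrite (_ : _ - _ = 0); last by ring.
rewrite ComplexField.Normc.normc0.
by rewrite mulr_ge0 ?normc_ge0 ?ltW.
Qed.

(** Polarisation, f g = ((f + g)^2 - (f - g)^2) / 4, reduces the product rule to the chain rule for
    squaring. *)
Lemma cdiffM f g z l m : cdiff f z l -> cdiff g z m ->
  cdiff (fun w => f w * g w) z (l * g z + f z * m).
Proof.
move=> Hf Hg.
have H1 := cdiff_comp (cdiffD Hf Hg) (cdiff_sqr _).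
have H2 := cdiff_comp (cdiffD Hf (cdiffZ (-1) Hg)) (cdiff_sqr _).
have H := cdiffZ (1/4) (cdiffD H1 (cdiffZ (-1) H2)).
have n4 : (4 : C) != 0 by rewrite pnatr_eq0.
rewrite (_ : l * g z + f z * m = 1 / 4 * (2 * (f z + g z) * (l + m) + -1 * (2 * (f z + -1 * g z) * (l + -1 * m)))); last by field.
apply: cdiff_ext H; exists 1 => // h _ /=; field => //.
Qed.

Lemma cdiffB f g z l m : cdiff f z l -> cdiff g z m ->
  cdiff (fun w => f w - g w) z (l - m).
Proof.
move=> Hf Hg; have := cdiffD Hf (cdiffZ (-1) Hg); rewrite mulN1r.
by apply: cdiff_ext; exists 1 => // h _; rewrite mulN1r.
Qed.

Lemma cdiff_inv z : z != 0 -> cdiff (fun w => w^-1) z (- z^-1 ^+ 2).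
Proof.
move=> z0 e e0; have nz : 0 < normc z by rewrite normc_gt0.
exists (Num.min (normc z / 2) (e * normc z ^+ 3 / 2)).
  by rewrite lt_min !divr_gt0 // mulr_gt0 // exprn_gt0.
move=> h; rewrite lt_min => /andP[h1 h2].
have hz : normc z / 2 <= normc (z + h).
  have := normc_tri_sub z (- h); rewrite opprK normcN; lra.
have zh : z + h != 0 by rewrite -normc_gt0 (lt_le_trans _ hz) // divr_gt0.
rewrite (_ : _ - _ = h * h * (z^-1 * z^-1 * (z + h)^-1)); last by field; rewrite z0 zh.
rewrite !normcM !normcV -!invfM -mulrA [e * _]mulrC ler_wpM2l ?normc_ge0 //.
have zh0 : 0 < normc (z + h) by rewrite normc_gt0.
rewrite ler_pdivrMr ?mulr_gt0 //.
have : 0 <= e * normc z * normc z * (normc (z + h) - normc z / 2).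
  by rewrite !mulr_ge0 ?subr_ge0 // ltW.
rewrite !exprS expr0 in h2; lra.
Qed.

Lemma cdiffV f z l : f z != 0 -> cdiff f z l -> cdiff (fun w => (f w)^-1) z (- (f z)^-1 ^+ 2 * l).
Proof. by move=> fz Hf; apply: (cdiff_comp Hf); exact: cdiff_inv. Qed.

Lemma cdiffableM f g z : cdiffable f z -> cdiffable g z -> cdiffable (fun w => f w * g w) z.
Proof. by move=> [l Hl] [m Hm]; eexists; exact: cdiffM Hl Hm. Qed.

Lemma cdiffableX f n z : cdiffable f z -> cdiffable (fun w => f w ^+ n) z.
Proof.
move=> Hf; elim: n => [|n IH].
  by exists 0; apply: cdiff_ext (cdiff_cst 1 z); exists 1.
have [l Hl] := cdiffableM Hf IH; exists l; apply: cdiff_ext Hl; exists 1 => // h _.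
by rewrite exprS.
Qed.

Lemma cdiffable_invB p z : z != p -> cdiffable (fun w => (w - p)^-1) z.
Proof.
move=> zp; eexists; apply: cdiffV; first by rewrite subr_eq0.
exact: cdiffB (cdiff_id _) (cdiff_cst _ _).
Qed.

End CdiffCalculus.

(** * Cauchy's integral formula and the identity theorem *)

Section Cauchy.
Context {R : realType}.
Local Notation C := R[i].

Lemma cdiffable_ccts_h (f : C -> C) a b y : a <= b ->
  (forall x, a <= x <= b -> cdiffable f (x +i* y)) -> ccts_on a b (fun x => f (x +i* y)).
Proof.
move=> ab H; apply: (@rcont_h _ f a b y y); rewrite ?lexx //.
apply: holo_rcont => -[x y'] /andP[/= xab /andP[yy yy']].
have -> : y' = y by apply/eqP; rewrite eq_le yy yy'.
exact: H.
Qed.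

Lemma cdiffable_ccts_v (f : C -> C) c d x : c <= d ->
  (forall y, c <= y <= d -> cdiffable f (x +i* y)) -> ccts_on c d (fun y => f (x +i* y)).
Proof.
move=> ab H; apply: (@rcont_v _ f x x c d); rewrite ?lexx //.
apply: holo_rcont => -[x' y] /andP[/= /andP[yy yy'] xab].
have -> : x' = x by apply/eqP; rewrite eq_le yy yy'.
exact: H.
Qed.

Lemma complex_neq (x y x' y' : R) : (x != x') || (y != y') -> x +i* y != x' +i* y'.
Proof. by rewrite eq_complex /= negb_and. Qed.

Section Punctured.
Variables (H : C -> C) (a b c d x0 y0 : R).
Hypotheses (ax : a < x0) (xb : x0 < b) (cy : c < y0) (yd : y0 < d).
Hypothesis HH : forall z, inrect a b c d z -> z != x0 +i* y0 -> cdiffable H z.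

Lemma punct_sides x1 x2 y1 y2 : a <= x1 -> x1 < x0 -> x0 < x2 -> x2 <= b -> c <= y1 -> y1 < y0 -> y0 < y2 -> y2 <= d ->
  sides_cts H x1 x2 y1 y2.
Proof.
move=> p1 p2 p3 p4 q1 q2 q3 q4; have p5 := ltW (lt_trans p2 p3); have q5 := ltW (lt_trans q2 q3).
split; [apply: cdiffable_ccts_h => //|apply: cdiffable_ccts_h => //|apply: cdiffable_ccts_v => //|apply: cdiffable_ccts_v => //]; move=> t /andP[t1 t2]; apply: HH.
- by rewrite /inrect /= (le_trans p1 t1) (le_trans t2 p4) q1 (le_trans q5 q4).
- by apply: complex_neq; rewrite [y1 == _]lt_eqF ?orbT.
- by rewrite /inrect /= (le_trans p1 t1) (le_trans t2 p4) q4 (le_trans q1 q5).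
- by apply: complex_neq; rewrite [y2 == _]gt_eqF ?orbT.
- by rewrite /inrect /= (le_trans q1 t1) (le_trans t2 q4) p1 (le_trans p5 p4).
- by apply: complex_neq; rewrite lt_eqF.
- by rewrite /inrect /= (le_trans q1 t1) (le_trans t2 q4) p4 (le_trans p1 p5).
- by apply: complex_neq; rewrite gt_eqF.
Qed.

(** Four strips that avoid the puncture are cut off, and Goursat's theorem annihilates each of
    them. *)
Lemma punct_rect e : 0 < e -> a <= x0 - e -> x0 + e <= b -> c <= y0 - e -> y0 + e <= d ->
  rect H a b c d = rect H (x0 - e) (x0 + e) (y0 - e) (y0 + e).
Proof.
move=> e0 p1 p2 p3 p4; set x1 := x0 - e in p1 *; set x2 := x0 + e in p2 *.
set y1 := y0 - e in p3 *; set y2 := y0 + e in p4 *.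
have x10 : x1 < x0 by rewrite /x1; lra. have x20 : x0 < x2 by rewrite /x2; lra.
have y10 : y1 < y0 by rewrite /y1; lra. have y20 : y0 < y2 by rewrite /y2; lra.
have G a' b' c' d' : a <= a' -> a' <= b' -> b' <= b -> c <= c' -> c' <= d' -> d' <= d ->
    [|| b' < x0, x0 < a', d' < y0 | y0 < c'] -> rect H a' b' c' d' = 0.
  move=> q1 q2 q3 q4 q5 q6 q7; apply: goursat => // -[x y] /andP[/= /andP[r1 r2] /andP[r3 r4]].
  apply: HH; first by rewrite /inrect /= (le_trans q1 r1) (le_trans r2 q3) (le_trans q4 r3) (le_trans r4 q6).
  apply: complex_neq; case/or4P: q7 => q7.
  - by rewrite lt_eqF // (le_lt_trans r2).
  - by rewrite gt_eqF // (lt_le_trans _ r1).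
  - by rewrite [y == _]lt_eqF ?orbT // (le_lt_trans r4).
  - by rewrite [y == _]gt_eqF ?orbT // (lt_le_trans _ r3).
have l1 := ltW x10; have l2 := ltW x20; have l3 := ltW y10; have l4 := ltW y20.
have l5 := le_trans l1 l2; have l6 := le_trans l3 l4.
rewrite (@rect_splitx _ _ _ _ _ _ (punct_sides (lexx a) ax xb (lexx b) (lexx c) cy yd (lexx d)) x1); last by rewrite p1 (le_trans l5 p2).
rewrite (@G a x1 c d) ?add0r ?lexx ?p1 ?x10 ?orbT //; [|exact: le_trans l5 p2|by rewrite (ltW (lt_trans cy yd))].
rewrite (@rect_splitx _ _ _ _ _ _ (punct_sides p1 x10 xb (lexx b) (lexx c) cy yd (lexx d)) x2); last by rewrite l5 p2.
rewrite [X in _ + X]G ?addr0 ?lexx ?x20 ?orbT ?p2 //; [|exact: le_trans p1 l5|by rewrite (ltW (lt_trans cy yd))].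
rewrite (@rect_splity _ _ _ _ _ _ (punct_sides p1 x10 x20 p2 (lexx c) cy yd (lexx d)) y1); last by rewrite p3 (le_trans l6 p4).
rewrite (@G x1 x2 c y1) ?add0r ?lexx ?y10 ?orbT //; [|exact: le_trans l6 p4].
rewrite (@rect_splity _ _ _ _ _ _ (punct_sides p1 x10 x20 p2 p3 y10 yd (lexx d)) y2); last by rewrite l6 p4.
by rewrite [X in _ + X]G ?addr0 ?lexx ?y20 ?orbT //; exact: le_trans p3 l6.
Qed.

End Punctured.

Lemma rint_ge a b (f : R -> R) M : a <= b -> cts_on a b f ->
  (forall x, a <= x <= b -> M <= f x) -> M * (b - a) <= rint a b f.
Proof.
by move=> ab cf H; rewrite -(@rint_cst _ a b M) //; apply: rint_le => //; exact: cts_on_cst.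
Qed.

Section Kernel.
Variables (a b c d x0 y0 : R).
Hypotheses (ax : a < x0) (xb : x0 < b) (cy : c < y0) (yd : y0 < d).
Let z0 : C := x0 +i* y0.
Let K (z : C) := (z - z0)^-1.

Let Kdiff z : inrect a b c d z -> z != x0 +i* y0 -> cdiffable K z.
Proof. by move=> _ zz; exact: cdiffable_invB. Qed.

Let small : exists2 r, 0 < r & forall e, 0 < e -> e <= r -> [/\ a <= x0 - e, x0 + e <= b, c <= y0 - e & y0 + e <= d].
Proof.
exists (Num.min (Num.min (x0 - a) (b - x0)) (Num.min (y0 - c) (d - y0))); first by rewrite !lt_min !subr_gt0 ax xb cy yd.
by move=> e _; rewrite !le_min => /andP[/andP[p1 p2] /andP[p3 p4]]; split; lra.
Qed.

Lemma inv_half_le (e t : R) : 0 < e -> `|t| <= e -> (2 * e)^-1 <= e / (t ^+ 2 + e ^+ 2).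
Proof.
move=> e0 te; have t2 : t ^+ 2 <= e ^+ 2 by rewrite -[t ^+ 2]real_normK ?num_real // lerXn2r ?nnegrE // ltW.
have e2 : 0 < e ^+ 2 by rewrite exprn_gt0.
rewrite ler_pdivlMr ?ltr_wpDl ?sqr_ge0 // mulrC ler_pdivrMr ?mulr_gt0 //.
by rewrite (_ : e * (2 * e) = e ^+ 2 + e ^+ 2) ?lerD2r //; ring.
Qed.

(** The exact value is 2 pi i, but the formula is only ever divided by it, so that a lower bound is
    enough. On a small square centred at the pole each edge contributes at least 1 to the imaginary
    part, because e / (t^2 + e^2) >= 1 / (2 e) along it. *)
Lemma kernel_ge : 4 <= normc (rect K a b c d).
Proof.
have [e e0 He] := small; have [p1 p2 p3 p4] := He e e0 (lexx e).
rewrite (punct_rect ax xb cy yd Kdiff e0) //.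
have [[h1 h1'] [h2 h2'] [h3 h3'] [h4 h4']] : sides_cts K (x0 - e) (x0 + e) (y0 - e) (y0 + e).
  by apply: (punct_sides Kdiff) => //; lra.
rewrite (le_trans _ (Im_le_normc _)) // (le_trans _ (ler_norm _)) //.
rewrite /rect complexIm_D complexIm_B complexIm_M complexRe_B /= mul0r mul1r add0r.
have xx : x0 - e <= x0 + e by lra. have yy : y0 - e <= y0 + e by lra.
have E1 : (2 * e)^-1 * (x0 + e - (x0 - e)) = 1 by field; rewrite gt_eqF.
have E2 : (2 * e)^-1 * (y0 + e - (y0 - e)) = 1 by field; rewrite gt_eqF.
have ab t s : s - e <= t <= s + e -> `|t - s| <= e by move=> /andP[? ?]; rewrite ler_norml; apply/andP; split; lra.
have I1 : 1 <= rint (x0 - e) (x0 + e) (fun x => Im (K (x +i* (y0 - e)))).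
  rewrite -{1}E1; apply: rint_ge => // x /ab xe; rewrite (le_trans (inv_half_le e0 xe)) //.
  by rewrite /K /= -mulNr; apply: le_of_eq; congr (_ / _); ring.
have I2 : 1 <= rint (x0 - e) (x0 + e) (fun x => - Im (K (x +i* (y0 + e)))).
  rewrite -{1}E1; apply: rint_ge => //; first exact: cts_onN.
  move=> x /ab xe; rewrite (le_trans (inv_half_le e0 xe)) //.
  by rewrite /K /=; apply: le_of_eq; rewrite opprK; congr (_ / _); ring.
have I3 : 1 <= rint (y0 - e) (y0 + e) (fun y => Re (K ((x0 + e) +i* y))).
  rewrite -{1}E2; apply: rint_ge => // x /ab xe; rewrite (le_trans (inv_half_le e0 xe)) //.
  by rewrite /K /=; apply: le_of_eq; congr (_ / _); ring.
have I4 : 1 <= rint (y0 - e) (y0 + e) (fun y => - Re (K ((x0 - e) +i* y))).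
  rewrite -{1}E2; apply: rint_ge => //; first exact: cts_onN.
  move=> x /ab xe; rewrite (le_trans (inv_half_le e0 xe)) //.
  by rewrite /K /= -mulNr; apply: le_of_eq; congr (_ / _); ring.
have N (u v : R) g : cts_on u v g -> rint u v (fun x => - g x) = - rint u v g.
  by move=> cg; rewrite -mulN1r -rintZ //; apply: rint_ext => x _; rewrite mulN1r.
rewrite N // in I2; rewrite N // in I4; lra.
Qed.

(** After subtraction of [g z0 * K z] the integrand is a difference quotient of [g], bounded near
    [z0]. Its integral equals the one over arbitrarily small squares, and hence is 0. *)
Lemma cauchy (g : C -> C) : (forall z, inrect a b c d z -> cdiffable g z) ->
  rect (fun z => g z * K z) a b c d = g z0 * rect K a b c d.
Proof.
move=> hg; have [r r0 Hr] := small.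
have z0i : inrect a b c d z0 by rewrite /inrect /= !ltW.
have [l /cdiff_lip[s s0 Hs]] := hg _ z0i.
pose G z := g z * K z + (- g z0) * K z.
have dg z : inrect a b c d z -> z != x0 +i* y0 -> cdiffable (fun z => g z * K z) z.
  by move=> zi zz; apply: cdiffableM; [exact: hg|exact: Kdiff].
have dG z : inrect a b c d z -> z != x0 +i* y0 -> cdiffable G z.
  move=> zi zz; have [l1 h1] := dg _ zi zz; have [l2 h2] := Kdiff zi zz.
  by eexists; exact: cdiffD h1 (cdiffZ _ h2).
have sg := punct_sides dg (lexx a) ax xb (lexx b) (lexx c) cy yd (lexx d).
have sK := punct_sides Kdiff (lexx a) ax xb (lexx b) (lexx c) cy yd (lexx d).
apply/eqP; rewrite -subr_eq0 -mulNr -rectZ // -rectD //; last exact: sides_ctsZ.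
rewrite -/G -normc_eq0 eq_le normc_ge0 andbT leNgt; apply/negP => G0.
set B := normc l + 1 in Hs; have B0 : 0 < B by rewrite ltr_wpDl ?normc_ge0.
set q := normc (rect G a b c d) in G0.
(* The integral over the square of half side [e] is at most 16 B e, which this choice makes at most
   q / 2. *)
pose e := Num.min (Num.min r (s / 4)) (q / (32 * B)).
have e0 : 0 < e by rewrite !lt_min r0 !divr_gt0 // mulr_gt0.
have : e <= e by []; rewrite {2}/e !le_min => /andP[/andP[er es] eq].
have [p1 p2 p3 p4] := Hr e e0 er.
have bound : q <= 4 * B * ((x0 + e - (x0 - e)) + (y0 + e - (y0 - e))).
  rewrite /q (punct_rect ax xb cy yd dG e0) //; apply: rect_norm_le; [lra|lra| |].
    by apply: (punct_sides dG) => //; lra.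
  move=> [x y] /andP[/andP[/= /andP[x1 x2] /andP[y1 y2]] _].
  rewrite /G -mulrDl /K; have [->|zz] := eqVneq (x +i* y) z0.
    by rewrite subrr mul0r ComplexField.Normc.normc0 ltW.
  rewrite normcM normcV ler_pdivrMr ?normc_gt0 ?subr_eq0 //.
  have := Hs (x +i* y - z0); rewrite [z0 + _]addrC subrK; apply.
  rewrite (le_lt_trans (normc_le_ReIm _)) //= (le_lt_trans (y := e + e)) //; last by lra.
  by rewrite lerD // ler_norml; apply/andP; split; lra.
rewrite ler_pdivlMr ?mulr_gt0 // in eq; lra.
Qed.

End Kernel.

Lemma cts_on_bounded a b (f : R -> R) : a <= b -> cts_on a b f -> exists M, forall x, a <= x <= b -> `|f x| <= M.
Proof.
move=> ab cf; have [c _ H] := EVT_max ab (cts_on_within cf).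
have [d _ H'] := EVT_max ab (cts_on_within (cts_onN cf)).
exists (Num.max (f c) (- f d)) => x xab.
have := H x; have := H' x; rewrite !in_itv /= => /(_ xab) h1 /(_ xab) h2.
by rewrite le_max; case: (ger0P (f x)) => _; rewrite ?h1 ?h2 ?orbT.
Qed.

Section IdentityTheorem.
Variables (f : C -> C) (c : C) (a : R).
Hypothesis a0 : 0 < a.
Let A := Re c - a.
Let B := Re c + a.
Let D := Im c - a.
Let E := Im c + a.
Hypothesis hf : forall z, inrect A B D E z -> cdiffable f z.
Hypothesis fR : exists2 r, 0 < r & forall x : R, `|x| < r -> f (c + x%:C) = 0.

Let AB : A <= B. Proof. by rewrite lerD2l (le_trans _ (ltW a0)) // oppr_le0 ltW. Qed.
Let DE : D <= E. Proof. by rewrite lerD2l (le_trans _ (ltW a0)) // oppr_le0 ltW. Qed.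

Let bd_dist z : onbd A B D E z -> a <= normc (z - c).
Proof.
move=> /andP[_ /or4P[] /eqP h].
- by rewrite (le_trans _ (Re_le_normc _)) // complexRe_B h /A addrAC subrr add0r normrN ger0_norm // ltW.
- by rewrite (le_trans _ (Re_le_normc _)) // complexRe_B h /B addrAC subrr add0r ger0_norm // ltW.
- by rewrite (le_trans _ (Im_le_normc _)) // complexIm_B h /D addrAC subrr add0r normrN ger0_norm // ltW.
- by rewrite (le_trans _ (Im_le_normc _)) // complexIm_B h /E addrAC subrr add0r ger0_norm // ltW.
Qed.

Let sides_of (g : C -> C) : (forall z, onbd A B D E z -> cdiffable g z) -> sides_cts g A B D E.
Proof.
move=> H; split; [apply: cdiffable_ccts_h => //|apply: cdiffable_ccts_h => //|apply: cdiffable_ccts_v => //|apply: cdiffable_ccts_v => //];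
  by move=> t tab; apply: H; rewrite /onbd /inrect /= tab !lexx ?AB ?DE ?eqxx ?orbT.
Qed.

Let fM : exists2 M, 0 <= M & forall z, onbd A B D E z -> normc (f z) <= M.
Proof.
have [[h1 h1'] [h2 h2'] [h3 h3'] [h4 h4']] := sides_of (fun z zi => hf (proj1 (andP zi))).
have [m1 M1] := cts_on_bounded AB h1; have [m1' M1'] := cts_on_bounded AB h1'.
have [m2 M2] := cts_on_bounded AB h2; have [m2' M2'] := cts_on_bounded AB h2'.
have [m3 M3] := cts_on_bounded DE h3; have [m3' M3'] := cts_on_bounded DE h3'.
have [m4 M4] := cts_on_bounded DE h4; have [m4' M4'] := cts_on_bounded DE h4'.
pose n (x : R) := `|x|; have nn (x : R) : 0 <= n x by exact: normr_ge0.
exists (n m1 + n m1' + (n m2 + n m2') + (n m3 + n m3') + (n m4 + n m4')); first by rewrite !addr_ge0 ?nn.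
have g1 := nn m1; have g1' := nn m1'; have g2 := nn m2; have g2' := nn m2'.
have g3 := nn m3; have g3' := nn m3'; have g4 := nn m4; have g4' := nn m4'.
have ni (x : R) : x <= n x by exact: ler_norm.
move=> [x y] /andP[/andP[/= xab yde] /or4P[] /eqP h]; rewrite h in xab yde *;
  rewrite (le_trans (normc_le_ReIm _)) //.
- have := le_trans (M3 _ yde) (ni m3); have := le_trans (M3' _ yde) (ni m3'); move=> k1 k2.
  by rewrite (le_trans (lerD k2 k1)) //; lra.
- have := le_trans (M4 _ yde) (ni m4); have := le_trans (M4' _ yde) (ni m4'); move=> k1 k2.
  by rewrite (le_trans (lerD k2 k1)) //; lra.
- have := le_trans (M1 _ xab) (ni m1); have := le_trans (M1' _ xab) (ni m1'); move=> k1 k2.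
  by rewrite (le_trans (lerD k2 k1)) //; lra.
- have := le_trans (M2 _ xab) (ni m2); have := le_trans (M2' _ xab) (ni m2'); move=> k1 k2.
  by rewrite (le_trans (lerD k2 k1)) //; lra.
Qed.

(** Up to the constant of Cauchy's formula, [AN N] is the N-th Taylor coefficient of [f] at [c], and
    [EN N z0] is the remainder after N terms divided by (z0 - c)^N. *)
Let K z0 z : C := (z - z0)^-1.
Let P N (z : C) : C := f z * K c z ^+ N.
Let EN N z0 := rect (fun z => P N z * K z0 z) A B D E.
Let AN N := rect (fun z => P N z * K c z) A B D E.

Let Kd z0 z : normc (z0 - c) < a -> onbd A B D E z -> cdiffable (K z0) z.
Proof.
move=> h /bd_dist h'; apply: cdiffable_invB; apply/eqP => E'; move: h'; rewrite E' leNgt.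
by rewrite h.
Qed.

Let cc : normc (c - c) < a.
Proof. by rewrite subrr ComplexField.Normc.normc0. Qed.

Let Pd N z : onbd A B D E z -> cdiffable (P N) z.
Proof.
move=> zi; apply: cdiffableM; first by apply: hf; case/andP: zi.
by apply: cdiffableX; exact: Kd.
Qed.

(** One step of the geometric expansion of 1 / (z - z0) in powers of (z0 - c) / (z - c). *)
Let ENS N z0 : normc (z0 - c) < a -> EN N z0 = AN N + (z0 - c) * EN N.+1 z0.
Proof.
move=> hz; rewrite /EN /AN.
have s1 : sides_cts (fun z => P N z * K c z) A B D E.
  by apply: sides_of => z zi; apply: cdiffableM; [exact: Pd|exact: Kd].
have s2 : sides_cts (fun z => P N.+1 z * K z0 z) A B D E.
  by apply: sides_of => z zi; apply: cdiffableM; [exact: Pd|exact: Kd].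
rewrite -rectZ // -rectD //; last exact: sides_ctsZ.
rewrite /rect /hs /vs.
have key z : onbd A B D E z -> P N z * K z0 z = P N z * K c z + (z0 - c) * (P N.+1 z * K z0 z).
  move=> /bd_dist zi; rewrite /P /K exprSr.
  have zc : z - c != 0 by rewrite -normc_gt0 (lt_le_trans a0).
  have zz : z - z0 != 0.
    by rewrite subr_eq0; apply/eqP => E'; move: zi; rewrite E' leNgt hz.
  by field; rewrite zz zc.
congr (_ - _ + _ * (_ - _)); apply: cint_ext => t tab; apply: key; by rewrite /onbd /inrect /= tab !lexx ?AB ?DE ?eqxx ?orbT.
Qed.

Let ENbd : exists2 M, 0 <= M & forall N z0, normc (z0 - c) < a -> normc (EN N z0) <= M * a^-1 ^+ N / (a - normc (z0 - c)).
Proof.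
have [M M0 HM] := fM; exists (4 * M * ((B - A) + (E - D))).
  by rewrite mulr_ge0 ?mulr_ge0 // addr_ge0 // subr_ge0.
move=> N z0 hz; have hz' : 0 < a - normc (z0 - c) by rewrite subr_gt0.
have s2 : sides_cts (fun z => P N z * K z0 z) A B D E.
  by apply: sides_of => z zi; apply: cdiffableM; [exact: Pd|exact: Kd].
rewrite /EN (_ : 4 * M * _ * _ / _ = 4 * (M * a^-1 ^+ N / (a - normc (z0 - c))) * (B - A + (E - D))); last first.
  by ring.
apply: rect_norm_le => // z zi.
have h := bd_dist zi.
rewrite /P /K !normcM normcX !normcV ler_pM ?mulr_ge0 ?exprn_ge0 ?invr_ge0 ?normc_ge0 //.
  by rewrite ler_pM ?exprn_ge0 ?invr_ge0 ?normc_ge0 ?HM // lerXn2r ?nnegrE ?invr_ge0 ?normc_ge0 ?(ltW a0) // lef_pV2 ?posrE // (lt_le_trans a0).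
have : a - normc (z0 - c) <= normc (z - z0).
  have := normc_tri_sub (z - c) (z0 - c); rewrite (_ : z - c - (z0 - c) = z - z0); last by ring.
  lra.
by move=> h2; rewrite lef_pV2 ?posrE // (lt_le_trans hz').
Qed.

Let E0 z0 : normc (z0 - c) < a -> EN 0 z0 = f z0 * rect (K z0) A B D E.
Proof.
case: z0 => x y h.
have := le_lt_trans (Re_le_normc _) h; have := le_lt_trans (Im_le_normc _) h.
rewrite complexRe_B complexIm_B /= !ltr_norml => /andP[h1 h2] /andP[h3 h4].
rewrite -cauchy //; [|rewrite /A /B /D /E; lra..].
rewrite /EN; apply: rect_ext => // z zi.
by rewrite /P expr0 mulr1.
Qed.

(** All Taylor coefficients vanish, by induction. At a real displacement x > 0 with f(c + x) = 0 the
    quotient [EN N] is 0, so [ENS] gives |AN N| = x |EN N.+1|, and the last factor stays bounded as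
    x tends to 0. *)
Let E_pow N z0 : normc (z0 - c) < a -> EN 0 z0 = (z0 - c) ^+ N * EN N z0.
Proof.
elim: N z0 => [|N IH] z0 hz; first by rewrite mul1r.
suff A0 : AN N = 0 by rewrite IH // ENS // A0 add0r exprSr mulrA.
have [M M0 HM] := ENbd; have [r r0 Hr] := fR.
have small (x : R) : 0 < x -> x < r -> x < a / 2 -> normc (AN N) <= x * (M * a^-1 ^+ N.+1 / (a / 2)).
  move=> x0 xr xa; have xn : normc (c + x%:C - c) = x by rewrite addrAC subrr add0r normcR gtr0_norm.
  have xl : normc (c + x%:C - c) < a by rewrite xn; lra.
  have EN0 : EN N (c + x%:C) = 0.
    have := IH _ xl; rewrite E0 // Hr ?gtr0_norm // mul0r => /esym/eqP.
    by rewrite mulf_eq0 expf_eq0 -[_ - c == 0]negbK -normc_gt0 xn x0 andbF /= => /eqP.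
  have AE : AN N = - ((c + x%:C - c) * EN N.+1 (c + x%:C)) by apply/eqP; rewrite -addr_eq0 -ENS // EN0.
  rewrite AE normcN normcM xn ler_wpM2l ?(ltW x0) // (le_trans (HM _ _ xl)) // xn.
  by rewrite ler_wpM2l ?mulr_ge0 ?exprn_ge0 ?invr_ge0 ?(ltW a0) // lef_pV2 ?posrE; lra.
apply/eqP; rewrite -normc_eq0 eq_le normc_ge0 andbT leNgt; apply/negP => p.
set Q := M * _ / _ in small.
have Q0 : 0 <= Q by rewrite /Q !mulr_ge0 ?invr_ge0 ?exprn_ge0 ?invr_ge0 ?mulr_ge0 // ?(ltW a0).
pose x := Num.min (Num.min (r / 2) (a / 4)) (normc (AN N) / (2 * (Q + 1))).
have x0 : 0 < x by rewrite !lt_min !divr_gt0 // mulr_gt0 // ltr_wpDl.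
have : x <= x by []; rewrite {2}/x !le_min => /andP[/andP[x1 x2] x3].
have := small x x0; have xr : x < r by lra. have xa : x < a / 2 by lra.
move=> /(_ xr xa); rewrite ler_pdivlMr in x3; last by rewrite mulr_gt0 // ltr_wpDl.
by move=> h; nra.
Qed.

(** With every coefficient equal to 0, f(z0) is for each N a remainder of order (|z0 - c| / a)^N.
    The conclusion holds in the disc inscribed in the square. *)
Lemma identity_theorem z0 : normc (z0 - c) < a -> f z0 = 0.
Proof.
move=> hz; have [M M0 HM] := ENbd.
have k4 : 4 <= normc (rect (K z0) A B D E).
  case: z0 hz => x y h.
  have := le_lt_trans (Re_le_normc _) h; have := le_lt_trans (Im_le_normc _) h.
  rewrite complexRe_B complexIm_B /= !ltr_norml => /andP[h1 h2] /andP[h3 h4].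
  by apply: kernel_ge; rewrite /A /B /D /E; lra.
set q := normc (z0 - c) / a.
have q0 : 0 <= q by rewrite divr_ge0 ?normc_ge0 // ltW.
have q1 : q < 1 by rewrite ltr_pdivrMr // mul1r.
have bd N : normc (f z0) * 4 <= q ^+ N * (M / (a - normc (z0 - c))).
  apply: le_trans (_ : normc (EN 0 z0) <= _); first by rewrite E0 // normcM ler_wpM2l ?normc_ge0.
  rewrite (E_pow N) // normcM normcX.
  rewrite (le_trans (ler_wpM2l _ (HM N _ hz))) ?exprn_ge0 ?normc_ge0 //.
  by apply: le_of_eq; rewrite /q exprMn; ring.
apply/eqP; rewrite -normc_eq0 eq_le normc_ge0 andbT leNgt; apply/negP => p.
have := @cvg_geometric R (M / (a - normc (z0 - c))) q.
rewrite ger0_norm // => /(_ q1) /cvgrPdist_lt /(_ (normc (f z0) * 4)) [|N _ /(_ N (leqnn N))].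
  by rewrite mulr_gt0.
rewrite /geometric /= sub0r normrN ger0_norm; last first.
  by rewrite !mulr_ge0 ?exprn_ge0 // invr_ge0 subr_ge0 ltW.
by rewrite mulrC ltNge bd.
Qed.

End IdentityTheorem.

End Cauchy.

(** * Comparison with [derivable] over the complex numbers *)

Section Bridge.
Context {R : realType}.
Local Notation C := R[i].

Lemma normC_normc (z : C) : `|z| = (normc z)%:C.
Proof. by []. Qed.

(** A positive element of [R[i]] is real, so the radii of the norm topology amount to real
    numbers. *)
Lemma nbhs0_normc (P : set (C^o)) : nbhs (0 : C^o) P <->
  exists2 r : R, 0 < r & forall h : C, normc h < r -> P h.
Proof.
rewrite nbhs_ballP; split => [[e /= e0 He]|[r r0 Hr]].
  move: e0; rewrite ltcE /= => /andP[/eqP ie re]; exists (Re e) => // h hr; apply: He.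
  rewrite -ball_normE /= sub0r normrN normC_normc ltcE /= ie eqxx /=; exact: hr.
exists r%:C => /=; first by rewrite ltcR.
move=> h; rewrite -ball_normE /= sub0r normrN normC_normc ltcR; exact: Hr.
Qed.

Lemma cdiff_cvg (f : C^o -> C^o) (z l : C) : cdiff f z l <->
  (h^-1 *: ((f \o shift z) (h *: (1 : C^o)) - f z) @[h --> (0 : C^o)^'] --> (l : C^o)).
Proof.
have E (h : C) : h != 0 -> l - h^-1 *: ((f \o shift z) (h *: (1 : C^o)) - f z) =
    - (h^-1 * (f (z + h) - f z - l * h)).
  move=> h0; rewrite /= /GRing.scale /= mulr1 [h + z]addrC; by field.
split=> [H|].
  apply/cvgrPdist_le => e; rewrite ltcE /= => /andP[/eqP ie re].
  have [r r0 Hr] := H _ re; apply/nbhs0_normc; exists r => // h hr /= h0.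
  rewrite E // normrN normrM normfV !normC_normc.
  have nh : 0 < normc h by rewrite normc_gt0.
  have q : (normc h)^-1 * normc (f (z + h) - f z - l * h) <= Re e.
    by rewrite ler_pdivrMl // [_ * Re e]mulrC; exact: Hr.
  by rewrite -fmorphV -rmorphM lecE complexImC ie eqxx.
move/cvgrPdist_le => H e e0.
have /H : 0 < e%:C :> C by rewrite ltcR.
move/nbhs0_normc => [r r0 Hr]; exists r => // h hr.
have [->|h0] := eqVneq h 0.
  by rewrite addr0 subrr mulr0 subr0 ComplexField.Normc.normc0 mulr0.
have := Hr h hr h0; rewrite E // normrN normrM normfV !normC_normc.
have nh : 0 < normc h by rewrite normc_gt0.
by rewrite -fmorphV -rmorphM lecR ler_pdivrMl // [_ * e]mulrC.
Qed.

Lemma derivable_cdiff (f : C^o -> C^o) (z : C) : derivable f z 1 -> cdiff f z (derive1 f z).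
Proof. by move=> H; rewrite derive1E; apply/cdiff_cvg; exact: H. Qed.

End Bridge.

(** * The complex exponential *)

Section ComplexExp.
Context {R : realType}.
Local Notation C := R[i].

Lemma cexpD (z w : C) : cexp (z + w) = cexp z * cexp w.
Proof.
case: z => a b; case: w => c d; rewrite /cexp /= expRD cosD sinD.
by apply: complex_ext => /=; ring.
Qed.

Lemma cexp0 : cexp 0 = 1 :> C.
Proof. by rewrite /cexp /= expR0 cos0 sin0 mul1r. Qed.

Lemma cexpR (x : R) : cexp x%:C = (expR x)%:C.
Proof. by rewrite /cexp /= cos0 sin0 mulr1. Qed.

Lemma Re_cexp (z : C) : Re (cexp z) = expR (Re z) * cos (Im z).
Proof. by rewrite /cexp complexRe_M /= mul0r subr0. Qed.

Lemma normc_cexp (z : C) : normc (cexp z) = expR (Re z).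
Proof.
by rewrite /cexp normcM normcR /= cos2Dsin2 sqrtr1 mulr1 ger0_norm // expR_ge0.
Qed.

Lemma sin_norm_le (y : R) : `|sin y| <= `|y|.
Proof.
wlog y0 : y / 0 <= y.
  move=> H; case: (leP 0 y) => [/H//|/ltW y0]; rewrite -normrN -sinN -[leRHS]normrN.
  by apply: H; rewrite oppr_ge0.
have [c _] := @MVT_segment _ sin cos 0 y y0 (fun x _ => is_derive_sin x) (continuous_subspaceT (@continuous_sin R)).
by rewrite sin0 !subr0 => ->; rewrite normrM ler_piMl // cos_max.
Qed.

Lemma cos_dist_le (y : R) : `|cos y - 1| <= y ^+ 2.
Proof.
wlog y0 : y / 0 <= y.
  move=> H; case: (leP 0 y) => [/H//|/ltW y0]; rewrite -cosN -sqrrN.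
  by apply: H; rewrite oppr_ge0.
have [c + /=] := @MVT_segment _ cos (fun x => - sin x) 0 y y0 (fun x _ => is_derive_cos x) (continuous_subspaceT (@continuous_cos R)).
rewrite in_itv /= cos0 subr0 => /andP[c0 cy] ->; rewrite normrM normrN expr2.
by rewrite (ger0_norm y0) ler_wpM2r // (le_trans (sin_norm_le c)) // ger0_norm.
Qed.

Lemma cos_dist_le1 (y : R) : `|cos y - 1| <= `|y|.
Proof.
wlog y0 : y / 0 <= y.
  move=> H; case: (leP 0 y) => [/H//|/ltW y0]; rewrite -cosN -[leRHS]normrN.
  by apply: H; rewrite oppr_ge0.
have [c _] := @MVT_segment _ cos (fun x => - sin x) 0 y y0 (fun x _ => is_derive_cos x) (continuous_subspaceT (@continuous_cos R)).
by rewrite cos0 !subr0 => ->; rewrite normrM ler_piMl // normrN sin_max.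
Qed.

Lemma sin_dist_le (y : R) : `|sin y - y| <= y ^+ 2.
Proof.
wlog y0 : y / 0 <= y.
  move=> H; case: (leP 0 y) => [/H//|/ltW y0]; rewrite -normrN opprB -[- sin y]sinN -sqrrN.
  by rewrite -[y in y + _]opprK addrC; apply: H; rewrite oppr_ge0.
have [c + /=] := @MVT_segment _ sin cos 0 y y0 (fun x _ => is_derive_sin x) (continuous_subspaceT (@continuous_sin R)).
rewrite in_itv /= sin0 !subr0 => /andP[c0 cy] ->.
rewrite -{2}[y]mul1r -mulrBl normrM expr2 (ger0_norm y0) ler_wpM2r //.
by rewrite (le_trans (cos_dist_le1 c)) // ger0_norm.
Qed.

Lemma expR_sub1_le (x : R) : expR x - 1 <= x * expR x.
Proof.
have ex : expR (- x) * expR x = 1 by rewrite -expRD addNr expR0.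
have := ler_wpM2r (expR_ge0 x) (expR_ge1Dx (- x)); rewrite ex; lra.
Qed.

Lemma expR_dist1 (x : R) : `|expR x - 1| <= `|x| * expR `|x|.
Proof.
have h1 := expR_ge1Dx x; case: (leP 0 x) => x0.
  by rewrite (ger0_norm x0) ger0_norm ?expR_sub1_le //; lra.
rewrite (ltr0_norm x0) ler0_norm; last by rewrite subr_le0 -expR0 ler_expR ltW.
have E1 : 1 <= expR (- x) by rewrite -expR0 ler_expR oppr_ge0 ltW.
apply: le_trans (_ : - x * 1 <= _); first lra.
by rewrite ler_wpM2l // oppr_ge0 ltW.
Qed.

Lemma expR_dist2 (x : R) : `|expR x - 1 - x| <= x ^+ 2 * expR `|x|.
Proof.
have h1 := expR_ge1Dx x; have h2 := expR_sub1_le x.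
rewrite ger0_norm; last by lra.
case: (leP 0 x) => x0.
  by rewrite (ger0_norm x0); have := ler_wpM2l x0 h2; rewrite expr2; lra.
have E1 : 1 <= expR `|x| by rewrite -expR0 ler_expR.
apply: le_trans (_ : x ^+ 2 * 1 <= _); last by rewrite ler_wpM2l // sqr_ge0.
have h3 : x <= expR x - 1 by lra.
by have := ler_wnM2l (ltW x0) h3; rewrite expr2; lra.
Qed.

(** Only the real part enters the exponential: in imaginary directions the remainder is merely
    quadratic, so that real moments dominate it under the integral sign. *)
Lemma cexp_dist (z : C) : normc (cexp z - 1 - z) <= 4 * normc z ^+ 2 * expR `|Re z|.
Proof.
case: z => x y; rewrite (le_trans (normc_le_ReIm _)) //.
rewrite /cexp !complexRe_B !complexIm_B !complexRe_M !complexIm_M /= !mul0r !subr0 addr0.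
have hx : expR x <= expR `|x| by rewrite ler_expR ler_norm.
have E1 : 1 <= expR `|x| by rewrite -expR0 ler_expR.
set e := expR `|x| in hx E1 *; have n2 : Num.sqrt (x ^+ 2 + y ^+ 2) ^+ 2 = x ^+ 2 + y ^+ 2.
  by rewrite sqr_sqrtr // addr_ge0 ?sqr_ge0.
rewrite n2.
have b1 : `|expR x * cos y - 1 - x| <= (x ^+ 2 + y ^+ 2) * e.
  rewrite (_ : _ - x = (expR x - 1 - x) + expR x * (cos y - 1)); last by ring.
  rewrite (le_trans (ler_normD _ _)) // mulrDl lerD ?expR_dist2 // normrM mulrC.
  by rewrite ler_pM // ?cos_dist_le // ger0_norm // expR_ge0.
have b2 : `|expR x * sin y - y| <= (`|x| * `|y| + y ^+ 2) * e.
  rewrite (_ : _ - y = (expR x - 1) * sin y + (sin y - y)); last by ring.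
  rewrite (le_trans (ler_normD _ _)) // [leRHS]mulrDl lerD //.
    by rewrite normrM mulrAC ler_pM // ?expR_dist1 // sin_norm_le.
  by rewrite (le_trans (sin_dist_le y)) // ler_peMr ?sqr_ge0.
have b3 : `|x| * `|y| <= (x ^+ 2 + y ^+ 2).
  rewrite -[x ^+ 2]real_normK ?num_real // -[y ^+ 2]real_normK ?num_real //.
  have := sqr_ge0 (`|x| - `|y|); have := normr_ge0 x; have := normr_ge0 y; nra.
have b4 : 0 <= x ^+ 2 by exact: sqr_ge0.
have b5 : 0 <= y ^+ 2 by exact: sqr_ge0.
rewrite (le_trans (lerD b1 b2)) // -mulrDl ler_wpM2r ?(le_trans _ E1) //.
lra.
Qed.

End ComplexExp.

(** * Laplace transforms *)

Section Laplace.
Context {R : realType} {d : measure_display} {T : measurableType d}.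
Variable mu : {measure set T -> \bar R}.
Local Notation C := R[i].
Implicit Types (w u : T -> R).

(* Laplace transform of the image under u of the measure with density w *)
Definition lap w u (z : C) : C :=
  (\int[mu]_t (w t * Re (cexp (z * (u t)%:C))))%R +i* (\int[mu]_t (w t * Im (cexp (z * (u t)%:C))))%R.

Definition lap' w u (z : C) : C := lap (fun t => w t * u t) u z.

(** For nonnegative [w], finiteness at a real abscissa is absolute convergence on the whole vertical
    line through it. *)
Definition lap_fin w u (s : R) := (\int[mu]_t (w t * expR (s * u t))%:E < +oo)%E.

Variables (w u : T -> R).
Hypotheses (w0 : forall t, 0 <= w t) (mw : measurable_fun setT w) (mu_ : measurable_fun setT u).

Let mcexpRe z : measurable_fun setT (fun t => Re (cexp (z * (u t)%:C))).
Proof.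
case: z => x y; rewrite /cexp /=.
under eq_fun do rewrite mulr0 subr0 mul0r mulr0 subr0 add0r.
apply: measurable_funM.
  by apply: measurableT_comp => //; apply: measurable_funM.
apply: measurableT_comp; last by apply: measurable_funM.
by apply: continuous_measurable_fun; exact: continuous_cos.
Qed.

Let mcexpIm z : measurable_fun setT (fun t => Im (cexp (z * (u t)%:C))).
Proof.
case: z => x y; rewrite /cexp /=.
under eq_fun do rewrite mulr0 subr0 mul0r mulr0 addr0 add0r.
apply: measurable_funM.
  by apply: measurableT_comp => //; apply: measurable_funM.
apply: measurableT_comp; last by apply: measurable_funM.
by apply: continuous_measurable_fun; exact: continuous_sin.
Qed.

Let expint s : lap_fin w u s -> mu.-integrable setT (EFin \o (fun t => w t * expR (s * u t))).
Proof.
move=> fs; apply/integrableP; split.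
  apply/measurable_EFinP; apply: measurable_funM => //.
  by apply: measurableT_comp => //; apply: measurable_funM.
rewrite (eq_integral (fun t => (w t * expR (s * u t))%:E)) // => t _ /=.
by rewrite ger0_norm // mulr_ge0 ?expR_ge0.
Qed.

Variables (s r : R).
Hypotheses (r0 : 0 < r) (f1 : lap_fin w u (s - r)) (f2 : lap_fin w u (s + r)).

Let B t := w t * (expR ((s + r) * u t) + expR ((s - r) * u t)).

Let intB : mu.-integrable setT (EFin \o B).
Proof.
have := integrableD measurableT (expint f2) (expint f1).
by apply: eq_integrable => // t _ /=; rewrite /B mulrDr.
Qed.

Let B_ge0 t : 0 <= B t.
Proof. by rewrite mulr_ge0 // addr_ge0 ?expR_ge0. Qed.

Let dominated (f : T -> R) k : measurable_fun setT f -> (forall t, `|f t| <= k * B t) ->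
  mu.-integrable setT (EFin \o f).
Proof.
move=> mf H; apply: (le_integrable measurableT _ _ (integrableZl measurableT k intB)).
  exact/measurable_EFinP.
move=> t _ /=; rewrite lee_fin (le_trans (H t)) //; exact: ler_norm.
Qed.

(** Polynomial factors cost e^(r |v| / 2), half of the margin [r] on each side of [s]; the other
    half is left for the increment of the argument. *)
Let exp_bd (v : R) : 1 + `|v| + v ^+ 2 <= (1 + 2 / r + 8 / r ^+ 2) * expR (r / 2 * `|v|).
Proof.
have r2 : 0 < r ^+ 2 by rewrite exprn_gt0.
set e := expR _; have v0 := normr_ge0 v; have r20 : 0 <= r / 2 by rewrite divr_ge0 // ltW.
have rv : 0 <= r / 2 * `|v| by rewrite mulr_ge0.
have e1 : 1 <= e by rewrite -expR0 ler_expR.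
have h1 : `|v| <= 2 / r * e.
  have := expR_ge1Dx (r / 2 * `|v|); rewrite -/e => h.
  rewrite mulrAC ler_pdivlMr //; lra.
have h2 : v ^+ 2 <= 8 / r ^+ 2 * e.
  have := expR_ge1Dxn 1 rv; rewrite -/e /= => h.
  rewrite mulrAC ler_pdivlMr // -[v ^+ 2]real_normK ?num_real //.
  move: h; rewrite exprMn expr_div_n (_ : 2`!%:R = 2 :> R) //; lra.
have h0 : 1 <= 1 * e by rewrite mul1r.
by rewrite 2!mulrDl !lerD.
Qed.

Let K := 1 + 2 / r + 8 / r ^+ 2.
Let K_ge0 : 0 <= K.
Proof. by rewrite !addr_ge0 ?divr_ge0 ?exprn_ge0 // ltW. Qed.

Let exp_dom (x v : R) : `|x - s| <= r / 2 -> (1 + `|v| + v ^+ 2) * expR (x * v) <= K * (expR ((s + r) * v) + expR ((s - r) * v)).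
Proof.
move=> xs; apply: le_trans (_ : K * (expR (r / 2 * `|v|) * expR (x * v)) <= _).
  by rewrite mulrA ler_wpM2r ?expR_ge0 // exp_bd.
rewrite ler_wpM2l // -expRD.
have xv : x * v <= s * v + r / 2 * `|v|.
  rewrite -lerBlDl -mulrBl (le_trans (ler_norm _)) // normrM ler_wpM2r //.
case: (leP 0 v) => v0.
  rewrite (le_trans _ (_ : expR ((s + r) * v) <= _)) ?lerDl ?expR_ge0 // ler_expR.
  rewrite (ger0_norm v0) in xv *; lra.
rewrite (le_trans _ (_ : expR ((s - r) * v) <= _)) ?lerDr ?expR_ge0 // ler_expR.
rewrite (ltr0_norm v0) in xv *; lra.
Qed.

Let cexp_bound z t : `|Re z - s| <= r / 2 -> normc (cexp (z * (u t)%:C)) = expR (Re z * u t).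
Proof. by rewrite normc_cexp complexRe_M /= mulr0 subr0. Qed.

Let dom0 z t : `|Re z - s| <= r / 2 -> w t * (1 + `|u t| + u t ^+ 2) * normc (cexp (z * (u t)%:C)) <= K * B t.
Proof.
move=> zs; rewrite cexp_bound // /B mulrCA -mulrA ler_wpM2l //; exact: exp_dom.
Qed.

Let intRe z : `|Re z - s| <= r / 2 -> mu.-integrable setT (EFin \o (fun t => w t * Re (cexp (z * (u t)%:C)))).
Proof.
move=> zs; apply: (@dominated _ K); first exact: measurable_funM.
move=> t; apply: le_trans (dom0 t zs); rewrite normrM (ger0_norm (w0 t)) ler_pM ?Re_le_normc //.
by rewrite ler_peMr // -addrA lerDl addr_ge0 ?sqr_ge0.
Qed.

Let intIm z : `|Re z - s| <= r / 2 -> mu.-integrable setT (EFin \o (fun t => w t * Im (cexp (z * (u t)%:C)))).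
Proof.
move=> zs; apply: (@dominated _ K); first exact: measurable_funM.
move=> t; apply: le_trans (dom0 t zs); rewrite normrM (ger0_norm (w0 t)) ler_pM ?Im_le_normc //.
by rewrite ler_peMr // -addrA lerDl addr_ge0 ?sqr_ge0.
Qed.

Let intuRe z : `|Re z - s| <= r / 2 -> mu.-integrable setT (EFin \o (fun t => w t * u t * Re (cexp (z * (u t)%:C)))).
Proof.
move=> zs; apply: (@dominated _ K); first by do 2 apply: measurable_funM => //.
move=> t; apply: le_trans (dom0 t zs); rewrite normrM ler_pM ?Re_le_normc //.
rewrite normrM (ger0_norm (w0 t)) ler_wpM2l //.
by rewrite addrAC lerDr addr_ge0 ?sqr_ge0.
Qed.

Let intuIm z : `|Re z - s| <= r / 2 -> mu.-integrable setT (EFin \o (fun t => w t * u t * Im (cexp (z * (u t)%:C)))).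
Proof.
move=> zs; apply: (@dominated _ K); first by do 2 apply: measurable_funM => //.
move=> t; apply: le_trans (dom0 t zs); rewrite normrM ler_pM ?Im_le_normc //.
rewrite normrM (ger0_norm (w0 t)) ler_wpM2l //.
by rewrite addrAC lerDr addr_ge0 ?sqr_ge0.
Qed.

Let IB := (\int[mu]_t B t)%R.

Let point_bd z h t : Re z = s -> normc h <= r / 2 ->
  w t * normc (cexp ((z + h) * (u t)%:C) - cexp (z * (u t)%:C) - h * (u t)%:C * cexp (z * (u t)%:C)) <= 4 * K * normc h ^+ 2 * B t.
Proof.
move=> zs hr; set v := u t; rewrite mulrDl cexpD.
rewrite (_ : _ - _ = cexp (z * v%:C) * (cexp (h * v%:C) - 1 - h * v%:C)); last by ring.
rewrite normcM normc_cexp complexRe_M /= mulr0 subr0 zs.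
have := cexp_dist (h * v%:C); rewrite normcM normcR complexRe_M /= mulr0 subr0 => hd.
have hh : `|Re h * v| <= r / 2 * `|v|.
  by rewrite normrM ler_wpM2r // (le_trans (Re_le_normc _)).
have hv : expR `|Re h * v| <= expR (r / 2 * `|v|) by rewrite ler_expR.
have H2 : v ^+ 2 * (expR (s * v) * expR (r / 2 * `|v|)) <= K * (expR ((s + r) * v) + expR ((s - r) * v)).
  rewrite -expRD.
  have vv : 0 <= v ^+ 2 by exact: sqr_ge0.
  have cmp x : `|x - s| <= r / 2 -> v ^+ 2 * expR (x * v) <= K * (expR ((s + r) * v) + expR ((s - r) * v)).
    by move=> xs; apply: le_trans (exp_dom v xs); rewrite ler_wpM2r ?expR_ge0 // lerDr addr_ge0.
  case: (leP 0 v) => v0.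
    rewrite (ger0_norm v0) -mulrDl; apply: cmp; by rewrite addrAC subrr add0r ger0_norm // divr_ge0 // ltW.
  rewrite (ltr0_norm v0) (_ : s * v + r / 2 * - v = (s - r / 2) * v); last by ring.
  apply: cmp; by rewrite addrAC subrr add0r normrN ger0_norm // divr_ge0 // ltW.
rewrite /B (_ : 4 * K * normc h ^+ 2 * _ = w t * (4 * normc h ^+ 2 * (K * (expR ((s + r) * v) + expR ((s - r) * v))))); last by rewrite /v; ring.
rewrite ler_wpM2l // (le_trans (ler_wpM2l (expR_ge0 _) hd)) //.
rewrite (le_trans (ler_wpM2l (expR_ge0 _) (ler_wpM2l _ hv))) ?mulr_ge0 ?sqr_ge0 ?normc_ge0 //.
apply: le_trans (ler_wpM2l _ H2); last by rewrite mulr_ge0 ?sqr_ge0.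
by rewrite exprMn real_normK ?num_real //; apply: le_of_eq; ring.
Qed.

(** Differentiation under the integral sign: the pointwise Taylor remainder is at most |h|^2 times a
    multiple of [B], which is integrable by the finiteness at [s - r] and [s + r]. *)
Lemma lap_cdiff z : Re z = s -> cdiff (lap w u) z (lap' w u z).
Proof.
move=> zs e e0.
have IB0 : 0 <= IB by apply: Rintegral_ge0 => t _; exact: B_ge0.
have k0 : 0 < 8 * K * IB + 1 by rewrite ltr_wpDl // !mulr_ge0.
exists (Num.min (r / 2) (e / (8 * K * IB + 1))); first by rewrite lt_min !divr_gt0.
move=> h; rewrite lt_min => /andP[/ltW h1 h2].
have z1 : `|Re z - s| <= r / 2 by rewrite zs subrr normr0 divr_ge0 // ltW.
have z2 : `|Re (z + h) - s| <= r / 2.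
  by rewrite complexRe_D zs addrAC subrr add0r (le_trans (Re_le_normc _)).
pose G t := cexp ((z + h) * (u t)%:C) - cexp (z * (u t)%:C) - h * (u t)%:C * cexp (z * (u t)%:C).
have hB t : w t * normc (G t) <= 4 * K * normc h ^+ 2 * B t by exact: point_bd.
have bRe t : `|w t * Re (G t)| <= 4 * K * normc h ^+ 2 * B t.
  by rewrite normrM (ger0_norm (w0 t)) (le_trans _ (hB t)) // ler_wpM2l // Re_le_normc.
have bIm t : `|w t * Im (G t)| <= 4 * K * normc h ^+ 2 * B t.
  by rewrite normrM (ger0_norm (w0 t)) (le_trans _ (hB t)) // ler_wpM2l // Im_le_normc.
have iD (f g : T -> R) : mu.-integrable setT (EFin \o f) -> mu.-integrable setT (EFin \o g) ->
    mu.-integrable setT (EFin \o (fun t => f t + g t)).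
  by move=> If Ig; exact: (integrableD measurableT If Ig).
have iZ k (f : T -> R) : mu.-integrable setT (EFin \o f) -> mu.-integrable setT (EFin \o (fun t => k * f t)).
  by move=> If; exact: (integrableZl measurableT k If).
have lin (a1 a0 b b' : T -> R) k k' : mu.-integrable setT (EFin \o a1) -> mu.-integrable setT (EFin \o a0) ->
    mu.-integrable setT (EFin \o b) -> mu.-integrable setT (EFin \o b') ->
    mu.-integrable setT (EFin \o (fun t => a1 t + -1 * a0 t + (k * b t + k' * b' t))) /\
    (\int[mu]_t (a1 t + -1 * a0 t + (k * b t + k' * b' t)))%R =
    (\int[mu]_t a1 t)%R - (\int[mu]_t a0 t)%R + (k * (\int[mu]_t b t)%R + k' * (\int[mu]_t b' t)%R).
  move=> i1 i0 ib ib'; split.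
    exact: (iD _ _ (iD _ _ i1 (iZ _ _ i0)) (iD _ _ (iZ _ _ ib) (iZ _ _ ib'))).
  rewrite RintegralD //; [|exact: (iD _ _ i1 (iZ _ _ i0))|exact: (iD _ _ (iZ _ _ ib) (iZ _ _ ib'))].
  rewrite RintegralD //; last exact: iZ.
  rewrite RintegralD //; [|exact: iZ|exact: iZ].
  by rewrite !RintegralZl // mulN1r.
have [iRe' ER'] := lin _ _ _ _ (- Re h) (Im h) (intRe z2) (intRe z1) (intuRe z1) (intuIm z1).
have [iIm' EI'] := lin _ _ _ _ (- Im h) (- Re h) (intIm z2) (intIm z1) (intuRe z1) (intuIm z1).
have GR t : w t * Re (G t) = w t * Re (cexp ((z + h) * (u t)%:C)) + -1 * (w t * Re (cexp (z * (u t)%:C))) +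
    (- Re h * (w t * u t * Re (cexp (z * (u t)%:C))) + Im h * (w t * u t * Im (cexp (z * (u t)%:C)))).
  rewrite /G; move: (cexp ((z + h) * _)) (cexp (z * _)) => c1 c0; rewrite !complexRe_B (complexRe_M (h * _)) (complexRe_M h) (complexIm_M h) complexReC complexImC. ring.
have GI t : w t * Im (G t) = w t * Im (cexp ((z + h) * (u t)%:C)) + -1 * (w t * Im (cexp (z * (u t)%:C))) +
    (- Im h * (w t * u t * Re (cexp (z * (u t)%:C))) + - Re h * (w t * u t * Im (cexp (z * (u t)%:C)))).
  rewrite /G; move: (cexp ((z + h) * _)) (cexp (z * _)) => c1 c0; rewrite !complexIm_B (complexIm_M (h * _)) (complexRe_M h) (complexIm_M h) complexReC complexImC; ring.
have iRe : mu.-integrable setT (EFin \o (fun t => w t * Re (G t))).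
  by apply: eq_integrable iRe' => // t _ /=; rewrite GR.
have iIm : mu.-integrable setT (EFin \o (fun t => w t * Im (G t))).
  by apply: eq_integrable iIm' => // t _ /=; rewrite GI.
have ER : Re (lap w u (z + h) - lap w u z - lap' w u z * h) = (\int[mu]_t (w t * Re (G t)))%R.
  rewrite (eq_Rintegral _ (fun t _ => GR t)) ER' !complexRe_B complexRe_M /lap' /lap /=; ring.
have EI : Im (lap w u (z + h) - lap w u z - lap' w u z * h) = (\int[mu]_t (w t * Im (G t)))%R.
  rewrite (eq_Rintegral _ (fun t _ => GI t)) EI' !complexIm_B complexIm_M /lap' /lap /=; ring.
have intbd f : mu.-integrable setT (EFin \o f) -> (forall t, `|f t| <= 4 * K * normc h ^+ 2 * B t) ->
    `|(\int[mu]_t f t)%R| <= 4 * K * normc h ^+ 2 * IB.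
  move=> fi fb; rewrite (le_trans (le_normr_Rintegral _ fi)) // -RintegralZl //.
  apply: le_Rintegral => //; first exact: integrable_norm.
  exact: (integrableZl measurableT _ intB).
rewrite (le_trans (normc_le_ReIm _)) // ER EI.
rewrite (le_trans (lerD (intbd _ iRe bRe) (intbd _ iIm bIm))) //.
rewrite ltr_pdivlMr // in h2.
have := normc_ge0 h; set n := normc h in h2 *; set k := K * IB.
have -> : 4 * K * n ^+ 2 * IB + 4 * K * n ^+ 2 * IB = n * (8 * K * IB) * n by ring.
move=> n0; rewrite ler_wpM2r //; lra.
Qed.

End Laplace.

Section LaplaceReal.
Context {R : realType} {d : measure_display} {T : measurableType d}.
Variable mu : {measure set T -> \bar R}.
Variables (w u : T -> R).

Lemma lap_real (x : R) : lap mu w u x%:C = (\int[mu]_t (w t * expR (x * u t)))%R%:C.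
Proof.
rewrite /lap; congr (_ +i* _).
  by apply: eq_Rintegral => t _; rewrite -rmorphM cexpR.
rewrite (_ : (fun _ => _) = cst 0); last by apply/funext => t; rewrite -rmorphM cexpR /= mulr0.
by rewrite Rintegral_cst // mul0r.
Qed.

End LaplaceReal.

(** * Gaussian sums and Poisson summation *)

Section IntegralTools.
Context {R : realType}.
Local Open Scope ereal_scope.
Local Notation mu := (@lebesgue_measure R).

Lemma measurable_addl (a : R) : measurable_fun setT (fun x : R => (x + a)%R).
Proof. by apply: measurable_funD => //; exact: measurable_cst. Qed.

Lemma ge0_integral_shift (f : R -> \bar R) (a : R) : measurable_fun setT f -> (forall x, 0 <= f x) ->
  \int[mu]_x f (x + a)%R = \int[mu]_x f x.
Proof.
move=> mf f0; pose phi (x : measurableTypeR R) : measurableTypeR R := (x + a)%R.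
have mphi : measurable_fun setT phi by exact: measurable_addl.
have E := @ge0_integral_pushforward _ _ _ _ R phi mphi mu setT f measurableT mf (fun y _ => f0 y).
rewrite preimage_setT in E; rewrite -[LHS]E.
apply: eq_measure_integral => A mA _; apply/esym.
apply: (@lebesgue_measure_unique R (pushforward mu phi)) => // _ [[b c]] _ <-.
transitivity (mu `](b - a)%R, (c - a)%R]%classic); last first.
  by congr (mu _); apply/seteqP; split => x; rewrite /= !in_itv /= ltrBlDr lerBrDr.
rewrite !lebesgue_measure_itv /= !lte_fin ltrD2r; case: ifP => // _.
by rewrite -!EFinB; congr EFin; ring.
Qed.

Lemma ge0_integral_opp (f : R -> \bar R) : measurable_fun setT f -> (forall x, 0 <= f x) ->
  \int[mu]_x f (- x)%R = \int[mu]_x f x.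
Proof.
move=> mf f0; pose phi (x : measurableTypeR R) : measurableTypeR R := (- x)%R.
have mphi : measurable_fun setT phi by apply: measurableT_comp => //; exact: oppr_measurable.
have E := @ge0_integral_pushforward _ _ _ _ R phi mphi mu setT f measurableT mf (fun y _ => f0 y).
rewrite preimage_setT in E; rewrite -[LHS]E.
by apply: eq_measure_integral => A mA _; exact: lebesgue_measureN.
Qed.

(** The enumeration [h] does not depend on the summands: a whole family of sums becomes series along
    the same sequence, and these can be exchanged with integrals. *)
Lemma esum_nat (T : choiceType) (D : set T) : countable D ->
  exists h : nat -> option T, (forall n i, h n = Some i -> D i) /\
    forall a : T -> \bar R, (forall i, D i -> 0 <= a i) -> \esum_(i in D) a i = \sum_(n <oo) oapp a 0 (h n).
Proof.
move=> /countable_injP[g ginj]; pose h n := xget None [set o | exists2 i, D i & o = Some i /\ g i = n].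
have hD n i : h n = Some i -> D i /\ g i = n.
  by rewrite /h; case: xgetP => // o _ [j Dj [-> gj]] [<-].
have hg i : D i -> h (g i) = Some i.
  move=> Di; rewrite /h; case: xgetP => [p _ [j Dj [-> gj]]|H].
    by congr Some; apply: ginj; rewrite ?inE.
  by case: (H (Some i)); exists i.
exists h; split=> [n i /hD[]//|a a0].
rewrite nneseries_esumT; last first.
  by move=> n; case E : (h n) => [i|] //=; apply: a0; case: (hD _ _ E).
rewrite (_ : \esum_(i in [set: nat]) _ = \esum_(i in g @` D) oapp a 0 (h i)); last first.
  rewrite [RHS]esum_mkcond; apply: eq_esum => n _; case: ifPn => // nD.
  case E : (h n) => [i|] //=; case/negP: nD; rewrite inE; have [Di gi] := hD _ _ E.
  by exists i.
rewrite esum_image //.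
by apply: eq_esum => i Di; rewrite hg.
Qed.

Section Exchange.
Context {d : measure_display} {T : measurableType d} (m : {measure set T -> \bar R}).
Variables (I : choiceType) (D : set I) (f : I -> T -> \bar R).
Hypotheses (cD : countable D) (mf : forall i, D i -> measurable_fun setT (f i)) (f0 : forall i t, D i -> 0 <= f i t).

Lemma measurable_esum : measurable_fun setT (fun t => \esum_(i in D) f i t).
Proof.
have [h [hD H]] := esum_nat cD.
rewrite (_ : (fun t => _) = (fun t => \sum_(n <oo) (if h n is Some i then f i t else 0))); last first.
  apply/funext => t; rewrite H; last by move=> i; exact: f0.
  by apply: eq_eseriesr => n _; case: (h n).
apply: ge0_emeasurable_sum.
  by move=> n t _ _; case E : (h n) => [i|] //; apply: f0; exact: hD E.
by move=> n _; case E : (h n) => [i|] //; apply: mf; exact: hD E.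
Qed.

Lemma ge0_integral_esum : \int[m]_t (\esum_(i in D) f i t) = \esum_(i in D) (\int[m]_t f i t).
Proof.
have [h [hD H]] := esum_nat cD.
rewrite (_ : (fun t => _) = (fun t => \sum_(n <oo) (if h n is Some i then f i t else 0))); last first.
  apply/funext => t; rewrite H; last by move=> i; exact: f0.
  by apply: eq_eseriesr => n _; case: (h n).
rewrite integral_nneseries //.
- rewrite H; last by move=> i Di; apply: integral_ge0 => t _; exact: f0.
  by apply: eq_eseriesr => n _; case: (h n) => //=; rewrite integral0.
- by move=> n; case E : (h n) => [i|] //; apply: mf; exact: hD E.
- by move=> n t _; case E : (h n) => [i|] //; apply: f0; exact: hD E.
Qed.

End Exchange.

(** Each real lies in exactly one integer translate of [0, 1), so [f] is the sum of its restrictions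
    to these translates, which are then shifted back. *)
Lemma ge0_integral_unfold (f : R -> \bar R) : measurable_fun setT f -> (forall x, 0 <= f x) ->
  \int[mu]_(x in `[0%R, 1%R[) (\esum_(m in [set: int]) f (x + m%:~R)%R) = \int[mu]_x f x.
Proof.
move=> mf f0; set A : set R := `[0%R, 1%R[%classic.
have mA : measurable A by exact: measurable_itv.
have ind_ge0 x : 0 <= (\1_A x : R)%:E by rewrite lee_fin.
have mi (B : set R) : measurable B -> measurable_fun setT (fun x => (\1_B x : R)%:E).
  by move=> mB; apply/measurable_EFinP; exact: measurable_indic.
have Z : countable [set: int] by exact: countableP.
have E x : f x = \esum_(m in [set: int]) (f x * (\1_A (x - m%:~R)%R)%:E).
  rewrite (esumID [set Num.floor x]) //; last by move=> i _; exact: mule_ge0.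
  rewrite setTI esum_set1 ?mule_ge0 // (_ : \1_A _ = 1%R) ?mule1; last first.
    rewrite indicE mem_set // /A /= in_itv /= subr_ge0 floor_le /=.
    by rewrite ltrBlDr addrC -[1%R]/(1%:~R) -intrD floorD1_gt // num_real.
  rewrite esum1 ?adde0 // => m [_ /= mx]; rewrite (_ : \1_A _ = 0%R) ?mule0 //.
  rewrite indicE memNset // /A /= in_itv /= subr_ge0 ltrBlDr => /andP[h1 h2]; apply: mx.
  by apply/esym/floor_def; rewrite intrD h1 /= addrC.
under [RHS]eq_integral do rewrite E.
rewrite [LHS]integral_mkcond.
rewrite (_ : _ \_ _ = fun x => \esum_(m in [set: int]) (f (x + m%:~R)%R * (\1_A x)%:E)); last first.
  apply/funext => x; rewrite patchE; case: ifPn => xA.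
    by apply: eq_esum => m _; rewrite indicE xA mule1.
  by rewrite esum1 // => m _; rewrite indicE (negPf xA) mule0.
have m1 m : measurable_fun setT (fun x : R => f x * (\1_A (x - m%:~R)%R)%:E).
  by apply: emeasurable_funM => //; apply: measurableT_comp (mi _ mA) _; exact: measurable_addl.
have m2 m : measurable_fun setT (fun x : R => f (x + m%:~R)%R * (\1_A x)%:E).
  apply: emeasurable_funM; last exact: mi.
  by apply: measurableT_comp => //; exact: measurable_addl.
transitivity (\esum_(m in [set: int]) \int[mu]_x (f (x + m%:~R)%R * (\1_A x)%:E)).
  by apply: (@ge0_integral_esum _ _ mu _ _ _ Z) => m *; [exact: m2|exact: mule_ge0].
transitivity (\esum_(m in [set: int]) \int[mu]_x (f x * (\1_A (x - m%:~R)%R)%:E)); last first.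
  by apply/esym; apply: (@ge0_integral_esum _ _ mu _ _ _ Z) => m *; [exact: m1|exact: mule_ge0].
apply: eq_esum => m _; rewrite -(@ge0_integral_shift (fun x => f x * (\1_A (x - m%:~R)%R)%:E) m%:~R).
- by apply: eq_integral => x _; rewrite addrK.
- exact: m1.
- by move=> x; exact: mule_ge0.
Qed.

(** Up to normalisation this is the density of the normal law of mean [- s] and variance 1 / (2
    a). *)
Lemma integral_gauss_shift (a s : R) : (0 < a)%R ->
  \int[mu]_y (expR (- (a * (y + s) ^+ 2)))%:E = (Num.sqrt (pi / a))%:E.
Proof.
move=> a0; pose sg := Num.sqrt (2 * a)^-1.
have a2 : (0 < (2 * a)^-1)%R by rewrite invr_gt0 mulr_gt0.
have sg0 : sg != 0%R by rewrite gt_eqF // sqrtr_gt0.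
have sg2 : (sg ^+ 2 = (2 * a)^-1)%R by rewrite sqr_sqrtr // ltW.
have := integral_normal_pdf (- s) sg; under eq_integral do rewrite normal_pdfE //.
rewrite /normal_peak /normal_fun sg2.
have e2 : ((2 * a)^-1 *+ 2 = a^-1)%R by rewrite invfM -mulrnAl -[(2^-1 *+ 2)%R]mulr_natr mulVf ?mul1r // pnatr_eq0.
under eq_integral => x _ do rewrite EFinM opprK e2 invrK mulNr mulrC.
rewrite ge0_integralZl_EFin //.
- rewrite (_ : (pi / (2 * a) *+ 2 = pi / a)%R); last by rewrite -mulrnAr e2.
  set I := (\int[_]_x _); have s0 : (0 < Num.sqrt (pi / a))%R by rewrite sqrtr_gt0 divr_gt0 // pi_gt0.
  move=> H; transitivity I; first by apply: eq_integral => y _; rewrite mulrC.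
  by rewrite -[I]mul1e -(@divff _ (Num.sqrt (pi / a))) ?gt_eqF // EFinM -muleA H mule1.
- apply/measurable_EFinP; apply: measurableT_comp => //; apply: measurableT_comp => //.
  by apply: measurable_funM => //; apply: measurable_funX; exact: measurable_addl.
Qed.

End IntegralTools.

(** With the discrete sigma-algebra, sums over [int] are integrals for the counting measure, so that
    theta series are values of [lap] too. *)
HB.instance Definition _ := isPointed.Build int 0%R.
HB.instance Definition _ := @isMeasurable.Build default_measure_display
  int discrete_measurable discrete_measurable0
  discrete_measurableC discrete_measurableU.

Section CountingInt.
Context {R : realType}.
Local Open Scope ereal_scope.

Lemma measurable_int (f : int -> R) : measurable_fun setT f.
Proof. by []. Qed.

Lemma ge0_integral_counting_int (a : int -> \bar R) : (forall i, 0 <= a i) ->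
  \int[counting]_i a i = \esum_(i in [set: int]) a i.
Proof.
move=> a0; have E t : a t = \esum_(i in [set: int]) (a i * (\1_[set i] t)%:E).
  rewrite (esumID [set t]) //; last by move=> i _; rewrite mule_ge0 ?lee_fin.
  rewrite setTI esum_set1; last by rewrite mule_ge0 ?lee_fin.
  rewrite indicE mem_set // mule1 esum1 ?adde0 // => i [_ /= it].
  by rewrite indicE memNset ?mule0 //= => ti; apply: it.
under eq_integral do rewrite E.
transitivity (\esum_(i in [set: int]) \int[counting]_t (a i * (\1_[set i] t)%:E)).
  apply: (@ge0_integral_esum _ _ _ counting _ _ _ (countableP _)) => // i t _.
  by rewrite mule_ge0 ?lee_fin.
apply: eq_esum => i _; rewrite ge0_integralZl //.
rewrite integral_indic // setIT /= /counting asboolT; last exact: finite_set1.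
by rewrite fset_set1 cardfs1 mule1.
Qed.

Lemma gauss_series_fin (a s : R) : (0 < a)%R ->
  \esum_(j in [set: int]) (expR (- (a * j%:~R ^+ 2) + s * j%:~R))%:E < +oo.
Proof.
move=> a0; set E := esum _ _; set A : set R := `[0%R, 1%R[%classic.
have mA : measurable A by exact: measurable_itv.
(* By completing the square, - a m^2 + s m <= k - a / 2 (x + m)^2 for all integers m and all x in
   [0, 1); unfolding then bounds the sum by a Gaussian integral. *)
pose k := ((`|s| + a) ^+ 2 / (2 * a) + a / 2)%R.
have -> : E = \int[lebesgue_measure]_(x in A) (cst E x).
  rewrite integral_cst //; transitivity (E * 1); first by rewrite mule1.
  congr (_ * _); rewrite /A /=.
  by rewrite lebesgue_measure_itv /= lte01 oppr0 adde0.
pose phi (y : R) := (expR k * expR (- (a / 2 * (y + 0) ^+ 2)))%:E.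
have mphi : measurable_fun setT phi.
  apply/measurable_EFinP; apply: measurable_funM => //; apply: measurableT_comp => //; apply: measurableT_comp => //.
  by apply: measurable_funM => //; apply: measurable_funX; exact: measurable_addl.
have phi0 x : 0 <= phi x by rewrite lee_fin mulr_ge0 ?expR_ge0.
apply: (@le_lt_trans _ _ (\int[lebesgue_measure]_(x in A) (\esum_(m in [set: int]) phi (x + m%:~R)%R))).
  apply: ge0_le_integral => //.
  - by move=> x _; rewrite /cst /E esum_ge0 // => j _; rewrite lee_fin expR_ge0.
  - apply: measurable_funTS; apply: (measurable_esum (countableP _)) => // m _.
    by apply: measurableT_comp => //; exact: measurable_addl.
  - move=> x; rewrite /A /= in_itv /= => /andP[x0 x1].
    apply: le_esum => m _; rewrite lee_fin -expRD ler_expR addr0 /k.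
    set M : R := m%:~R; have h1 : (s * M <= `|s| * `|M|)%R by rewrite -normrM ler_norm.
    have h2 : (a * x * M <= a * `|M|)%R.
      by rewrite -mulrA ler_wpM2l ?(ltW a0) // (le_trans (ler_norm _)) // normrM ger0_norm // ler_piMl // ltW.
    have h3 : ((`|s| + a) * `|M| <= (`|s| + a) ^+ 2 / (2 * a) + a / 2 * M ^+ 2)%R.
      rewrite -[(M ^+ 2)%R]real_normK ?num_real // -subr_ge0.
      rewrite (_ : _ - _ = ((`|s| + a) - a * `|M|) ^+ 2 / (2 * a))%R; last by field; rewrite gt_eqF.
      by rewrite divr_ge0 ?sqr_ge0 // mulr_ge0 // ltW.
    have h4 : (0 <= a / 2 - a / 2 * x ^+ 2)%R.
      by rewrite subr_ge0 ler_piMr ?divr_ge0 ?(ltW a0) // expr_le1 // ltW.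
    have E2 : (a / 2 * (x + M) ^+ 2 = a / 2 * x ^+ 2 + a * x * M + a / 2 * M ^+ 2)%R by field.
    rewrite E2; lra.
rewrite ge0_integral_unfold // /phi; under eq_integral do rewrite EFinM.
rewrite ge0_integralZl_EFin ?expR_ge0 //.
- by rewrite integral_gauss_shift ?divr_gt0 // -EFinM ltry.
- apply/measurable_EFinP; apply: measurableT_comp => //; apply: measurableT_comp => //.
  by apply: measurable_funM => //; apply: measurable_funX; exact: measurable_addl.
Qed.

Definition zsum (f : int -> R) : R := (\int[counting]_(j in [set: int]) f j)%R.
Definition zsummable (f : int -> R) := \esum_(j in [set: int]) `|f j|%:E < +oo.

Lemma zsummableP f : zsummable f <-> (@counting int R).-integrable setT (EFin \o f).
Proof.
split=> [H|/integrableP[_ H]].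
  apply/integrableP; split; first by [].
  by under eq_integral do rewrite /=; rewrite ge0_integral_counting_int.
by rewrite /zsummable -ge0_integral_counting_int.
Qed.

Lemma zsumE f : (forall j, 0 <= f j)%R -> zsummable f -> (zsum f)%:E = \esum_(j in [set: int]) (f j)%:E.
Proof.
move=> f0 H; rewrite -ge0_integral_counting_int; last by move=> i; rewrite lee_fin.
rewrite /zsum /Rintegral fineK //; apply: integrable_fin_num => //; exact/zsummableP.
Qed.

Lemma zsummable_le f g : (forall j, `|f j| <= g j)%R -> zsummable g -> zsummable f.
Proof.
move=> H; apply: le_lt_trans; apply: le_esum => j _; rewrite lee_fin (le_trans (H j)) //; exact: ler_norm.
Qed.

Lemma zsummable_norm f : zsummable f -> zsummable (fun j => `|f j|)%R.
Proof. by rewrite /zsummable => H; under eq_esum do rewrite normr_id. Qed.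

Lemma zsumD f g : zsummable f -> zsummable g -> zsum (fun j => f j + g j)%R = (zsum f + zsum g)%R.
Proof. by move=> /zsummableP fi /zsummableP gi; exact: RintegralD. Qed.

Lemma zsumZ k f : zsummable f -> zsum (fun j => k * f j)%R = (k * zsum f)%R.
Proof. by move=> /zsummableP fi; exact: RintegralZl. Qed.

Lemma zsummableD f g : zsummable f -> zsummable g -> zsummable (fun j => f j + g j)%R.
Proof. by move=> /zsummableP fi /zsummableP gi; apply/zsummableP; exact: (integrableD measurableT fi gi). Qed.

Lemma zsummableZ k f : zsummable f -> zsummable (fun j => k * f j)%R.
Proof. by move=> /zsummableP fi; apply/zsummableP; exact: (integrableZl measurableT k fi). Qed.

Lemma gauss_zsummable (a s : R) : (0 < a)%R -> zsummable (fun j => expR (- (a * j%:~R ^+ 2) + s * j%:~R)).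
Proof.
move=> a0; rewrite /zsummable; under eq_esum do rewrite ger0_norm ?expR_ge0 //.
exact: gauss_series_fin.
Qed.

Lemma gauss_lap_fin_int (a s : R) : (0 < a)%R ->
  lap_fin counting (fun j : int => expR (- (a * j%:~R ^+ 2))) (fun j => j%:~R) s.
Proof.
move=> a0; rewrite /lap_fin ge0_integral_counting_int; last by move=> i; rewrite lee_fin mulr_ge0 ?expR_ge0.
under eq_esum do rewrite -expRD.
exact: gauss_series_fin.
Qed.

(** The decomposition f = (f + |f|) - |f| reduces the rearrangement to nonnegative sums. *)
Lemma zsum_bij (e e' : int -> int) f : cancel e e' -> cancel e' e -> zsummable f -> zsum (f \o e) = zsum f.
Proof.
move=> ee e'e fs.
have bij : set_bij [set: int] [set: int] e.
  by split=> // [x y _ _ exy|y _]; [rewrite -(ee x) exy ee|exists (e' y)].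
have r (g : int -> R) : (forall j, 0 <= g j)%R -> zsummable g -> zsummable (g \o e) /\ zsum (g \o e) = zsum g.
  move=> g0 gs; have gs' : zsummable (g \o e).
    by move: gs; rewrite /zsummable (reindex_esum _ _ _ (fun j => `|g j|%:E) bij).
  split=> //; apply: EFin_inj; rewrite !zsumE //; last by move=> j; exact: g0.
  by rewrite (reindex_esum _ _ _ (fun j => (g j)%:E) bij).
have f1 := zsummable_norm fs.
have f2 : zsummable (fun j => f j + `|f j|)%R by exact: zsummableD.
have p0 j : (0 <= f j + `|f j|)%R by rewrite -lerBlDr sub0r lerNl -normrN ler_norm.
have [s1 e1] := r _ (fun j => normr_ge0 (f j)) f1; have [s2 e2] := r _ p0 f2.
have E g : zsummable g -> zsum g = (zsum (fun j => g j + `|g j|) - zsum (fun j => `|g j|))%R.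
  by move=> gs; rewrite zsumD ?addrK //; exact: zsummable_norm.
rewrite (E f) // -e1 -e2 [LHS]E //.
by apply: zsummable_le s1 => j; exact: lexx.
Qed.

End CountingInt.

(** * The Fourier transform of a Gaussian *)

Section GaussFourier.
Context {R : realType}.
Local Notation C := R[i].
Local Notation mu := (@lebesgue_measure R).

Lemma measurable_gauss (a : R) : measurable_fun setT (fun y : R => expR (- (a * y ^+ 2))).
Proof.
apply: measurableT_comp => //; apply: measurableT_comp => //.
by apply: measurable_funM => //; apply: measurable_funX.
Qed.

Lemma gauss_lap_real (a x : R) : 0 < a ->
  (\int[mu]_y (expR (- (a * y ^+ 2)) * expR (x * y))%:E = (Num.sqrt (pi / a) * expR (x ^+ 2 / (4 * a)))%:E)%E.
Proof.
move=> a0; transitivity (\int[mu]_y ((expR (x ^+ 2 / (4 * a)))%:E * (expR (- (a * (y + - (x / (2 * a))) ^+ 2)))%:E))%E.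
  apply: eq_integral => y _; rewrite -EFinM -!expRD; congr (expR _)%:E.
  by field; rewrite gt_eqF.
rewrite ge0_integralZl_EFin ?expR_ge0 //.
- by rewrite integral_gauss_shift // -EFinM mulrC.
- apply/measurable_EFinP; apply: measurableT_comp => //; apply: measurableT_comp => //.
  by apply: measurable_funM => //; apply: measurable_funX; exact: measurable_addl.
Qed.

Lemma cdiff_cexp (z : C) : cdiff (@cexp R) z (cexp z).
Proof.
move=> e e0; have k0 : 0 < 4 * expR (Re z) * expR 1 by rewrite !mulr_gt0 ?expR_gt0.
exists (Num.min 1 (e / (4 * expR (Re z) * expR 1))); first by rewrite lt_min ltr01 divr_gt0.
move=> h; rewrite lt_min ltr_pdivlMr // => /andP[h1 h2].
rewrite cexpD (_ : _ - _ = cexp z * (cexp h - 1 - h)); last by ring.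
rewrite normcM normc_cexp.
have E1 : expR `|Re h| <= expR 1 by rewrite ler_expR (le_trans (Re_le_normc h)) // ltW.
rewrite (le_trans (ler_wpM2l (expR_ge0 _) (cexp_dist h))) //.
rewrite (le_trans (ler_wpM2l (expR_ge0 _) (ler_wpM2l _ E1))) ?mulr_ge0 ?normc_ge0 //.
rewrite (_ : expR _ * (_ * _) = normc h * (4 * expR (Re z) * expR 1) * normc h); last by ring.
by rewrite ler_wpM2r ?normc_ge0 // ltW.
Qed.

Lemma Re_cexp_i (b y : R) : Re (cexp ((0 +i* b) * y%:C)) = cos (b * y).
Proof.
have -> : (0 +i* b) * y%:C = 0 +i* (b * y) by simpc.
by rewrite Re_cexp /= expR0 mul1r.
Qed.

(** For real exponents the transform is found by completing the square. Both sides are entire in the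
    exponent, and the identity theorem carries the formula to [0 +i* b]. *)
Lemma gauss_fourier (a b : R) : 0 < a ->
  (\int[mu]_y (expR (- (a * y ^+ 2)) * cos (b * y)))%R = Num.sqrt (pi / a) * expR (- (b ^+ 2 / (4 * a))).
Proof.
move=> a0; pose w (y : R) := expR (- (a * y ^+ 2)); pose k : C := ((4 * a)^-1)%:C.
have w0 y : 0 <= w y by exact: expR_ge0.
have fin s : lap_fin mu w id s by rewrite /lap_fin gauss_lap_real // ltry.
pose f z := lap mu w id z - (Num.sqrt (pi / a))%:C * cexp (k * (z * z)).
have df z : cdiffable f z.
  eexists; apply: cdiffB.
    by apply: (@lap_cdiff _ _ _ mu w id w0 _ _ (Re z) 1) => //; exact: measurable_gauss.
  apply: cdiffZ; apply: (@cdiff_comp _ (@cexp R) (fun z => k * (z * z))); last exact: cdiff_cexp.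
  by apply: cdiffZ; exact: cdiff_sqr.
have f0 (x : R) : f (0 + x%:C) = 0.
  rewrite add0r /f lap_real /Rintegral gauss_lap_real //= -!rmorphM cexpR -!rmorphM.
  by apply/eqP; rewrite subr_eq0; apply/eqP; congr (_ * expR _)%:C; rewrite expr2 mulrC.
have b1 : 0 < `|b| + 1 by rewrite ltr_wpDl.
have fR : exists2 r, 0 < r & forall x : R, `|x| < r -> f (0 + x%:C) = 0 by exists 1.
have h : lap mu w id (0 +i* b) = (Num.sqrt (pi / a))%:C * cexp (k * ((0 +i* b) * (0 +i* b))).
  apply/eqP; rewrite -subr_eq0; apply/eqP.
  have := @identity_theorem R f 0 _ b1 (fun z _ => df z) fR (0 +i* b); apply.
  by rewrite subr0 /= expr0n add0r sqrtr_sqr ltrDl ltr01.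
have := congr1 (@complex.Re R) h.
have -> : k * ((0 +i* b) * (0 +i* b)) = (- (b ^+ 2 / (4 * a)))%:C.
  by apply: complex_ext; rewrite /k /=; field; rewrite gt_eqF.
move=> hh; transitivity (Re (lap mu w id (0 +i* b))); last by rewrite hh cexpR -rmorphM.
apply: eq_Rintegral => y _.
by rewrite Re_cexp_i.
Qed.

End GaussFourier.

(** * One-dimensional theta series *)

Section ThetaOneDim.
Context {R : realType}.
Local Notation C := R[i].
Local Notation mu := (@lebesgue_measure R).
Implicit Types (a d y : R).

Definition gz a (j : int) : R := expR (- (a * j%:~R ^+ 2)).
Definition thA a y : R := zsum (fun j => gz a j * cos (2 * pi * j%:~R * y)).
Definition thB a y : R := zsum (fun m => expR (- (a * (y + m%:~R) ^+ 2))).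
Definition th0 a : R := zsum (gz a).
Definition zlap a : C -> C := lap counting (gz a) (fun j : int => j%:~R).

Lemma gz_ge0 a j : 0 <= gz a j. Proof. exact: expR_ge0. Qed.

Lemma gz_summable a : 0 < a -> zsummable (gz a).
Proof.
move=> a0; have := gauss_zsummable 0 a0; apply: zsummable_le => j.
by rewrite /gz mul0r addr0 ger0_norm ?expR_ge0.
Qed.

Lemma thB_summable a y : 0 < a -> zsummable (fun m => expR (- (a * (y + m%:~R) ^+ 2))).
Proof.
move=> a0; apply: zsummable_le (zsummableZ (expR (- (a * y ^+ 2))) (gauss_zsummable (- (2 * a * y)) a0)) => j.
rewrite ger0_norm ?expR_ge0 // -expRD ler_expR; apply: le_of_eq; ring.
Qed.

Lemma cos_bd_summable (w : int -> R) (g : int -> R) : (forall j, 0 <= w j) -> zsummable w ->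
  (forall j, `|g j| <= 1) -> zsummable (fun j => w j * g j).
Proof.
by move=> w0 ws g1; apply: zsummable_le ws => j; rewrite normrM (ger0_norm (w0 j)) ler_piMr.
Qed.

Lemma zlap_cdiff a z : 0 < a -> cdiffable (zlap a) z.
Proof.
move=> a0; eexists.
apply: (@lap_cdiff _ _ _ counting (gz a) _ (gz_ge0 a) _ _ (Re z) 1) => //; exact: gauss_lap_fin_int.
Qed.

(** [thF a] and [thG a] are the entire functions that restrict to [thB a] and [thA a] on the real
    line; expanding (z + m)^2 exhibits the first as a Gaussian factor times a transform. *)
Definition thF a (z : C) : C := cexp ((- a)%:C * (z * z)) * zlap a ((- (2 * a))%:C * z).
Definition thG a (z : C) : C := zlap a ((0 +i* (2 * pi)) * z).

Lemma cdiffable_comp (f g : C -> C) z : cdiffable g z -> cdiffable f (g z) -> cdiffable (f \o g) z.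
Proof. by move=> [m Hm] [l Hl]; eexists; exact: cdiff_comp Hm Hl. Qed.

Lemma thF_cdiff a z : 0 < a -> cdiffable (thF a) z.
Proof.
move=> a0; apply: cdiffableM.
  apply: (@cdiffable_comp (@cexp R) (fun z => (- a)%:C * (z * z))); last by eexists; exact: cdiff_cexp.
  by eexists; apply: cdiffZ; exact: cdiff_sqr.
apply: (@cdiffable_comp (zlap a) (fun z => (- (2 * a))%:C * z)); last exact: zlap_cdiff.
by eexists; apply: cdiffZ; exact: cdiff_id.
Qed.

Lemma thG_cdiff a z : 0 < a -> cdiffable (thG a) z.
Proof.
move=> a0; apply: (@cdiffable_comp (zlap a) (fun z => (0 +i* (2 * pi)) * z)); last exact: zlap_cdiff.
by eexists; apply: cdiffZ; exact: cdiff_id.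
Qed.

Lemma thF_real a y : 0 < a -> thF a y%:C = (thB a y)%:C.
Proof.
move=> a0; rewrite /thF -!rmorphM cexpR /zlap lap_real -rmorphM /thB /zsum; congr (_%:C).
rewrite -RintegralZl //; last first.
  apply/(zsummableP (fun j : int => gz a j * expR (- (2 * a) * y * j%:~R))).
  apply: zsummable_le (gauss_zsummable (- (2 * a) * y) a0) => j.
  by rewrite ger0_norm ?mulr_ge0 ?expR_ge0 // expRD.
apply: eq_Rintegral => j _; rewrite -!expRD; congr expR; ring.
Qed.

Lemma thG_Re a y : Re (thG a y%:C) = thA a y.
Proof.
rewrite /thG /zlap /lap /thA /=; apply: eq_Rintegral => j _.
by rewrite !(mul0r, mulr0, subr0, add0r, addr0, sub0r, oppr0) expR0 mul1r; congr (_ * cos _); ring.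
Qed.

Lemma thG_Im a y : 0 < a -> Im (thG a y%:C) = 0.
Proof.
move=> a0; rewrite /thG /zlap /lap /=.
set f := fun j : int => _; have E : Rintegral counting setT f = zsum (fun j => gz a j * sin (2 * pi * j%:~R * y)).
  apply: eq_Rintegral => j _; rewrite /f.
  by rewrite !(mul0r, mulr0, subr0, add0r, addr0, sub0r, oppr0) expR0 mul1r; congr (_ * sin _); ring.
rewrite E; have sm : zsummable (fun j => gz a j * sin (2 * pi * j%:~R * y)).
  by apply: cos_bd_summable; [exact: gz_ge0|exact: gz_summable|move=> j; exact: sin_max].
have := zsum_bij (@opprK _) (@opprK _) sm.
rewrite (_ : _ \o _ = fun j => -1 * (gz a j * sin (2 * pi * j%:~R * y))); last first.
  apply/funext => j /=; rewrite /gz mulrNz sqrrN.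
  rewrite (_ : 2 * pi * - j%:~R * y = - (2 * pi * j%:~R * y)); last by ring.
  by rewrite sinN; ring.
rewrite zsumZ //; set x := zsum _ => h; lra.
Qed.

Lemma cts_on_Re (f : C -> C) a b : a <= b -> (forall x : R, cdiffable f x%:C) -> cts_on a b (fun x => Re (f x%:C)).
Proof. by move=> ab H; have [] := @cdiffable_ccts_h _ f a b 0 ab (fun x _ => H x). Qed.

Lemma thB_cts a : 0 < a -> cts_on 0 1 (thB a).
Proof.
move=> a0; rewrite (_ : thB a = fun x => Re (thF a x%:C)).
  by apply: cts_on_Re => // x; exact: thF_cdiff.
by apply/funext => y; rewrite thF_real.
Qed.

Lemma thA_cts a : 0 < a -> cts_on 0 1 (thA a).
Proof.
move=> a0; rewrite (_ : thA a = fun x => Re (thG a x%:C)).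
  by apply: cts_on_Re => // x; exact: thG_cdiff.
by apply/funext => y; rewrite thG_Re.
Qed.

Lemma thB_periodic a y (m : int) : 0 < a -> thB a (y + m%:~R) = thB a y.
Proof.
move=> a0; rewrite /thB -(zsum_bij (addrK m) (subrK m) (thB_summable y a0)).
by apply: eq_Rintegral => j _ /=; rewrite intrD [j%:~R + _]addrC addrA.
Qed.

Lemma thB_ge0 a y : 0 <= thB a y.
Proof. by apply: Rintegral_ge0 => j _; exact: expR_ge0. Qed.

Lemma cos_2piz (m : int) (x : R) : cos (x + 2 * pi * m%:~R) = cos x.
Proof.
have H (n : nat) (z : R) : cos (z + 2 * pi * n%:R) = cos z.
  elim: n z => [|n IH] z; first by rewrite mulr0 addr0.
  have -> : z + 2 * pi * n.+1%:R = z + 2 * pi * n%:R + pi *+ 2 by rewrite -natr1; ring.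
  by rewrite cosD2pi IH.
case: m => n; first exact: H.
rewrite NegzE mulrNz -(H n.+1 (x + _)) -addrA mulrN addNr addr0 //.
Qed.

Lemma rint_periodize (phi F : R -> R) : measurable_fun setT phi -> (forall y, 0 <= phi y) ->
  cts_on 0 1 F -> (forall y, (F y)%:E = (\esum_(m in [set: int]) (phi (y + m%:~R))%:E)%E) ->
  ((rint 0 1 F)%:E = \int[mu]_y (phi y)%:E)%E.
Proof.
move=> mphi phi0 cF HF.
have Fi : mu.-integrable `[0, 1[ (EFin \o F).
  by apply: (integrableS _ _ _ (cts_on_integrable cF)) => // x; rewrite /= !in_itv /= => /andP[-> /ltW].
rewrite /rint -Rintegral_itv_bndo_bndc // /Rintegral fineK; last exact: integrable_fin_num.
rewrite -(@ge0_integral_unfold _ (fun y => (phi y)%:E)) //; last exact/measurable_EFinP.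
by apply: eq_integral => y _; rewrite HF.
Qed.

Lemma esum_zsum (f : int -> R) : (forall j, 0 <= f j) -> zsummable f ->
  (\esum_(j in [set: int]) (f j)%:E)%E = (zsum f)%:E.
Proof. by move=> f0 fs; rewrite zsumE. Qed.

Lemma cts_cos (k a b : R) : cts_on a b (fun y => cos (k * y)).
Proof.
apply: cts_on_continuous => y; apply: (@continuous_comp _ _ _ (fun y => k * y) cos); last exact: continuous_cos.
by apply: cvgM; [exact: cvg_cst|exact: cvg_id].
Qed.

(** Fourier coefficients of the periodised Gaussian. Adding 1 to the cosine keeps the integrand
    nonnegative, as unfolding requires; the 1 is removed again in [thB_cos]. *)
Lemma thB_cos_int d (n : nat) : 0 < d ->
  rint 0 1 (fun y => thB (pi / d) y * (1 + cos (2 * pi * n%:R * y))) = Num.sqrt d * (1 + gz (pi * d) n).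
Proof.
move=> d0; have a0 : 0 < pi / d by rewrite divr_gt0 // pi_gt0.
set a := pi / d in a0 *; pose w (y : R) := expR (- (a * y ^+ 2)).
pose phi y := w y * (1 + cos (2 * pi * n%:R * y)).
have c0 (x : R) : 0 <= 1 + cos x by have := cos_geN1 x; lra.
have mc : measurable_fun setT (fun y : R => cos (2 * pi * n%:R * y)).
  apply: measurableT_comp; last by apply: measurable_funM.
  by apply: continuous_measurable_fun; exact: continuous_cos.
have mphi : measurable_fun setT phi.
  apply: measurable_funM; first exact: measurable_gauss.
  by apply: measurable_funD => //; exact: measurable_cst.
have iw : mu.-integrable setT (EFin \o w).
  apply/integrableP; split; first by apply/measurable_EFinP; exact: measurable_gauss.
  rewrite [X in (X < _)%E](_ : _ = (Num.sqrt (pi / a))%:E) ?ltry // -(integral_gauss_shift 0 a0).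
  by apply: eq_integral => y _; rewrite /= addr0 ger0_norm ?expR_ge0.
have iwc : mu.-integrable setT (EFin \o (fun y => w y * cos (2 * pi * n%:R * y))).
  apply: (le_integrable measurableT _ _ iw); first by apply/measurable_EFinP; apply: measurable_funM => //; exact: measurable_gauss.
  by move=> y _ /=; rewrite lee_fin normrM ler_piMr // cos_max.
have sq : Num.sqrt (pi / a) = Num.sqrt d.
  by congr Num.sqrt; rewrite /a invf_div mulrCA divff ?mulr1 // gt_eqF ?pi_gt0.
apply: EFin_inj; rewrite (@rint_periodize phi) //.
- transitivity (\int[mu]_y (w y + w y * cos (2 * pi * n%:R * y))%:E)%E.
    by apply: eq_integral => y _; rewrite /phi mulrDr mulr1.
  rewrite -[LHS]fineK; last first.
    by apply: integrable_fin_num => //; exact: (integrableD measurableT iw iwc).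
  congr EFin; have := RintegralD measurableT iw iwc; rewrite {1}/Rintegral => ->.
  rewrite /w gauss_fourier // sq.
  have := gauss_fourier 0 a0; under eq_Rintegral do rewrite mul0r cos0 mulr1.
  rewrite sq expr0n /= mul0r oppr0 expR0 => ->; rewrite -mulrDr; congr (_ * (1 + expR _)).
  rewrite /a -[(n : int)%:~R]/(n%:R); congr (- _).
  by move: (lt0r_neq0 (pi_gt0 R)); move: (pi : R) => p p0; field; rewrite p0 gt_eqF.
- by move=> y; rewrite mulr_ge0 ?expR_ge0.
- apply: cts_onM; first exact: thB_cts.
  by apply: cts_onD; [exact: cts_on_cst|exact: cts_cos].
- move=> y; rewrite /phi; transitivity (\esum_(m in [set: int]) ((1 + cos (2 * pi * n%:R * y)) * expR (- (a * (y + m%:~R) ^+ 2)))%:E)%E.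
    rewrite esum_zsum.
    + by rewrite zsumZ; [rewrite mulrC|exact: thB_summable].
    + by move=> j; rewrite mulr_ge0 ?expR_ge0.
    + by apply: zsummableZ; exact: thB_summable.
  apply: eq_esum => m _; rewrite mulrC -(cos_2piz (n%:Z * m)); congr (_ * (1 + cos _))%:E.
  by rewrite intrM -[n%:Z%:~R]/(n%:R); ring.
Qed.

Lemma thB_int d : 0 < d -> rint 0 1 (thB (pi / d)) = Num.sqrt d.
Proof.
move=> d0; have a0 : 0 < pi / d by rewrite divr_gt0 // pi_gt0.
have g0 : gz (pi * d) 0%N = 1 by rewrite /gz (_ : (0%N : int)%:~R = 0 :> R) // expr0n mulr0 oppr0 expR0.
have := thB_cos_int 0 d0; rewrite g0.
under [X in rint _ _ X]eq_fun do rewrite mulr0 mul0r cos0 mulrC.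
rewrite rintZ; last exact: thB_cts.
by move=> h; lra.
Qed.

Lemma thB_cos d (n : nat) : 0 < d ->
  rint 0 1 (fun y => cos (2 * pi * n%:R * y) * thB (pi / d) y) = Num.sqrt d * gz (pi * d) n.
Proof.
move=> d0; have a0 : 0 < pi / d by rewrite divr_gt0 // pi_gt0.
have := thB_cos_int n d0; under [X in rint _ _ X]eq_fun do rewrite mulrDr mulr1 [_ * cos _]mulrC.
rewrite rintD; [|exact: thB_cts|by apply: cts_onM; [exact: cts_cos|exact: thB_cts]].
by rewrite thB_int // (mulrDr (Num.sqrt d) 1) mulr1 => /addrI.
Qed.

(** One factor is unfolded over the line; the product of two Gaussians at distance k is a Gaussian
    in y times e^(- a k^2 / 2). *)
Lemma thB_sqr_int a : 0 < a -> rint 0 1 (fun y => thB a y * thB a y) = Num.sqrt (pi / (2 * a)) * th0 (a / 2).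
Proof.
move=> a0; have a20 : 0 < a / 2 by rewrite divr_gt0.
pose phi y := expR (- (a * y ^+ 2)) * thB a y.
have E y : (phi y)%:E = (\esum_(k in [set: int]) (expR (- (a * y ^+ 2)) * expR (- (a * (y + k%:~R) ^+ 2)))%:E)%E.
  rewrite esum_zsum; first by rewrite zsumZ //; exact: thB_summable.
    by move=> j; rewrite mulr_ge0 ?expR_ge0.
  by apply: zsummableZ; exact: thB_summable.
have mk (k : int) : measurable_fun setT (fun y : R => (expR (- (a * y ^+ 2)) * expR (- (a * (y + k%:~R) ^+ 2)))%:E).
  apply/measurable_EFinP; apply: measurable_funM; first exact: measurable_gauss.
  apply: measurableT_comp => //; apply: measurableT_comp => //.
  by apply: measurable_funM => //; apply: measurable_funX; exact: measurable_addl.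
apply: EFin_inj; rewrite (@rint_periodize phi).
- transitivity (\int[mu]_y \esum_(k in [set: int]) (expR (- (a * y ^+ 2)) * expR (- (a * (y + k%:~R) ^+ 2)))%:E)%E.
    by apply: eq_integral => y _; rewrite E.
  transitivity (\esum_(k in [set: int]) \int[mu]_y (expR (- (a * y ^+ 2)) * expR (- (a * (y + k%:~R) ^+ 2)))%:E)%E.
    apply: (@ge0_integral_esum _ _ _ mu _ _ _ (countableP _)) => [k _|k y _]; first exact: mk.
    by rewrite lee_fin mulr_ge0 ?expR_ge0.
  rewrite /th0 -zsumZ; last exact: gz_summable.
  rewrite -esum_zsum; last 2 first.
    by move=> j; rewrite mulr_ge0 ?sqrtr_ge0 ?expR_ge0.
    by apply: zsummableZ; exact: gz_summable.
  apply: eq_esum => k _; have b0 : 0 < 2 * a by rewrite mulr_gt0.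
  transitivity (\int[mu]_y ((gz (a / 2) k)%:E * (expR (- (2 * a * (y + k%:~R / 2) ^+ 2)))%:E))%E.
    by apply: eq_integral => y _; rewrite /gz -EFinM -!expRD; congr (expR _)%:E; field.
  rewrite ge0_integralZl_EFin ?expR_ge0 //; first by rewrite integral_gauss_shift // -EFinM mulrC.
  apply/measurable_EFinP; apply: measurableT_comp => //; apply: measurableT_comp => //.
  by apply: measurable_funM => //; apply: measurable_funX; exact: measurable_addl.
- apply/(measurable_EFinP setT phi); rewrite (_ : EFin \o phi = fun y => (\esum_(k in [set: int]) (expR (- (a * y ^+ 2)) * expR (- (a * (y + k%:~R) ^+ 2)))%:E)%E); last exact/funext.
  apply: (measurable_esum (countableP _)) => [k _|k y _]; first exact: mk.
  by rewrite lee_fin mulr_ge0 ?expR_ge0.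
- by move=> y; rewrite mulr_ge0 ?expR_ge0 ?thB_ge0.
- by apply: cts_onM; exact: thB_cts.
- move=> y; rewrite -zsumZ; last exact: thB_summable.
  rewrite -esum_zsum; last 2 first.
    by move=> j; rewrite mulr_ge0 ?thB_ge0 ?expR_ge0.
    by apply: zsummableZ; exact: thB_summable.
  by apply: eq_esum => m _; rewrite /phi thB_periodic // mulrC.
Qed.

Lemma cos_int (n : nat) : rint 0 1 (fun y => cos (2 * pi * n%:R * y)) = (n == 0)%:R.
Proof.
have [->|n0] := eqVneq n 0%N.
  under [X in rint _ _ X]eq_fun do rewrite mulr0 mul0r cos0.
  by rewrite rint_cst // subr0 mulr1.
have k0 : 2 * pi * n%:R != 0 :> R by rewrite !mulf_neq0 ?pnatr_eq0 // gt_eqF ?pi_gt0.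
set k : R := 2 * pi * n%:R in k0 *.
have sk : sin k = 0.
  have := @cos_2piz n (pi / 2); rewrite cosD cos_pihalf sin_pihalf mul0r sub0r mul1r -/k => /eqP.
  by rewrite oppr_eq0 => /eqP.
have D (x : R) : is_derive x 1 (fun y => sin (k * y) / k) (cos (k * x)).
  by apply: is_derive_eq; rewrite /GRing.scale /=; field.
rewrite /rint /Rintegral (@continuous_FTC2 _ (fun y => cos (k * y)) (fun y => sin (k * y) / k)) //.
- by rewrite -EFinB /= mulr1 sk mulr0 sin0 !mul0r subrr.
- by apply: cts_on_within; exact: cts_cos.
- have cs (x : R) : {for x, continuous (fun y : R => sin (k * y) / k)}.
    by apply: differentiable_continuous; apply/derivable1_diffP; exact: (@ex_derive _ _ _ _ _ _ _ (D x)).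
  split; first by move=> x _; exact: (@ex_derive _ _ _ _ _ _ _ (D x)).
  + by apply: cvg_at_right_filter; exact: cs.
  + by apply: cvg_at_left_filter; exact: cs.
- by move=> x _; rewrite derive1E; have Dx := D x; rewrite derive_val.
Qed.

Lemma cos_cos_int (n m : nat) : rint 0 1 (fun y => cos (2 * pi * n%:R * y) * cos (2 * pi * m%:R * y)) =
  ((n + m == 0)%N%:R + (n == m)%:R) / 2.
Proof.
wlog nm : n m / (m <= n)%N.
  move=> H; case: (leqP m n) => [/H//|/ltnW /H E]; rewrite addnC [n == m]eq_sym -E.
  by apply: rint_ext => y _; rewrite mulrC.
have -> : (n == m) = (n - m == 0)%N by rewrite subn_eq0 eqn_leq nm andbT.
rewrite -!cos_int -rintD; [|exact: cts_cos..].
rewrite [RHS]mulrC -rintZ; last by apply: cts_onD; exact: cts_cos.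
apply: rint_ext => y _; rewrite natrD natrB //.
rewrite (_ : 2 * pi * (n%:R + m%:R) * y = 2 * pi * n%:R * y + 2 * pi * m%:R * y); last by ring.
rewrite (_ : 2 * pi * (n%:R - m%:R) * y = 2 * pi * n%:R * y - 2 * pi * m%:R * y); last by ring.
by rewrite cosB cosD; field.
Qed.

(** The terms at j and - j are merged, whence the weight 1 at 0 and 2 elsewhere. *)
Lemma th0_even_sum (g : int -> R) : (forall j, 0 <= g j) -> (forall j, g (- j) = g j) -> zsummable g ->
  ((zsum g)%:E = \sum_(n <oo) ((if n == 0%N then 1 else 2) * g n)%:E)%E.
Proof.
move=> g0 ge gs; rewrite zsumE //.
have g0' (j : int) : (0%:E <= (g j)%:E)%E by rewrite lee_fin.
rewrite (esumID (range Posz)) // setTI esum_image; last by move=> x y _ _ [].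
rewrite (_ : [set: int] `&` ~` range Posz = range Negz); last first.
  apply/seteqP; split => [[n|n] [_ h]|j [n _ <-]] /=; first by case: h; exists n.
    by exists n.
  by split=> // -[m _].
rewrite esum_image; last by move=> x y _ _ [].
rewrite (_ : \esum_(n in [set: nat]) (g (Negz n))%:E = \esum_(n in [set: nat]) (if n == 0%N then 0 else g n)%:E)%E; last first.
  rewrite [RHS](esumID (range S)); last by move=> n _; case: ifP; rewrite lee_fin.
  rewrite setTI esum_image; last by move=> x y _ _ [].
  rewrite [X in (_ + X)%E]esum1 ?adde0; last first.
    by move=> [|n] [_ h] //; case: h; exists n.
  by apply: eq_esum => n _; rewrite NegzE ge.
rewrite -esumD; [|by move=> n _|by move=> n _; case: ifP; rewrite lee_fin].
rewrite -nneseries_esumT.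
  by apply: eq_eseriesr => n _; rewrite -EFinD; case: ifP => _; congr EFin; ring.
by move=> n; rewrite -EFinD lee_fin addr_ge0 //; case: ifP.
Qed.

(** * Bessel's inequality for the periodised Gaussian *)

Section ParsevalTheta.
Variable d : R.
Hypothesis d0 : 0 < d.
Let c (j : int) := gz (pi * d) j.
Let m (n : nat) : R := if n == 0%N then 1 else 2.
Let e (n : nat) (y : R) := cos (2 * pi * n%:R * y).
Let Bn y := (Num.sqrt d)^-1 * thB (pi / d) y.
Let AN N y := \sum_(n < N) m n * c n * e n y.
Let SN N := \sum_(n < N) m n * c n * c n.
Let pid0 : 0 < pi * d. Proof. by rewrite mulr_gt0 // pi_gt0. Qed.
Let pidV0 : 0 < pi / d. Proof. by rewrite divr_gt0 // pi_gt0. Qed.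
Let sd0 : 0 < Num.sqrt d. Proof. by rewrite sqrtr_gt0. Qed.

Let cts_e n : cts_on 0 1 (e n). Proof. exact: cts_cos. Qed.
Let cts_Bn : cts_on 0 1 Bn. Proof. by apply: cts_onZ; exact: thB_cts. Qed.
Let ANS N y : AN N.+1 y = AN N y + m N * c N * e N y. Proof. by rewrite /AN big_ord_recr. Qed.
Let cts_AN N : cts_on 0 1 (AN N).
Proof.
elim: N => [|N IH]; first by rewrite (_ : AN 0 = cst 0); [exact: cts_on_cst|apply/funext => y; rewrite /AN big_ord0].
rewrite (_ : AN N.+1 = fun y => AN N y + m N * c N * e N y); last by apply/funext => y; rewrite ANS.
by apply: cts_onD => //; exact: cts_onZ.
Qed.

Let int_eAN N M : (M <= N)%N -> rint 0 1 (fun y => e N y * AN M y) = 0.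
Proof.
elim: M => [|M IH] MN.
  under [X in rint _ _ X]eq_fun do rewrite /AN big_ord0 mulr0.
  by rewrite rint_cst // mul0r.
under [X in rint _ _ X]eq_fun do rewrite ANS mulrDr [e N _ * (_ * _)]mulrCA.
rewrite rintD; [|exact: cts_onM|by apply: cts_onZ; exact: cts_onM].
rewrite IH ?(ltnW MN) // rintZ; last exact: cts_onM.
have nm : (N == M) = false by rewrite gtn_eqF.
have nm0 : (N + M == 0)%N = false by rewrite addn_eq0 [N == 0%N]gtn_eqF // (leq_ltn_trans _ MN).
by rewrite cos_cos_int nm nm0 addr0 mul0r mulr0 addr0.
Qed.

Let int_eBn N : rint 0 1 (fun y => e N y * Bn y) = c N.
Proof.
under [X in rint _ _ X]eq_fun do rewrite mulrCA.
rewrite rintZ; last by apply: cts_onM => //; exact: thB_cts.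
by rewrite thB_cos // mulKf // gt_eqF.
Qed.

(** The square norm of [Bn] is itself a theta value, so that Bessel's inequality compares two theta
    values. *)
Let V := (Num.sqrt (2 * d))^-1 * th0 (pi / (2 * d)).

Let int_Bn2 : rint 0 1 (fun y => Bn y * Bn y) = V.
Proof.
rewrite (_ : (fun y => _) = (fun y => d^-1 * (thB (pi / d) y * thB (pi / d) y))); last first.
  apply/funext => y; rewrite /Bn mulrACA; congr (_ * _).
  by rewrite -invfM -expr2 sqr_sqrtr // ltW.
rewrite rintZ; last by apply: cts_onM; exact: thB_cts.
rewrite thB_sqr_int // /V (_ : pi / d / 2 = pi / (2 * d)); last by rewrite invfM mulrA mulrAC.
have E2 : pi / (2 * (pi / d)) = d / 2.
  by move: (lt0r_neq0 (pi_gt0 R)); move: (pi : R) => p p0; field; rewrite p0 gt_eqF.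
rewrite E2 (mulrA d^-1); congr (_ * th0 _).
have s2 : 0 < Num.sqrt 2 :> R by rewrite sqrtr_gt0.
rewrite !sqrtrM ?(ltW d0) // sqrtrV // invfM -{1}(@sqr_sqrtr _ d) ?(ltW d0) //.
by field; rewrite !gt_eqF.
Qed.

(** By orthogonality of the cosines, adding the N-th harmonic with its own Fourier coefficient
    lowers the squared distance to [Bn] by m_N c_N^2. *)
Let int_AB N : rint 0 1 (fun y => (AN N y - Bn y) * (AN N y - Bn y)) = V - SN N.
Proof.
elim: N => [|N IH].
  rewrite /SN big_ord0 subr0 -int_Bn2; apply: rint_ext => y _.
  by rewrite /AN big_ord0 sub0r mulrNN.
rewrite (_ : (fun y => _) = (fun y => (AN N y - Bn y) * (AN N y - Bn y) + (2 * (m N * c N) * (e N y * AN N y) +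
    (- (2 * (m N * c N)) * (e N y * Bn y) + (m N * c N) ^+ 2 * (e N y * e N y))))); last first.
  by apply/funext => y; rewrite ANS; ring.
have ce k : cts_on 0 1 (fun y => k * (e N y * AN N y)) by apply: cts_onZ; exact: cts_onM.
have cb k : cts_on 0 1 (fun y => k * (e N y * Bn y)) by apply: cts_onZ; exact: cts_onM.
have cee k : cts_on 0 1 (fun y => k * (e N y * e N y)) by apply: cts_onZ; exact: cts_onM.
have cab : cts_on 0 1 (fun y => AN N y - Bn y) by apply: cts_onD => //; exact: cts_onN.
rewrite rintD; [|exact: cts_onM|by do 2 (apply: cts_onD => //)].
rewrite IH rintD; [|exact: ce|exact: cts_onD].
rewrite rintD // !rintZ; [|exact: cts_onM..].
rewrite int_eAN // int_eBn cos_cos_int eqxx /SN big_ord_recr /= /m.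
by case: N {IH ce cb cee cab} => [|N] /=; field.
Qed.

Let rint_ge0 (f : R -> R) : cts_on 0 1 f -> (forall y, 0 <= f y) -> 0 <= rint 0 1 f.
Proof.
by move=> cf f0; have := rint_ge ler01 cf (fun x _ => f0 x); rewrite mul0r.
Qed.

Let cAB N : cts_on 0 1 (fun y => (AN N y - Bn y) * (AN N y - Bn y)).
Proof. by apply: cts_onM; apply: cts_onD => //; exact: cts_onN. Qed.

Let c2_summable : zsummable (fun j => c j * c j).
Proof. by apply: cos_bd_summable; [exact: gz_ge0|exact: gz_summable|move=> j; rewrite ger0_norm ?expR_ge0 // -expR0 ler_expR oppr_le0 mulr_ge0 ?sqr_ge0 ?ltW]. Qed.

Let evc j : c (- j) = c j. Proof. by rewrite /c /gz mulrNz sqrrN. Qed.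

Lemma sup_bound (x V' : R) (a : nat -> R) : (forall n, 0 <= a n) -> (x%:E = \sum_(n <oo) (a n)%:E)%E ->
  (forall N, \sum_(n < N) a n <= V') -> x <= V'.
Proof.
move=> a0 E H; rewrite -lee_fin E; apply: lime_le.
  by apply: is_cvg_nneseries => n _ _; rewrite lee_fin.
by near=> N; rewrite sumEFin big_mkord lee_fin.
Unshelve. all: by end_near. Qed.

Lemma partial_le (x : R) (a : nat -> R) N : (forall n, 0 <= a n) -> (x%:E = \sum_(n <oo) (a n)%:E)%E ->
  \sum_(n < N) a n <= x.
Proof.
move=> a0 E; rewrite -lee_fin E (le_trans _ (nneseries_lim_ge N _)) //.
  by rewrite sumEFin big_mkord.
by move=> n _ _; rewrite lee_fin.
Qed.

Let m0 n : 0 <= m n. Proof. by rewrite /m; case: ifP. Qed.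

Lemma th0_le : th0 (pi * (2 * d)) <= V.
Proof.
have -> : th0 (pi * (2 * d)) = zsum (fun j => c j * c j).
  by apply: eq_Rintegral => j _; rewrite /c /gz -expRD; congr expR; ring.
apply: (@sup_bound _ _ (fun n => m n * (c n * c n))).
- by move=> n; rewrite !mulr_ge0 ?expR_ge0.
- rewrite th0_even_sum //; first by move=> j; rewrite mulr_ge0 ?expR_ge0.
  by move=> j; rewrite evc.
- move=> N; have := rint_ge0 (cAB N) (fun y => sqr_ge0 _); rewrite int_AB subr_ge0 /SN.
  by under eq_bigr do rewrite -mulrA.
Qed.

Lemma theta_partial_cts N : cts_on 0 1 (AN N). Proof. exact: cts_AN. Qed.
Lemma theta_partial_int N : rint 0 1 (fun y => (AN N y - Bn y) * (AN N y - Bn y)) = V - SN N.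
Proof. exact: int_AB. Qed.

End ParsevalTheta.

(** Bessel's inequalities for [d] and for 1 / d point in opposite directions, so both are
    equalities: Parseval's identity results without completeness of the trigonometric system. *)
Lemma th0_functional d : 0 < d -> th0 (pi * d) = (Num.sqrt d)^-1 * th0 (pi / d).
Proof.
move=> d0; have le (D : R) : 0 < D -> th0 (pi * D) <= (Num.sqrt D)^-1 * th0 (pi / D).
  move=> D0; have D2 : 0 < D / 2 by rewrite divr_gt0.
  by have := th0_le D2; rewrite (_ : 2 * (D / 2) = D) //; field.
apply/eqP; rewrite eq_le le //=; have := le d^-1; rewrite invr_gt0 invrK => /(_ d0).
by rewrite sqrtrV ?(ltW d0) // invrK -ler_pdivrMl ?sqrtr_gt0.
Qed.

Lemma rint0_eq0 (f : R -> R) : cts_on 0 1 f -> (forall y, 0 <= f y) -> rint 0 1 f <= 0 ->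
  forall y, 0 < y < 1 -> f y = 0.
Proof.
move=> cf f0 If y /andP[y0 y1]; apply/eqP; rewrite eq_le f0 andbT leNgt; apply/negP => fy.
have yI : 0 <= y <= 1 by rewrite !ltW.
have e0 : 0 < f y / 2 by rewrite divr_gt0.
have [r r0 Hr] := cf y yI _ e0.
pose s := Num.min (Num.min (r / 2) y) (1 - y).
have s0 : 0 < s by rewrite !lt_min divr_gt0 // y0 subr_gt0.
have : s <= s by []; rewrite {2}/s !le_min => /andP[/andP[sr sy] s1]; clearbody s.
have A1 : 0 <= y - s <= 1 by apply/andP; split; lra.
have A2 : y - s <= y <= 1 by apply/andP; split; lra.
rewrite (rint_split A1 cf) (rint_split A2 (cts_on_sub _ _ cf)) // in If; last by case/andP: A1.
have ge a b : 0 <= a -> a <= b -> b <= 1 -> 0 <= rint a b f.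
  move=> a0 ab b1; have := rint_ge ab (cts_on_sub a0 b1 cf) (fun x _ => f0 x); by rewrite mul0r.
have := ge 0 (y - s) (lexx _); have := ge y 1 (ltW y0) (ltW y1) (lexx _).
have ys : y - s <= y by lra.
have cys : cts_on (y - s) y f by apply: cts_on_sub cf; lra.
have := @rint_ge _ (y - s) y f (f y / 2) ys cys.
have h : forall x, y - s <= x <= y -> f y / 2 <= f x.
  move=> x /andP[x1 x2]; have := Hr x; rewrite ler_norml ltr_norml => /(_ _ _)/andP[].
  - by apply/andP; split; lra.
  - by apply/andP; split; lra.
  - by move=> h _; lra.
move=> /(_ h) h1 h2 /(_ _ _) h3; have h4 : 0 <= rint 0 (y - s) f by apply: h3; lra.
have : 0 < f y / 2 * (y - (y - s)) by rewrite mulr_gt0 //; lra.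
lra.
Qed.

(** Parseval's identity makes the partial sums [AN N] converge to [Bn] in mean square, while they
    converge to [thA a] uniformly; the continuous difference has mean square 0 and vanishes. *)
Lemma theta1 d y : 0 < d -> 0 < y < 1 -> thA (pi * d) y = (Num.sqrt d)^-1 * thB (pi / d) y.
Proof.
move=> d0 y01; set a := pi * d; pose c (j : int) := gz a j.
pose m (n : nat) : R := if n == 0%N then 1 else 2.
pose AN N y := \sum_(n < N) m n * c n * cos (2 * pi * n%:R * y).
pose Bn y := (Num.sqrt d)^-1 * thB (pi / d) y.
have a0 : 0 < a by rewrite mulr_gt0 // pi_gt0.
have b0 : 0 < pi / d by rewrite divr_gt0 // pi_gt0.
have m0 n : 0 <= m n by rewrite /m; case: ifP.
have cs : zsummable c by exact: gz_summable.
have ce j : c (- j) = c j by rewrite /c /gz mulrNz sqrrN.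
pose C0 := zsum c; pose CN N := \sum_(n < N) m n * c n.
have cb (x : R) : -1 <= cos x <= 1 by rewrite cos_geN1 cos_le1.
have bound N x : `|thA a x - AN N x| <= C0 - CN N.
  (* The terms c_j (1 + sg cos) are nonnegative, so each partial sum is below the total; the two
     signs together bound the distance from [thA]. *)
  have gen (sg : R) : sg = 1 \/ sg = -1 -> CN N + sg * AN N x <= C0 + sg * thA a x.
    move=> sgE; have sb z : 0 <= 1 + sg * cos z by have := cb z; case: sgE => -> /andP[? ?]; lra.
    have sm : zsummable (fun j => c j * cos (2 * pi * j%:~R * x)).
      by apply: cos_bd_summable => // j; [exact: expR_ge0|exact: cos_max].
    have E : zsum (fun j => c j * (1 + sg * cos (2 * pi * j%:~R * x))) = C0 + sg * thA a x.
      rewrite -zsumZ // -zsumD //; last exact: zsummableZ.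
      by apply: eq_Rintegral => j _; rewrite mulrDr mulr1 mulrCA.
    have ps : zsummable (fun j => c j * (1 + sg * cos (2 * pi * j%:~R * x))).
      apply: zsummable_le (zsummableZ 2 cs) => j.
      rewrite ger0_norm ?mulr_ge0 ?expR_ge0 // mulrC ler_wpM2r ?expR_ge0 //.
      by have := cb (2 * pi * j%:~R * x); case: sgE => -> /andP[? ?]; lra.
    rewrite -E; have := @partial_le _ (fun n => m n * (c n * (1 + sg * cos (2 * pi * n%:R * x)))) N _ (th0_even_sum _ _ ps).
    rewrite (_ : \sum_(n < N) _ = CN N + sg * AN N x); last first.
      rewrite /CN /AN mulr_sumr -big_split /=; apply: eq_bigr => n _; ring.
    apply.
    - by move=> n; rewrite !mulr_ge0 ?expR_ge0.
    - by move=> j; rewrite mulr_ge0 ?expR_ge0.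
    - by move=> j; rewrite ce; congr (_ * (1 + _ * _)); rewrite mulrNz mulrN mulNr cosN.
  have := gen 1 (or_introl erefl); have := gen (-1) (or_intror erefl).
  by rewrite ler_norml => h1 h2; apply/andP; split; lra.
have intb N : rint 0 1 (fun x => (AN N x - Bn x) * (AN N x - Bn x)) = (Num.sqrt (2 * d))^-1 * th0 (pi / (2 * d)) - \sum_(n < N) m n * c n * c n.
  exact: (theta_partial_int d0).
have cA : cts_on 0 1 (thA a) by exact: thA_cts.
have cB : cts_on 0 1 Bn by apply: cts_onZ; exact: thB_cts.
have cAN N : cts_on 0 1 (AN N) by exact: (theta_partial_cts d).
have cE : cts_on 0 1 (fun x => thA a x - Bn x) by apply: cts_onD => //; exact: cts_onN.
have cEN N : cts_on 0 1 (fun x => AN N x - Bn x) by apply: cts_onD => //; exact: cts_onN.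
have c2s : zsummable (fun j => c j * c j).
  apply: cos_bd_summable => // [j|j]; first exact: expR_ge0.
  by rewrite ger0_norm ?expR_ge0 // -expR0 ler_expR oppr_le0 mulr_ge0 ?sqr_ge0 ?ltW.
have V2 : (Num.sqrt (2 * d))^-1 * th0 (pi / (2 * d)) = zsum (fun j => c j * c j).
  rewrite -th0_functional ?mulr_gt0 //; apply: eq_Rintegral => j _.
  by rewrite /c /gz -expRD; congr expR; rewrite /a; ring.
have tail (g : int -> R) : (forall j, 0 <= g j) -> (forall j, g (- j) = g j) -> zsummable g ->
    forall e, 0 < e -> exists N0, forall N, (N0 <= N)%N -> zsum g - \sum_(n < N) m n * g n < e.
  move=> g0 ge gs e e0; apply: contrapT => H.
  have : zsum g <= zsum g - e.
    apply: (sup_bound _ (th0_even_sum g0 ge gs)); first by move=> n; rewrite mulr_ge0 // m0.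
    move=> N; rewrite lerBrDr leNgt; apply/negP => h; apply: H; exists N => M NM.
    have : \sum_(n < N) m n * g n <= \sum_(n < M) m n * g n.
      rewrite -(subnKC NM) big_split_ord /= lerDl; apply: sumr_ge0 => n _; exact: mulr_ge0.
    rewrite -/m in h; lra.
  by lra.
have key : rint 0 1 (fun x => (thA a x - Bn x) * (thA a x - Bn x)) <= 0.
  (* The integrand is at most 2 T^2 + 2 (AN - Bn)^2 with T < min(1, e / 4); each of the two terms
     integrates to at most e / 2. *)
  apply/ler_addgt0Pr => e e0; rewrite add0r.
  have e4 : 0 < e / 4 by rewrite divr_gt0.
  have e41 : 0 < Num.min 1 (e / 4) by rewrite lt_min ltr01.
  have [N1 H1] := tail c (fun j => expR_ge0 _) ce cs _ e41.
  have [N2 H2] := tail _ (fun j => mulr_ge0 (expR_ge0 _) (expR_ge0 _)) (fun j => congr2 *%R (ce j) (ce j)) c2s _ e4.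
  pose N := maxn N1 N2; have := H1 N (leq_maxl _ _); have := H2 N (leq_maxr _ _).
  rewrite lt_min -/C0 -/(CN N) => h2 /andP[h11 h1].
  have cK : cts_on 0 1 (fun x => (AN N x - Bn x) * (AN N x - Bn x)) by exact: cts_onM.
  apply: (@le_trans _ _ (rint 0 1 (fun x => 2 * (C0 - CN N) ^+ 2 + 2 * ((AN N x - Bn x) * (AN N x - Bn x))))).
    apply: rint_le; [exact: cts_onM|by apply: cts_onD; [exact: cts_on_cst|exact: cts_onZ]|].
    move=> x _; have := bound N x; set u := thA a x; set v := AN N x; set w := Bn x; set T := C0 - CN N => uv.
    have : (u - v) ^+ 2 <= T ^+ 2.
      by rewrite -[(u - v) ^+ 2]real_normK ?num_real // lerXn2r // nnegrE (le_trans _ uv).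
    have : 0 <= (u - v - (v - w)) ^+ 2 by exact: sqr_ge0.
    by rewrite !expr2; nra.
  rewrite rintD; [|exact: cts_on_cst|exact: cts_onZ].
  rewrite rint_cst // rintZ // intb V2.
  rewrite (eq_bigr (fun n : 'I_N => m n * (c n * c n))); last by move=> n _; rewrite mulrA.
  have T0 : 0 <= C0 - CN N by exact: le_trans (normr_ge0 _) (bound N 0).
  have : (C0 - CN N) ^+ 2 <= e / 4 by rewrite expr2; nra.
  lra.
have := rint0_eq0 (cts_onM cE cE) (fun x => sqr_ge0 _) key y01.
by move=> /eqP; rewrite mulf_eq0 orbb subr_eq0 => /eqP.
Qed.

End ThetaOneDim.

(** * Theta series with a shift and a character *)

Section ThetaCharacter.
Context {R : realType}.
Local Notation C := R[i].
Implicit Types (a d b g e : R).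

(** [theta1] is the identity on a real interval centred at 1 / 2, and both sides are entire. *)
Lemma thetaC d (z : C) : 0 < d -> thG (pi * d) z = (Num.sqrt d)^-1%:C * thF (pi / d) z.
Proof.
move=> d0; have a0 : 0 < pi * d by rewrite mulr_gt0 // pi_gt0.
have b0 : 0 < pi / d by rewrite divr_gt0 // pi_gt0.
pose f z := thG (pi * d) z - (Num.sqrt d)^-1%:C * thF (pi / d) z; pose c : C := (2^-1)%:C.
apply/eqP; rewrite -subr_eq0; apply/eqP; rewrite -/(f z).
have n0 : 0 < normc (z - c) + 1 by rewrite ltr_wpDl ?normc_ge0.
apply: (@identity_theorem R f c _ n0); last by rewrite ltrDl.
  move=> w _; have [l Hl] := thG_cdiff w a0; have [m Hm] := thF_cdiff w b0.
  by eexists; apply: cdiffB; [exact: Hl|apply: cdiffZ; exact: Hm].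
exists 2^-1; first by rewrite invr_gt0.
move=> x hx; rewrite /c -rmorphD; set y := 2^-1 + x.
have y01 : 0 < y < 1 by move: hx; rewrite ltr_norml /y => /andP[? ?]; apply/andP; split; lra.
rewrite /f thF_real //; have -> : thG (pi * d) y%:C = (thA (pi * d) y)%:C.
  by apply: complex_ext; [rewrite thG_Re|rewrite thG_Im].
by rewrite theta1 // -rmorphM subrr.
Qed.

Lemma zlap_summable a (z k : C) : 0 < a -> zsummable (fun j => gz a j * Re (k * cexp (z * j%:~R%:C))).
Proof.
move=> a0; apply: zsummable_le (zsummableZ (normc k) (gauss_zsummable (Re z) a0)) => j.
rewrite normrM (ger0_norm (gz_ge0 a j)) expRD (mulrCA (normc k)) -/(gz a j) ler_wpM2l ?gz_ge0 //.
rewrite (le_trans (Re_le_normc _)) // normcM normc_cexp ler_wpM2l ?normc_ge0 //.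
by rewrite ler_expR; apply: le_of_eq; rewrite complexRe_M /= mulr0 subr0.
Qed.

Lemma zlap_Re a (k z : C) : 0 < a -> Re (k * zlap a z) = zsum (fun j => gz a j * Re (k * cexp (z * j%:~R%:C))).
Proof.
move=> a0; rewrite complexRe_M /zlap /lap [Re (_ +i* _)]/= [Im (_ +i* _)]/= -/(zsum _) -/(zsum _).
have s1 : zsummable (fun j => gz a j * Re (cexp (z * j%:~R%:C))).
  by apply: zsummable_le (zsummable_norm (zlap_summable z 1 a0)) => j; rewrite mul1r.
have s2 : zsummable (fun j => gz a j * Im (cexp (z * j%:~R%:C))).
  apply: zsummable_le (zsummable_norm (zlap_summable z (0 +i* -1) a0)) => j.
  by apply: le_of_eq; congr (`|_ * _|); case: (cexp _) => p q /=; ring.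
rewrite -zsumZ // -mulNr -zsumZ // -zsumD; [|exact: zsummableZ..].
by apply: eq_Rintegral => j _; rewrite complexRe_M; ring.
Qed.

(** One complex argument yields a shift and a character at once: its real part [g] is the character
    on the left and the shift on the right, its imaginary part [d * b] plays the converse roles. *)
Lemma theta_char d b g e : 0 < d ->
  zsum (fun t => expR (- (pi * d * (t%:~R + b) ^+ 2)) * cos (2 * pi * (g * t%:~R + e))) =
  (Num.sqrt d)^-1 * zsum (fun m => expR (- (pi / d * (m%:~R - g) ^+ 2)) * cos (2 * pi * ((m%:~R - g) * b + e))).
Proof.
move=> d0; have a0 : 0 < pi * d by rewrite mulr_gt0 // pi_gt0.
have b0 : 0 < pi / d by rewrite divr_gt0 // pi_gt0.
have p0 := lt0r_neq0 (pi_gt0 R); have dn : d != 0 by rewrite gt_eqF.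
(* The factor [k] completes the square to (t + b)^2 and inserts the phase [e]. *)
pose k : C := cexp ((- (pi * d * b ^+ 2)) +i* (2 * pi * e)).
pose z : C := g +i* (d * b).
have H := congr1 (fun w => Re (k * w)) (thetaC z d0); cbv beta in H.
have sq : 0 < Num.sqrt d by rewrite sqrtr_gt0.
rewrite mulrCA (_ : Re (_%:C * (k * thF _ z)) = (Num.sqrt d)^-1 * Re (k * thF (pi / d) z)) in H; last first.
  by rewrite complexRe_M [Im _%:C]/= [Re _%:C]/= mul0r subr0.
move: H; rewrite /thG /thF mulrA !zlap_Re // => H.
transitivity (zsum (fun j => gz (pi * d) j * Re (k * cexp ((0 +i* (2 * pi)) * z * j%:~R%:C)))).
  apply: eq_Rintegral => t _; rewrite /gz /k -cexpD.
  set w := (X in cexp X).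
  have -> : w = (- (pi * d * b ^+ 2) - 2 * pi * d * b * t%:~R) +i* (2 * pi * (g * t%:~R + e)).
    by apply: complex_ext; rewrite /w /z /=; move: (pi : R) => p; ring.
  rewrite Re_cexp /= mulrA -expRD; congr (expR _ * _); move: (pi : R) => p; ring.
rewrite H; congr (_ * _).
have sm : zsummable (fun m => expR (- (pi / d * (m%:~R - g) ^+ 2)) * cos (2 * pi * ((m%:~R - g) * b + e))).
  apply: cos_bd_summable => [j|  |j]; [exact: expR_ge0| |exact: cos_max].
  have := thB_summable (- g) b0; apply: zsummable_le => j.
  by rewrite ger0_norm ?expR_ge0 // addrC.
rewrite -[RHS](zsum_bij (@opprK _) (@opprK _) sm); apply: eq_Rintegral => m _.
rewrite /gz /k -!cexpD.
set w := (X in cexp X).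
have -> : w = (- (pi / d * g ^+ 2) - 2 * (pi / d) * g * m%:~R) +i* (2 * pi * ((- m%:~R - g) * b + e)).
  by apply: complex_ext; rewrite /w /z /=; move: (pi : R) => p; field.
rewrite Re_cexp [Re (_ +i* _)]/= [Im (_ +i* _)]/= mulrA -expRD /= mulrNz; congr (expR _ * _); move: (pi : R) => p; ring.
Qed.

Lemma zsum1D_esum (w c : int -> R) : (forall j, 0 <= w j) -> zsummable w -> (forall j, `|c j| <= 1) ->
  (\esum_(j in [set: int]) (w j * (1 + c j))%:E = (zsum w + zsum (fun j => w j * c j))%:E)%E.
Proof.
move=> w0 ws c1; have cs : zsummable (fun j => w j * c j) by exact: cos_bd_summable.
rewrite esum_zsum -?zsumD //.
- by congr EFin; apply: eq_Rintegral => j _; rewrite mulrDr mulr1.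
- by move=> j; rewrite mulr_ge0 //; have := c1 j; rewrite ler_norml => /andP[? ?]; lra.
- have -> : (fun j => w j * (1 + c j)) = fun j => w j + w j * c j by apply/funext => j; rewrite mulrDr mulr1.
  exact: zsummableD.
Qed.

(* One-dimensional Poisson summation for a twisted Gaussian, arranged so that only nonnegative series occur. *)
Lemma theta_char_esum d b g e : 0 < d ->
  (\esum_(t in [set: int]) (expR (- (pi * d * (t%:~R + b) ^+ 2)) * (1 + cos (2 * pi * (g * t%:~R + e))))%:E +
   \esum_(m in [set: int]) ((Num.sqrt d)^-1 * expR (- (pi / d * (m%:~R - g) ^+ 2)))%:E =
   \esum_(t in [set: int]) (expR (- (pi * d * (t%:~R + b) ^+ 2)))%:E +
   \esum_(m in [set: int]) ((Num.sqrt d)^-1 * expR (- (pi / d * (m%:~R - g) ^+ 2)) *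
       (1 + cos (2 * pi * ((m%:~R - g) * b + e))))%:E)%E.
Proof.
move=> d0; have a0 : 0 < pi * d by rewrite mulr_gt0 // pi_gt0.
have b0 : 0 < pi / d by rewrite divr_gt0 // pi_gt0.
have sq : 0 <= (Num.sqrt d)^-1 by rewrite invr_ge0 sqrtr_ge0.
have s1 : zsummable (fun t => expR (- (pi * d * (t%:~R + b) ^+ 2))).
  by have := thB_summable b a0; apply: zsummable_le => j; rewrite ger0_norm ?expR_ge0 // addrC.
have s2 : zsummable (fun m => (Num.sqrt d)^-1 * expR (- (pi / d * (m%:~R - g) ^+ 2))).
  apply: zsummableZ; have := thB_summable (- g) b0; apply: zsummable_le => j.
  by rewrite ger0_norm ?expR_ge0 // addrC.
have k0 (j : int) : 0 <= (Num.sqrt d)^-1 * expR (- (pi / d * (j%:~R - g) ^+ 2)) by rewrite mulr_ge0 ?expR_ge0.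
rewrite zsum1D_esum //; last by move=> j; exact: cos_max.
rewrite zsum1D_esum //; last by move=> j; exact: cos_max.
rewrite esum_zsum // esum_zsum //.
rewrite -!EFinD theta_char //; congr EFin.
rewrite -addrA; congr (_ + _); rewrite addrC; congr (_ + _).
rewrite -zsumZ.
  by apply: eq_Rintegral => j _; rewrite mulrA.
apply: cos_bd_summable => [j||j]; [exact: expR_ge0| |exact: cos_max].
have := zsummableZ (Num.sqrt d) s2; apply: zsummable_le => j.
by rewrite mulVKf ?gt_eqF ?sqrtr_gt0 // ger0_norm ?expR_ge0.
Qed.

Lemma theta_shift_fin d b : 0 < d -> (\esum_(t in [set: int]) (expR (- (pi * d * (t%:~R + b) ^+ 2)))%:E < +oo)%E.
Proof.
move=> d0; have a0 : 0 < pi * d by rewrite mulr_gt0 // pi_gt0.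
rewrite esum_zsum ?ltry //.
by have := thB_summable b a0; apply: zsummable_le => j; rewrite ger0_norm ?expR_ge0 // addrC.
Qed.

(** By Poisson summation the shifted sum is a cosine series in [b] with nonnegative coefficients,
    hence largest at b = 0. Uniformity in [b] gives finiteness in the induction on the rank. *)
Lemma theta_shift_le d b : 0 < d ->
  (\esum_(t in [set: int]) (expR (- (pi * d * (t%:~R + b) ^+ 2)))%:E <=
   \esum_(m in [set: int]) ((Num.sqrt d)^-1 * expR (- (pi / d * m%:~R ^+ 2)))%:E)%E.
Proof.
move=> d0; have := theta_char_esum b 0 0 d0; have F := theta_shift_fin b d0.
have sq : 0 <= (Num.sqrt d)^-1 by rewrite invr_ge0 sqrtr_ge0.
have b0 : 0 < pi / d by rewrite divr_gt0 // pi_gt0.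
set A := (\esum_(t in _) (expR _)%:E)%E in F *.
rewrite (_ : (\esum_(t in _) (_ * (1 + cos (2 * pi * (0 * _ + 0))))%:E)%E = (A + A)%E); last first.
  rewrite /A -esumD; try by move=> i _; rewrite lee_fin expR_ge0.
  apply: eq_esum => j _; rewrite -EFinD mul0r addr0 mulr0 cos0; congr EFin; ring.
set h := (\esum_(m in _) (_ * expR (- (pi / d * (m%:~R - 0) ^+ 2)))%:E)%E.
have -> : (\esum_(m in [set: int]) ((Num.sqrt d)^-1 * expR (- (pi / d * m%:~R ^+ 2)))%:E)%E = h.
  by apply: eq_esum => j _; rewrite subr0.
have Ffin : A \is a fin_num.
  by rewrite ge0_fin_numE // esum_ge0 // => j _; rewrite lee_fin expR_ge0.
have hf : h \is a fin_num.
  rewrite ge0_fin_numE; last by apply: esum_ge0 => j _; rewrite lee_fin mulr_ge0 ?expR_ge0.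
  rewrite /h esum_zsum; [exact: ltry|by move=> j; rewrite mulr_ge0 ?expR_ge0|].
  apply: zsummableZ; have := thB_summable 0 b0; apply: zsummable_le => j.
  by rewrite ger0_norm ?expR_ge0 // add0r subr0.
set B := esum _ _ => E.
have : (A + A + h <= A + (h + h))%E.
  rewrite E leeD2lE // /h -esumD; try by move=> i _; rewrite lee_fin mulr_ge0 ?expR_ge0.
  apply: le_esum => j _; rewrite -EFinD lee_fin mulrDr mulr1 lerD2l.
  rewrite ler_piMr ?cos_le1 // mulr_ge0 ?expR_ge0 //.
by rewrite -addeA leeD2lE // leeD2rE.
Qed.

End ThetaCharacter.

Section EsumTools.
Context {R : realType}.
Local Open Scope ereal_scope.

Lemma addeIr (x y z : \bar R) : x \is a fin_num -> y + x = z + x -> y = z.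
Proof. by move=> xf /(congr1 (fun t => t - x)); rewrite !addeK. Qed.

Lemma esumZl (T : choiceType) (D : set T) (k : R) (a : T -> \bar R) : (0 <= k)%R -> (forall i, 0 <= a i) ->
  \esum_(i in D) (k%:E * a i) = k%:E * \esum_(i in D) a i.
Proof.
move=> k0 a0.
have H (l : R) (b : T -> \bar R) : (0 <= l)%R -> (forall i, 0 <= b i) -> \esum_(i in D) (l%:E * b i) <= l%:E * \esum_(i in D) b i.
  move=> l0 b0; apply: ge_ereal_sup => _ [X [finX XD] <-].
  rewrite fsbig_finite //= -ge0_sume_distrr // lee_wpmul2l ?lee_fin //.
  by rewrite -fsbig_finite //; apply: esum_ge; exists X.
apply/eqP; rewrite eq_le H //=; case: (eqVneq k 0%R) => [->|kn0].
  by rewrite mul0e esum_ge0 // => i _; rewrite mul0e.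
have {kn0}k0 : (0 < k)%R by rewrite lt_def kn0.
have ka i : 0 <= k%:E * a i by apply: mule_ge0 => //; rewrite lee_fin ltW.
have ki : (0 <= k^-1)%R by rewrite invr_ge0 ltW.
have := lee_wpmul2l (x := k%:E) _ (H _ _ ki ka).
rewrite lee_fin (ltW k0) => /(_ isT).
rewrite muleA -EFinM divff ?gt_eqF // mul1e.
by under [X in (_ * X <= _)]eq_esum do rewrite muleA -EFinM mulVf ?gt_eqF // mul1e.
Qed.

Lemma esum_pair (T1 T2 : choiceType) (a : T1 * T2 -> \bar R) : (forall p, 0 <= a p) ->
  \esum_(i in [set: T1]) \esum_(j in [set: T2]) a (i, j) = \esum_(p in [set: T1 * T2]) a p.
Proof.
move=> a0; rewrite (@esum_esum _ _ _ [set: T1] (fun=> [set: T2]) (fun i j => a (i, j))) //.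
rewrite (_ : _ `*`` _ = setT); last by apply/seteqP; split.
by apply: eq_esum => -[].
Qed.

Lemma esum_bij (T1 T2 : choiceType) (e : T1 -> T2) (a : T2 -> \bar R) : bijective e ->
  \esum_(j in [set: T2]) a j = \esum_(i in [set: T1]) a (e i).
Proof.
move=> [e' ee e'e]; apply: reindex_esum; split=> // [x y _ _ exy|y _].
  by rewrite -(ee x) exy ee.
by exists (e' y).
Qed.

Lemma esum_swap (T1 T2 : choiceType) (a : T1 -> T2 -> \bar R) : (forall i j, 0 <= a i j) ->
  \esum_(i in [set: T1]) \esum_(j in [set: T2]) a i j = \esum_(j in [set: T2]) \esum_(i in [set: T1]) a i j.
Proof.
move=> a0; rewrite (esum_pair (a := fun p => a p.1 p.2)) //.
rewrite (esum_pair (a := fun p => a p.2 p.1)) //.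
rewrite (@esum_bij _ _ (fun p : T2 * T1 => (p.2, p.1)) (fun p => a p.1 p.2)) //.
by exists (fun p => (p.2, p.1)) => -[].
Qed.

End EsumTools.

(** * Poisson summation for positive definite quadratic forms *)

Section QuadraticForms.
Context {R : realType}.

Definition qf n (S : 'M[R]_n) (x : 'rV[R]_n) : R := (x *m S *m x^T) 0 0.
Definition dotv n (c x : 'rV[R]_n) : R := (c *m x^T) 0 0.
Definition posdef n (S : 'M[R]_n) := S^T = S /\ forall x, x != 0 -> 0 < qf S x.
Definition zrow n (x : 'rV[int]_n) : 'rV[R]_n := map_mx (fun m : int => m%:~R) x.

Lemma qf_congr n (P D : 'M[R]_n) x : qf (P *m D *m P^T) x = qf D (x *m P).
Proof. by rewrite /qf trmx_mul !mulmxA. Qed.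

Lemma dotvDl n (a b x : 'rV[R]_n) : dotv (a + b) x = dotv a x + dotv b x.
Proof. by rewrite /dotv mulmxDl mxE. Qed.

Lemma dotvZl n (k : R) (a x : 'rV[R]_n) : dotv (k *: a) x = k * dotv a x.
Proof. by rewrite /dotv -scalemxAl mxE. Qed.

Lemma dotvC n (a b : 'rV[R]_n) : dotv a b = dotv b a.
Proof. by rewrite /dotv -[a *m b^T]trmxK trmx_mul trmxK mxE. Qed.

Lemma qf_diag n (d : R) (S : 'M[R]_n) (m : 'M[R]_1) (x : 'rV[R]_n) :
  qf (block_mx d%:M 0 0 S) (row_mx m x) = d * m 0 0 ^+ 2 + qf S x.
Proof.
rewrite /qf mul_row_block !mulmx0 addr0 add0r tr_row_mx mul_row_col mxE; congr (_ + _).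
by rewrite [m]mx11_scalar tr_scalar_mx -!scalar_mxM mxE eqxx mulr1n mxE eqxx mulr1n; ring.
Qed.

(** Completion of the square in the first coordinate: [d] is the corner entry and [S'] its Schur
    complement. *)
Lemma posdef_schur n (S : 'M[R]_(1 + n)) : posdef S ->
  exists d (b : 'rV[R]_n) S', [/\ 0 < d, posdef S' &
    S = block_mx 1%:M 0 b^T 1%:M *m block_mx d%:M 0 0 S' *m (block_mx 1%:M 0 b^T 1%:M)^T].
Proof.
move=> [sS pS]; pose d := ulsubmx S 0 0; pose u := ursubmx S.
have dE : qf S (row_mx 1%:M 0) = d.
  rewrite /qf -{1}[S]submxK mul_row_block !mul1mx !mul0mx !addr0 tr_row_mx mul_row_col trmx0 mulmx0 addr0.
  by rewrite trmx1 mulmx1.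
have d0 : 0 < d.
  rewrite -dE; apply: pS; apply/eqP => /matrixP /(_ 0 (lshift n 0)).
  by rewrite row_mxEl !mxE eqxx => /eqP; rewrite oner_eq0.
have ulE : ulsubmx S = d%:M by rewrite [LHS]mx11_scalar.
have dlE : dlsubmx S = u^T by rewrite /u trmx_ursub sS.
pose b := d^-1 *: u; have ub : u = d *: b by rewrite scalerA divff ?gt_eqF // scale1r.
pose S' := drsubmx S - d *: (b^T *m b).
have SE : S = block_mx 1%:M 0 b^T 1%:M *m block_mx d%:M 0 0 S' *m (block_mx 1%:M 0 b^T 1%:M)^T.
  rewrite tr_block_mx trmxK !trmx1 trmx0 !mulmx_block !(mulmx0, mul0mx, mulmx1, mul1mx, addr0, add0r).
  rewrite -[LHS]submxK ulE dlE -/u ub; congr block_mx.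
  - by rewrite mul_scalar_mx.
  - by rewrite mul_mx_scalar linearZ.
  - by rewrite mul_mx_scalar -scalemxAl /S' addrC subrK.
exists d, b, S'; split=> //; split.
  rewrite /S' linearB /= linearZ /= trmx_mul trmxK; congr (_ - _).
  by rewrite trmx_drsub sS.
move=> x x0; have := pS (row_mx (- (x *m b^T)) x).
rewrite SE qf_congr mul_row_block mulmx1 mulmx0 addNr add0r mulmx1 qf_diag mxE expr0n mulr0 add0r; apply.
by apply: contra_neq x0 => /(congr1 rsubmx); rewrite row_mxKr => ->; rewrite linear0.
Qed.

Lemma row_mx_bij n : bijective (fun p : int * 'rV[int]_n => row_mx p.1%:M p.2 : 'rV[int]_(1 + n)).
Proof.
exists (fun x => (lsubmx x 0 0, rsubmx x)) => [[m x]|x] /=.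
  by rewrite row_mxKl row_mxKr mxE eqxx.
by rewrite -mx11_scalar hsubmxK.
Qed.

Local Open Scope ereal_scope.

Definition theta n (S : 'M[R]_n) : \bar R := \esum_(x in [set: 'rV[int]_n]) (expR (- (pi * qf S (zrow x))))%:E.

(** The character [c] belongs to the induction: Poisson summation in the first coordinate turns its
    shift by [dotv x b] into a character of the remaining coordinates. The weights 1 + cos keep all
    terms nonnegative. *)
Definition poisson_at n (S : 'M[R]_n) := [/\ (0 < \det S)%R, theta S < +oo & forall c,
  \esum_(x in [set: 'rV[int]_n]) (expR (- (pi * qf S (zrow x))) * (1 + cos (2 * pi * dotv c (zrow x))))%:E =
  theta S + \esum_(y in [set: 'rV[int]_n]) ((Num.sqrt (\det S))^-1 * expR (- (pi * qf (invmx S) (zrow y - c))))%:E].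

Let poisson_step n (S : 'M[R]_(1 + n)) : (forall S' : 'M[R]_n, posdef S' -> poisson_at S') -> posdef S -> poisson_at S.
Proof.
move=> IH pS; have [d [b [S' [d0 pS' SE]]]] := posdef_schur pS; have [D0 F0 H] := IH _ pS'.
have S'u : S' \in unitmx by rewrite unitmxE unitfE gt_eqF.
have detS : (\det S = d * \det S')%R.
  by rewrite SE !det_mulmx det_tr !det_lblock !det1 !mulr1 !mul1r det_scalar expr1.
have qS (m : int) (x : 'rV[int]_n) : qf S (zrow (row_mx m%:M x)) = (d * (m%:~R + dotv (zrow x) b) ^+ 2 + qf S' (zrow x))%R.
  rewrite SE qf_congr /zrow map_row_mx mul_row_block !mulmx1 mulmx0 add0r qf_diag.
  by rewrite 3!mxE eqxx /dotv.
have qSi (m : R) (y : 'rV[R]_n) : qf (invmx S) (row_mx m%:M y) = (d^-1 * m ^+ 2 + qf (invmx S') (y - m *: b))%R.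
  pose V : 'M[R]_(1 + n) := block_mx 1%:M (- b) 0 1%:M.
  have VL : (block_mx 1%:M 0 b^T 1%:M)^T *m V = 1%:M.
    rewrite tr_block_mx trmxK !trmx1 trmx0 mulmx_block !(mulmx0, mul0mx, mulmx1, mul1mx, addr0, add0r).
    by rewrite addNr -scalar_mx_block.
  have LV : block_mx 1%:M 0 b^T 1%:M *m V^T = 1%:M.
    by rewrite -[LHS]trmxK trmx_mul trmxK mulmx1C ?trmx1.
  have -> : invmx S = V *m block_mx d^-1%:M 0 0 (invmx S') *m V^T.
    have Su : S \in unitmx by rewrite unitmxE unitfE detS mulf_neq0 // gt_eqF.
    have E1 : S *m (V *m block_mx d^-1%:M 0 0 (invmx S') *m V^T) = 1%:M.
      rewrite {1}SE -!mulmxA (mulmxA _^T V) VL mul1mx (mulmxA (block_mx d%:M 0 0 S')) mulmx_block.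
      rewrite !(mulmx0, mul0mx, addr0, add0r) mulmxV // -scalar_mxM divff ?gt_eqF //.
      by rewrite -scalar_mx_block mul1mx LV.
    by rewrite -[LHS]mulmx1 -E1 mulKmx.
  rewrite qf_congr mul_row_block mulmx1 mulmx0 addr0 mulmxN mul_scalar_mx mulmx1 qf_diag.
  by rewrite [(- _ + _)%R]addrC; congr (_ * _ ^+ 2 + _)%R; rewrite mxE eqxx mulr1n.
have sq : (0 <= (Num.sqrt (\det S'))^-1)%R by rewrite invr_ge0 sqrtr_ge0.
have sqd : (0 <= (Num.sqrt d)^-1)%R by rewrite invr_ge0 sqrtr_ge0.
pose w (x : 'rV[int]_n) : R := expR (- (pi * qf S' (zrow x))).
have w0 x : (0 <= w x)%R by exact: expR_ge0.
have c0 (t : R) : (0 <= 1 + cos t)%R by have := cos_geN1 t; lra.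
have E0 (t : R) : 0 <= (expR t)%:E by rewrite lee_fin expR_ge0.
have E1 (t z : R) : 0 <= (expR t * (1 + cos z))%:E by rewrite lee_fin mulr_ge0 ?expR_ge0.
have E2 (t : R) : 0 <= ((Num.sqrt d)^-1 * expR t)%:E by rewrite lee_fin mulr_ge0 ?expR_ge0.
have E3 (t z : R) : 0 <= ((Num.sqrt d)^-1 * expR t * (1 + cos z))%:E by rewrite lee_fin !mulr_ge0 ?expR_ge0.
have thS : theta S = \esum_(x in [set: 'rV[int]_n]) ((w x)%:E *
    \esum_(m in [set: int]) (expR (- (pi * d * (m%:~R + dotv (zrow x) b) ^+ 2)))%:E).
  rewrite /theta (esum_bij _ (@row_mx_bij n)) -esum_pair; last by move=> p; rewrite lee_fin expR_ge0.
  rewrite esum_swap; last by move=> i j; rewrite lee_fin expR_ge0.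
  apply: eq_esum => x _; rewrite -esumZl //; apply: eq_esum => m _; rewrite -EFinM -expRD qS /=.
  by congr (expR _)%:E; ring.
have thF : theta S < +oo.
  rewrite thS; set B := \esum_(m in [set: int]) ((Num.sqrt d)^-1 * expR (- (pi / d * m%:~R ^+ 2)))%:E.
  have Bf : B < +oo.
    rewrite /B; under eq_esum do rewrite EFinM; rewrite esumZl // lte_mul_pinfty ?lee_fin //.
    have := @theta_shift_fin R d^-1 0; rewrite invr_gt0 => /(_ d0).
    by under eq_esum do rewrite addr0.
  have B0 : 0 <= B by apply: esum_ge0.
  apply: (@le_lt_trans _ _ (\esum_(x in [set: 'rV[int]_n]) (fine B * w x)%:E)).
    apply: le_esum => x _; rewrite [X in _ <= X]EFinM fineK ?ge0_fin_numE // muleC.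
    by apply: lee_wpmul2r; rewrite ?lee_fin //; exact: theta_shift_le.
  under eq_esum do rewrite EFinM; rewrite esumZl ?fine_ge0 // lte_mul_pinfty ?lee_fin ?fine_ge0 //.
split; [by rewrite detS mulr_gt0| exact: thF | move=> c].
pose g := lsubmx c 0%R 0%R; pose c' : 'rV[R]_n := rsubmx c.
have cE : c = row_mx g%:M c' by rewrite -mx11_scalar hsubmxK.
(* [theta_char_esum] has a dual sum on its left side too. Summed over [x] it contributes
   [Hh * theta S'], which is finite, is added to both sides here, and is found again on the right at
   the end. *)
pose Hh := \esum_(m in [set: int]) ((Num.sqrt d)^-1 * expR (- (pi / d * (m%:~R - g) ^+ 2)))%:E.
have Hf : Hh * theta S' \is a fin_num.
  apply: fin_numM; rewrite ge0_fin_numE ?esum_ge0 //.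
  rewrite /Hh; under eq_esum do rewrite EFinM; rewrite esumZl // lte_mul_pinfty ?lee_fin //.
  by have := @theta_shift_fin R d^-1 (- g); rewrite invr_gt0 => /(_ d0).
apply: (addeIr Hf).
have -> : \esum_(x in [set: 'rV[int]_(1 + n)]) (expR (- (pi * qf S (zrow x))) * (1 + cos (2 * pi * dotv c (zrow x))))%:E =
   \esum_(x in [set: 'rV[int]_n]) ((w x)%:E * \esum_(m in [set: int])
     (expR (- (pi * d * (m%:~R + dotv (zrow x) b) ^+ 2)) * (1 + cos (2 * pi * (g * m%:~R + dotv c' (zrow x)))))%:E).
  rewrite (esum_bij _ (@row_mx_bij n)) -esum_pair //.
  rewrite esum_swap //; apply: eq_esum => x _; rewrite -esumZl //; apply: eq_esum => m _.
  rewrite -EFinM mulrA -expRD qS /=; congr (expR _ * (1 + cos (_ * _)))%:E; first by ring.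
  rewrite /dotv cE /zrow map_row_mx tr_row_mx mul_row_col mxE; congr (_ + _)%R.
  by rewrite map_scalar_mx tr_scalar_mx -scalar_mxM mxE eqxx mulr1n.
have HhE : Hh * theta S' = \esum_(x in [set: 'rV[int]_n]) ((w x)%:E * Hh).
  have Hf' : Hh \is a fin_num.
    rewrite ge0_fin_numE ?esum_ge0 // /Hh; under eq_esum do rewrite EFinM; rewrite esumZl // lte_mul_pinfty ?lee_fin //.
    by have := @theta_shift_fin R d^-1 (- g); rewrite invr_gt0 => /(_ d0).
  rewrite -(fineK Hf') /theta -esumZl // ?fine_ge0 ?esum_ge0 //.
  by apply: eq_esum => x _; rewrite muleC.
rewrite HhE -esumD; [|by move=> x _; rewrite mule_ge0 ?esum_ge0 ?lee_fin..].
under eq_esum => x _ do rewrite -ge0_muleDr ?esum_ge0 // theta_char_esum // ge0_muleDr ?esum_ge0 //.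
rewrite esumD; [|by move=> x _; rewrite mule_ge0 ?esum_ge0 ?lee_fin..].
rewrite -thS -addeA; congr (_ + _).
transitivity (\esum_(m in [set: int]) (((Num.sqrt d)^-1 * expR (- (pi / d * (m%:~R - g) ^+ 2)))%:E *
   \esum_(x in [set: 'rV[int]_n]) (w x * (1 + cos (2 * pi * dotv ((m%:~R - g) *: b + c') (zrow x))))%:E)).
  transitivity (\esum_(x in [set: 'rV[int]_n]) \esum_(m in [set: int]) ((w x)%:E * ((Num.sqrt d)^-1 * expR (- (pi / d * (m%:~R - g) ^+ 2)) *
   (1 + cos (2 * pi * ((m%:~R - g) * dotv (zrow x) b + dotv c' (zrow x)))))%:E)).
    by apply: eq_esum => x _; rewrite -esumZl.
  rewrite esum_swap; last by move=> *; rewrite mule_ge0 ?lee_fin.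
  apply: eq_esum => m _; rewrite -esumZl ?mulr_ge0 ?expR_ge0 //; last by move=> x; rewrite lee_fin mulr_ge0.
  apply: eq_esum => x _; rewrite -!EFinM mulrCA; congr (_ * (_ * (1 + cos (_ * _))))%:E.
  by rewrite dotvDl dotvZl (dotvC b).
transitivity (\esum_(m in [set: int]) (((Num.sqrt d)^-1 * expR (- (pi / d * (m%:~R - g) ^+ 2)))%:E * theta S' +
   ((Num.sqrt d)^-1 * expR (- (pi / d * (m%:~R - g) ^+ 2)))%:E *
   \esum_(y in [set: 'rV[int]_n]) ((Num.sqrt (\det S'))^-1 * expR (- (pi * qf (invmx S') (zrow y - ((m%:~R - g) *: b + c')))))%:E)).
  apply: eq_esum => m _; rewrite -ge0_muleDr ?esum_ge0 //.
  by congr (_ * _); exact: H.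
rewrite esumD; last first.
- by move=> m _; rewrite mule_ge0 ?esum_ge0 // => y _; rewrite lee_fin mulr_ge0 ?expR_ge0.
- by move=> m _; rewrite mule_ge0 ?esum_ge0.
rewrite addeC; congr (_ + _).
  rewrite (esum_bij _ (@row_mx_bij n)) -esum_pair; last by move=> p; rewrite lee_fin mulr_ge0 ?expR_ge0 ?invr_ge0 ?sqrtr_ge0.
  apply: eq_esum => m _; rewrite -esumZl; last first.
  - by move=> y; rewrite lee_fin mulr_ge0 ?expR_ge0.
  - by rewrite mulr_ge0 ?expR_ge0.
  apply: eq_esum => y _; rewrite -EFinM mulrACA -invfM -sqrtrM ?(ltW d0) // -detS -expRD; congr (_ * expR _)%:E.
  have -> : (zrow (row_mx m%:M y) - c = row_mx (m%:~R - g)%:M (zrow y - c'))%R.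
    by rewrite cE /zrow map_row_mx opp_row_mx add_row_mx map_scalar_mx raddfB.
  rewrite qSi (_ : zrow y - ((m%:~R - g) *: b + c') = zrow y - c' - (m%:~R - g) *: b)%R; last first.
    by rewrite opprD addrA addrAC.
  by move: (pi : R) => p; ring.
rewrite -HhE -(fineK (_ : theta S' \is a fin_num)); last by rewrite ge0_fin_numE ?esum_ge0.
under eq_esum => m _ do rewrite muleC.
by rewrite esumZl ?fine_ge0 ?esum_ge0 // muleC.
Qed.

Lemma poisson_twisted n (S : 'M[R]_n) : posdef S -> poisson_at S.
Proof.
elim: n S => [|n IH] S pS.
  have q0 (D : 'M[R]_0) x : qf D x = 0%R by rewrite /qf [x]thinmx0 !mul0mx mxE.
  have d0 (c x : 'rV[R]_0) : dotv c x = 0%R by rewrite /dotv [c]thinmx0 !mul0mx mxE.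
  have T (f : 'rV[int]_0 -> \bar R) : (forall x, 0 <= f x) -> \esum_(x in [set: 'rV[int]_0]) f x = f 0%R.
    move=> f0; rewrite -(esum_set1 (t := 0%R)) //; congr esum; apply/seteqP; split=> x // _.
    by rewrite [x]thinmx0.
  split; first by rewrite det_mx00.
  - by rewrite /theta T ?ltry // => x; rewrite lee_fin expR_ge0.
  - move=> c; rewrite /theta !T; try by move=> x; rewrite lee_fin !q0 ?d0 ?mulr_ge0 ?expR_ge0 ?mulr0 ?cos0 ?invr_ge0 ?sqrtr_ge0.
    by rewrite !q0 d0 !mulr0 cos0 oppr0 expR0 det_mx00 sqrtr1 invr1 !mul1r EFinD.
exact: poisson_step.
Qed.

(** For the trivial character the left side of the twisted formula is twice [theta S], and one
    finite copy cancels. *)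
Theorem theta_functional n (S : 'M[R]_n) : posdef S ->
  [/\ (0 < \det S)%R, theta S < +oo & theta S = ((Num.sqrt (\det S))^-1)%:E * theta (invmx S)].
Proof.
move=> /poisson_twisted[D0 F H]; split=> //.
have Ff : theta S \is a fin_num by rewrite ge0_fin_numE // esum_ge0 // => x _; rewrite lee_fin expR_ge0.
apply: (addeIr Ff); have := H 0%R.
rewrite (_ : (\esum_(x in _) _ ) = theta S + theta S); last first.
  rewrite /theta -esumD; try by move=> x _; rewrite lee_fin expR_ge0.
  by apply: eq_esum => x _; rewrite -EFinD /dotv mul0mx mxE mulr0 cos0; congr EFin; ring.
move=> ->.
rewrite addeC.
congr (_ + theta S).
rewrite /theta -esumZl; [|by rewrite invr_ge0 sqrtr_ge0|by move=> x; rewrite lee_fin expR_ge0].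
by apply: eq_esum => x _; rewrite subr0.
Qed.

End QuadraticForms.

(** * Lattices and fractional ideals in a number field *)

Section Embeddings.
Variables (R : realType) (K : fieldExtType rat).
Local Notation C := R[i].
Local Notation n := (\dim {:K}).

Lemma primitive_generator : exists a : K, <<1; a>>%VS = {:K}%VS.
Proof.
exists (separable_generator 1%VS {:K}%AS); rewrite -eq_adjoin_separable_generator ?sub1v //.
apply/separableP => y _; apply: pcharf0_separable => p.
by rewrite pchar_lalg pchar_num.
Qed.

(* The embeddings of K into the complex numbers, indexed by the conjugates of a primitive element; the basis is a
   power basis, whose matrix of conjugates is a Vandermonde matrix. *)
Lemma embeddings_exist : exists (sg : 'I_n -> {rmorphism K -> C}) (e : 'I_n -> K) (cj : 'I_n -> 'I_n),
  [/\ \det (\matrix_(i, j) sg j (e i)) != 0,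
      forall x, exists v : 'I_n -> rat, x = \sum_i v i *: e i,
      involutive cj & forall j x, sg (cj j) x = (sg j x)^*].
Proof.
have [a aE] := primitive_generator.
have [p pE] : exists q, minPoly 1%VS a = map_poly (in_alg K) q by apply/polyOver1P; exact: minPolyOver.
have sp : size p = n.+1.
  rewrite -(size_map_poly (in_alg K)) -pE size_minPoly adjoin_degreeE aE /=.
  by rewrite dimv1 divn1.
have mp : p \is monic by rewrite -(map_monic (in_alg K)) -pE monic_minPoly.
have sepp : separable_poly p.
  rewrite -(separable_map (in_alg K)) -pE; apply: pcharf0_separable => q.
  by rewrite pchar_lalg pchar_num.
pose ev (q : {poly rat}) : K := (map_poly (in_alg K) q).[a].
have evp x : exists q : {poly rat}, (size q <= n)%N && (ev q == x).
  have /polyOver1P[q qE] := Fadjoin_polyOver 1%VS a x.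
  exists q; apply/andP; split.
    rewrite -(size_map_poly (in_alg K)) -qE (leq_trans (size_Fadjoin_poly _ _ _)) //.
    by rewrite -ltnS -size_minPoly pE size_map_poly sp.
  by rewrite /ev -qE Fadjoin_poly_eq // aE memvf.
pose qx x := xchoose (evp x).
have qs x : (size (qx x) <= n)%N by have /andP[] := xchooseP (evp x).
have qe x : ev (qx x) = x by apply/eqP; have /andP[] := xchooseP (evp x).
have [rs prs] := closed_field_poly_normal (map_poly (ratr : rat -> C) p).
have lc : lead_coef (map_poly (ratr : rat -> C) p) = 1 by rewrite lead_coef_map (monicP mp) rmorph1.
rewrite lc scale1r in prs.
have srs : size rs = n.
  by apply: succn_inj; rewrite -sp -(size_map_poly (ratr : {rmorphism rat -> C})) /= prs size_prod_XsubC.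
have urs : uniq rs by rewrite -separable_prod_XsubC -prs separable_map.
have evz z : z \in rs -> forall q1 q2, ev q1 = ev q2 -> (map_poly (ratr : rat -> C) q1).[z] = (map_poly ratr q2).[z].
  move=> zr q1 q2 E; apply/eqP; rewrite -subr_eq0 -hornerN -hornerD -rmorphB /=.
  have : p %| q1 - q2.
    rewrite -(dvdp_map (in_alg K)) -pE; apply: minPoly_dvdp.
      by apply/polyOver1P; exists (q1 - q2).
    by rewrite /root rmorphB hornerD hornerN subr_eq0; apply/eqP.
  rewrite -(dvdp_map (ratr : {rmorphism rat -> C})) /= prs => /dvdpP[w ->].
  by rewrite hornerM (_ : (\prod_(_ <- _) _).[z] = 0) ?mulr0 //; apply/eqP; rewrite -/(root _ z) root_prod_XsubC.
pose z (j : 'I_n) := rs`_j.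
have zr j : z j \in rs by rewrite mem_nth // srs.
pose f j x : C := (map_poly ratr (qx x)).[z j].
have fE j q : f j (ev q) = (map_poly (ratr : rat -> C) q).[z j] by apply: evz => //; rewrite qe.
have fB j : zmod_morphism (f j).
  by move=> x y; rewrite -{1}(qe x) -{1}(qe y) /ev -hornerN -hornerD -rmorphB fE rmorphB hornerD hornerN.
have fM j : monoid_morphism (f j).
  split=> [|x y].
    by rewrite -[1](_ : ev 1 = 1) ?fE /ev rmorph1 hornerC.
  by rewrite -{1}(qe x) -{1}(qe y) /ev -hornerM -rmorphM fE rmorphM hornerM.
pose sg j : {rmorphism K -> C} := HB.pack (f j) (GRing.isZmodMorphism.Build _ _ _ (fB j)) (GRing.isMonoidMorphism.Build _ _ _ (fM j)).
have sga j : sg j a = z j.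
  by rewrite -[a](_ : ev 'X = a); [rewrite /= fE map_polyX hornerX|rewrite /ev map_polyX hornerX].
have zi : injective z by move=> i j /eqP; rewrite nth_uniq ?srs // => /eqP /val_inj.
have cz j : exists k, z k == (z j)^*.
  have : (z j)^* \in rs.
    have E : map_poly (@conjc R) (map_poly (ratr : rat -> C) p) = map_poly ratr p.
      by rewrite -map_poly_comp; apply: eq_map_poly => q /=; rewrite fmorph_rat.
    by rewrite -root_prod_XsubC -prs -E complex_root_conj conjcK prs root_prod_XsubC.
  by move=> /(nthP 0)[k]; rewrite srs => kn <-; exists (Ordinal kn).
pose cj j := xchoose (cz j).
have cjE j : z (cj j) = (z j)^* by apply/eqP; exact: (xchooseP (cz j)).
exists sg, (fun i => a ^+ i), cj; split.
- rewrite (_ : \matrix_(i, j) _ = Vandermonde n (\row_j z j)); last first.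
    by apply/matrixP => i j; rewrite !mxE rmorphXn /= -[f j a]/(sg j a) sga.
  rewrite det_Vandermonde; apply/prodf_neq0 => i _; apply/prodf_neq0 => j ij.
  by rewrite !mxE subr_eq0; apply: contraTneq ij => /zi ->; rewrite ltnn.
- move=> x; exists (fun i => (qx x)`_i); rewrite -{1}(qe x) /ev.
  rewrite (@horner_coef_wide _ n) ?size_map_poly //.
  by apply: eq_bigr => i _; rewrite coef_map mulr_algl.
- by move=> j; apply: zi; rewrite !cjE conjcK.
- move=> j x; rewrite -(qe x) -[sg (cj j) _]/(f (cj j) _) -[sg j _]/(f j _) !fE cjE.
  rewrite -[RHS]horner_map /= -map_poly_comp; congr (_.[_]); apply: eq_map_poly => q /=.
  by rewrite fmorph_rat.
Qed.

End Embeddings.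

(** * Conjugates, bases and the trace *)

Section FieldTrace.
Variables (R : realType) (K : fieldExtType rat).
Local Notation C := R[i].
Local Notation n := (\dim {:K}).
Variable sg : 'I_n -> {rmorphism K -> C}.
Implicit Types (b : 'I_n -> K) (x y : K).
Local Notation ratC := (map_mx (ratr : rat -> C)).
Local Notation intQ := (map_mx (intr : int -> rat)).
Local Notation intC := (map_mx (intr : int -> C)).

Definition emb b : 'M[C]_n := \matrix_(i, j) sg j (b i).
Definition embv x : 'rV[C]_n := \row_j sg j x.
Definition lc b (v : 'rV[rat]_n) : K := \sum_i v 0 i *: b i.
Definition mxb (U : 'M[rat]_n) b i : K := lc b (row i U).
(** A nonzero determinant of conjugates stands for being a basis over the rationals; [lc_inj] and
    [basis_coord] recover uniqueness and existence of coordinates. *)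
Definition is_basis b := \det (emb b) != 0.
Local Notation basis := is_basis.

Lemma embM x y : embv (x * y) = embv x *m diag_mx (embv y).
Proof. by apply/rowP => j; rewrite mul_mx_diag !mxE rmorphM. Qed.

Lemma emb_inj : injective embv.
Proof.
have n0 : (0 < n)%N by rewrite adim_gt0.
by move=> x y /rowP /(_ (Ordinal n0)); rewrite !mxE => /fmorph_inj.
Qed.

Lemma embv_lc b v : embv (lc b v) = ratC v *m emb b.
Proof.
apply/rowP => j; rewrite !mxE rmorph_sum; apply: eq_bigr => i _.
by rewrite !mxE rmorphZ_num.
Qed.

Lemma emb_row b i : row i (emb b) = embv (b i).
Proof. by apply/rowP => j; rewrite !mxE. Qed.

Lemma emb_ext b b' : emb b = emb b' -> b =1 b'.
Proof. by move=> E i; apply: emb_inj; rewrite -!emb_row E. Qed.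

Lemma emb_mxb U b : emb (mxb U b) = ratC U *m emb b.
Proof. by apply/row_matrixP => i; rewrite emb_row embv_lc row_mul map_row. Qed.

Lemma emb_mulr b x : emb (fun i => b i * x) = emb b *m diag_mx (embv x).
Proof. by apply/row_matrixP => i; rewrite emb_row embM row_mul emb_row. Qed.

Lemma basis_unit b : basis b -> emb b \in unitmx.
Proof. by rewrite unitmxE unitfE. Qed.

Lemma lc_inj b : basis b -> injective (lc b).
Proof.
move=> /basis_unit bu v w /(congr1 embv); rewrite !embv_lc => /(congr1 (mulmx^~ (invmx (emb b)))).
by rewrite !mulmxK // => /map_mx_inj.
Qed.

Lemma lc_mxb U b v : lc (mxb U b) v = lc b (v *m U).
Proof.
rewrite /lc; under eq_bigr do rewrite scaler_sumr.
rewrite exchange_big; apply: eq_bigr => k _; rewrite mxE scaler_suml.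
by apply: eq_bigr => i _; rewrite scalerA mxE.
Qed.

Lemma lcD b v w : lc b (v + w) = lc b v + lc b w.
Proof. by rewrite /lc -big_split; apply: eq_bigr => i _; rewrite mxE scalerDl. Qed.

Lemma lcN b v : lc b (- v) = - lc b v.
Proof. by rewrite /lc -sumrN; apply: eq_bigr => i _; rewrite mxE scaleNr. Qed.

Lemma lcZ b q v : lc b (q *: v) = q *: lc b v.
Proof. by rewrite /lc scaler_sumr; apply: eq_bigr => i _; rewrite mxE scalerA. Qed.

Lemma lc_delta b i : lc b (delta_mx 0 i) = b i.
Proof.
rewrite /lc (bigD1 i) //= mxE !eqxx scale1r big1 ?addr0 // => j ji.
by rewrite mxE eqxx (negPf ji) scale0r.
Qed.

Lemma mxb_basis U b : basis b -> (\det U != 0) = basis (mxb U b).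
Proof. by rewrite /is_basis emb_mxb det_mulmx det_map_mx mulf_eq0 fmorph_eq0 negb_or => ->; rewrite andbT. Qed.

Variable e : 'I_n -> K.
Hypotheses (e_basis : basis e) (e_span : forall x, exists v : 'I_n -> rat, x = \sum_i v i *: e i).

Lemma basis_coord b x : basis b -> exists v, x = lc b v.
Proof.
have ex y : exists v : 'rV[rat]_n, y == lc e v.
  have [v vE] := e_span y; exists (\row_i v i); rewrite vE; apply/eqP.
  by apply: eq_bigr => i _; rewrite mxE.
pose U := \matrix_i xchoose (ex (b i)); move=> bb.
have bE : emb b = ratC U *m emb e.
  by apply/row_matrixP => i; rewrite row_mul -map_row rowK -embv_lc emb_row -(eqP (xchooseP (ex (b i)))).
have Uu : U \in unitmx.
  by move: bb; rewrite unitmxE unitfE /is_basis bE det_mulmx det_map_mx mulf_eq0 fmorph_eq0 negb_or => /andP[].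
have /eqP -> := xchooseP (ex x); set v := xchoose _.
exists (v *m invmx U); apply: emb_inj.
have Uu' : ratC U \in unitmx by rewrite map_unitmx.
by rewrite !embv_lc map_mxM map_invmx bE mulmxA (mulmxKV Uu').
Qed.

(** The matrix of conjugates of a basis diagonalises multiplication by [x], with the conjugates of
    [x] on the diagonal. *)
Lemma field_traceE x : ratr (field_trace x) = \sum_j sg j x.
Proof.
pose ve (i : 'I_n) := (vbasis {:K})`_i; set M := passmx.mxof (vbasis {:K}) (vbasis {:K}) (amulr x).
have veE v : lc ve v = passmx.vecof (vbasis {:K}) v by [].
have bve : basis_of {:K} (vbasis {:K}) by exact: vbasisP.
have sp y : y = lc ve (passmx.rVof (vbasis {:K}) y) by rewrite veE passmx.rVofK.
have vb : basis ve.
  pose U := \matrix_i passmx.rVof (vbasis {:K}) (e i).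
  have eE : emb e = ratC U *m emb ve.
    by apply/row_matrixP => i; rewrite row_mul -map_row rowK -embv_lc emb_row -sp.
  by move: e_basis; rewrite /is_basis eE det_mulmx mulf_eq0 negb_or => /andP[].
have ME : ratC M *m emb ve = emb ve *m diag_mx (embv x).
  apply/row_matrixP => i; rewrite row_mul -map_row -embv_lc row_mul emb_row -embM; congr embv.
  by rewrite rowE passmx.mul_mxof -sp lfunE /= -veE lc_delta.
have tE : ratr (\tr M) = \tr (ratC M) by rewrite trace_map_mx.
have vu := basis_unit vb.
rewrite /field_trace -/M tE -(mulmxK vu (ratC M)) ME mxtrace_mulC (mulKmx vu) mxtrace_diag.
by apply: eq_bigr => j _; rewrite mxE.
Qed.

End FieldTrace.

(** * Lattices, trace duality and covolume *)

Section Lattices.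
Variables (R : realType) (K : fieldExtType rat).
Local Notation C := R[i].
Local Notation n := (\dim {:K}).
Variables (sg : 'I_n -> {rmorphism K -> C}) (e : 'I_n -> K).
Hypotheses (e_basis : is_basis sg e) (e_span : forall x, exists v : 'I_n -> rat, x = \sum_i v i *: e i).
Implicit Types (b : 'I_n -> K) (x y : K) (L M : set K).
Local Notation ratC := (map_mx (ratr : rat -> C)).
Local Notation intQ := (map_mx (intr : int -> rat)).
Local Notation intC := (map_mx (intr : int -> C)).
Local Notation basis := (is_basis sg).
Local Notation emb := (emb sg).
Local Notation embv := (embv sg).
Local Notation tr := (@field_trace K).
Let coord b x : basis b -> exists v, x = lc b v. Proof. exact: basis_coord. Qed.

Lemma ratC_int m k (A : 'M[int]_(m, k)) : ratC (intQ A) = intC A.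
Proof. by apply/matrixP => i j; rewrite !mxE ratr_int. Qed.

Lemma ratr_inj : injective (ratr : rat -> C).
Proof. exact: fmorph_inj. Qed.

Lemma field_traceD x y : tr (x + y) = tr x + tr y.
Proof.
apply: ratr_inj; rewrite rmorphD /= !(field_traceE e_basis) -big_split /=.
by apply: eq_bigr => j _; rewrite rmorphD.
Qed.

Lemma field_traceZ q x : tr (q *: x) = q * tr x.
Proof.
apply: ratr_inj; rewrite rmorphM /= !(field_traceE e_basis) mulr_sumr.
by apply: eq_bigr => j _; rewrite rmorphZ_num.
Qed.

Lemma field_trace0 : tr 0 = 0.
Proof. by rewrite -[X in tr X](scale0r (0 : K)) field_traceZ mul0r. Qed.

Lemma field_trace_lc b v y : tr (lc b v * y) = \sum_i v 0 i * tr (b i * y).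
Proof.
apply: ratr_inj; rewrite (field_traceE e_basis) rmorph_sum /=.
under [RHS]eq_bigr do rewrite rmorphM /= (field_traceE e_basis) mulr_sumr.
rewrite exchange_big; apply: eq_bigr => j _ /=; rewrite rmorphM rmorph_sum mulr_suml.
by apply: eq_bigr => i _; rewrite rmorphZ_num rmorphM mulrA.
Qed.

Definition trmx_form b : 'M[rat]_n := \matrix_(i, j) tr (b i * b j).

Lemma trmx_formE b : ratC (trmx_form b) = emb b *m (emb b)^T.
Proof.
apply/matrixP => i j; rewrite !mxE (field_traceE e_basis).
by apply: eq_bigr => k _; rewrite !mxE rmorphM.
Qed.

(** The basis dual to [b] for the trace form. *)
Definition dualb b := mxb (invmx (trmx_form b)) b.

Lemma emb_dualbT b : basis b -> emb (dualb b) *m (emb b)^T = 1%:M.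
Proof.
move=> bb; have Tu : trmx_form b \in unitmx.
  rewrite unitmxE unitfE -(fmorph_eq0 (ratr : {rmorphism rat -> C})) -det_map_mx trmx_formE det_mulmx det_tr.
  by rewrite mulf_eq0 orbb.
by rewrite emb_mxb -mulmxA -trmx_formE -map_mxM (mulVmx Tu) map_mx1.
Qed.

Lemma dualb_basis b : basis b -> basis (dualb b).
Proof.
move=> /emb_dualbT /(congr1 determinant); rewrite det_mulmx det1 => E; apply: contra_eqN E => /eqP ->.
by rewrite mul0r eq_sym oner_neq0.
Qed.

Lemma dualbK b : basis b -> dualb (dualb b) =1 b.
Proof.
move=> bb; apply: (@emb_ext _ _ sg); have E1 := emb_dualbT (dualb_basis bb).
have E2 : emb b *m (emb (dualb b))^T = 1%:M by rewrite -[LHS]trmxK trmx_mul trmxK emb_dualbT // trmx1.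
by rewrite -[LHS]mul1mx -E2 -mulmxA (mulmx1C E1) mulmx1.
Qed.

Lemma tr_dualb b i j : basis b -> tr (dualb b i * b j) = (i == j)%:R.
Proof.
move=> bb; apply: ratr_inj; rewrite (field_traceE e_basis).
have /matrixP /(_ i j) : emb (dualb b) *m (emb b)^T = 1%:M.
  exact: emb_dualbT.
rewrite !mxE ratr_nat => <-; apply: eq_bigr => k _; rewrite !mxE rmorphM //.
Qed.

Lemma lc_dualb b x : basis b -> x = lc (dualb b) (\row_i tr (x * b i)).
Proof.
move=> bb; apply: (@emb_inj _ _ sg); rewrite embv_lc.
have -> : ratC (\row_i tr (x * b i)) = embv x *m (emb b)^T.
  apply/rowP => i; rewrite !mxE (field_traceE e_basis); apply: eq_bigr => k _.
  by rewrite !mxE rmorphM.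
by rewrite -mulmxA (mulmx1C (emb_dualbT bb)) mulmx1.
Qed.

Definition zcomb b (x : 'rV[int]_n) := lc b (intQ x).
Definition zspan b : set K := range (zcomb b).
(** This is 2^(r_2) times the Euclidean covolume. In this normalisation trace duality inverts
    covolumes, and that of the integers squares to |d_K|. *)
Definition covolb b : R := normc (\det (emb b)).

Lemma zspanP b y : zspan b y <-> exists2 v : 'rV[rat]_n, (forall i, v 0 i \is a Num.int) & y = lc b v.
Proof.
split=> [[x _ <-]|[v vi ->]].
  by exists (intQ x) => // i; rewrite mxE; apply/intrP; exists (x 0 i).
exists (\row_i Num.floor (v 0 i)) => //; congr lc; apply/rowP => i.
by rewrite !mxE; apply/eqP; rewrite -intrEfloor.
Qed.

Lemma zspan_gen b i : zspan b (b i).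
Proof.
apply/zspanP; exists (delta_mx 0 i); last by rewrite lc_delta.
by move=> j; rewrite mxE rpred_nat.
Qed.

Definition is_sub L := L 0 /\ forall x y, L x -> L y -> L (x - y).

Lemma subN L x : is_sub L -> L x -> L (- x).
Proof. by move=> [L0 LB] Lx; rewrite -sub0r; exact: LB. Qed.

Lemma subD L x y : is_sub L -> L x -> L y -> L (x + y).
Proof. by move=> Ls Lx Ly; rewrite -[y]opprK; apply: (proj2 Ls) => //; exact: subN. Qed.

Lemma subZ L x (m : int) : is_sub L -> L x -> L (m%:~R * x).
Proof.
move=> Ls Lx; have H (k : nat) : L (k%:R * x).
  by elim: k => [|k IH]; [rewrite mul0r; exact: (proj1 Ls)|rewrite -natr1 mulrDl mul1r; exact: subD].
by case: m => k; [exact: H|rewrite NegzE mulrNz mulNr; apply: subN => //; exact: H].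
Qed.

Lemma subS L (I : Type) (r : seq I) (P : pred I) (F : I -> K) : is_sub L -> (forall i, P i -> L (F i)) ->
  L (\sum_(i <- r | P i) F i).
Proof. by move=> Ls H; apply: (big_ind L) => //; [exact: (proj1 Ls)|move=> x y; exact: subD]. Qed.

Lemma sub_zcomb L b : is_sub L -> (forall i, L (b i)) -> zspan b `<=` L.
Proof.
move=> Ls Lb _ [x _ <-]; apply: subS => // i _.
by rewrite mxE -mulr_algl alg_num_field ratr_int; exact: subZ.
Qed.

Lemma zspan_sub b : is_sub (zspan b).
Proof.
split; first by apply/zspanP; exists 0; [move=> i; rewrite mxE rpred0|rewrite /lc big1 // => i _; rewrite mxE scale0r].
move=> x y /zspanP[v vi ->] /zspanP[w wi ->]; apply/zspanP; exists (v - w); last by rewrite lcD lcN.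
by move=> i; rewrite !mxE rpredB.
Qed.

Definition is_lat L := exists2 b, basis b & L = zspan b.
Definition latd L : set K := [set x | forall y, L y -> tr (x * y) \is a Num.int].

Lemma lat_sub L : is_lat L -> is_sub L.
Proof. by move=> [b _ ->]; exact: zspan_sub. Qed.

Lemma latd_zspan b : basis b -> latd (zspan b) = zspan (dualb b).
Proof.
move=> bb; apply/seteqP; split=> x H.
  apply/zspanP; exists (\row_i tr (x * b i)); last exact: lc_dualb.
  by move=> i; rewrite mxE; apply: H; exact: zspan_gen.
move: H => /zspanP[v vi ->] y /zspanP[w wi ->].
rewrite field_trace_lc rpred_sum // => i _; rewrite rpredM // mulrC field_trace_lc rpred_sum // => j _.
by rewrite rpredM // mulrC tr_dualb // rpred_nat.
Qed.

Lemma latd_lat L : is_lat L -> is_lat (latd L).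
Proof. by move=> [b bb ->]; exists (dualb b); [exact: dualb_basis|exact: latd_zspan]. Qed.

Lemma latdK L : is_lat L -> latd (latd L) = L.
Proof.
move=> [b bb ->]; rewrite !latd_zspan ?dualb_basis //; congr zspan.
by apply/funext; exact: dualbK.
Qed.

Lemma normc_int (m : int) : normc (m%:~R : C) = `|m|%N%:R.
Proof.
have -> : (m%:~R : C) = (m%:~R)%:C by rewrite rmorph_int.
by rewrite normcR -[X in X = _]intr_norm -abszE.
Qed.

Lemma zspan_incl b b' : zspan b' `<=` zspan b -> exists U : 'M[int]_n, emb b' = intC U *m emb b.
Proof.
move=> H; have ex i : exists x : 'rV[int]_n, zcomb b x == b' i by have [x _ E] := H _ (zspan_gen b' i); exists x; apply/eqP.
exists (\matrix_i xchoose (ex i)); apply/row_matrixP => i.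
by rewrite row_mul -map_row rowK -ratC_int -embv_lc emb_row; congr embv; apply/esym/eqP; exact: (xchooseP (ex i)).
Qed.

Lemma zspan_incl_of b b' (U : 'M[int]_n) : emb b' = intC U *m emb b -> zspan b' `<=` zspan b.
Proof.
move=> E; apply: sub_zcomb; first exact: zspan_sub.
move=> i; exists (row i U) => //; apply: (@emb_inj _ _ sg).
by rewrite embv_lc ratC_int -emb_row E row_mul map_row.
Qed.

Lemma covolb_gt0 b : basis b -> 0 < covolb b.
Proof. by rewrite /covolb normc_gt0. Qed.

(** [k] is the absolute determinant of the integer matrix between the bases, which is unimodular
    when k = 1. *)
Lemma covolb_incl b b' : basis b -> basis b' -> zspan b' `<=` zspan b ->
  exists k : nat, [/\ (0 < k)%N, covolb b' = k%:R * covolb b & k = 1%N -> zspan b `<=` zspan b'].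
Proof.
move=> bb bb' /zspan_incl[U UE]; exists `|\det U|%N.
have E : covolb b' = `|\det U|%N%:R * covolb b by rewrite /covolb UE det_mulmx normcM det_map_mx normc_int.
split=> //.
  rewrite lt0n; apply: contraTneq (covolb_gt0 bb') => k0.
  by rewrite E k0 mul0r ltxx.
move=> k1; have Uu : U \in unitmx.
  rewrite unitmxE -[_ \is a GRing.unit]/((\det U == 1) || (\det U == -1)); move: (\det U) k1 => d; lia.
apply: (@zspan_incl_of _ _ (invmx U)).
by rewrite UE mulmxA -map_mxM mulVmx // map_mx1 mul1mx.
Qed.

Lemma covolb_eq b b' : basis b -> basis b' -> zspan b' = zspan b -> covolb b' = covolb b.
Proof.
move=> bb bb' E; have [k [k0 Ek _]] := covolb_incl bb bb' ltac:(by rewrite E).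
have [l [l0 El _]] := covolb_incl bb' bb ltac:(by rewrite E).
apply/eqP; rewrite eq_le; apply/andP; split.
  by rewrite El ler_peMl ?ler1n // ltW // covolb_gt0.
by rewrite Ek ler_peMl ?ler1n // ltW // covolb_gt0.
Qed.

Definition covol L : R := xget 0 [set v | exists b, [/\ basis b, L = zspan b & v = covolb b]].

Lemma covolE b : basis b -> covol (zspan b) = covolb b.
Proof.
move=> bb; rewrite /covol; case: xgetP => [v _ [b' [bb' E ->]]|H]; first exact: covolb_eq.
by case: (H (covolb b)); exists b.
Qed.

Lemma covol_gt0 L : is_lat L -> 0 < covol L.
Proof. by move=> [b bb ->]; rewrite covolE // covolb_gt0. Qed.

Lemma covol_incl L L' : is_lat L -> is_lat L' -> L' `<=` L ->
  exists k : nat, [/\ (0 < k)%N, covol L' = k%:R * covol L & k = 1%N -> L = L'].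
Proof.
move=> [b bb ->] [b' bb' ->] H; have [k [k0 kE k1]] := covolb_incl bb bb' H.
by exists k; split=> //; [rewrite !covolE|move=> /k1 ?; apply/seteqP].
Qed.

Lemma covol_latd L : is_lat L -> covol (latd L) = (covol L)^-1.
Proof.
move=> [b bb ->]; rewrite latd_zspan // !covolE ?dualb_basis //.
have /(congr1 (fun A : 'M[C]_n => normc (\det A))) := emb_dualbT bb.
rewrite det_mulmx det_tr normcM det1 => E; apply: (mulIf (lt0r_neq0 (covolb_gt0 bb))).
by rewrite mulVf ?lt0r_neq0 ?covolb_gt0 // [LHS]E -[1]/((1 : R)%:C) normcR normr1.
Qed.

(* A tuple of elements of L with minimal covolume generates L: otherwise a vector with fractional coordinates in [0, 1)
   would give a smaller one. *)
Lemma sub_lattice L b v : is_sub L -> L `<=` zspan b -> basis b -> basis v -> (forall i, L (v i)) -> is_lat L.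
Proof.
move=> Ls Lb bb vb Lv.
pose P (k : nat) := `[< exists w, [/\ basis w, forall i, L (w i) & covolb w = k%:R * covolb b] >].
have Pw w : basis w -> (forall i, L (w i)) -> exists2 k, P k & covolb w = k%:R * covolb b.
  move=> bw Lw; have [k [_ kE _]] := covolb_incl bb bw (subset_trans (sub_zcomb Ls Lw) Lb).
  by exists k => //; apply/asboolP; exists w.
have exP : exists k, P k by have [k Pk _] := Pw v vb Lv; exists k.
case: (ex_minnP exP) => k /asboolP[w [bw Lw kE]] kmin; exists w => //.
apply/seteqP; split=> [y Ly|]; last exact: sub_zcomb.
have [q qE] := coord y bw.
pose f : 'rV[rat]_n := \row_i (q 0 i - (Num.floor (q 0 i))%:~R).
have Lf : L (lc w f).
  rewrite (_ : f = q - intQ (\row_i Num.floor (q 0 i))); last by apply/rowP => i; rewrite !mxE.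
  rewrite lcD lcN -qE; apply: (proj2 Ls) => //; apply: (sub_zcomb Ls Lw).
  by exists (\row_i Num.floor (q 0 i)).
have f0 i : f 0 i = 0.
  apply: contrapT => fi; pose w' j := if j == i then lc w f else w j.
  pose U : 'M[rat]_n := \matrix_j (if j == i then f else delta_mx 0 j).
  have w'E : w' =1 mxb U w.
    by move=> j; rewrite /w' /mxb rowK; case: ifP => // _; rewrite lc_delta.
  have dU : \det U = f 0 i.
    have cof j : cofactor U i j = (1%:M : 'M[rat]_n) j i.
      transitivity ((\adj (1%:M : 'M[rat]_n)) j i); last by rewrite -[\adj _]mul1mx mul_mx_adj det1.
      rewrite mxE /cofactor; congr (_ * \det _); apply/matrixP => a c; rewrite !mxE.
      by rewrite eq_sym (negPf (neq_lift _ _)) mxE eqxx /= eq_sym.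
    rewrite (expand_det_row _ i) (bigD1 i) //= big1 ?addr0; last first.
      by move=> j ji; rewrite cof [X in _ * X]mxE (negPf ji) mulr0.
    by rewrite cof [X in _ * X]mxE eqxx mulr1 mxE eqxx.
  have embE : emb w' = ratC U *m emb w by rewrite -emb_mxb; apply/matrixP => a c; rewrite !mxE w'E.
  have fE : 0 <= f 0 i < 1.
    by rewrite mxE subr_ge0 floor_le ltrBlDr addrC -[1]/(1%:~R) -intrD floorD1_gt.
  have fi0 : f 0 i != 0 by apply/eqP.
  have cw' : covolb w' = ratr (f 0 i) * covolb w.
    rewrite /covolb embE det_mulmx normcM det_map_mx dU; congr (_ * _); rewrite /=.
    rewrite (_ : ratr (f 0 i) = (ratr (f 0 i) : R)%:C); last by rewrite fmorph_rat.
    by rewrite normcR ger0_norm // ler0q; case/andP: fE.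
  have bw' : basis w'.
    by rewrite /is_basis -normc_gt0 -[normc _]/(covolb w') cw' mulr_gt0 ?covolb_gt0 // ltr0q lt_def fi0; case/andP: fE.
  have [l Pl lE] := Pw w' bw' (fun j => ltac:(rewrite /w'; case: ifP => // _; exact: Lw)).
  have := kmin l Pl; rewrite leqNgt => /negP; apply.
  have c0 := covolb_gt0 bb; rewrite -(ltr_nat R) -(ltr_pM2r c0) -lE -kE cw' gtr_pMl ?covolb_gt0 //.
  by rewrite -(rmorph1 (ratr : {rmorphism rat -> R})) /= ltr_rat; case/andP: fE.
rewrite qE; exists (\row_i Num.floor (q 0 i)) => //; congr lc; apply/rowP => i.
by rewrite !mxE; apply/esym/eqP; rewrite -subr_eq0; have := f0 i; rewrite mxE => ->.
Qed.

Lemma ratmx_denominator m k (U : 'M[rat]_(m, k)) :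
  exists2 N : nat, (0 < N)%N & forall i j, N%:R * U i j \is a Num.int.
Proof.
exists (\prod_i \prod_j `|denq (U i j)|)%N.
  by rewrite !prodn_gt0 // => i; rewrite prodn_gt0 // => j; rewrite absz_gt0 denq_eq0.
move=> i j; rewrite (bigD1 i) //= (bigD1 j) //= !natrM.
have dq : `|denq (U i j)|%N%:R * U i j \is a Num.int.
  by rewrite natr_absz gtr0_norm ?denq_gt0 // mulrC -numqE; apply/intrP; exists (numq (U i j)).
have E (x y z u : rat) : x * y * z * u = y * z * (x * u) by ring.
by rewrite E; apply: rpredM => //; apply: rpredM; exact: rpred_nat.
Qed.

Lemma lat_scale b b' : basis b -> basis b' ->
  exists2 N : nat, (0 < N)%N & forall x, zspan b' x -> zspan b (N%:R * x).
Proof.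
move=> bb bb'; have ex i : exists v : 'rV[rat]_n, b' i == lc b v by have [v ->] := coord (b' i) bb; exists v.
have [N N0 H] := ratmx_denominator (\matrix_i xchoose (ex i)); exists N => // x /zspanP[v vi ->].
rewrite mulr_natl -(scaler_nat N (lc b' v)) /lc scaler_sumr; apply: subS; first exact: zspan_sub.
move=> i _; rewrite scalerA mulrC -scalerA; have /intrP[m ->] := vi i.
rewrite -mulr_algl alg_num_field ratr_int; apply: subZ; first exact: zspan_sub.
apply/zspanP; exists (N%:R *: xchoose (ex i)).
  by move=> j; have := H i j; rewrite !mxE.
by rewrite lcZ -(eqP (xchooseP (ex i))).
Qed.

Local Notation OK := (ring_of_integers K).

Lemma OK1 : OK 1. Proof. exact: integral1. Qed.
Lemma OK0 : OK 0. Proof. exact: mxpoly.integral0. Qed.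
Lemma OKM x y : OK x -> OK y -> OK (x * y). Proof. exact: integral_mul. Qed.
Lemma OK_sub : is_sub OK. Proof. by split; [exact: OK0|move=> x y; exact: integral_sub]. Qed.

Lemma lat_basis_neq0 b : basis b -> (\row_i b i : 'rV[K]_n) != 0.
Proof.
apply: contra => /eqP /rowP b0; have n0 : (0 < n)%N by rewrite adim_gt0.
apply/det0P; exists (delta_mx 0 (Ordinal n0)).
  by apply/eqP => /rowP /(_ (Ordinal n0)) /eqP; rewrite !mxE !eqxx oner_eq0.
by apply/rowP => j; rewrite -rowE !mxE; have := b0 (Ordinal n0); rewrite !mxE => ->; rewrite rmorph0.
Qed.

(** Multiplication by [x] has an integer matrix [U] in a basis of [L], and [x] is a root of its
    characteristic polynomial. The transpose occurs because eigenvectors are rows. *)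
Lemma lat_stable_integral L x : is_lat L -> (forall y, L y -> L (x * y)) -> OK x.
Proof.
move=> [b bb ->] H; have ex i : exists v : 'rV[int]_n, zcomb b v == x * b i.
  by have [v _ E] := H _ (zspan_gen b i); exists v; apply/eqP.
pose U := \matrix_i xchoose (ex i); exists (char_poly U^T); first exact: char_poly_monic.
rewrite map_char_poly -eigenvalue_root_char; apply/eigenvalueP; exists (\row_i b i); last exact: lat_basis_neq0.
apply/rowP => i; rewrite !mxE -(eqP (xchooseP (ex i))) /zcomb /lc.
by apply: eq_bigr => k _; rewrite !mxE -mulr_algl alg_num_field ratr_int mulrC.
Qed.

(** A suitable multiple of [x] maps the lattice spanned by [e] into itself. *)
Lemma integral_scale x : exists2 N : nat, (0 < N)%N & OK (N%:R * x).
Proof.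
have [->|x0] := eqVneq x 0; first by exists 1%N; rewrite ?mulr0 //; exact: OK0.
have bx : basis (fun i => e i * x).
  rewrite /is_basis emb_mulr det_mulmx det_diag mulf_neq0 //; apply/prodf_neq0 => j _.
  by rewrite mxE fmorph_eq0.
have [N N0 H] := lat_scale e_basis bx; exists N => //.
apply: (@lat_stable_integral (zspan e)); first by exists e.
move=> y ey; rewrite -mulrA; apply: H; move: ey => /zspanP[v vi ->]; apply/zspanP; exists v => //.
by rewrite /lc mulr_sumr; apply: eq_bigr => i _; rewrite mulrC scalerAl.
Qed.

Lemma rat_integral (q : rat) : integralOver (intr : int -> rat) q -> q \is a Num.int.
Proof.
move=> [p mp rp]; have : (ratr q : algC) \is a Num.int.
  apply: Cint_rat_Aint; first exact: Crat_rat.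
  apply: (@root_monic_Aint (map_poly (intr : int -> algC) p)).
  - rewrite -[X in root X _](_ : map_poly ratr (map_poly intr p) = _); last first.
      by rewrite -map_poly_comp; apply: eq_map_poly => m /=; rewrite ratr_int.
    by rewrite (fmorph_root (ratr : {rmorphism rat -> algC})).
  - by rewrite monic_map.
  - by apply/polyOverP => i; rewrite coef_map /= intr_int.
move=> /intrP[m mE]; apply/intrP; exists m; apply: (fmorph_inj (ratr : {rmorphism rat -> algC})).
by rewrite /= mE ratr_int.
Qed.

Lemma trace_integral x : OK x -> tr x \is a Num.int.
Proof.
move=> Ox; apply: rat_integral.
have : integralOver (intr : int -> C) (ratr (tr x)).
  rewrite (field_traceE e_basis); apply: (big_ind (integralOver (intr : int -> C))).
  - exact: mxpoly.integral0.
  - by move=> y z; exact: integral_add.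
  - move=> j _; have [p mp rp] := Ox; exists p => //.
    rewrite -[X in root X _](_ : map_poly (sg j) (map_poly intr p) = _); last first.
      by rewrite -map_poly_comp; apply: eq_map_poly => m /=; rewrite rmorph_int.
    by rewrite fmorph_root.
move=> [p mp rp]; exists p => //; move: rp.
rewrite -[X in root X _](_ : map_poly ratr (map_poly intr p) = _); last first.
  by rewrite -map_poly_comp; apply: eq_map_poly => m /=; rewrite ratr_int.
by rewrite (fmorph_root (ratr : {rmorphism rat -> C})).
Qed.

Lemma basis_scale b x : basis b -> x != 0 -> basis (fun i => b i * x).
Proof.
move=> bb x0; rewrite /is_basis emb_mulr det_mulmx det_diag mulf_neq0 //; apply/prodf_neq0 => j _.
by rewrite mxE fmorph_eq0.
Qed.

Lemma natK_eq0 (N : nat) : (N%:R == 0 :> K) = (N == 0%N).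
Proof.
have /pcharf0P -> // : [pchar K] =i pred0.
by move=> p; rewrite pchar_lalg pchar_num.
Qed.

(** The integers contain the span of a basis made of integers and, traces of integers being
    integers, lie in the trace dual of that span; [sub_lattice] applies in between. *)
Lemma OK_lat : is_lat OK.
Proof.
have [N N0 H] : exists2 N : nat, (0 < N)%N & forall i, OK (e i * N%:R).
  have ex i : exists N : nat, (0 < N)%N && `[< OK (N%:R * e i) >].
    by have [N N0 NO] := integral_scale (e i); exists N; rewrite N0; apply/asboolP.
  exists (\prod_i xchoose (ex i))%N; first by rewrite prodn_gt0 // => i; case/andP: (xchooseP (ex i)).
  move=> i; rewrite (bigD1 i) //= natrM mulrA [_ * _%:R]mulrC mulrC.
  apply: OKM; last exact: mxpoly.integral_nat.
  by rewrite mulrC; have /andP[_ /asboolP] := xchooseP (ex i).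
have bN : basis (fun i => e i * N%:R) by apply: basis_scale => //; rewrite natK_eq0 -lt0n.
apply: (sub_lattice OK_sub _ (dualb_basis bN) bN H).
rewrite -latd_zspan // => x Ox y /(sub_zcomb OK_sub H) Oy.
by apply: trace_integral; exact: OKM.
Qed.

(** * Fractional ideals and their inverses *)

Definition frac M := is_lat M /\ forall a x, OK a -> M x -> M (a * x).
Definition pm M N : set K := [set x | exists2 s : seq (K * K), (forall p, p \in s -> M p.1 /\ N p.2) & x = \sum_(p <- s) p.1 * p.2].
Definition inv M : set K := [set x | forall y, M y -> OK (x * y)].

Lemma frac_lat M : frac M -> is_lat M. Proof. by case. Qed.
Lemma frac_sub M : frac M -> is_sub M. Proof. by move=> /frac_lat; exact: lat_sub. Qed.
Lemma OK_frac : frac OK. Proof. by split; [exact: OK_lat|move=> a x; exact: OKM]. Qed.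

Lemma pm_in M N x y : M x -> N y -> pm M N (x * y).
Proof. by move=> Mx Ny; exists [:: (x, y)]; rewrite ?big_seq1 // => p; rewrite inE => /eqP ->. Qed.

Lemma pm_least M N L : is_sub L -> (forall x y, M x -> N y -> L (x * y)) -> pm M N `<=` L.
Proof.
move=> Ls H _ [s sP ->]; rewrite big_seq; apply: subS => // p /sP[]; exact: H.
Qed.

Lemma pm_sub M N : is_sub M -> is_sub (pm M N).
Proof.
move=> Ms; split; first by exists [::]; rewrite ?big_nil.
move=> x y [s sP ->] [t tP ->]; exists (s ++ [seq (- p.1, p.2) | p <- t]).
  move=> p; rewrite mem_cat => /orP[/sP//|/mapP[q /tP[q1 q2] ->]] /=.
  by split=> //; exact: subN.
rewrite big_cat big_map /= -sumrN; congr (_ + _); apply: eq_bigr => p _; by rewrite mulNr.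
Qed.

Lemma pmC M N : is_sub M -> is_sub N -> pm M N = pm N M.
Proof.
by move=> Ms Ns; apply/seteqP; split; (apply: pm_least; first exact: pm_sub) => x y Mx Ny; rewrite mulrC; exact: pm_in.
Qed.

Lemma pm_mono M M' N N' : is_sub M' -> M `<=` M' -> N `<=` N' -> pm M N `<=` pm M' N'.
Proof.
by move=> Ms MM NN; apply: pm_least; [exact: pm_sub|move=> x y Mx Ny; apply: pm_in; [exact: MM|exact: NN]].
Qed.

Lemma pmA M N L : is_sub M -> is_sub N -> is_sub L -> pm M (pm N L) = pm (pm M N) L.
Proof.
move=> Ms Ns Ls; apply/seteqP; split.
  apply: pm_least; first by apply: pm_sub; exact: pm_sub.
  move=> x _ Mx [s sP ->]; rewrite mulr_sumr big_seq; apply: subS; first by apply: pm_sub; exact: pm_sub.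
  by move=> p /sP[p1 p2]; rewrite mulrA; apply: pm_in => //; exact: pm_in.
apply: pm_least; first exact: pm_sub.
move=> _ z [s sP ->] Lz; rewrite mulr_suml big_seq; apply: subS; first exact: pm_sub.
by move=> p /sP[p1 p2]; rewrite -mulrA; apply: pm_in => //; exact: pm_in.
Qed.

Lemma pm1 M : frac M -> pm OK M = M.
Proof.
move=> Mf; apply/seteqP; split; first by apply: pm_least; [exact: frac_sub|exact: (proj2 Mf)].
by move=> x Mx; rewrite -[x]mul1r; apply: pm_in => //; exact: OK1.
Qed.

Lemma zspan_scale b x : zspan (fun i => b i * x) = [set y * x | y in zspan b].
Proof.
have E v : lc (fun i => b i * x) v = lc b v * x.
  by rewrite /lc mulr_suml; apply: eq_bigr => i _; rewrite scalerAl.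
apply/seteqP; split=> [_ [v _ <-]|_ [_ [v _ <-] <-]]; last by exists v => //; rewrite /zcomb E.
by exists (zcomb b v); [exists v|rewrite /zcomb E].
Qed.

Lemma lat_neq0 L : is_lat L -> exists2 x, L x & x != 0.
Proof.
move=> [b bb ->]; apply: contrapT => H; have /negP := lat_basis_neq0 bb; apply.
apply/eqP/rowP => i; rewrite !mxE; apply/eqP; apply: contrapT => /negP bi; apply: H.
by exists (b i) => //; exact: zspan_gen.
Qed.

(** The product contains x N for a nonzero x of [M], and a common denominator [k] of the products
    b_i N puts it inside a multiple of the lattice spanned by [e]. *)
Lemma lat_pm M N : is_lat M -> is_lat N -> is_lat (pm M N).
Proof.
move=> Ml Nl; have Ms := lat_sub Ml; have Ns := lat_sub Nl; case: (Ml) => b bb ME; case: (Nl) => c bc NE.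
have [x Mx x0] := lat_neq0 Ml.
have ex i : exists k : nat, (0 < k)%N && `[< forall y, N y -> zspan e (k%:R * (b i * y)) >].
  have [->|bi0] := eqVneq (b i) 0.
    exists 1%N; apply/asboolP => y _; rewrite mul0r mulr0; exact: (proj1 (zspan_sub e)).
  have [k k0 H] := lat_scale e_basis (basis_scale bc bi0); exists k; rewrite k0; apply/asboolP => y Ny.
  by apply: H; rewrite zspan_scale (mulrC (b i)); exists y => //; rewrite -NE.
pose k := (\prod_i xchoose (ex i))%N.
have k0 : (0 < k)%N by rewrite prodn_gt0 // => i; case/andP: (xchooseP (ex i)).
have kK : (k%:R : K) != 0 by rewrite natK_eq0 -lt0n.
apply: (@sub_lattice _ (fun i => e i * k%:R^-1) (fun i => c i * x)).
- exact: pm_sub.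
- move=> y My; rewrite zspan_scale; exists (k%:R * y); last by rewrite mulrC mulKf.
  apply: (pm_least (L := [set y | zspan e (k%:R * y)]) _ _ My).
    split=> [|u v Hu Hv] /=; first by rewrite mulr0; exact: (proj1 (zspan_sub e)).
    by rewrite mulrBr; exact: (proj2 (zspan_sub e)).
  move=> u z; rewrite ME => -[w _ <-] Nz /=; rewrite /zcomb /lc mulr_suml mulr_sumr.
  apply: subS; first exact: zspan_sub.
  move=> i _; have /andP[_ /asboolP /(_ z Nz) Hz] := xchooseP (ex i).
  rewrite mxE -mulr_algl alg_num_field ratr_int /k (bigD1 i) //= natrM.
  set p := (\prod_(_ < _ | _) _)%N; set q := xchoose _.
  have -> : q%:R * p%:R * ((w 0 i)%:~R * b i * z) = (w 0 i)%:~R * ((p : int)%:~R * (q%:R * (b i * z))).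
    by rewrite -[(p : int)%:~R]/(p%:R); ring.
  by do 2 (apply: subZ; first exact: zspan_sub).
- by apply: basis_scale; rewrite // invr_eq0.
- exact: basis_scale.
- by move=> i; rewrite mulrC; apply: pm_in => //; rewrite NE; exact: zspan_gen.
Qed.

Lemma frac_pm M N : frac M -> frac N -> frac (pm M N).
Proof.
move=> [Ml Mf] [Nl Nf]; split; first exact: lat_pm.
move=> a _ Oa [s sP ->]; rewrite mulr_sumr big_seq; apply: subS; first by apply: pm_sub; exact: lat_sub.
by move=> p /sP[p1 p2]; rewrite mulrA; apply: pm_in => //; exact: Mf.
Qed.

Lemma frac_latd M : frac M -> frac (latd M).
Proof.
move=> [Ml Mf]; split; first exact: latd_lat.
by move=> a x Oa Mx y My; rewrite (mulrC a x) -mulrA; apply: Mx; exact: Mf.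
Qed.

(** Since the double dual of the integers is the integers, x M is integral exactly when x M pairs
    integrally with the dual of the integers. Inverses of fractional ideals are thereby lattices. *)
Lemma inv_latd M : inv M = latd (pm M (latd OK)).
Proof.
have tr_pm x : (forall y z, M y -> latd OK z -> tr (x * (y * z)) \is a Num.int) -> latd (pm M (latd OK)) x.
  move=> H _ [s sP ->]; rewrite mulr_sumr.
  elim: s sP => [|p s IH] sP; first by rewrite big_nil field_trace0 rpred0.
  rewrite big_cons field_traceD rpredD //; first by have [? ?] := sP p (mem_head _ _); exact: H.
  by apply: IH => q qs; apply: sP; rewrite inE qs orbT.
apply/seteqP; split=> x H.
  by apply: tr_pm => y z My Oz; rewrite mulrA mulrC; apply: Oz; exact: H.
move=> y My; rewrite -(latdK OK_lat) => z Oz; rewrite -mulrA; apply: H; exact: pm_in.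
Qed.

Lemma frac_inv M : frac M -> frac (inv M).
Proof. by move=> Mf; rewrite inv_latd; apply: frac_latd; apply: frac_pm => //; apply: frac_latd; exact: OK_frac. Qed.

Lemma pm_zspan M b y : is_sub M -> pm M (zspan b) y -> exists X : 'I_n -> K, (forall k, M (X k)) /\ y = \sum_k X k * b k.
Proof.
move=> Ms [s sP ->]; elim: s sP => [|p s IH] sP.
  by exists (fun=> 0); split=> [k|]; [exact: (proj1 Ms)|rewrite big_nil big1 // => k _; rewrite mul0r].
have [X [MX XE]] : exists X : 'I_n -> K, (forall k, M (X k)) /\ \sum_(p <- s) p.1 * p.2 = \sum_k X k * b k.
  by apply: IH => q qs; apply: sP; rewrite inE qs orbT.
have [Mp [v _ vE]] := sP p (mem_head _ _).
exists (fun k => (v 0 k)%:~R * p.1 + X k); split=> [k|]; first by apply: subD => //; exact: subZ.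
rewrite big_cons XE -vE /zcomb /lc mulr_sumr -big_split; apply: eq_bigr => k _ /=.
by rewrite mxE -mulr_algl alg_num_field ratr_int mulrDl mulrCA mulrA.
Qed.

Lemma det_congr1 (J : set K) m (A : 'M[K]_m) : is_sub J -> J `<=` OK -> (forall a x, OK a -> J x -> J (a * x)) ->
  (forall i j, J (A i j - (i == j)%:R)) -> J (\det A - 1).
Proof.
move=> Js JO Jf H; rewrite -(det1 K m) /determinant -sumrB; apply: subS => // s _; rewrite -mulrBr.
have Om1 : OK (-1) by apply: integral_opp; exact: OK1.
apply: (Jf); first by case: (perm.odd_perm s); rewrite ?expr1 ?expr0 //; exact: OK1.
pose Q (x y : K) := [/\ J (x - y), OK x & OK y].
have QP x y : Q x y -> J (x - y) by case.
apply: QP; apply: (big_ind2 Q).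
- by split; [rewrite subrr; exact: (proj1 Js)|exact: OK1|exact: OK1].
- move=> x x' y y' [xx Ox Ox'] [yy Oy Oy']; split; [|exact: OKM|exact: OKM].
  have -> : x * y - x' * y' = x * (y - y') + y' * (x - x') by ring.
  by apply: subD => //; exact: Jf.
- move=> i _; move: (perm.fun_of_perm s i) => j; rewrite [1%:M i j]mxE.
  have O1 : OK (i == j)%:R by exact: mxpoly.integral_nat.
  split=> //; rewrite -[A i j](subrK (i == j)%:R); apply: subD => //; [exact: OK_sub|exact: JO].
Qed.

(** The determinant trick: writing each b_i as a combination with coefficients X in [J] makes 1 - X
    singular, while its determinant is 1 modulo [J]. *)
Lemma nakayama J L : is_sub J -> J `<=` OK -> (forall a x, OK a -> J x -> J (a * x)) -> is_lat L -> pm J L = L -> J 1.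
Proof.
move=> Js JO Jf [b bb ->] E.
have ex i : exists X : 'rV[K]_n, `[< (forall k, J (X 0 k)) /\ b i = \sum_k X 0 k * b k >].
  have [X [JX XE]] : exists X : 'I_n -> K, (forall k, J (X k)) /\ b i = \sum_k X k * b k.
    by apply: pm_zspan => //; rewrite E; exact: zspan_gen.
  by exists (\row_k X k); apply/asboolP; split=> [k|]; [rewrite mxE|rewrite {1}XE; apply: eq_bigr => k _; rewrite mxE].
pose X := \matrix_i xchoose (ex i).
have XJ i k : J (X i k) by rewrite mxE; have /asboolP[] := xchooseP (ex i).
have Xb i : b i = \sum_k X i k * b k.
  have /asboolP[_ {1}->] := xchooseP (ex i); by apply: eq_bigr => k _; rewrite mxE.
have d0 : \det (1%:M - X^T) = 0.
  apply/eqP/det0P; exists (\row_i b i); first exact: lat_basis_neq0.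
  apply/rowP => i; rewrite mulmxBr mulmx1 !mxE {1}Xb -sumrB big1 // => k _.
  by rewrite !mxE [b k * _]mulrC subrr.
have := @det_congr1 J n (1%:M - X^T) Js JO Jf; rewrite d0 sub0r => H.
rewrite -[1]opprK; apply: subN => //; apply: H => i j.
by rewrite mxE [1%:M i j]mxE [(- X^T) i j]mxE [X^T i j]mxE addrAC subrr add0r; apply: subN.
Qed.

(** No factorisation into primes is used. For J = M inv(M), an element that carries [J] into the
    integers stabilises the lattice inv(M), hence is integral; so inv(J) is the ring. Dualising, J
    times the dual of the integers is that dual, and [nakayama] puts 1 in [J]. *)
Lemma inv_mul M : frac M -> pm M (inv M) = OK.
Proof.
move=> Mf; have If := frac_inv Mf; have Jf := frac_pm Mf If; set J := pm M (inv M) in Jf *.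
have JO : J `<=` OK by apply: pm_least; [exact: OK_sub|move=> x y Mx Iy; rewrite mulrC; exact: Iy].
have invJ : inv J = OK.
  apply/seteqP; split=> x; last by move=> Ox y /JO; exact: OKM.
  move=> H; apply: (lat_stable_integral (frac_lat If)) => z Iz y My.
  by rewrite -mulrA [z * y]mulrC; apply: H; exact: pm_in.
have JD : pm J (latd OK) = latd OK.
  rewrite -[LHS]latdK; last by apply: lat_pm; [exact: frac_lat|apply: latd_lat; exact: OK_lat].
  by rewrite -inv_latd invJ.
have J1 : J 1 by apply: (nakayama (frac_sub Jf) JO (proj2 Jf) _ JD); apply: latd_lat; exact: OK_lat.
by apply/seteqP; split=> // x Ox; rewrite -[x]mulr1; exact: (proj2 Jf).
Qed.

Lemma invK M : frac M -> inv (inv M) = M.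
Proof.
move=> Mf; apply/seteqP; split=> x; last by move=> Mx y Iy; rewrite mulrC; exact: Iy.
move=> H; have : pm M (inv M) 1 by rewrite inv_mul //; exact: OK1.
move=> [s sP E]; rewrite -[x]mulr1 E mulr_sumr big_seq; apply: subS; first exact: frac_sub.
move=> p /sP[p1 p2]; rewrite mulrCA mulrC; apply: (proj2 Mf) => //; exact: H.
Qed.

Lemma inv_has1 I : inv I 1 <-> I `<=` OK.
Proof. by split=> H x Ix; [rewrite -[x]mul1r|rewrite mul1r]; exact: H. Qed.

Lemma ideal_frac I : is_ideal I -> I <> [set 0] -> frac I.
Proof.
move=> [IO I0 ID IM] In0; have Om1 : OK (-1) by apply: integral_opp; exact: OK1.
have Is : is_sub I.
  by split=> // x y Ix Iy; apply: ID => //; rewrite -mulN1r; exact: IM.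
split=> //; have [x Ix x0] : exists2 x, I x & x != 0.
  apply: contrapT => H; apply: In0; apply/seteqP; split=> [x Ix|_ ->] //=.
  by apply: contrapT => x0; apply: H; exists x => //; exact/eqP.
have [b bb OE] := OK_lat.
apply: (@sub_lattice _ b (fun i => b i * x)) => //; first by rewrite -OE.
  exact: basis_scale.
by move=> i; apply: IM => //; rewrite OE; exact: zspan_gen.
Qed.

Lemma frac_ideal I : frac I -> I `<=` OK -> is_ideal I /\ I <> [set 0].
Proof.
move=> If IO; have Is := frac_sub If; split.
  by split=> //; [exact: (proj1 Is)|move=> x y; exact: subD|exact: (proj2 If)].
by move=> E; have [x] := lat_neq0 (frac_lat If); rewrite E => ->; rewrite eqxx.
Qed.

(** * Indices and multiplicativity of the norm *)

Definition cosets L L' : set (set K) := [set [set x + y | y in L'] | x in L].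

Lemma zspan_unimodular b (U : 'M[int]_n) : U \in unitmx -> zspan (mxb (intQ U) b) = zspan b.
Proof.
move=> Uu; apply/seteqP; split=> [_ [x _ <-]|_ [x _ <-]].
  by exists (x *m U) => //; rewrite /zcomb lc_mxb map_mxM.
by exists (x *m invmx U) => //; rewrite /zcomb lc_mxb -map_mxM mulmxKV.
Qed.

Lemma coset_eq L x y : is_sub L -> L (x - y) -> [set x + z | z in L] = [set y + z | z in L].
Proof.
move=> Ls Lxy; apply/seteqP; split=> _ [z Lz <-].
  by exists (x - y + z); [exact: subD|ring].
by exists (- (x - y) + z); [apply: subD => //; exact: subN|ring].
Qed.

Lemma coset_eqP L x y : is_sub L -> [set x + z | z in L] = [set y + z | z in L] -> L (x - y).
Proof.
move=> Ls E; have : [set y + z | z in L] x by rewrite -E; exists 0; [exact: (proj1 Ls)|rewrite addr0].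
by move=> [z Lz <-]; rewrite addrAC subrr add0r.
Qed.

(* Smith normal form provides bases b of L and (d_i b_i) of L', so that L / L' is the product of the Z / d_i Z. *)
Lemma cosets_card L L' : is_lat L -> is_lat L' -> L' `<=` L ->
  finite_set (cosets L L') /\ #|` fset_set (cosets L L')|%:R * covol L = covol L'.
Proof.
move=> [b bb LE] [b' bb' LE'] LL; have [U UE] : exists U : 'M[int]_n, emb b' = intC U *m emb b.
  by apply: zspan_incl; rewrite -LE -LE'.
have [P Pu [Q Qu [d _ UD]]] := int_Smith_normal_form U.
set D : 'M[int]_n := (X in _ = _ *m X *m _) in UD.
pose c := mxb (intQ Q) b.
have bc : basis c by rewrite /c -(mxb_basis _ bb) det_map_mx intr_eq0; apply: contraTneq Qu => q0; rewrite unitmxE q0.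
have LEc : L = zspan c by rewrite zspan_unimodular.
have b'E : b' =1 mxb (intQ P) (mxb (intQ D) c).
  apply: (@emb_ext _ _ sg); rewrite UE UD !emb_mxb !ratC_int !map_mxM !mulmxA //.
have LEc' : L' = zspan (mxb (intQ D) c) by rewrite LE' (funext b'E) zspan_unimodular.
have DE : D = diag_mx (\row_i d`_i) by apply/matrixP => i j; rewrite !mxE.
pose c' := mxb (intQ D) c.
have dn (i : 'I_n) : d`_i != 0.
  apply/eqP => di; move: bb'; rewrite /is_basis UE UD !map_mxM !det_mulmx DE.
  rewrite map_diag_mx det_diag (bigD1 i) //= !mxE di rmorph0 mul0r mulr0 mul0r.
  by rewrite mul0r eqxx.
pose dd (i : 'I_n) : nat := absz (d`_i).
have dd0 i : (0 < dd i)%N by rewrite absz_gt0.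
have memL' (w : 'rV[int]_n) : L' (lc c (intQ w)) <-> forall i : 'I_n, (d`_i %| w 0%R i)%Z.
  have lcq (q : 'rV[int]_n) : lc c' (intQ q) = lc c (intQ (\row_i (q 0 i * d`_i))).
    by rewrite lc_mxb -map_mxM DE mul_mx_diag; congr lc; apply/rowP => i; rewrite !mxE.
  rewrite LEc'; split=> [[q _]|H].
    rewrite -/c' /zcomb lcq => /(lc_inj bc) /rowP E i; have /intr_inj <- : (q 0 i * d`_i)%:~R = (w 0 i)%:~R :> rat.
      by have := E i; rewrite !mxE.
    exact: dvdz_mull.
  exists (\row_i (w 0%R i %/ d`_i)%Z) => //; rewrite -/c' /zcomb lcq; congr lc; apply/rowP => i.
  by rewrite !mxE divzK.
pose FT := {dffun forall i : 'I_n, 'I_(dd i)}.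
pose rep (f : FT) : 'rV[int]_n := \row_i (f i : nat)%:Z.
pose g (f : FT) := [set lc c (intQ (rep f)) + y | y in L'].
have L's : is_sub L' by rewrite LE'; exact: zspan_sub.
have lcB v w : lc c (intQ v) - lc c (intQ w) = lc c (intQ (v - w)).
  by rewrite -lcN -lcD -map_mxN -map_mxD.
have g_inj : injective g.
  move=> f f' /(coset_eqP L's); rewrite lcB => /memL' H; apply/ffunP => i; apply/val_inj.
  have := H i; rewrite !mxE => /dvdzP[q qE].
  have h1 : (f i < dd i)%N by []; have h2 : (f' i < dd i)%N by [].
  have key (a a' : nat) (di k : int) : (a < `|di|)%N -> (a' < `|di|)%N -> a%:Z - a'%:Z = k * di -> a = a'.
    move=> k1 k2 kE; have [k0|k0] := eqVneq k 0; first by move: kE; rewrite k0 mul0r; lia.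
    by nia.
  exact: (key _ _ _ _ h1 h2 qE).
have cE : cosets L L' = g @` [set: FT].
  apply/seteqP; split=> [_ [x Lx <-]|_ [f _ <-]]; last first.
    by exists (lc c (intQ (rep f))) => //; rewrite LEc; exists (rep f).
  move: Lx; rewrite LEc => -[w _ <-].
  have md i : (`|(w 0%R i %% d`_i)%Z| < dd i)%N by have := ltz_mod (w 0 i) (dn i); have := modz_ge0 (w 0 i) (dn i); rewrite /dd; lia.
  pose f : FT := [ffun i => Ordinal (md i)]; exists f => //; apply: coset_eq => //.
  rewrite /zcomb lcB; apply/memL' => i; rewrite !mxE ffunE /= abszE ger0_norm ?modz_ge0 //.
  apply/dvdzP; exists (- (w 0%R i %/ d`_i)%Z).
  by rewrite {2}(divz_eq (w 0 i) d`_i); ring.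
have fin : finite_set (cosets L L') by rewrite cE; apply: finite_image; exact: finite_finset.
split=> //; have -> : #|` fset_set (cosets L L')| = (\prod_i dd i)%N.
  rewrite cE fset_set_image; last exact: finite_finset.
  rewrite card_imfset //= (_ : fset_set [set: FT] = [fset x in enum FT]%fset); last first.
    by apply/fsetP => f; rewrite in_fset_set ?in_setT; [rewrite !inE mem_enum|exact: finite_finset].
  rewrite -[size _]/(#|` _|) card_fseq undup_id ?enum_uniq // -cardE card_dep_ffun.
  by rewrite foldrE big_map big_enum /=; apply: eq_bigr => i _; rewrite card_ord.
rewrite LE' LEc !covolE // /covolb UE UD.
have -> : intC (P *m D *m Q) *m emb b = intC P *m (intC D *m emb c).
  by rewrite /c emb_mxb ratC_int !map_mxM !mulmxA.
rewrite det_mulmx normcM det_map_mx normc_int (_ : `|\det P|%N = 1%N) ?mul1r; last first.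
  by move: Pu; rewrite unitmxE -[_ \is a GRing.unit]/((\det P == 1) || (\det P == -1)); move: (\det P) => p; lia.
rewrite det_mulmx normcM DE map_diag_mx det_diag (_ : \prod_i _ = (\prod_(i < n) d`_i : int)%:~R); last first.
  by rewrite rmorph_prod; apply: eq_bigr => i _; rewrite !mxE.
rewrite normc_int; congr (_%:R * _).
by rewrite (big_morph absz abszM (erefl : absz 1 = 1%N)).
Qed.

(** Multiplication by [x] induces a surjection from L / L' onto M / M'; the inequality compares the
    two cardinals. *)
Lemma cosets_surj L L' M M' x : is_lat L -> is_lat L' -> is_lat M -> is_lat M' -> L' `<=` L -> M' `<=` M ->
  (forall z, L' z -> M' (x * z)) -> (forall y, M y -> exists2 z, L z & M' (y - x * z)) ->
  covol M' * covol L <= covol L' * covol M.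
Proof.
move=> Ll L'l Ml M'l LL MM xL H.
have [fL <-] := cosets_card Ll L'l LL; have [fM <-] := cosets_card Ml M'l MM.
rewrite mulrAC [leRHS]mulrAC -!mulrA [covol M * _]mulrC.
apply: ler_wpM2r; first by rewrite mulr_ge0 // ltW // covol_gt0.
rewrite ler_nat; have M's := lat_sub M'l; have L's := lat_sub L'l.
pose F (A : set K) : set K := [set y | exists a m, [/\ A a, M' m & y = x * a + m]].
have sub : cosets M M' `<=` F @` cosets L L'.
  move=> _ [y My <-]; have [z Lz Mz] := H y My; exists [set z + w | w in L']; first by exists z.
  rewrite (coset_eq M's Mz); apply/seteqP; split=> u.
    move=> [_ [m [[w Lw <-] Mm ->]]]; exists (x * w + m); first by apply: subD => //; exact: xL.
    by rewrite mulrDr addrA.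
  by move=> [m Mm <-]; exists z, m; split=> //; exists 0; [exact: (proj1 L's)|rewrite addr0].
apply: (@leq_trans #|` fset_set (F @` cosets L L')|).
  apply: fsubset_leq_card; rewrite -fset_set_sub //; first exact: finite_image.
by rewrite fset_set_image //; apply: leq_imfset_card.
Qed.

Definition maxid p := [/\ frac p, p `<=` OK, p <> OK & forall J, frac J -> p `<=` J -> J `<=` OK -> J = p \/ J = OK].

(** Among the proper ideals above [I], one of least index is maximal; an ideal between it and the
    ring has no larger index, hence the same. *)
Lemma maxid_exists I : frac I -> I `<=` OK -> I <> OK -> exists2 p, maxid p & I `<=` p.
Proof.
move=> If IO In; pose P (k : nat) := `[< exists J, [/\ frac J, I `<=` J, J `<=` OK, J <> OK & covol J = k%:R * covol OK] >].
have PJ J : frac J -> I `<=` J -> J `<=` OK -> J <> OK -> exists2 k, P k & covol J = k%:R * covol OK.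
  move=> Jf IJ JO Jn; have [k [_ kE _]] := covol_incl OK_lat (frac_lat Jf) JO.
  by exists k => //; apply/asboolP; exists J.
have exP : exists k, P k by have [k Pk _] := PJ I If (fun x => id) IO In; exists k.
case: (ex_minnP exP) => k /asboolP[p [pf Ip pO pn pE]] kmin; exists p => //; split=> // J Jf pJ JO.
have [->|Jn] := pselect (J = OK); [by right|left].
have [l Pl lE] := PJ J Jf (subset_trans Ip pJ) JO Jn.
have [m [m0 mE m1]] := covol_incl (frac_lat Jf) (frac_lat pf) pJ.
apply: m1; apply/eqP; rewrite eqn_leq m0 andbT -(ler_nat R).
have c0 := covol_gt0 OK_lat; have := kmin l Pl; rewrite -(ler_nat R) -(ler_pM2r c0) -lE -pE mE.
by rewrite -[leRHS]mul1r ler_pM2r // covol_gt0 //; exact: frac_lat.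
Qed.

Lemma pmCA P Q M : frac P -> frac Q -> frac M -> pm P (pm Q M) = pm Q (pm P M).
Proof.
by move=> /frac_sub Ps /frac_sub Qs /frac_sub Ms; rewrite !pmA // (pmC Ps).
Qed.

Lemma pm_integral P M : frac P -> frac M -> P `<=` OK -> pm P M `<=` M.
Proof.
by move=> Pf Mf PO; apply: pm_least; [exact: frac_sub|move=> x y /PO; exact: (proj2 Mf)].
Qed.

(** P / p P is a line over the residue field. With [x] in [P] outside p P, the module S generated by
    [x] and p P gives inv(P) S between [p] and the ring; it is not [p], since [x] would then lie in
    p P. *)
Lemma maxid_cyclic p P : maxid p -> frac P ->
  exists2 x, P x & forall u, P u -> exists a w, [/\ OK a, pm p P w & u = x * a + w].
Proof.
move=> [pf pO pn pmax] Pf; have ppf := frac_pm pf Pf; have pPs := frac_sub ppf.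
have pP := pm_integral pf Pf pO.
have [x Px nx] : exists2 x, P x & ~ pm p P x.
  apply: contrapT => H; apply: pn; have E : pm p P = P.
    by apply/seteqP; split=> // x Px; apply: contrapT => nx; apply: H; exists x.
  have := congr1 (pm (inv P)) E; rewrite pmCA // ?(pmC (frac_sub (frac_inv Pf))) ?inv_mul //; try exact: frac_sub.
    by rewrite pmC ?pm1 //; [exact: frac_sub|exact: lat_sub OK_lat].
  exact: frac_inv.
exists x => //; pose S := [set u | exists a w, [/\ OK a, pm p P w & u = x * a + w]].
have SP : S `<=` P.
  by move=> _ [a [w [Oa /pP Pw ->]]]; apply: subD => //; [exact: frac_sub|rewrite mulrC; exact: (proj2 Pf)].
have pS : pm p P `<=` S by move=> w pw; exists 0, w; rewrite mulr0 add0r; split=> //; exact: OK0.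
have Ss : is_sub S.
  split; first by apply: pS; exact: (proj1 pPs).
  move=> _ _ [a [w [Oa pw ->]]] [a' [w' [Oa' pw' ->]]]; exists (a - a'), (w - w'); split; [exact: (proj2 OK_sub)|exact: (proj2 pPs)|ring].
have Sf : frac S.
  split; last first.
    by move=> b _ Ob [a [w [Oa pw ->]]]; exists (b * a), (b * w); split; [exact: OKM|exact: (proj2 ppf)|ring].
  have [c bc cE] := frac_lat Pf; have [v bv vE] := frac_lat ppf.
  by apply: (sub_lattice Ss _ bc bv) => [|i]; [rewrite -cE|apply: pS; rewrite vE; exact: zspan_gen].
have If := frac_inv Pf; have Af := frac_pm If Sf.
have S_of : pm P (pm (inv P) S) = S.
  by rewrite pmA ?inv_mul ?pm1 //; exact: frac_sub.
have pA : p `<=` pm (inv P) S.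
  have {1}<- : pm (inv P) (pm p P) = p.
    rewrite pmCA // (pmC (frac_sub If)) ?inv_mul // ?(pmC (frac_sub pf)) ?pm1 //; [exact: lat_sub OK_lat|exact: frac_sub].
  by apply: pm_mono => //; exact: frac_sub.
have AO : pm (inv P) S `<=` OK.
  by apply: pm_least; [exact: OK_sub|move=> y z Iy /SP; exact: Iy].
case: (pmax _ Af pA AO) => E.
  case: nx; rewrite (pmC (frac_sub pf) (frac_sub Pf)) -E S_of; exists 1, 0; rewrite mulr1 addr0.
  by split=> //; [exact: OK1|exact: (proj1 pPs)].
by move=> u Pu; have : S u by rewrite -S_of E pmC ?pm1 //; [exact: frac_sub|exact: lat_sub OK_lat].
Qed.

(** A generator of [P] modulo p P maps Q / p Q onto P Q / p P Q. *)
Lemma covol_maxid_le p P Q : maxid p -> frac P -> frac Q ->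
  covol (pm p (pm P Q)) * covol Q <= covol (pm p Q) * covol (pm P Q).
Proof.
move=> pm_ Pf Qf; have [x Px xH] := maxid_cyclic pm_ Pf; have [pf pO _ _] := pm_.
have PQf := frac_pm Pf Qf; have pPQf := frac_pm pf PQf; have pPQs := frac_sub pPQf.
apply: (@cosets_surj _ _ _ _ x); try exact: frac_lat.
- by apply: frac_lat; exact: frac_pm.
- exact: pm_integral.
- exact: pm_integral.
- by move=> z pz; rewrite pmCA //; exact: pm_in.
- have Qs := frac_sub Qf; apply: pm_least.
    split; first by exists 0; [exact: (proj1 Qs)|rewrite mulr0 subrr; exact: (proj1 pPQs)].
    move=> y y' [z Qz H] [z' Qz' H']; exists (z - z'); first exact: (proj2 Qs).
    by rewrite (_ : _ - _ = (y - x * z) - (y' - x * z')); [exact: (proj2 pPQs)|ring].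
  move=> u v Pu Qv; have [a [w [Oa pw ->]]] := xH u Pu; exists (a * v); first exact: (proj2 Qf).
  rewrite (_ : _ - _ = w * v); last by ring.
  by rewrite pmA; [exact: pm_in|exact: frac_sub..].
Qed.

(** [covol_maxid_le] for [P] and the ring gives one inequality, and for inv(P) and [P] the opposite
    one. *)
Lemma covol_maxid p P : maxid p -> frac P -> covol (pm p P) * covol OK = covol p * covol P.
Proof.
move=> pm_ Pf; have [pf _ _ _] := pm_; have Os := OK_sub; have ps := frac_sub pf; have Ps := frac_sub Pf.
have If := frac_inv Pf; have Is := frac_sub If.
apply/eqP; rewrite eq_le; apply/andP; split.
  by have := covol_maxid_le pm_ Pf OK_frac; rewrite (pmC Ps Os) pm1 // (pmC ps Os) pm1.
by have := covol_maxid_le pm_ If Pf; rewrite (pmC Is Ps) inv_mul // (pmC ps Os) pm1.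
Qed.

(** Induction on the index [k] of [I]: a maximal ideal p above [I] splits off as I = p (inv(p) I),
    and the second factor is an integral ideal of smaller index. *)
Lemma covol_pm I P : frac I -> I `<=` OK -> frac P -> covol (pm I P) * covol OK = covol I * covol P.
Proof.
move=> If IO; have [k [_ kE _]] := covol_incl OK_lat (frac_lat If) IO.
have [m] := ubnP k; elim: m k I P If IO kE => // m IH k I P If IO kE km Pf.
have [->|In] := pselect (I = OK); first by rewrite pm1 // mulrC.
have [p pm_ Ip] := maxid_exists If IO In; have [pf pO pn _] := pm_.
have ipf := frac_inv pf; have I'f := frac_pm ipf If.
have pI' : pm p (pm (inv p) I) = I by rewrite pmA ?inv_mul ?pm1 //; exact: frac_sub.
have I'O : pm (inv p) I `<=` OK.
  by apply: pm_least; [exact: OK_sub|move=> y z Iy /Ip; exact: Iy].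
have [k' [_ k'E _]] := covol_incl OK_lat (frac_lat I'f) I'O.
have [r [r0 rE r1]] := covol_incl OK_lat (frac_lat pf) pO.
have c0 := covol_gt0 OK_lat; have cn := lt0r_neq0 c0.
have covI Q : frac Q -> covol (pm p Q) = r%:R * covol Q.
  by move=> Qf; apply: (mulIf cn); rewrite covol_maxid // rE; ring.
have kk' : (k' < m)%N.
  have kE' : k = (r * k')%N.
    apply/eqP; rewrite -(eqr_nat R) natrM; apply/eqP; apply: (mulIf cn).
    by rewrite -kE -{1}pI' covI // k'E mulrA.
  have r2 : (1 < r)%N by rewrite ltn_neqAle r0 andbT eq_sym; apply/eqP => /r1 E; apply: pn.
  have k'0 : (0 < k')%N.
    by rewrite lt0n; apply: contraTneq (covol_gt0 (frac_lat I'f)) => k0; rewrite k'E k0 mul0r ltxx.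
  by rewrite -ltnS (leq_trans _ km) // ltnS kE' ltn_Pmull.
have E := IH k' _ P I'f I'O k'E kk' Pf.
rewrite -pI' -pmA ?covI //; try exact: frac_sub.
  by rewrite -mulrA E mulrA.
exact: frac_pm.
Qed.

Lemma covol_scale M x : x != 0 -> is_lat M -> covol [set y * x | y in M] = normc (\prod_j sg j x) * covol M.
Proof.
move=> x0 [b bb ->]; rewrite -zspan_scale !covolE //; last exact: basis_scale.
rewrite /covolb emb_mulr det_mulmx det_diag normcM mulrC; congr (normc _ * _).
by apply: eq_bigr => j _; rewrite mxE.
Qed.

Lemma frac_scale M x : x != 0 -> frac M -> frac [set y * x | y in M].
Proof.
move=> x0 [[b bb ME] Mf]; split.
  by rewrite ME -zspan_scale; exists (fun i => b i * x) => //; exact: basis_scale.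
by move=> a _ Oa [y My <-]; exists (a * y); [exact: Mf|rewrite mulrA].
Qed.

(** Clearing denominators by [N] makes [M] integral, so that [covol_pm] applies; the norm of [N]
    then cancels. *)
Lemma covol_inv M : frac M -> covol M * covol (inv M) = covol OK ^+ 2.
Proof.
move=> Mf; have [b bb ME] := frac_lat Mf; have [c bc OE] := OK_lat.
have [N N0 H] := lat_scale bc bb; have x0 : (N%:R : K) != 0 by rewrite natK_eq0 -lt0n.
pose I := [set y * N%:R | y in M]; have If : frac I by exact: frac_scale.
have IO : I `<=` OK by move=> _ [y My <-]; rewrite mulrC OE; apply: H; rewrite -ME.
have := covol_pm If IO (frac_inv Mf).
have -> : pm I (inv M) = [set y * N%:R | y in OK].
  rewrite -(inv_mul Mf); apply/seteqP; split.
    apply: pm_least; first by apply: lat_sub; apply: frac_lat; apply: frac_scale => //; apply: frac_pm => //; exact: frac_inv.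
    by move=> _ z [y My <-] Iz; exists (y * z); [exact: pm_in|ring].
  move=> _ [_ [s sP ->] <-]; exists [seq (p.1 * N%:R, p.2) | p <- s].
    by move=> _ /mapP[p /sP[p1 p2] ->] /=; split=> //; exists p.1.
  by rewrite big_map mulr_suml; apply: eq_bigr => p _ /=; ring.
rewrite !covol_scale //; [|exact: frac_lat|exact: OK_lat] => E.
have n0 : normc (\prod_j sg j (N%:R : K)) != 0.
  by rewrite normc_eq0; apply/prodf_neq0 => j _; rewrite fmorph_eq0.
by apply: (mulfI n0); rewrite mulrA -E expr2 mulrA.
Qed.

Lemma ideal_norm_covol I : frac I -> I `<=` OK -> (ideal_norm I)%:R * covol (inv I) = covol OK.
Proof.
move=> If IO; have [_ NE] := cosets_card OK_lat (frac_lat If) IO.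
have c0 := covol_gt0 OK_lat; apply: (mulIf (lt0r_neq0 c0)).
by rewrite -expr2 -(covol_inv If) -NE /ideal_norm -/(cosets OK I); ring.
Qed.

Lemma latd_scale M x : x != 0 -> latd [set y * x | y in M] = [set y * x^-1 | y in latd M].
Proof.
move=> x0; apply/seteqP; split=> [z Hz|_ [z Hz <-] _ [y My <-]].
  exists (z * x); last by rewrite mulfK.
  by move=> y My; rewrite -mulrA [x * y]mulrC; apply: Hz; exists y.
by rewrite mulrACA mulrC [x^-1 * x]mulVf // mul1r; exact: Hz.
Qed.

Lemma K_countable : countable [set: K].
Proof.
have ex y : exists v : 'rV[rat]_n, y == lc e v by have [v ->] := coord y e_basis; exists v.
apply/countable_injP; pose f y := xchoose (ex y); exists (fun y => choice.pickle (f y)) => x y _ _ /(pcan_inj choice.pickleK) E.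
by rewrite (eqP (xchooseP (ex x))) (eqP (xchooseP (ex y))) -/(f x) E.
Qed.

Lemma frac_countable : countable [set M | frac M].
Proof.
have ex M : exists b : 'I_n -> 'rV[rat]_n, frac M -> M = zspan (fun i => lc e (b i)).
  have [[[b bb ME] _]|nf] := pselect (frac M); last by exists (fun=> 0).
  have ex i : exists v : 'rV[rat]_n, b i == lc e v by have [v ->] := coord (b i) e_basis; exists v.
  exists (fun i => xchoose (ex i)) => _; rewrite ME; congr zspan; apply/funext => i; exact/eqP/(xchooseP (ex i)).
have [g gE] := choice ex.
pose h M : 'M[rat]_n := \matrix_i g M i.
apply/countable_injP; exists (fun M => choice.pickle (h M)) => M M'; rewrite !inE => Mf M'f /(pcan_inj choice.pickleK) E.
rewrite (gE M Mf) (gE M' M'f); congr zspan; apply/funext => i; congr lc.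
by have := congr1 (row i) E; rewrite !rowK.
Qed.

Lemma discriminant_covol : `|ratr (discriminant K) : R| = covol OK ^+ 2.
Proof.
have dE (b : n.-tuple K) : integral_basis b ->
    `|ratr (\det (\matrix_(i, j) tr (tnth b i * tnth b j))) : R| = covol OK ^+ 2.
  move=> [bb bO]; pose c i := tnth b i.
  have cE : OK = zspan c.
    apply/seteqP; split=> x.
      move=> /bO[a ->]; exists (\row_i a i) => //; apply: eq_bigr => i _.
      by rewrite !mxE -mulr_algl alg_num_field ratr_int mulrzl /c (tnth_nth 0).
    move=> [v _ <-]; apply/bO; exists [ffun i => v 0 i]; apply: eq_bigr => i _.
    by rewrite ffunE !mxE -mulr_algl alg_num_field ratr_int mulrzl /c (tnth_nth 0).
  have cb : basis c.
    pose U := \matrix_i passmx.rVof b (e i).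
    have eE : emb e = ratC U *m emb c.
      apply/row_matrixP => i; rewrite row_mul -map_row rowK -embv_lc emb_row; congr embv.
      rewrite -[LHS](passmx.rVofK bb); apply: eq_bigr => k _; by rewrite /c (tnth_nth 0).
    by move: e_basis; rewrite /is_basis eE det_mulmx mulf_eq0 negb_or => /andP[].
  rewrite cE covolE // /covolb -[\matrix_(i, j) _]/(trmx_form c) -[LHS]normcR.
  rewrite -[_%:C]/(real_complex R (ratr _)) fmorph_rat -det_map_mx trmx_formE det_mulmx det_tr normcM expr2 //.
rewrite /discriminant; case: xgetP => [d _ [b ib ->]|H]; first exact: dE.
(* The remaining case would be the default value of [discriminant]; it is excluded by exhibiting an
   integral basis. *)
have [c bc cE] := OK_lat; pose b := [tuple c i | i < n].
have ib : integral_basis b.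
  split.
    rewrite basisEfree subvf size_tuple leqnn !andbT.
    apply/freeP => k k0 i.
    have : lc c (\row_i k i) = lc c 0.
      rewrite /lc; under [RHS]eq_bigr do rewrite mxE scale0r; rewrite big1_eq -[RHS]k0.
      by apply: eq_bigr => j _; rewrite mxE -tnth_nth tnth_mktuple.
    by move=> /(lc_inj bc) /rowP /(_ i); rewrite !mxE.
  move=> x; rewrite cE; split=> [[v _ <-]|[a ->]].
    exists [ffun i => v 0 i]; apply: eq_bigr => i _.
    by rewrite ffunE !mxE -mulr_algl alg_num_field ratr_int mulrzl -tnth_nth tnth_mktuple.
  exists (\row_i a i) => //; apply: eq_bigr => i _.
  by rewrite !mxE -mulr_algl alg_num_field ratr_int mulrzl -tnth_nth tnth_mktuple.
by case: (H (\det (\matrix_(i, j) tr (tnth b i * tnth b j)))); exists b.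
Qed.

Variable cj : 'I_n -> 'I_n.
Hypotheses (cjK : involutive cj) (cjE : forall j x, sg (cj j) x = (sg j x)^*).

(** * Theta series of lattices and their functional equation *)

Section GramMatrix.
Implicit Type w : 'I_n -> R.
Local Notation conjM := (map_mx (@conjc R)).
Local Notation RC := (map_mx (real_complex R)).
Let diagw w : 'M[C]_n := diag_mx (\row_j (w j)%:C).

Definition wnorm w x : R := \sum_j w j * normc (sg j x) ^+ 2.
Let gramf w x y : C := \sum_j (w j)%:C * sg j x * (sg j y)^*.
(** Taking real parts yields a real matrix and loses nothing when conjugate embeddings carry equal
    weights, because the sum is then real. *)
Definition gram b w : 'M[R]_n := \matrix_(i, k) Re (gramf w (b i) (b k)).

Lemma mulC_conj (z : C) : z * z^* = (normc z ^+ 2)%:C.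
Proof.
case: z => a c; rewrite /= sqr_sqrtr ?addr_ge0 ?sqr_ge0 //.
by apply: complex_ext => /=; ring.
Qed.

Let conj3 (a : R) (z u : C) : (a%:C * z * u^*)^* = a%:C * z^* * u^*^*.
Proof. by case: z => p q; case: u => p' q'; apply: complex_ext => /=; ring. Qed.

Let conj3' (a : R) (z u : C) : (a%:C * z * u^*)^* = a%:C * z^* * u.
Proof. by case: z => p q; case: u => p' q'; apply: complex_ext => /=; ring. Qed.

Let gramf_conj w x y : (gramf w x y)^* = gramf w y x.
Proof.
rewrite /gramf rmorph_sum; apply: eq_bigr => j _; rewrite [LHS]conj3'; ring.
Qed.

Let gramf_real w x y : (forall j, w (cj j) = w j) -> (gramf w x y)^* = gramf w x y.
Proof.
move=> wc; rewrite /gramf rmorph_sum [RHS](reindex_inj (inv_inj cjK)); apply: eq_bigr => j _.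
by rewrite [LHS]conj3 !cjE wc.
Qed.

Lemma gramC b w : (forall j, w (cj j) = w j) -> RC (gram b w) = emb b *m diagw w *m (conjM (emb b))^T.
Proof.
move=> wc; apply/matrixP => i k; rewrite mxE [gram b w i k]mxE.
have -> : (emb b *m diagw w *m (conjM (emb b))^T) i k = gramf w (b i) (b k).
  by rewrite mxE; apply: eq_bigr => j _; rewrite mul_mx_diag !mxE; ring.
have := gramf_real (b i) (b k) wc; case: (gramf _ _ _) => a c /= [] H.
by apply: complex_ext => //=; lra.
Qed.

Lemma gram_sym b w : (forall j, w (cj j) = w j) -> (gram b w)^T = gram b w.
Proof.
by move=> wc; apply/matrixP => i k; rewrite !mxE -gramf_conj gramf_real.
Qed.

Lemma gramC' b w : (forall j, w (cj j) = w j) -> RC (gram b w) = conjM (emb b) *m diagw w *m (emb b)^T.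
Proof.
move=> wc; rewrite -[LHS](_ : RC (gram b w)^T = _); last by rewrite gram_sym.
by rewrite -map_trmx gramC // !trmx_mul trmxK tr_diag_mx mulmxA.
Qed.

Let conjMM m k l (A : 'M[C]_(m, k)) (B : 'M[C]_(k, l)) : conjM (A *m B) = conjM A *m conjM B.
Proof. exact: map_mxM. Qed.

Lemma gram_form b w (v : 'rV[R]_n) : (forall j, w (cj j) = w j) ->
  qf (gram b w) v = \sum_j w j * normc ((RC v *m emb b) 0 j) ^+ 2.
Proof.
move=> wc; apply: (fmorph_inj (real_complex R)).
transitivity ((RC v *m RC (gram b w) *m (RC v)^T) 0 0).
  by rewrite map_trmx -!map_mxM [RHS]mxE.
have vr : conjM (RC v) = RC v.
  by apply/matrixP => i k; rewrite !mxE; apply: complex_ext; rewrite /= ?oppr0.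
rewrite gramC // (_ : _ *m _ *m _ = (RC v *m emb b) *m diagw w *m (conjM (RC v *m emb b))^T); last first.
  by rewrite conjMM vr trmx_mul !mulmxA.
rewrite mxE rmorph_sum; apply: eq_bigr => j _; rewrite mul_mx_diag.
set y := RC v *m emb b; rewrite mxE [(\row_j _) _ _]mxE [(conjM y)^T _ _]mxE [conjM y _ _]mxE mulrAC mulC_conj.
by rewrite mulrC -[LHS]rmorphM.
Qed.

Lemma gram_posdef b w : basis b -> (forall j, 0 < w j) -> (forall j, w (cj j) = w j) -> posdef (gram b w).
Proof.
move=> bb w0 wc; split; first exact: gram_sym.
move=> v v0; rewrite gram_form //; set y := RC v *m emb b.
have [j yj] : exists j, y 0 j != 0.
  apply: contrapT => H; move/eqP: v0; apply; have y0 : y = 0.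
    by apply/rowP => j; rewrite [RHS]mxE; apply/eqP; apply: contrapT => /negP yj; apply: H; exists j.
  have := mulmxK (basis_unit bb) (RC v); rewrite -/y y0 mul0mx => /esym E.
  by apply/rowP => i; have /rowP /(_ i) := E; rewrite !mxE => -[].
rewrite (bigD1 j) //= ltr_pwDl //; first by rewrite mulr_gt0 // exprn_gt0 // normc_gt0.
by apply: sumr_ge0 => k _; rewrite mulr_ge0 ?sqr_ge0 // ltW.
Qed.

Lemma gram_det b w : (forall j, w (cj j) = w j) -> \det (gram b w) = covolb b ^+ 2 * \prod_j w j.
Proof.
move=> wc; apply: (fmorph_inj (real_complex R)); rewrite -det_map_mx gramC // !det_mulmx det_tr.
have -> : \det (conjM (emb b)) = (\det (emb b))^* by exact: det_map_mx.
rewrite det_diag mulrAC mulC_conj -/(covolb b) (_ : \prod_i _ = real_complex R (\prod_j w j)) -?rmorphM //.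
by rewrite rmorph_prod; apply: eq_bigr => j _; rewrite mxE.
Qed.

(** With E and E' the matrices of conjugates of [b] and its dual, the two Gram matrices are conj(E)
    W E^T and E' W^-1 conj(E')^T. As E^T E' = 1, their product collapses. *)
Lemma gram_inv b w : basis b -> (forall j, 0 < w j) -> (forall j, w (cj j) = w j) ->
  invmx (gram b w) = gram (dualb b) (fun j => (w j)^-1).
Proof.
move=> bb w0 wc; have E := emb_dualbT bb.
have M1 : gram b w *m gram (dualb b) (fun j => (w j)^-1) = 1%:M.
  apply: (@map_mx_inj _ _ (real_complex R)); rewrite map_mxM gramC' // gramC; last by move=> j; rewrite wc.
  rewrite -!mulmxA (mulmxA (emb b)^T) (mulmx1C E) mul1mx (mulmxA (diagw w)).
  have -> : diagw w *m diagw (fun j => (w j)^-1) = 1%:M.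
    apply/matrixP => i k; rewrite mul_diag_mx !mxE; case: eqP => [->|_]; last by rewrite !mulr0n mulr0.
    by rewrite !mulr1n -rmorphM mulfV ?gt_eqF.
  rewrite mul1mx map_trmx -conjMM.
  have -> : emb b *m (emb (dualb b))^T = 1%:M by rewrite -[LHS]trmxK trmx_mul trmxK E trmx1.
  rewrite (_ : map_mx _ _ = 1%:M) ?map_mx1 //; exact: (map_mx1 (@conjc R)).
have Su : gram b w \in unitmx by case/mulmx1_unit: M1.
by rewrite -[LHS]mulmx1 -M1 mulKmx.
Qed.

Definition lattice_theta L w : \bar R := (\esum_(x in L) (expR (- (pi * wnorm w x)))%:E)%E.

Lemma gram_theta b w : basis b -> (forall j, w (cj j) = w j) -> theta (gram b w) = lattice_theta (zspan b) w.
Proof.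
move=> bb wc; rewrite /lattice_theta /zspan esum_image; last first.
  by move=> x y _ _ /(lc_inj bb) /matrixP E; apply/matrixP => i k; have := E i k; rewrite !mxE => /intr_inj.
apply: eq_esum => x _; rewrite gram_form //; congr (expR (- (_ * _)))%:E.
apply: eq_bigr => j _; congr (_ * normc _ ^+ 2).
have H := embv_lc sg b (intQ x); rewrite ratC_int in H.
have E : RC (zrow x) = intC x by apply/matrixP => i k; rewrite !mxE /= rmorph_int.
by rewrite E -H mxE.
Qed.

Lemma lattice_theta_functional L w : is_lat L -> (forall j, 0 < w j) -> (forall j, w (cj j) = w j) ->
  (lattice_theta L w < +oo)%E /\
  lattice_theta L w = (((covol L * Num.sqrt (\prod_j w j))^-1)%R%:E * lattice_theta (latd L) (fun j => (w j)^-1)%R)%E.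
Proof.
move=> [b bb ->] w0 wc; have [_ F E] := theta_functional (gram_posdef bb w0 wc).
rewrite -gram_theta // latd_zspan // -gram_theta ?dualb_basis //; last by move=> j; rewrite wc.
split; first exact: F.
rewrite E (gram_inv bb w0 wc) (covolE bb) (gram_det b wc).
have c0 : 0 <= covolb b by rewrite ltW // covolb_gt0.
by rewrite (sqrtrM _ (sqr_ge0 _)) sqrtr_sqr (ger0_norm c0).
Qed.

End GramMatrix.

End Lattices.

Section EsumSwap.
Context {R : realType}.

Lemma esum_swapD (T1 T2 : choiceType) (D1 : set T1) (D2 : set T2) (a : T1 -> T2 -> \bar R) : (forall i j, (0 <= a i j)%E) ->
  (\esum_(i in D1) \esum_(j in D2) a i j = \esum_(j in D2) \esum_(i in D1) a i j)%E.
Proof.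
move=> a0; rewrite !esum_esum //.
apply: (reindex_esum (D2 `*`` fun=> D1) (D1 `*`` fun=> D2) (fun p => (p.2, p.1)) (fun k => a k.1 k.2)).
split=> [[i j] [Di Dj]|[i j] [k l] _ _ [-> ->]|[i j] [Di Dj]] //.
by exists (j, i).
Qed.

End EsumSwap.

(** * Product measures and measure-preserving maps *)

Section ProductSigmaFinite.
Local Open Scope ereal_scope.
Context {R : realType} d1 d2 (T1 : measurableType d1) (T2 : measurableType d2).
Variables (m1 : {sigma_finite_measure set T1 -> \bar R}) (m2 : {sigma_finite_measure set T2 -> \bar R}).

(** A name for the product measure that carries the sigma-finite structure used when products are
    iterated. *)
Definition prodm : set (T1 * T2)%type -> \bar R := m1 \x m2.
HB.instance Definition _ := Measure.on prodm.

Let prodm_sigma_finite : sigma_finite setT prodm.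
Proof.
have [F TF Foo] := sigma_finiteT m1; have [G TG Goo] := sigma_finiteT m2.
exists (fun k => if choice.unpickle k is Some (i, j) then F i `*` G j else set0).
  apply/seteqP; split=> // -[y z] _.
  have [i _ Fi] : (\bigcup_i F i) y by rewrite -TF.
  have [j _ Gj] : (\bigcup_i G i) z by rewrite -TG.
  by exists (choice.pickle (i, j)) => //; rewrite choice.pickleK.
move=> k; case: (choice.unpickle k) => [[i j]|]; last by split=> //; rewrite measure0.
have [mF oF] := Foo i; have [mG oG] := Goo j; split; first exact: measurableX.
by rewrite /prodm product_measure1E // lte_mul_pinfty // ge0_fin_numE.
Qed.

HB.instance Definition _ := Measure_isSigmaFinite.Build _ _ _ prodm prodm_sigma_finite.

Lemma prodm_integral (f : T1 * T2 -> \bar R) : measurable_fun setT f -> (forall p, 0 <= f p) ->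
  \int[prodm]_p f p = \int[m1]_y \int[m2]_z f (y, z).
Proof. by move=> mf f0; rewrite /prodm fubini_tonelli1. Qed.

End ProductSigmaFinite.

Section CountingNat.
Context {R : realType}.

Definition countm : set nat -> \bar R := counting.
HB.instance Definition _ := Measure.on countm.
HB.instance Definition _ := Measure_isSigmaFinite.Build _ _ _ countm (sigma_finite_counting R).

End CountingNat.

Section Preserving.
Local Open Scope ereal_scope.
Context {R : realType}.

(** Stated through integrals of nonnegative functions, the form in which changes of variables are
    made and which Tonelli's theorem carries to products. *)
Definition preserving d (T : measurableType d) (m : set T -> \bar R) (phi : T -> T) := measurable_fun setT phi /\
  forall f : T -> \bar R, measurable_fun setT f -> (forall t, 0 <= f t) -> \int[m]_t f (phi t) = \int[m]_t f t.

Lemma preserving_prod d1 d2 (T1 : measurableType d1) (T2 : measurableType d2)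
    (m1 : {sigma_finite_measure set T1 -> \bar R}) (m2 : {sigma_finite_measure set T2 -> \bar R}) p1 p2 :
  preserving m1 p1 -> preserving m2 p2 -> preserving (prodm m1 m2) (fun p => (p1 p.1, p2 p.2)).
Proof.
move=> [mp1 P1] [mp2 P2]; have mp : measurable_fun setT (fun p : (T1 * T2)%type => (p1 p.1, p2 p.2)).
  by apply: measurable_fun_pair; apply: measurableT_comp.
split=> // f mf f0; rewrite (prodm_integral m1 m2 (measurableT_comp mf mp) (fun p => f0 _)) (prodm_integral m1 m2 mf f0).
transitivity (\int[m1]_y fubini_F m2 f (p1 y)).
  apply: eq_integral => y _; rewrite /fubini_F /=.
  apply: (P2 (fun z => f (p1 y, z))) => //.
  by apply: measurableT_comp => //; exact: measurable_pair1.
by apply: P1; [exact: measurable_fun_fubini_tonelli_F|move=> y; apply: integral_ge0].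
Qed.

Lemma prodm_integralM d1 d2 (T1 : measurableType d1) (T2 : measurableType d2)
    (m1 : {sigma_finite_measure set T1 -> \bar R}) (m2 : {sigma_finite_measure set T2 -> \bar R}) (g : T1 -> R) (h : T2 -> R) :
  measurable_fun setT g -> measurable_fun setT h -> (forall y, 0 <= g y)%R -> (forall z, 0 <= h z)%R ->
  \int[prodm m1 m2]_p (g p.1 * h p.2)%:E = \int[m1]_y (g y)%:E * \int[m2]_z (h z)%:E.
Proof.
move=> mg mh g0 h0; rewrite prodm_integral.
- transitivity (\int[m1]_y ((g y)%:E * \int[m2]_z (h z)%:E)).
    apply: eq_integral => y _ /=; under eq_integral do rewrite EFinM.
    rewrite ge0_integralZl_EFin //; first by move=> z _; rewrite lee_fin.
    exact/measurable_EFinP.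
  rewrite ge0_integralZr //; first exact/measurable_EFinP.
    by move=> y _; rewrite lee_fin.
  by apply: integral_ge0 => z _; rewrite lee_fin.
- by apply/measurable_EFinP; apply: measurable_funM; apply: measurableT_comp.
- by move=> p; rewrite lee_fin mulr_ge0.
Qed.

End Preserving.

Section CoordinateSpace.
Context {R : realType}.
Local Open Scope ereal_scope.
Local Notation mu := (@lebesgue_measure R).

(* A copy of R^r with its Lebesgue measure, built as an iterated product. *)
Lemma coordinate_space (r : nat) : exists (d : measure_display) (T : measurableType d)
    (m : {sigma_finite_measure set T -> \bar R}) (x : 'I_r -> T -> R),
  [/\ forall i, measurable_fun setT (x i),
      forall a : 'I_r -> R, exists2 phi : T -> T, preserving m phi & forall t i, x i (phi t) = (x i t + a i)%R,
      exists2 nu : T -> T, preserving m nu & forall t i, x i (nu t) = (- x i t)%R &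
      forall g : 'I_r -> R -> R, (forall i, measurable_fun setT (g i)) -> (forall i y, (0 <= g i y)%R) ->
        \int[m]_t (\prod_i g i (x i t))%:E = \prod_(i < r) \int[mu]_y (g i y)%:E].
Proof.
elim: r => [|r [d [T [m [x [mx sh [nu pnu xnu] pr]]]]]].
  exists _, unit, (dirac tt), (fun i _ => 0%R); split.
  - by case.
  - by move=> a; exists id; [split|move=> t []].
  - by exists id; [split|move=> t []].
  - move=> g _ _; rewrite !big_ord0 integral_cst // mul1e.
    exact: diracT.
pose x' (i : 'I_r.+1) (p : (measurableTypeR R * T)%type) : R := if unlift ord0 i is Some j then x j p.2 else p.1.
exists _, _, (prodm mu m), x'; split.
- move=> i; rewrite /x'; case: (unlift ord0 i) => [j|]; last exact: measurable_fst.
  by apply: (measurableT_comp (mx j)); exact: measurable_snd.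
- move=> a; have [phi pphi xphi] := sh (fun i => a (lift ord0 i)).
  have p0 : preserving mu (fun y : measurableTypeR R => (y + a ord0)%R).
    by split; [exact: measurable_addl|move=> f mf f0; exact: ge0_integral_shift].
  eexists; first exact: preserving_prod p0 pphi.
  move=> t i; rewrite /x' /=; case: (unliftP ord0 i) => [j|] ij; last by rewrite ij.
  by rewrite xphi ij.
- have p0 : preserving mu (fun y : measurableTypeR R => (- y)%R).
    by split; [exact: oppr_measurable|move=> f mf f0; exact: ge0_integral_opp].
  eexists; first exact: preserving_prod p0 pnu.
  by move=> t i; rewrite /x' /=; case: (unlift ord0 i).
- move=> g mg g0; rewrite big_ord_recl -(pr (fun j => g (lift ord0 j))) //.
  rewrite -prodm_integralM //.
  + apply: eq_integral => p _; rewrite big_ord_recl /x' unlift_none; congr (_ * _)%:E.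
    by apply: eq_bigr => j _; rewrite liftK.
  + exact: mg.
  + by apply: measurable_prod => j _; apply: measurableT_comp.
  + by move=> z; rewrite prodr_ge0.
Qed.

End CoordinateSpace.

(** * Unfolding over a countable group *)

Section Unfolding.
Context {R : realType} {d : measure_display} {T : measurableType d}.
Variables (mu : {sigma_finite_measure set T -> \bar R}) (r : nat) (x : 'I_r -> T -> R).
Local Notation V := ('I_r -> R).
Implicit Types (f : V -> R) (a c u : V).
Local Notation pt t := (fun i => x i t).
Hypothesis mx : forall i, measurable_fun setT (x i).
Hypothesis x_shift : forall a, exists2 phi : T -> T, preserving mu phi & forall t i, x i (phi t) = x i t + a i.
Hypothesis x_opp : exists2 nu : T -> T, preserving mu nu & forall t i, x i (nu t) = - x i t.

Definition shift u a : V := fun i => u i + a i.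
Definition vopp u : V := fun i => - u i.
Definition mble f := measurable_fun setT (fun t => f (pt t)).
Definition J f : \bar R := (\int[mu]_t (f (pt t))%:E)%E.

Lemma shiftA u a c : shift (shift u a) c = shift (shift u c) a.
Proof. by apply/funext => i; rewrite /shift; ring. Qed.

Lemma vopp_shift u a : vopp (shift u a) = shift (vopp u) (vopp a).
Proof. by apply/funext => i; rewrite /shift /vopp; ring. Qed.

Lemma voppK u : vopp (vopp u) = u.
Proof. by apply/funext => i; rewrite /vopp opprK. Qed.

Lemma shiftK u a : shift (shift u (vopp a)) a = u.
Proof. by apply/funext => i; rewrite /shift /vopp; ring. Qed.

Lemma mble_shift f a : mble f -> mble (fun u => f (shift u a)).
Proof.
move=> mf; have [phi [mphi _] xphi] := x_shift a; rewrite /mble.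
rewrite (_ : (fun t => _) = (fun t => f (pt t)) \o phi); first exact: measurableT_comp.
by apply/funext => t /=; congr f; apply/funext => i; rewrite xphi.
Qed.

Lemma J_shift f a : mble f -> (forall u, 0 <= f u) -> J (fun u => f (shift u a)) = J f.
Proof.
move=> mf f0; have [phi [mphi E] xphi] := x_shift a.
rewrite /J -[RHS]E; [|exact/measurable_EFinP|by move=> t; rewrite lee_fin].
by apply: eq_integral => t _; congr (f _)%:E; apply/funext => i; rewrite xphi.
Qed.

Lemma mble_opp f : mble f -> mble (fun u => f (vopp u)).
Proof.
move=> mf; have [phi [mphi _] xphi] := x_opp; rewrite /mble.
rewrite (_ : (fun t => _) = (fun t => f (pt t)) \o phi); first exact: measurableT_comp.
by apply/funext => t /=; congr f; apply/funext => i; rewrite xphi.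
Qed.

Lemma J_opp f : mble f -> (forall u, 0 <= f u) -> J (fun u => f (vopp u)) = J f.
Proof.
move=> mf f0; have [phi [mphi E] xphi] := x_opp.
rewrite /J -[RHS]E; [|exact/measurable_EFinP|by move=> t; rewrite lee_fin].
by apply: eq_integral => t _; congr (f _)%:E; apply/funext => i; rewrite xphi.
Qed.

Lemma mbleM f g : mble f -> mble g -> mble (fun u => f u * g u).
Proof. exact: measurable_funM. Qed.

Lemma mbleD f g : mble f -> mble g -> mble (fun u => f u + g u).
Proof. exact: measurable_funD. Qed.

Lemma mble_cst k : mble (fun=> k).
Proof. exact: measurable_cst. Qed.

Lemma mbleN f : mble f -> mble (fun u => - f u).
Proof.
move=> mf; rewrite (_ : (fun u => - f u) = fun u => -1 * f u); first by apply: mbleM => //; exact: mble_cst.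
by apply/funext => u; rewrite mulN1r.
Qed.

Lemma mble_expR f : mble f -> mble (fun u => expR (f u)).
Proof. by move=> mf; apply: measurableT_comp. Qed.

Lemma J_le f g : mble f -> mble g -> (forall u, 0 <= f u <= g u) -> (J f <= J g)%E.
Proof.
move=> mf mg H; apply: ge0_le_integral => //.
- by move=> t _; rewrite lee_fin; case/andP: (H (pt t)).
- exact/measurable_EFinP.
- exact/measurable_EFinP.
- by move=> t _; rewrite lee_fin; case/andP: (H (pt t)).
Qed.

Lemma JD f g : mble f -> mble g -> (forall u, 0 <= f u) -> (forall u, 0 <= g u) -> J (fun u => f u + g u) = (J f + J g)%E.
Proof.
move=> mf mg f0 g0; rewrite /J -ge0_integralD //; try by move=> t _; rewrite lee_fin.
  exact/measurable_EFinP.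
exact/measurable_EFinP.
Qed.

Lemma JZ k f : 0 <= k -> mble f -> (forall u, 0 <= f u) -> J (fun u => k * f u) = (k%:E * J f)%E.
Proof.
move=> k0 mf f0; rewrite /J -ge0_integralZl_EFin //; try by move=> t _; rewrite lee_fin.
exact/measurable_EFinP.
Qed.

Lemma J_ge0 f : (forall u, 0 <= f u) -> (0 <= J f)%E.
Proof. by move=> f0; apply: integral_ge0 => t _; rewrite lee_fin. Qed.

Variables (X : choiceType) (D : set X) (G : choiceType) (E : set G) (act : G -> X -> X) (ginv : G -> G) (tr : G -> V).
Hypotheses (cD : countable D) (cE : countable E).
Hypotheses (ginvE : forall k, E k -> E (ginv k)) (ginvK : forall k, E k -> ginv (ginv k) = k).
Hypotheses (actD : forall k M, E k -> D M -> D (act k M)) (actK : forall k M, E k -> D M -> act (ginv k) (act k M) = M).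
Hypothesis trV : forall k, E k -> tr (ginv k) = vopp (tr k).
Implicit Types (F W : X -> V -> R).

Definition invariant F := forall k M u, E k -> D M -> F (act k M) (shift u (tr k)) = F M u.
(** A partition of unity for the action of [E]; it replaces the indicator function of a fundamental
    domain. *)
Definition weight W := [/\ forall M u, 0 <= W M u, forall M, D M -> mble (W M) &
  forall M u, D M -> (\esum_(k in E) (W (act k M) (shift u (tr k)))%:E = 1)%E].
(* The integral of F over the quotient of D x R^r by E; by [orbital_weight] it does not depend on the weight W. *)
Definition orbital W F : \bar R := (\esum_(M in D) J (fun u => (W M u * F M u)%R))%E.
Definition admissible F := [/\ forall M u, 0 <= F M u, forall M, D M -> mble (F M) & invariant F].

Lemma act_bij k : E k -> set_bij D D (act k).
Proof.
move=> Ek; split=> [M DM|M N|M DM].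
- exact: actD.
- by rewrite !inE => DM DN H; rewrite -(actK Ek DM) H actK.
- exists (act (ginv k) M); first by apply: actD => //; exact: ginvE.
  by rewrite -{1}(ginvK Ek) actK //; exact: ginvE.
Qed.

Lemma ginv_bij : set_bij E E ginv.
Proof.
split=> [k Ek|k l|k Ek]; first exact: ginvE.
  by rewrite !inE => Ek El H; rewrite -(ginvK Ek) H ginvK.
by exists (ginv k); [exact: ginvE|exact: ginvK].
Qed.

(** The sum 1 of the translates of [W2] is inserted and each term is carried back by its own group
    element; the translates of [W1] then add up to 1. *)
Lemma orbital_weight W1 W2 F : weight W1 -> weight W2 -> admissible F -> orbital W1 F = orbital W2 F.
Proof.
move=> [W10 mW1 W1E] [W20 mW2 W2E] [F0 mF Fi].
pose H k M u := W1 (act (ginv k) M) (shift u (tr (ginv k))) * F M u * W2 M u.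
have H0 k M u : 0 <= H k M u by rewrite !mulr_ge0.
have mH k M : E k -> D M -> mble (H k M).
  by move=> Ek DM; do 2 (apply: mbleM; last by auto); apply: mble_shift; apply: mW1; apply: actD => //; exact: ginvE.
transitivity (\esum_(M in D) \esum_(k in E) J (fun u => H k (act k M) (shift u (tr k))))%E.
  apply: eq_esum => M DM.
  transitivity (\int[mu]_t (\esum_(k in E) (H k (act k M) (shift (pt t) (tr k)))%:E))%E; last first.
    apply: (ge0_integral_esum mu cE) => [k Ek|k t _]; last by rewrite lee_fin.
    by apply/measurable_EFinP; apply: (mble_shift (f := H k (act k M))); apply: mH => //; exact: actD.
  apply: eq_integral => t _.
  rewrite -[LHS]mule1 -(W2E M (pt t) DM) -esumZl ?mulr_ge0 //; last by move=> k; rewrite lee_fin.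
  apply: eq_esum => k Ek; rewrite -EFinM; congr EFin; rewrite /H actK // Fi //; congr (W1 _ _ * _ * _).
  by rewrite trV //; apply/funext => i; rewrite /shift /vopp addrK.
transitivity (\esum_(k in E) \esum_(M in D) J (H k M))%E.
  rewrite [LHS]esum_swapD; last by move=> M k; exact: J_ge0.
  apply: eq_esum => k Ek; rewrite [RHS](reindex_esum _ _ _ _ (act_bij Ek)).
  by apply: eq_esum => M DM; apply: J_shift; [apply: mH => //; exact: actD|exact: H0].
rewrite esum_swapD; last by move=> M k; exact: J_ge0.
apply: eq_esum => M DM; rewrite -(ge0_integral_esum mu cE (f := fun k t => (H k M (pt t))%:E)); last first.
- by move=> k t _; rewrite lee_fin.
- by move=> k Ek; apply/measurable_EFinP; exact: mH.
apply: eq_integral => t _; rewrite -[RHS]mule1 -(W1E M (pt t) DM) (reindex_esum _ _ _ _ ginv_bij).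
rewrite -esumZl ?mulr_ge0 //; last by move=> k; rewrite lee_fin.
by apply: eq_esum => k Ek; rewrite -EFinM; congr EFin; rewrite /H ginvK //; ring.
Qed.

Lemma weight_shift W c : weight W -> weight (fun M u => W M (shift u c)).
Proof.
move=> [W0 mW WE]; split=> // [M DM|M u DM]; first exact: (mble_shift (f := W M) c (mW M DM)).
by rewrite -(WE M (shift u c) DM); apply: eq_esum => k Ek; rewrite shiftA.
Qed.

Lemma admissible_shift F c : admissible F -> admissible (fun M u => F M (shift u c)).
Proof.
move=> [F0 mF Fi]; split=> // [M DM|k M u Ek DM]; first exact: (mble_shift (f := F M) c (mF M DM)).
by rewrite shiftA Fi.
Qed.

Lemma orbital_shift W F c : weight W -> admissible F -> orbital W (fun M u => F M (shift u c)) = orbital W F.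
Proof.
move=> Ww Fa; have [W0 mW WE] := Ww; have [F0 mF Fi] := Fa.
rewrite -[RHS](orbital_weight (weight_shift (vopp c) Ww) Ww Fa); apply: eq_esum => M DM.
rewrite -[LHS](J_shift (vopp c)); last by move=> u; rewrite mulr_ge0.
  by congr J; apply/funext => u; rewrite shiftK.
by apply: mbleM; [exact: mW|exact: (mble_shift (f := F M) c (mF M DM))].
Qed.

Variable dl : X -> X.
Hypotheses (dlD : forall M, D M -> D (dl M)) (dlK : forall M, D M -> dl (dl M) = M).
Hypothesis dl_act : forall k M, E k -> D M -> dl (act k M) = act (ginv k) (dl M).

Lemma dl_bij : set_bij D D dl.
Proof.
split=> [M|M N|M DM]; first exact: dlD.
  by rewrite !inE => DM DN H; rewrite -(dlK DM) H dlK.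
by exists (dl M); [exact: dlD|exact: dlK].
Qed.

Lemma weight_dual W : weight W -> weight (fun M u => W (dl M) (vopp u)).
Proof.
move=> [W0 mW WE]; split=> // [M DM|M u DM]; first by apply: (mble_opp (f := W (dl M))); apply: mW; exact: dlD.
rewrite -(WE (dl M) (vopp u) (dlD DM)) [RHS](reindex_esum _ _ _ _ ginv_bij).
by apply: eq_esum => k Ek; rewrite dl_act // vopp_shift trV.
Qed.

(** Duality turns a weight into a weight, so that [orbital_weight] absorbs the change. *)
Lemma orbital_dual W F : weight W -> admissible F -> orbital W (fun M u => F (dl M) (vopp u)) = orbital W F.
Proof.
move=> Ww Fa; have [W0 mW WE] := Ww; have [F0 mF Fi] := Fa.
rewrite -[RHS](orbital_weight (weight_dual Ww) Ww Fa) /orbital [RHS](reindex_esum _ _ _ _ dl_bij).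
apply: eq_esum => M DM; rewrite -[RHS]J_opp; last by move=> u; rewrite mulr_ge0.
  by congr J; apply/funext => u; rewrite voppK dlK.
by apply: mbleM; [apply: (mble_opp (f := W _)); apply: mW; do 2 (apply: dlD)|apply: mF; exact: dlD].
Qed.

Variable h : nat -> option X.
Hypotheses (hD : forall n M, h n = Some M -> D M)
  (hE : forall a : X -> \bar R, (forall M, D M -> 0 <= a M)%E -> (\esum_(M in D) a M = \sum_(n <oo) oapp a 0 (h n))%E).
Let cN : {sigma_finite_measure set nat -> \bar R} := @countm R.
Local Notation muN := (prodm cN mu).
(** The sum over [D] and the integral over [T] become one integral over a product space, so that
    [lap] applies to orbital integrals. *)
Definition unroll F (p : (nat * T)%type) : R := if h p.1 is Some M then F M (pt p.2) else 0.

Lemma measurable_unroll F : (forall M, D M -> mble (F M)) -> measurable_fun setT (unroll F).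
Proof.
move=> mF _ B mB; rewrite setTI.
rewrite (_ : _ @^-1` B = \bigcup_n ([set n] `*` ((fun t => if h n is Some M then F M (pt t) else 0) @^-1` B))).
  apply: bigcupT_measurable => n; apply: measurableX => //.
  rewrite -[X in measurable X]setTI; case E1 : (h n) => [M|]; last by apply: measurable_cst.
  by apply: mF => //; exact: hD E1.
by apply/seteqP; split=> [[n t] Bt|[n t] [k _ [/= <-]]]; [exists n|].
Qed.

Lemma unroll_integral F : (forall M u, 0 <= F M u) -> (forall M, D M -> mble (F M)) ->
  (\int[muN]_p (unroll F p)%:E = \esum_(M in D) J (F M))%E.
Proof.
move=> F0 mF; rewrite prodm_integral.
- rewrite hE; last by move=> M _; exact: J_ge0.
  rewrite ge0_integral_count; last by move=> n; apply: integral_ge0 => t _; rewrite lee_fin /unroll /=; case: (h n).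
  apply: eq_eseriesr => n _; rewrite /unroll /=; case: (h n) => [M|] //=.
  by rewrite integral0.
- by apply/measurable_EFinP; exact: measurable_unroll.
- by move=> p; rewrite lee_fin /unroll; case: (h _).
Qed.

Variables (th y : X -> V -> R) (c : V) (l : R) (W : X -> V -> R).
Hypotheses (Ww : weight W) (th_adm : admissible th) (y_mble : forall M, D M -> mble (y M)) (y_inv : invariant y).
Hypotheses (y_shift : forall M u, D M -> y M (shift u c) = y M u + l) (y_dual : forall M u, D M -> y (dl M) (vopp u) = - y M u).
Hypothesis th_dual : forall M u, D M -> 1 + th M u = expR (- y M u) * (1 + th (dl M) (vopp u)).
Hypothesis th_fin : forall s, 1 < s -> (orbital W (fun M u => th M u * expR (s * y M u))%R < +oo)%E.
Let q := expR (l / 2).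
Let qV := expR (- (l / 2)).

Lemma admissible_expR s F : admissible F -> admissible (fun M u => F M u * expR (s * y M u)).
Proof.
move=> [F0 mF Fi]; split=> [M u|M DM|k M u Ek DM]; first by rewrite mulr_ge0 ?expR_ge0.
  by apply: mbleM; [exact: mF|apply: mble_expR; apply: mbleM; [exact: mble_cst|exact: y_mble]].
by rewrite Fi // y_inv.
Qed.

Let y_unshift M u : D M -> y M (shift u (vopp c)) = y M u - l.
Proof. by move=> DM; rewrite -{2}(shiftK u c) y_shift // addrK. Qed.

(* The same combination of translates kills both 1 and exp (- y), the two pole terms of [th_dual]. *)
Let psi M u := q * th M (shift u c) + qV * th M (shift u (vopp c)) - (q + qV) * th M u.
(** [lap_cdiff] takes a nonnegative density, whence the splitting of [psi]. Both parts satisfy the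
    relation of [psi_dual], because its factor is positive. *)
Let psip M u := Num.max (psi M u) 0.
Let psin M u := Num.max (- psi M u) 0.

Let qE : q * qV = 1. Proof. by rewrite /q /qV -expRD subrr expR0. Qed.
Let qE2 : q * q = expR l. Proof. by rewrite /q -expRD -splitr. Qed.
Let q0 : 0 < q. Proof. exact: expR_gt0. Qed.
Let qV0 : 0 < qV. Proof. exact: expR_gt0. Qed.

Lemma psi_dual M u : D M -> psi M u = expR (- y M u) * psi (dl M) (vopp u).
Proof.
move=> DM; rewrite /psi.
have E0 := th_dual u DM; have E1 := th_dual (shift u c) DM; have E2 := th_dual (shift u (vopp c)) DM.
rewrite vopp_shift y_shift // opprD expRD in E1; rewrite vopp_shift voppK y_unshift // opprB expRD in E2.
have lV : expR (- l) = qV * qV by rewrite /qV -expRD; congr expR; field.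
have lE : expR l = q * q by rewrite qE2.
rewrite lV in E1; rewrite lE in E2.
set a := th M u in E0 *; set b := th M (shift u c) in E1 *; set b' := th M (shift u (vopp c)) in E2 *.
set a' := th (dl M) _ in E0 *; set d1 := th (dl M) _ in E1 *; set d2 := th (dl M) (shift (vopp u) c) in E2 *.
have -> : a = expR (- y M u) * (1 + a') - 1 by rewrite -E0; ring.
have -> : b = expR (- y M u) * (qV * qV) * (1 + d1) - 1 by rewrite -E1; ring.
have -> : b' = q * q * expR (- y M u) * (1 + d2) - 1 by rewrite -E2; ring.
have qV' : qV = q^-1 by rewrite -[LHS]mul1r -(mulVf (lt0r_neq0 q0)) -mulrA qE mulr1.
by rewrite qV'; field; rewrite gt_eqF.
Qed.

Lemma psi_mble M : D M -> mble (psi M).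
Proof.
move=> DM; have [_ mF _] := th_adm.
apply: mbleD; first apply: mbleD.
- by apply: mbleM; [exact: mble_cst|apply: (mble_shift (f := th M)); exact: mF].
- by apply: mbleM; [exact: mble_cst|apply: (mble_shift (f := th M)); exact: mF].
- by apply: mbleN; apply: mbleM; [exact: mble_cst|exact: mF].
Qed.

Lemma psi_inv : invariant psi.
Proof.
by have [_ _ Fi] := th_adm => k M u Ek DM; rewrite /psi ![shift (shift _ _) c]shiftA ![shift (shift _ _) (vopp c)]shiftA !Fi.
Qed.

Lemma psip_adm : admissible psip.
Proof.
split=> [M u|M DM|k M u Ek DM]; first by rewrite le_max lexx orbT.
  by apply: measurable_maxr; [exact: psi_mble|exact: mble_cst].
by rewrite /psip psi_inv.
Qed.

Lemma psin_adm : admissible psin.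
Proof.
split=> [M u|M DM|k M u Ek DM]; first by rewrite le_max lexx orbT.
  by apply: measurable_maxr; [apply: mbleN; exact: psi_mble|exact: mble_cst].
by rewrite /psin psi_inv.
Qed.

Let maxM (a b : R) : 0 < a -> Num.max (a * b) 0 = a * Num.max b 0.
Proof. by move=> a0; rewrite maxr_pMr ?ltW // mulr0. Qed.

Lemma orbital_le F F' : admissible F -> admissible F' -> (forall M u, D M -> F M u <= F' M u) -> (orbital W F <= orbital W F')%E.
Proof.
move=> [F0 mF _] [F0' mF' _] H; have [W0 mW _] := Ww; apply: le_esum => M DM.
apply: J_le; [by apply: mbleM; auto|by apply: mbleM; auto|move=> u].
by rewrite mulr_ge0 //= ler_wpM2l // H.
Qed.

Lemma orbitalD F F' : admissible F -> admissible F' -> (orbital W (fun M u => F M u + F' M u)%R = orbital W F + orbital W F')%E.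
Proof.
move=> [F0 mF _] [F0' mF' _]; have [W0 mW _] := Ww.
rewrite -esumD; try by move=> M _; apply: J_ge0 => u; rewrite mulr_ge0.
apply: eq_esum => M DM; rewrite -JD; try by move=> u; rewrite mulr_ge0.
- by congr J; apply/funext => u; rewrite mulrDr.
- by apply: mbleM; auto.
- by apply: mbleM; auto.
Qed.

Lemma orbitalZ k F : 0 <= k -> admissible F -> (orbital W (fun M u => k * F M u)%R = k%:E * orbital W F)%E.
Proof.
move=> k0 [F0 mF _]; have [W0 mW _] := Ww; rewrite -esumZl //; last by move=> M; apply: J_ge0 => u; rewrite mulr_ge0.
apply: eq_esum => M DM; rewrite -JZ //; last by move=> u; rewrite mulr_ge0.
  by congr J; apply/funext => u; rewrite mulrCA.
by apply: mbleM; auto.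
Qed.

Lemma admissibleD F F' : admissible F -> admissible F' -> admissible (fun M u => F M u + F' M u).
Proof.
move=> [F0 mF Fi] [F0' mF' Fi']; split=> [M u|M DM|k M u Ek DM]; first by rewrite addr_ge0.
  by apply: mbleD; auto.
by rewrite Fi // Fi'.
Qed.

Lemma admissibleZ k F : 0 <= k -> admissible F -> admissible (fun M u => k * F M u).
Proof.
move=> k0 [F0 mF Fi]; split=> [M u|M DM|g M u Eg DM]; first by rewrite mulr_ge0.
  by apply: mbleM; [exact: mble_cst|auto].
by rewrite Fi.
Qed.

Let tm s : X -> V -> R := fun M u => th M u * expR (s * y M u).
Let tms s a : X -> V -> R := fun M u => th M (shift u a) * expR (s * y M u).

Let tm_adm s : admissible (tm s). Proof. exact: admissible_expR. Qed.

Let tms_orbital s a k : (forall M u, D M -> y M (shift u a) = y M u + k) ->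
  orbital W (tms s a) = ((expR (- (s * k)))%:E * orbital W (tm s))%E.
Proof.
move=> H; rewrite -(orbital_shift a Ww (tm_adm s)) -orbitalZ ?expR_ge0 //; last exact: (admissible_shift a (tm_adm s)).
apply: eq_esum => M DM; congr J; apply/funext => u; rewrite /tms /tm H //; congr (_ * _).
by rewrite [RHS]mulrCA -expRD; congr (_ * expR _); ring.
Qed.

Let tms_adm s a : admissible (tms s a).
Proof. by apply: admissible_expR; exact: admissible_shift. Qed.

Let mom P s := orbital W (fun M u => P M u * expR (s * y M u)).

Let psipn M u : psip M u + (q + qV) * th M u = psin M u + (q * th M (shift u c) + qV * th M (shift u (vopp c))).
Proof.
have E1 : psip M u = psin M u + psi M u.
  by rewrite /psip /psin; case: (leP (psi M u) 0) => h1; case: (leP (- psi M u) 0) => h2; lra.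
by rewrite E1 /psi; ring.
Qed.

Let psi_le M u : psip M u <= q * th M (shift u c) + qV * th M (shift u (vopp c)) /\ psin M u <= (q + qV) * th M u.
Proof.
have [F0 _ _] := th_adm.
have h1 : 0 <= q * th M (shift u c) by rewrite mulr_ge0 // ltW.
have h2 : 0 <= qV * th M (shift u (vopp c)) by rewrite mulr_ge0 // ltW.
have h3 : 0 <= (q + qV) * th M u by rewrite mulr_ge0 // addr_ge0 // ltW.
by split; rewrite ge_max; apply/andP; split=> //; rewrite /psi; lra.
Qed.

Let mom_gt1 s : 1 < s -> (mom psip s < +oo)%E /\ (mom psin s < +oo)%E.
Proof.
move=> s1; have tf := th_fin s1; have ql : 0 <= q + qV by rewrite addr_ge0 // ltW.
have e1 := tms_orbital s y_shift; have e2 := tms_orbital s y_unshift.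
split; (apply: le_lt_trans; first apply: orbital_le).
- exact: admissible_expR psip_adm.
- by apply: (admissibleD (admissibleZ (ltW q0) (tms_adm s c)) (admissibleZ (ltW qV0) (tms_adm s (vopp c)))).
- move=> M u DM; rewrite /tms !mulrA -mulrDl ler_wpM2r ?expR_ge0 //; exact: (proj1 (psi_le M u)).
- rewrite orbitalD ?orbitalZ ?(ltW q0) ?(ltW qV0) //; try exact: admissibleZ (ltW _) (tms_adm _ _).
  rewrite e1 e2; apply: lte_add_pinfty; apply: lte_mul_pinfty; rewrite ?lee_fin ?(ltW q0) ?(ltW qV0) //;
  by apply: lte_mul_pinfty; rewrite ?lee_fin ?expR_ge0.
- exact: admissible_expR psin_adm.
- by apply: (admissibleZ ql (tm_adm s)).
- move=> M u DM; rewrite /tm !mulrA ler_wpM2r ?expR_ge0 //; exact: (proj2 (psi_le M u)).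
- by rewrite orbitalZ //; apply: lte_mul_pinfty; rewrite ?lee_fin.
Qed.

Let mom_dual P s : admissible P -> (forall M u, D M -> P M u = expR (- y M u) * P (dl M) (vopp u)) -> mom P s = mom P (1 - s).
Proof.
move=> Pa PE; rewrite /mom -[RHS](orbital_dual Ww (admissible_expR (1 - s) Pa)).
apply: eq_esum => M DM; congr J; apply/funext => u; rewrite PE // y_dual //; congr (_ * _).
by rewrite mulrAC -expRD mulrC; congr (_ * expR _); ring.
Qed.

Let psip_dual M u : D M -> psip M u = expR (- y M u) * psip (dl M) (vopp u).
Proof. by move=> DM; rewrite /psip psi_dual // maxM // expR_gt0. Qed.

Let psin_dual M u : D M -> psin M u = expR (- y M u) * psin (dl M) (vopp u).
Proof. by move=> DM; rewrite /psin psi_dual // -mulrN maxM // expR_gt0. Qed.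

(** Convergence is given for s > 1 and carried to s < 0 by the symmetry; for 0 <= s <= 1 it follows
    from e^(s y) <= e^(2 y) + e^(- y). *)
Let mom_fin s : (mom psip s < +oo)%E /\ (mom psin s < +oo)%E.
Proof.
have H P t : admissible P -> (mom P 2%R < +oo)%E -> (mom P (-1)%R < +oo)%E -> 0 <= t <= 1 -> (mom P t < +oo)%E.
  move=> Pa f2 f1 /andP[t0 t1]; apply: (@le_lt_trans _ _ (mom P 2%R + mom P (-1)%R)%E); last exact: (lte_add_pinfty f2 f1).
  rewrite /mom -orbitalD; try exact: admissible_expR.
  apply: orbital_le; [exact: admissible_expR|by apply: admissibleD; exact: admissible_expR|move=> M u DM].
  rewrite -mulrDr; apply: ler_wpM2l; first by case: Pa.
  case: (leP 0 (y M u)) => y0.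
    by rewrite -[leLHS]addr0 lerD ?expR_ge0 // ler_expR; nra.
  by rewrite -[leLHS]add0r lerD ?expR_ge0 // ler_expR; nra.
have [p2 n2] := mom_gt1 (ltr1n R 2 : 1 < 2).
have E12 : 1 - -1 = 2 :> R by rewrite opprK.
have p1 : (mom psip (-1)%R < +oo)%E by rewrite (mom_dual (-1) psip_adm psip_dual) E12; exact: p2.
have n1 : (mom psin (-1)%R < +oo)%E by rewrite (mom_dual (-1) psin_adm psin_dual) E12; exact: n2.
have [s1|s1] := ltP 1 s; first exact: mom_gt1.
have [s0|s0] := leP 0 s.
  by split; [apply: (H psip s psip_adm p2 p1)|apply: (H psin s psin_adm n2 n1)]; rewrite s0 s1.
have s1' : 1 < 1 - s by lra.
have [h1 h2] := mom_gt1 s1'.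
by rewrite (mom_dual s psip_adm psip_dual) (mom_dual s psin_adm psin_dual); split; [exact: h1|exact: h2].
Qed.

Let wgt P M u := W M u * P M u.
Let yN := unroll y.

Let lapP P := lap muN (unroll (wgt P)) yN.

Let unroll_expR P s p : unroll (wgt P) p * expR (s * yN p) = unroll (fun M u => W M u * (P M u * expR (s * y M u))) p.
Proof. by rewrite /yN /unroll /wgt; case: (h _) => [M|]; rewrite ?mul0r // mulrA. Qed.

Let mom_int P s : admissible P -> (\int[muN]_p (unroll (wgt P) p * expR (s * yN p))%:E = mom P s)%E.
Proof.
move=> Pa; have [F0 mF _] := admissible_expR s Pa; have [W0 mW _] := Ww.
rewrite /mom /orbital -unroll_integral.
- by apply: eq_integral => p _; rewrite unroll_expR.
- by move=> M u; rewrite mulr_ge0.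
- by move=> M DM; apply: mbleM; auto.
Qed.

Let lapP_cdiff P z : admissible P -> (forall s, mom P s < +oo)%E -> cdiffable (lapP P) z.
Proof.
move=> Pa Pf; have [F0 mF _] := Pa; have [W0 mW _] := Ww; eexists.
apply: (@lap_cdiff _ _ _ muN (unroll (wgt P)) yN _ _ _ (Re z) 1) => //.
- by move=> p; rewrite /unroll /wgt; case: (h _) => // M; rewrite mulr_ge0.
- by apply: measurable_unroll => M DM; apply: mbleM; auto.
- by apply: measurable_unroll => M DM; auto.
- by rewrite /lap_fin mom_int.
- by rewrite /lap_fin mom_int.
Qed.

Let lapP_real P s : admissible P -> lapP P s%:C = (fine (mom P s))%:C.
Proof. by move=> Pa; rewrite /lapP lap_real /Rintegral mom_int. Qed.

(** For s > 1 the three translates of [th] in [psi] can be integrated separately, and translation by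
    [c] multiplies the moment by e^(- s l). With the coefficients [q] and [qV] this produces the
    hyperbolic cosines. *)
Theorem completed_function : exists L : R[i] -> R[i],
  [/\ forall z, cdiffable L z, forall s : R, L (1 - s)%:C = L s%:C &
      forall s : R, 1 < s -> L s%:C =
        ((expR (l / 2 - s * l) + expR (s * l - l / 2) - (expR (l / 2) + expR (- (l / 2)))) *
         fine (orbital W (fun M u => th M u * expR (s * y M u))))%:C].
Proof.
exists (fun z => lapP psip z - lapP psin z); split=> [z|s|s s1].
- have [m1 H1] := lapP_cdiff z psip_adm (fun s => proj1 (mom_fin s)).
  have [m2 H2] := lapP_cdiff z psin_adm (fun s => proj2 (mom_fin s)).
  by eexists; exact: cdiffB H1 H2.
- rewrite !lapP_real; try exact: psip_adm; try exact: psin_adm.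
  by rewrite -(mom_dual s psip_adm psip_dual) -(mom_dual s psin_adm psin_dual).
rewrite !lapP_real; try exact: psip_adm; try exact: psin_adm.
rewrite -rmorphB /=; congr (_%:C); have [p1 n1] := mom_gt1 s1; have tf := th_fin s1.
have ge P : admissible P -> (0 <= orbital W P)%E.
  by move=> [F0 _ _]; have [W0 _ _] := Ww; apply: esum_ge0 => M _; apply: J_ge0 => u; rewrite mulr_ge0.
have fn P : admissible P -> (orbital W P < +oo)%E -> orbital W P \is a fin_num by move=> Pa; rewrite ge0_fin_numE // ge.
have pf : mom psip s \is a fin_num by exact: fn _ (admissible_expR s psip_adm) p1.
have nf : mom psin s \is a fin_num by exact: fn _ (admissible_expR s psin_adm) n1.
have tfn : orbital W (tm s) \is a fin_num by apply: fn.
have ql : 0 <= q + qV by rewrite addr_ge0 // ltW.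
(* The definition of [psi] with all minus signs moved across, so that it can be integrated in the
   extended reals. *)
have E0 : (mom psip s + (q + qV)%:E * orbital W (tm s) =
   mom psin s + (q%:E * orbital W (tms s c) + qV%:E * orbital W (tms s (vopp c))))%E.
  rewrite -!orbitalZ ?(ltW q0) ?(ltW qV0) // -!orbitalD;
    try exact: admissible_expR psip_adm; try exact: admissible_expR psin_adm;
    try exact: (admissibleZ ql (tm_adm s)); try exact: (admissibleZ (ltW q0) (tms_adm s c));
    try exact: (admissibleZ (ltW qV0) (tms_adm s (vopp c)));
    try exact: (admissibleD (admissibleZ (ltW q0) (tms_adm s c)) (admissibleZ (ltW qV0) (tms_adm s (vopp c)))).
  apply: eq_esum => M DM; congr J; apply/funext => u; congr (_ * _).
  rewrite /tm /tms; have := psipn M u; set e := expR _ => E1.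
  transitivity ((psip M u + (q + qV) * th M u) * e); first by ring.
  by rewrite E1; ring.
rewrite (tms_orbital s y_shift) (tms_orbital s y_unshift) -/(tm s) in E0.
rewrite -(fineK pf) -(fineK nf) -(fineK tfn) -!EFinM -!EFinD in E0; have {E0} := EFin_inj E0.
have e1 : expR (l / 2 - s * l) = q * expR (- (s * l)) by rewrite /q -expRD.
have e2 : expR (s * l - l / 2) = qV * expR (- (s * - l)) by rewrite /qV -expRD; congr expR; ring.
rewrite e1 e2 -/q -/qV; move: (fine (mom psip s)) (fine (mom psin s)) (fine (orbital W (tm s))) => a b t.
by move=> E1; apply: (addIr ((q + qV) * t)); apply: (addIr b); rewrite addrAC subrK E1; ring.
Qed.

End Unfolding.

(** * The completed zeta function *)

Section LocalFactor.
Context {R : realType}.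
Local Notation mu := (@lebesgue_measure R).
Implicit Types (m : nat) (s t : R).

Definition local_density m t : R := expR (- (pi * m%:R * expR (2 * t))).
(** The substitution x = e^(2 y) gives pi^(- s / 2) Gamma(s / 2) / 2 for m = 1 and (2 pi)^(- s)
    Gamma(s) / 2 for m = 2. *)
Definition local_integral m s : R := (\int[mu]_y (local_density m y * expR (s * (m%:R * y))))%R.

Lemma measurable_local_density m : measurable_fun setT (local_density m).
Proof.
apply: measurableT_comp => //; apply: measurableT_comp; first exact: oppr_measurable.
by apply: measurable_funM => //; apply: measurableT_comp => //; exact: measurable_funM.
Qed.

Lemma measurable_local m s : measurable_fun setT (fun t => local_density m t * expR (s * (m%:R * t))).
Proof.
apply: measurable_funM; first exact: measurable_local_density.
by apply: measurableT_comp => //; do 2 (apply: measurable_funM => //).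
Qed.

Lemma integral_exp_half (b : R) : 0 < b ->
  (\int[mu]_t (exponential_pdf b t + exponential_pdf b (- t))%:E = 2%:E)%E.
Proof.
move=> b0; under eq_integral do rewrite EFinD.
have mp : measurable_fun setT (exponential_pdf b) by exact: measurable_exponential_pdf.
have mn : measurable_fun setT (fun t => exponential_pdf b (- t)).
  by apply: measurableT_comp => //; exact: oppr_measurable.
rewrite ge0_integralD //; try (by move=> t _; rewrite lee_fin exponential_pdf_ge0 // ltW);
  try exact/measurable_EFinP.
rewrite (ge0_integral_opp (f := fun t => (exponential_pdf b t)%:E)) ?integral_exponential_pdf //.
  exact/measurable_EFinP.
by move=> t; rewrite lee_fin exponential_pdf_ge0 // ltW.
Qed.

(* -a e^{2t} + c t <= -a t^2 + c t <= c^2/(4a) controls the right tail, and c > 0 the left one. *)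
Lemma exp_exp_fin (a c : R) : 0 < a -> 0 < c -> (\int[mu]_t (expR (- (a * expR (2 * t)) + c * t))%:E < +oo)%E.
Proof.
move=> a0 c0; pose k := expR ((2 * c) ^+ 2 / (4 * a)) / c.
have e0 : 1 <= expR ((2 * c) ^+ 2 / (4 * a)).
  by rewrite -expR0 ler_expR divr_ge0 ?sqr_ge0 // mulr_ge0 // ltW.
have k0 : 0 <= k by rewrite divr_ge0 ?ltW // expR_gt0.
have p0 t : 0 <= exponential_pdf c t by rewrite exponential_pdf_ge0 // ltW.
have mp : measurable_fun setT (fun t => exponential_pdf c t + exponential_pdf c (- t)).
  apply: measurable_funD; first exact: measurable_exponential_pdf.
  by apply: measurableT_comp; [exact: measurable_exponential_pdf|exact: oppr_measurable].
apply: (@le_lt_trans _ _ (\int[mu]_t (k * (exponential_pdf c t + exponential_pdf c (- t)))%:E)%E); last first.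
  under eq_integral do rewrite EFinM.
  rewrite ge0_integralZl_EFin // ?integral_exp_half // ?ltry //.
    by move=> t _; rewrite lee_fin addr_ge0.
  exact/measurable_EFinP.
apply: ge0_le_integral => //.
- apply/measurable_EFinP; apply: measurableT_comp => //; apply: measurable_funD; last exact: measurable_funM.
  apply: measurableT_comp; first exact: oppr_measurable.
  by apply: measurable_funM => //; apply: measurableT_comp => //; exact: measurable_funM.
- by apply/measurable_EFinP; exact: measurable_funM.
move=> t _; rewrite lee_fin; have [t0|t0] := leP 0 t.
  apply: (@le_trans _ _ (k * exponential_pdf c t)); last by rewrite ler_wpM2l // lerDl.
  rewrite exponential_pdfE // /k mulrA divfK ?gt_eqF // -expRD ler_expR.
  have h1 : (1 + t) ^+ 2 <= expR (2 * t).
    by rewrite expRM_natl ler_pXn2r ?nnegrE ?expR_ge0 ?expR_ge1Dx // addr_ge0.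
  have h2 : a * t ^+ 2 <= a * expR (2 * t) by rewrite ler_pM2l // (le_trans _ h1) // ler_pXn2r ?nnegrE //; lra.
  have h3 : 2 * c * t - a * t ^+ 2 <= (2 * c) ^+ 2 / (4 * a).
    rewrite ler_pdivlMr; last by rewrite mulr_gt0.
    have := sqr_ge0 (2 * c - 2 * a * t); rewrite !expr2; nra.
  by lra.
apply: (@le_trans _ _ (k * exponential_pdf c (- t))); last by rewrite ler_wpM2l // lerDr.
rewrite exponential_pdfE; last by rewrite oppr_ge0 ltW.
rewrite /k mulrA divfK ?gt_eqF // -[X in X <= _]mul1r ler_pM ?expR_ge0 //.
rewrite ler_expR; have := expR_ge0 (2 * t); nra.
Qed.

Lemma local_fin m s : (0 < m)%N -> 0 < s -> (\int[mu]_y (local_density m y * expR (s * (m%:R * y)))%:E < +oo)%E.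
Proof.
move=> m0 s0; have m0' : 0 < m%:R :> R by rewrite ltr0n.
have := @exp_exp_fin (pi * m%:R) (s * m%:R); rewrite !mulr_gt0 ?pi_gt0 // => /(_ isT isT).
by congr (_ < _)%E; apply: eq_integral => y _; rewrite expRD mulrA.
Qed.

End LocalFactor.

(** * Summation over finite sets of ideals *)

Section RealPartialSums.
Context {R : realType} {T : choiceType}.
Local Notation C := R[i].

(** The partial sums are real and increase along finite sets, so that their limit is real and is
    their supremum. *)
Lemma totally_esum (a : T -> R) (l : C^o) : (forall i, 0 <= a i) ->
  partial_sum (fun i => (a i)%:C : C^o) @ totally --> l ->
  l = (Re l)%:C /\ (\esum_(i in [set: T]) (a i)%:E = (Re l)%:E)%E.
Proof.
move=> a0; have FT : Filter (@totally T) := @filter_filter _ _ totally_filter; move=> /cvgrPdist_lt H; pose S (A : {fset T}) : R := \sum_(i : A) a (val i).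
have SE A : partial_sum (fun i => (a i)%:C : C^o) A = (S A)%:C by rewrite /partial_sum /S rmorph_sum.
have {}H (e : R) : 0 < e -> exists A : {fset T}, forall B : {fset T}, (A `<=` B)%fset -> normc (l - (S B)%:C) < e.
  move=> e0; have /H [A _ HA] : 0 < e%:C :> C by rewrite ltcR.
  by exists A => B AB; have := HA B AB; rewrite /= SE normC_normc ltcR.
have RE e : 0 < e -> exists A : {fset T}, forall B : {fset T}, (A `<=` B)%fset -> `|Re l - S B| < e /\ `|Im l| < e.
  move=> e0; have [A HA] := H e e0; exists A => B AB; have HB := HA B AB; split; apply: le_lt_trans HB.
    by have := Re_le_normc (l - (S B)%:C); rewrite complexRe_B.
  by have := Im_le_normc (l - (S B)%:C); rewrite complexIm_B /= subr0.
have SF A : (S A)%:E = (\sum_(i \in [set` A]) (a i)%:E)%E.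
  by rewrite fsbig_finite //= set_fsetK big_seq_fsetE sumEFin.
have SM (A B : {fset T}) : (A `<=` B)%fset -> S A <= S B.
  move=> /fsubsetP AB; rewrite -lee_fin !SF; apply: lee_fsum_nneg_subset => //.
    by move=> i; rewrite !inE; exact: AB.
  by move=> i _; rewrite lee_fin.
have Sle A : S A <= Re l.
  apply/ler_addgt0Pr => e e0; have [B HB] := RE e e0.
  have [/ltr_normlP [h1 h2] _] := HB _ (fsubsetUl B A).
  by apply: (le_trans (SM _ _ (fsubsetUr B A))); lra.
split.
  apply: complex_ext => //=; apply/eqP; rewrite -normr_le0; apply/ler_addgt0Pr => e e0.
  by have [B HB] := RE e e0; have [_ h] := HB _ (fsubset_refl B); rewrite add0r ltW.
apply/eqP; rewrite eq_le; apply/andP; split.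
  apply: ge_ereal_sup => _ [X [fX _] <-].
  by rewrite -(fset_setK fX) -SF lee_fin.
apply/lee_addgt0Pr => e e0; have [B HB] := RE e e0.
have [/ltr_normlP [h1 h2] _] := HB _ (fsubset_refl B).
apply: (@le_trans _ _ ((S B)%:E + e%:E)%E); first by rewrite -EFinD lee_fin; lra.
apply: leeD => //; apply: esum_ge; exists [set` B]; first by split.
by rewrite SF.
Qed.

End RealPartialSums.

(** * Archimedean places *)

Section Places.
Variables (n : nat) (cj : 'I_n -> 'I_n).
Hypothesis cjK : involutive cj.

(** A place is an orbit of [cj], represented by its smaller index. *)
Lemma places_exist : exists r (pl : 'I_n -> 'I_r) (rep : 'I_r -> 'I_n),
  [/\ forall i, pl (rep i) = i, forall j, pl (cj j) = pl j & forall j k, pl j = pl k -> j = k \/ j = cj k].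
Proof.
pose S := [pred j : 'I_n | (j <= cj j)%N].
pose c (j : 'I_n) := if (j <= cj j)%N then j else cj j.
have cS j : c j \in S.
  by rewrite /c inE; case: ifPn => //; rewrite -ltnNge cjK => /ltnW.
have cC j : c (cj j) = c j.
  rewrite /c cjK; case: (ltngtP j (cj j)) => // H; exact/val_inj.
have cE j : c j = j \/ c j = cj j by rewrite /c; case: ifP; auto.
pose pl j := enum_rank_in (cS j) (c j).
have plE j k : pl j = pl k <-> c j = c k.
  split=> [/(congr1 enum_val)|H]; first by rewrite !enum_rankK_in.
  by apply: enum_val_inj; rewrite !enum_rankK_in.
exists #|S|, pl, (fun i => enum_val i); split=> [i|j|j k].
- have /[!inE] iS := enum_valP i.
  by apply: enum_val_inj; rewrite enum_rankK_in // /c iS.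
- by apply/plE.
- move/plE; case: (cE j) => ->; case: (cE k) => -> // H; first by left.
  + by right.
  + by right; rewrite -H cjK.
  + by left; rewrite -[j]cjK H cjK.
Qed.

Variables (r : nat) (pl : 'I_n -> 'I_r) (rep : 'I_r -> 'I_n).
Hypotheses (plK : forall i, pl (rep i) = i) (pl_fib : forall j k, pl j = pl k -> j = k \/ j = cj k).

Definition mult (i : 'I_r) : nat := #|[pred j | pl j == i]|.

Lemma mult12 i : mult i = 1%N \/ mult i = 2%N.
Proof.
have m0 : (0 < mult i)%N by apply/card_gt0P; exists (rep i); rewrite inE plK.
have m2 : (mult i <= 2)%N.
  apply: (@leq_trans #|[set rep i; cj (rep i)]%SET|); last by rewrite cards2; case: (_ != _).
  apply: subset_leq_card; apply/fintype.subsetP => j; rewrite inE => /eqP ji.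
  by apply/finset.set2P; apply: pl_fib; rewrite ji plK.
by case: (mult i) m0 m2 => [|[|[|?]]] //; auto.
Qed.

Lemma mult_gt0 i : (0 < mult i)%N.
Proof. by have [->|->] := mult12 i. Qed.

Lemma sum_places {A : ringType} (f : 'I_r -> A) : \sum_j f (pl j) = \sum_i (mult i)%:R * f i.
Proof.
rewrite (partition_big pl predT) //=; apply: eq_bigr => i _.
rewrite (eq_bigr (fun=> f i)) => [|j /eqP-> //].
by rewrite sumr_const mulr_natl.
Qed.

Lemma mult_sum : (\sum_i mult i = n)%N.
Proof.
rewrite -[RHS]card_ord -sum1_card (partition_big pl predT) //=.
by apply: eq_bigr => i _; rewrite sum1_card.
Qed.

End Places.

(** * The zeta function as an orbital integral *)

Section ZetaIntegral.
Variables (R : realType) (K : fieldExtType rat).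
Local Notation C := R[i].
Local Notation n := (\dim {:K}).
Variables (sg : 'I_n -> {rmorphism K -> C}) (e : 'I_n -> K).
Hypotheses (e_basis : is_basis sg e) (e_span : forall x, exists v : 'I_n -> rat, x = \sum_i v i *: e i).
Variable cj : 'I_n -> 'I_n.
Hypotheses (cjK : involutive cj) (cjE : forall j x, sg (cj j) x = (sg j x)^*).
Variables (r : nat) (pl : 'I_n -> 'I_r) (rep : 'I_r -> 'I_n).
Hypotheses (plK : forall i, pl (rep i) = i) (pl_cj : forall j, pl (cj j) = pl j)
  (pl_fib : forall j k, pl j = pl k -> j = k \/ j = cj k).
Local Notation V := ('I_r -> R).
Local Notation D := [set M | frac sg M].
Local Notation K0 := [set k : K | k != 0].
Local Notation has1 := [set M : set K | M 1].
Local Notation OK := (ring_of_integers K).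
Local Notation covol := (covol sg).
Local Notation m i := (mult pl i)%:R.
Implicit Types (M : set K) (u : V) (x k : K).

Definition wt u j : R := expR (2 * u (pl j)).
Definition gterm u x : R := expR (- (pi * wnorm sg (wt u) x)).
Definition theta0 M u : R := fine (\esum_(x in M `&` K0) (gterm u x)%:E)%E.
Definition logvol M u : R := ln (covol M) + \sum_i m i * u i.
Definition scaleK k M : set K := [set x * k | x in M].
(** The sign is the one for which scaling the lattice by [k] is undone by the shift of the
    logarithmic coordinates. *)
Definition logK k : V := fun i => - ln (normc (sg (rep i) k)).
(* The factor 1_M(1) selects the inverses of the integral ideals when the theta series is unfolded. *)
Definition weightK M u : R := \1_M (1 : K) * gterm u 1 * expR (- ln (theta0 M u)).

Lemma normc_sg_gt0 j x : x != 0 -> 0 < normc (sg j x).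
Proof. by move=> x0; rewrite normc_gt0 fmorph_eq0. Qed.

Lemma normc_conj (z : C) : normc z^* = normc z.
Proof. by case: z => a b /=; rewrite sqrrN. Qed.

Lemma normc_prod I (s : seq I) (F : I -> C) : normc (\prod_(i <- s) F i) = \prod_(i <- s) normc (F i).
Proof. by rewrite (big_morph (@normc R) normcM (ComplexField.Normc.normc1 R)). Qed.

Lemma ln_prod I (s : seq I) (F : I -> R) : (forall i, 0 < F i) -> ln (\prod_(i <- s) F i) = \sum_(i <- s) ln (F i).
Proof.
move=> F0; elim: s => [|i s IH]; first by rewrite !big_nil ln1.
by rewrite !big_cons lnM ?IH // posrE // prodr_gt0.
Qed.

Lemma normc_sg_rep j x : normc (sg (rep (pl j)) x) = normc (sg j x).
Proof. by have [->|->] := pl_fib (plK (pl j)); rewrite // cjE normc_conj. Qed.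

Lemma wt_gt0 u j : 0 < wt u j. Proof. exact: expR_gt0. Qed.
Lemma wt_cj u j : wt u (cj j) = wt u j. Proof. by rewrite /wt pl_cj. Qed.

Lemma wt_opp u j : wt (vopp u) j = (wt u j)^-1.
Proof. by rewrite /wt /vopp mulrN expRN. Qed.

Lemma wt_prod u : Num.sqrt (\prod_j wt u j) = expR (\sum_i m i * u i).
Proof.
rewrite /wt -(big_morph expR (@expRD R) (@expR0 R)) -mulr_sumr (sum_places pl u).
by rewrite [2 * _]mulrC expRM_natr sqrtr_sqr ger0_norm // expR_ge0.
Qed.

Lemma gterm_ge0 u x : 0 <= gterm u x. Proof. exact: expR_ge0. Qed.

Lemma gterm0 u : gterm u 0 = 1.
Proof.
by rewrite /gterm /wnorm big1 ?mulr0 ?oppr0 ?expR0 // => j _; rewrite rmorph0 ComplexField.Normc.normc0 expr0n mulr0.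
Qed.

Lemma gterm_shift u k x : k != 0 -> gterm (shift u (logK k)) (x * k) = gterm u x.
Proof.
move=> k0; rewrite /gterm /wnorm; congr (expR (- (_ * _))); apply: eq_bigr => j _.
rewrite rmorphM normcM /wt /shift /logK normc_sg_rep mulrDr mulrN expRD expRN mulr_natl expRM_natl.
by rewrite lnK ?posrE ?normc_sg_gt0 //; field; rewrite gt_eqF // normc_sg_gt0.
Qed.

Lemma lattice_theta_split M u : D M ->
  (lattice_theta sg M (wt u) = 1 + \esum_(x in M `&` K0) (gterm u x)%:E)%E /\
  (\esum_(x in M `&` K0) (gterm u x)%:E < +oo)%E.
Proof.
move=> DM; have LM := frac_lat DM; have [M0 _] := lat_sub LM.
have [F _] := lattice_theta_functional e_basis cjK cjE LM (wt_gt0 u) (wt_cj u).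
have E1 : (lattice_theta sg M (wt u) = 1 + \esum_(x in M `&` K0) (gterm u x)%:E)%E.
  rewrite /lattice_theta (esumID [set (0 : K)]) //.
  rewrite (_ : M `&` [set (0 : K)] = [set (0 : K)]); last by apply/seteqP; split=> [x [_ ->]|x ->].
  rewrite esum_set1 ?lee_fin ?gterm_ge0 // -/(gterm u 0) gterm0; congr (_ + esum _ _)%E.
  by apply/seteqP; split=> x [Mx /eqP].
split=> //; apply: le_lt_trans F.
by rewrite E1 leeDr // lee_fin.
Qed.

Lemma theta0E M u : D M -> (theta0 M u)%:E = (\esum_(x in M `&` K0) (gterm u x)%:E)%E.
Proof.
move=> DM; have [_ F] := lattice_theta_split u DM; rewrite /theta0 fineK // ge0_fin_numE // esum_ge0 // => x _.
by rewrite lee_fin gterm_ge0.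
Qed.

Lemma lattice_theta_theta0 M u : D M -> lattice_theta sg M (wt u) = (1 + theta0 M u)%:E.
Proof. by move=> DM; have [-> _] := lattice_theta_split u DM; rewrite EFinD theta0E. Qed.

Lemma theta0_ge0 M u : 0 <= theta0 M u.
Proof. by apply/fine_ge0/esum_ge0 => x _; rewrite lee_fin gterm_ge0. Qed.

Lemma theta0_gt0 M u : D M -> 0 < theta0 M u.
Proof.
move=> DM; have [x Mx x0] := lat_neq0 (frac_lat DM).
rewrite -lte_fin theta0E //; apply: (@lt_le_trans _ _ (gterm u x)%:E); first by rewrite lte_fin expR_gt0.
apply: esum_ge; exists [set x]; first by split=> // _ ->.
by rewrite fsbig_set1.
Qed.

Lemma scaleK_inj k : k != 0 -> injective (fun x => x * k).
Proof. by move=> k0; exact: mulIf. Qed.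

Lemma theta0_scale k M u : k != 0 -> D M -> theta0 (scaleK k M) (shift u (logK k)) = theta0 M u.
Proof.
move=> k0 DM; have Dk : D (scaleK k M) by exact: frac_scale.
apply: EFin_inj; rewrite [LHS](theta0E _ Dk) [RHS](theta0E _ DM).
rewrite (reindex_esum (M `&` K0) _ (fun x => x * k)); last first.
  split=> [x [Mx x0]|x z _ _|_ [[x Mx <-] x0]].
  - by split; [exists x|rewrite /= mulf_neq0].
  - exact: scaleK_inj.
  - by exists x => //; split=> //; apply: contraNneq x0 => ->; rewrite mul0r.
by apply: eq_esum => x _; rewrite gterm_shift.
Qed.

Lemma theta0_dual M u : D M -> 1 + theta0 M u = expR (- logvol M u) * (1 + theta0 (latd M) (vopp u)).
Proof.
move=> DM; have LM := frac_lat DM; have Dd : D (latd M) by exact: frac_latd e_basis _ DM.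
apply: EFin_inj; rewrite [LHS](esym (lattice_theta_theta0 u DM)) EFinM.
have -> := esym (lattice_theta_theta0 (vopp u) Dd).
have [_ ->] := lattice_theta_functional e_basis cjK cjE LM (wt_gt0 u) (wt_cj u).
rewrite (_ : wt (vopp u) = fun j => (wt u j)^-1); last by apply/funext => j; rewrite wt_opp.
congr (_%:E * _)%E.
by rewrite wt_prod /logvol expRN expRD lnK // posrE (covol_gt0 e_basis LM).
Qed.

Lemma logvol_dual M u : D M -> logvol (latd M) (vopp u) = - logvol M u.
Proof.
move=> DM; rewrite /logvol (covol_latd e_basis (frac_lat DM)) lnV ?posrE ?(covol_gt0 e_basis (frac_lat DM)) //.
by rewrite opprD; congr (_ + _); rewrite -sumrN; apply: eq_bigr => i _; rewrite /vopp mulrN.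
Qed.

(** The covolume gets multiplied by the absolute values of all conjugates of [k]; grouped by places,
    their logarithms are what the shift by [logK k] removes. *)
Lemma logvol_scale k M u : k != 0 -> D M -> logvol (scaleK k M) (shift u (logK k)) = logvol M u.
Proof.
move=> k0 DM; have LM := frac_lat DM; rewrite /logvol (covol_scale e_basis k0 LM).
have p0 : 0 < normc (\prod_j sg j k) by rewrite normc_gt0; apply/prodf_neq0 => j _; rewrite fmorph_eq0.
rewrite lnM ?posrE ?(covol_gt0 e_basis LM) // addrAC addrC; congr (_ + _).
rewrite (eq_bigr (fun i => m i * u i + m i * logK k i)) => [|i _]; last by rewrite /shift mulrDr.
rewrite big_split /= addrCA -[RHS]addr0; congr (_ + _).
rewrite normc_prod ln_prod => [|j]; last exact: normc_sg_gt0.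
rewrite (eq_bigr (fun j => ln (normc (sg (rep (pl j)) k)))) => [|j _]; last by rewrite normc_sg_rep.
rewrite (sum_places pl (fun i => ln (normc (sg (rep i) k)))) -big_split /= big1 // => i _.
by rewrite /logK; ring.
Qed.

(** Once k is replaced by 1 / k, the numerators are the terms of the theta series in the common
    denominator. *)
Lemma weightK_sum M u : D M -> (\esum_(k in K0) (weightK (scaleK k M) (shift u (logK k)))%:E = 1)%E.
Proof.
move=> DM; have t0 := theta0_gt0 u DM.
have E1 k : k != 0 -> weightK (scaleK k M) (shift u (logK k)) = (theta0 M u)^-1 * (\1_M k^-1 * gterm u k^-1).
  move=> k0; rewrite /weightK (theta0_scale u k0 DM) expRN lnK ?posrE // mulrC; congr (_ * (_ * _)).
    rewrite !indicE; congr (_%:R); congr nat_of_bool; apply/idP/idP; rewrite !inE.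
      by move=> [x Mx xk]; rewrite -[k^-1]mul1r -xk mulfK.
    by move=> H; exists k^-1 => //; rewrite mulVf.
  by rewrite -{1}(mulVf k0) gterm_shift.
rewrite (eq_esum (b := fun k => ((theta0 M u)^-1%:E * (\1_M k^-1 * gterm u k^-1)%:E)%E)); last by move=> k k0; rewrite E1.
have g0 k : 0 <= \1_M k * gterm u k by rewrite mulr_ge0 ?gterm_ge0 // indicE.
rewrite esumZl ?invr_ge0 ?ltW //; last by move=> k; rewrite lee_fin.
have bij : set_bij K0 K0 (fun k : K => k^-1).
  split=> [k|k l _ _|k] /=; rewrite ?invr_eq0 //; first exact: invr_inj.
  by move=> k0; exists k^-1; rewrite ?invrK //= invr_eq0.
rewrite -(reindex_esum _ _ _ (fun k => (\1_M k * gterm u k)%:E) bij).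
rewrite (_ : esum _ _ = (theta0 M u)%:E); first by rewrite -EFinM mulVf ?gt_eqF.
rewrite theta0E // setIC esum_mkcondr; apply: eq_esum => k _.
by rewrite indicE; case: ifP => _; rewrite ?mul1r ?mul0r.
Qed.

Context {d : measure_display} {T : measurableType d} (mu : {sigma_finite_measure set T -> \bar R}) (X : 'I_r -> T -> R).
Hypothesis mX : forall i, measurable_fun setT (X i).
Local Notation mble := (mble X).

Lemma mble_sum (I : Type) (s : seq I) (f : I -> V -> R) : (forall i, mble (f i)) -> mble (fun u => \sum_(i <- s) f i u).
Proof. by move=> mf; apply: measurable_sum => i; exact: mf. Qed.

Lemma mble_gterm x : mble (fun u => gterm u x).
Proof.
apply: mble_expR; apply: mbleN; apply: mbleM; first exact: mble_cst.
apply: mble_sum => j; apply: mbleM; last exact: mble_cst.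
by apply: mble_expR; apply: mbleM; [exact: mble_cst|exact: mX].
Qed.

Lemma mble_logvol M : mble (logvol M).
Proof.
apply: mbleD; first exact: mble_cst.
by apply: mble_sum => i; apply: mbleM; [exact: mble_cst|exact: mX].
Qed.

Lemma mble_theta0 M : D M -> mble (theta0 M).
Proof.
move=> DM; apply: measurableT_comp; first exact: fine_measurable.
apply: measurable_esum.
- by apply: sub_countable (K_countable e_basis e_span); exact: subset_card_le.
- by move=> x _; apply/measurable_EFinP; exact: mble_gterm.
- by move=> x t _; rewrite lee_fin gterm_ge0.
Qed.

Lemma weightK_weight : weight X D K0 scaleK logK weightK.
Proof.
split=> [M u|M DM|M u DM]; last exact: weightK_sum.
  by rewrite /weightK !mulr_ge0 ?expR_ge0 // indicE.
apply: mbleM; first by apply: mbleM; [exact: mble_cst|exact: mble_gterm].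
apply: mble_expR; apply: mbleN; apply: measurableT_comp; first exact: measurable_ln.
exact: mble_theta0.
Qed.

Lemma theta0_admissible : admissible X D K0 scaleK logK theta0.
Proof.
split=> [M u|M DM|k M u k0 DM]; [exact: theta0_ge0|exact: mble_theta0|exact: theta0_scale].
Qed.

Hypothesis X_prod : forall g : 'I_r -> R -> R, (forall i, measurable_fun setT (g i)) -> (forall i y, 0 <= g i y) ->
  (\int[mu]_t (\prod_i g i (X i t))%:E = \prod_(i < r) \int[@lebesgue_measure R]_y (g i y)%:E)%E.

Let prod_EFin (f : 'I_r -> \bar R) : (forall i, f i \is a fin_num) -> (\prod_(i < r) f i = (\prod_i fine (f i))%:E)%E.
Proof.
move=> ff; apply: (big_ind2 (fun a b => a = b%:E)) => // [_ a _ b -> ->|i _]; first by rewrite EFinM.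
by rewrite fineK.
Qed.

(** The theta series cancels the denominator of the weight, and the Gaussian at x = 1 that remains
    is a product over the places. *)
Lemma orbital_theta0 s : 0 < s ->
  orbital mu X D weightK (fun M u => (theta0 M u * expR (s * logvol M u))%R) =
  ((\prod_i local_integral (mult pl i) s)%R%:E * \esum_(M in D `&` has1) (expR (s * ln (covol M)))%R%:E)%E.
Proof.
move=> s0; pose g i (y : R) := local_density (mult pl i) y * expR (s * (m i * y)).
have g0 i y : 0 <= g i y by rewrite mulr_ge0 ?expR_ge0.
have mg i : measurable_fun setT (g i) by exact: measurable_local.
have P0 : 0 <= \prod_i local_integral (mult pl i) s by rewrite prodr_ge0 // => i _; apply: Rintegral_ge0 => y _; exact: g0.
rewrite esum_mkcondr -esumZl //; last by move=> M; case: ifP; rewrite // lee_fin expR_ge0.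
apply: eq_esum => M DM; rewrite /J /weightK indicE; have [M1|M1] := boolP (1 \in M); last first.
  have -> : (M \in has1) = false by apply/negbTE; apply: contra M1; rewrite !inE.
  by under eq_integral do rewrite !mul0r; rewrite integral0 mule0.
have -> : (M \in has1) by move: M1; rewrite !inE.
transitivity (\int[mu]_t (expR (s * ln (covol M)) * \prod_i g i (X i t))%:E)%E.
  apply: eq_integral => t _; congr EFin; set u := (fun i => X i t).
  rewrite mul1r expRN lnK ?posrE ?theta0_gt0 // mulrA mulfVK ?gt_eqF ?theta0_gt0 // /logvol mulrDr expRD mulrCA; congr (_ * _).
  rewrite big_split /= /gterm; congr (_ * _).
    rewrite /local_density -(big_morph expR (@expRD R) (@expR0 R)); congr expR.
    rewrite sumrN; congr (- _); rewrite /wnorm /wt mulr_sumr.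
    rewrite (eq_bigr (fun j => pi * expR (2 * u (pl j)))) => [|j _]; last first.
      by rewrite rmorph1 ComplexField.Normc.normc1 expr1n mulr1.
    by rewrite (sum_places pl (fun i => pi * expR (2 * u i))); apply: eq_bigr => i _; rewrite mulrCA mulrA.
  by rewrite mulr_sumr (big_morph expR (@expRD R) (@expR0 R)).
under eq_integral do rewrite EFinM.
rewrite ge0_integralZl_EFin ?expR_ge0 //; last 2 first.
- by move=> t _; rewrite lee_fin prodr_ge0.
- apply/measurable_EFinP; apply: measurable_prod => i _; exact: measurableT_comp.
rewrite X_prod // prod_EFin; first by rewrite muleC.
move=> i; rewrite ge0_fin_numE; first by apply: local_fin => //; exact: mult_gt0 plK pl_fib i.
by apply: integral_ge0 => y _; rewrite lee_fin g0.
Qed.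

Lemma ideal_sum (s : R) : (\esum_(M in D `&` has1) (expR (s * ln (covol M)))%:E =
  (expR (s * ln (covol OK)))%:E * \esum_(I in nonzero_ideals K) (expR (- s * ln (ideal_norm I)%:R))%:E)%E.
Proof.
have cOK := covol_gt0 e_basis (OK_lat e_basis e_span).
have fI I : nonzero_ideals K I -> frac sg I /\ I `<=` OK.
  by move=> [Ii In]; split; [exact: ideal_frac e_basis e_span _ Ii In|case: Ii].
rewrite -esumZl ?expR_ge0 //.
rewrite (reindex_esum (nonzero_ideals K) _ (@inv K)); last first.
  split=> [I /fI [If IO]|I J|M [DM M1]].
  - by split; [exact: frac_inv e_basis e_span _ If|apply/inv_has1].
  - by rewrite !inE => /fI[If _] /fI[Jf _] E; rewrite -(invK e_basis e_span If) E (invK e_basis e_span Jf).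
  - have Mf := frac_inv e_basis e_span DM; exists (inv M); last exact: invK e_basis e_span _ DM.
    by apply: (frac_ideal Mf); apply/inv_has1; rewrite (invK e_basis e_span DM).
apply: eq_esum => I /fI[If IO]; rewrite -EFinM -expRD; congr (expR _)%:E.
have E := ideal_norm_covol e_basis e_span If IO.
have cI := covol_gt0 e_basis (frac_lat (frac_inv e_basis e_span If)).
have N0 : 0 < (ideal_norm I)%:R :> R by rewrite -(pmulr_lgt0 _ cI) E.
by rewrite -E lnM ?posrE //; ring.
Qed.

Variable zeta : C^o -> C^o.
Hypothesis zetaP : is_dedekind_zeta K zeta.

Lemma zeta_real (s : R) : 1 < s -> zeta s%:C = (Re (zeta s%:C))%:C /\
  (\esum_(I in nonzero_ideals K) (expR (- s * ln (ideal_norm I)%:R))%:E = (Re (zeta s%:C))%:E)%E.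
Proof.
move=> s1; have [H _ _] := zetaP; have {}H := H s%:C s1.
pose a (I : set_type (nonzero_ideals K)) := expR (- s * ln (ideal_norm (set_val I))%:R).
have {}H : partial_sum (fun I => (a I)%:C : C^o) @ totally --> zeta s%:C.
  suff -> : (fun I => (a I)%:C : C^o) = fun I => nat_cpow (ideal_norm (set_val I)) (- s%:C) by exact: H.
  by apply/funext => I; rewrite /nat_cpow -rmorphN -rmorphM cexpR.
have [E1 E2] := totally_esum (fun I => expR_ge0 _) H; split=> //; rewrite -E2.
rewrite (reindex_esum [set: set_type (nonzero_ideals K)] _ set_val) //.
Qed.

Hypothesis (x_shift : forall a, exists2 phi : T -> T, preserving mu phi & forall t i, X i (phi t) = X i t + a i).
Hypothesis (x_opp : exists2 nu : T -> T, preserving mu nu & forall t i, X i (nu t) = - X i t).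

Lemma zeta_orbital (s : R) : 1 < s -> orbital mu X D weightK (fun M u => (theta0 M u * expR (s * logvol M u))%R) =
  (\prod_i local_integral (mult pl i) s * expR (s * ln (covol OK)) * Re (zeta s%:C))%:E.
Proof.
move=> s1; rewrite orbital_theta0 ?(lt_trans _ s1) // ideal_sum (proj2 (zeta_real s1)) -!EFinM.
by rewrite mulrA.
Qed.

Let l : R := n%:R.

(** The translation chosen is 1 at every place; it raises [logvol] by the sum of the local degrees,
    whence l = n. *)
Lemma zeta_completed : exists L : C -> C, [/\ forall z, cdiffable L z, forall s : R, L (1 - s)%:C = L s%:C &
  forall s : R, 1 < s -> L s%:C = ((expR (l / 2 - s * l) + expR (s * l - l / 2) - (expR (l / 2) + expR (- (l / 2)))) *
    \prod_i local_integral (mult pl i) s * expR (s * ln (covol OK)))%:C * zeta s%:C].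
Proof.
have cK : countable K0 by apply: sub_countable (K_countable e_basis e_span); exact: subset_card_le.
have [h [hD hE]] := @esum_nat R _ _ (frac_countable e_basis e_span).
have tsc k M u : k != 0 -> D M -> logvol (scaleK k M) (shift u (logK k)) = logvol M u by move=> k0 DM; exact: logvol_scale.
have sK (k : K) M : k != 0 -> scaleK k^-1 (scaleK k M) = M.
  move=> k0; apply/seteqP; split=> [_ [_ [x Mx <-] <-]|x Mx]; first by rewrite mulfK.
  by exists (x * k); [exists x|rewrite mulfK].
have [||||||||||||||L [L1 L2 L3]] := @completed_function R d T mu r X x_shift x_opp _ D _ K0 scaleK (fun k => k^-1) logK cK
 _ _ _ _ _ (@latd K) _ _ _ h hD hE theta0 logvol (fun=> 1) l weightK weightK_weight theta0_admissible.
- by move=> k; rewrite /= invr_eq0.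
- by move=> k _; rewrite invrK.
- by move=> k M k0 DM; exact: frac_scale k0 DM.
- by move=> k M k0 _; exact: sK.
- move=> k k0; apply/funext => i; rewrite /logK /vopp fmorphV normcV lnV // posrE.
  exact: normc_sg_gt0.
- by move=> M DM; exact: frac_latd e_basis _ DM.
- by move=> M DM; exact: latdK e_basis _ (frac_lat DM).
- by move=> k M k0 DM; exact: latd_scale k0.
- by move=> M _; exact: mble_logvol.
- by move=> k M u k0 DM; exact: tsc.
- move=> M u DM; rewrite /logvol -addrA; congr (_ + _).
  rewrite (eq_bigr (fun i => m i * u i + m i)) => [|i _]; last by rewrite /shift mulrDr mulr1.
  by rewrite big_split /=; congr (_ + _); rewrite /l -natr_sum mult_sum.
- by move=> M u DM; exact: logvol_dual.
- by move=> M u DM; exact: theta0_dual.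
- by move=> s s1; rewrite zeta_orbital // ltry.
exists L; split=> // s s1; rewrite L3 // zeta_orbital // [in RHS](proj1 (zeta_real s1)) -rmorphM; congr (_%:C).
by rewrite /= !mulrA.
Qed.

End ZetaIntegral.

Theorem dedekind_zeta_completed (R : realType) (K : fieldExtType rat) (zeta : R[i]^o -> R[i]^o) (d := `|ratr (discriminant K) : R|) (n := \dim {:K}) :
  is_dedekind_zeta K zeta -> exists r (m : 'I_r -> nat) (L : R[i] -> R[i]),
  [/\ 0 < d, (forall i, m i = 1%N \/ m i = 2%N) /\ (\sum_i m i = n)%N, forall z, cdiffable L z, forall s : R, L (1 - s)%:C = L s%:C &
  forall s : R, 1 < s -> L s%:C = ((expR (n%:R / 2 - s * n%:R) + expR (s * n%:R - n%:R / 2) - (expR (n%:R / 2) + expR (- (n%:R / 2)))) *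
    \prod_i local_integral (m i) s * expR (s * (ln d / 2)))%:C * zeta s%:C].
Proof.
have [sg [e [cj [e_basis e_span cjK cjE]]]] := embeddings_exist R K.
have [r [pl [rep [plK pl_cj pl_fib]]]] := places_exist cjK.
have [dp [T [mu [X [mX x_shift x_opp X_prod]]]]] := @coordinate_space R r.
move=> zP; have cOK := covol_gt0 e_basis (OK_lat e_basis e_span).
have [L [L1 L2 L3]] := zeta_completed e_basis e_span cjK cjE plK pl_cj pl_fib mX X_prod zP x_shift x_opp.
have dE := discriminant_covol e_basis e_span.
have lnE : ln d / 2 = ln (covol sg (ring_of_integers K)).
  by rewrite /d dE lnXn // -[_ *+ 2]mulr_natr mulfK // pnatr_eq0.
exists r, (mult pl), L; rewrite lnE /d dE exprn_gt0 //; split=> //.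
by split=> [i|]; [exact: (mult12 plK pl_fib)|exact: mult_sum].
Qed.

(** * Numerical bounds for the logarithmic derivative of the gamma factors *)

Section ElementaryBounds.
Context {R : realType}.
Implicit Types (x y t h : R).

Lemma le_from0 (f f' : R -> R) x : 0 <= x -> (forall t, 0 <= t <= x -> is_derive t 1 f (f' t)) ->
  (forall t, 0 <= t <= x -> 0 <= f' t) -> f 0 <= f x.
Proof.
move=> x0 df f'0; have [t|| c ct E] := @MVT_segment R f f' 0 x x0.
- by rewrite in_itv /= => /andP[t0 tx]; apply: df; rewrite !ltW.
- apply: continuous_in_subspaceT => t; rewrite inE /= in_itv /= => /df[dt _].
  exact/differentiable_continuous/derivable1_diffP.
by rewrite -subr_ge0 E subr0 mulr_ge0 // f'0.
Qed.

(** The difference has derivative t^8 / (1 + t^2); for the upper bound below it is t^10 / (1 +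
    t^2). *)
Lemma atan_ge x : 0 <= x -> x - x ^+ 3 / 3 + x ^+ 5 / 5 - x ^+ 7 / 7 <= atan x.
Proof.
move=> x0; rewrite -subr_ge0.
pose f t := atan t - (t - t ^+ 3 / 3 + t ^+ 5 / 5 - t ^+ 7 / 7).
have -> : 0 = f 0 by rewrite /f atan0 !expr0n /= !mul0r; ring.
apply: (@le_from0 f (fun t => (1 + t ^+ 2)^-1 - (1 - t ^+ 2 + t ^+ 4 - t ^+ 6))) => [//|t _|t /andP[t0 tx]].
  apply: is_deriveB; apply: is_derive_eq.
  by rewrite /GRing.scale /=; field.
have d0 : 0 < 1 + t ^+ 2 by rewrite ltr_wpDr ?sqr_ge0.
rewrite subr_ge0 -[X in _ <= X]mul1r ler_pdivlMr //.
have -> : (1 - t ^+ 2 + t ^+ 4 - t ^+ 6) * (1 + t ^+ 2) = 1 - t ^+ 8 by ring.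
by rewrite gerBl exprn_ge0.
Qed.

Lemma atan_le x : 0 <= x -> atan x <= x - x ^+ 3 / 3 + x ^+ 5 / 5 - x ^+ 7 / 7 + x ^+ 9 / 9.
Proof.
move=> x0; rewrite -subr_ge0.
pose f t := t - t ^+ 3 / 3 + t ^+ 5 / 5 - t ^+ 7 / 7 + t ^+ 9 / 9 - atan t.
have -> : 0 = f 0 by rewrite /f atan0 !expr0n /= !mul0r; ring.
apply: (@le_from0 f (fun t => 1 - t ^+ 2 + t ^+ 4 - t ^+ 6 + t ^+ 8 - (1 + t ^+ 2)^-1)) => [//|t _|t /andP[t0 tx]].
  apply: is_deriveB; apply: is_derive_eq.
  by rewrite /GRing.scale /=; field.
have d0 : 0 < 1 + t ^+ 2 by rewrite ltr_wpDr ?sqr_ge0.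
rewrite subr_ge0 -[X in X <= _]mul1r ler_pdivrMr //.
have -> : (1 - t ^+ 2 + t ^+ 4 - t ^+ 6 + t ^+ 8) * (1 + t ^+ 2) = 1 + t ^+ 10 by ring.
by rewrite lerDl exprn_ge0.
Qed.

(** The right side has tangent 1, and the bounds 0 <= atan x <= x place it in (- pi / 2, pi / 2),
    where the tangent is injective. *)
Lemma machin : pi / 4 = 4 * atan 5^-1 - atan 239^-1 :> R.
Proof.
pose a := atan (5^-1 : R); pose b := atan (239^-1 : R); set X := _ - _.
have two : pi / 2 >= 1 :> R by exact: pihalf_ge1.
have abd (x : R) : - (pi / 2) < atan x < pi / 2 by rewrite atan_gtNpi2 atan_ltpi2.
have ca : 0 < cos a by exact: cos_gt0_pihalf (abd _).
have cb : 0 < cos b by exact: cos_gt0_pihalf (abd _).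
have sa : sin a = cos a / 5.
  by have : tan a = 5^-1 by [exact: atanK]; rewrite /tan => /(canRL (divfK (lt0r_neq0 ca))) ->; rewrite mulrC.
have sb : sin b = cos b / 239.
  by have : tan b = 239^-1 by [exact: atanK]; rewrite /tan => /(canRL (divfK (lt0r_neq0 cb))) ->; rewrite mulrC.
have XE : X = a *+ 2 *+ 2 - b by rewrite /X -/a -/b -mulrnA mulr_natl.
(* (5 + i)^4 = 476 + 480 i gives the sine and cosine of 4 a as multiples of cos(a)^4 / 625. *)
have sX : sin X = cos a ^+ 4 * cos b * (480 / 625 - 476 / 625 / 239).
  by rewrite XE sinB !mulr2n !(sinD, cosD) sa sb; field.
have cX : cos X = cos a ^+ 4 * cos b * (476 / 625 + 480 / 625 / 239).
  by rewrite XE cosB !mulr2n !(sinD, cosD) sa sb; field.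
have k0 : 0 < 476 / 625 + 480 / 625 / 239 :> R by lra.
have tX : tan X = 1.
  rewrite /tan sX cX (_ : 480 / 625 - 476 / 625 / 239 = 476 / 625 + 480 / 625 / 239); last by field.
  have := mulr_gt0 (mulr_gt0 (exprn_gt0 4 ca) cb) k0; move: (_ * _ * (_ + _)) => p p0.
  by rewrite divff // gt_eqF.
have i0 (k : nat) : 0 <= k%:R^-1 :> R by rewrite invr_ge0.
have a0 : 0 <= a by rewrite -atan0 le_atan.
have b0 : 0 <= b by rewrite -atan0 le_atan.
have lt1 (x : R) : 0 <= x -> atan x <= x.
  move=> x0; rewrite -subr_ge0; pose f (t : R) := t - atan t.
  have -> : 0 = f 0 by rewrite /f atan0 subr0.
  apply: (@le_from0 f (fun t => 1 - (1 + t ^+ 2)^-1)) => // t _.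
  by rewrite subr_ge0 invf_le1 ?ltr_wpDr ?sqr_ge0 // lerDl sqr_ge0.
have a1 : a <= 5^-1 by exact: lt1.
have b1 : b <= 239^-1 by exact: lt1.
have b2 : 239^-1 <= 5^-1 :> R by lra.
have X1 : - (pi / 2) < X.
  by rewrite XE; clear -two a0 a1 b0 b1 b2; clearbody a b; lra.
have X2 : X < pi / 2.
  by rewrite XE; clear -two a0 a1 b0 b1 b2; clearbody a b; lra.
clear -X1 X2 tX; clearbody X.
have Xin : X \in `](- (pi / 2)), (pi / 2)[.
  by rewrite in_itv; apply/andP; split; [exact: X1|exact: X2].
by have := tanK Xin; rewrite tX atan1.
Qed.

(** Decimals are spelled in groups of three digits, here and below: the bounds are 3.141591 and
    3.141593. *)
Lemma pi_bounds : 3 + 141 / 1000 + 591 / 1000 ^+ 2 <= (pi : R) <= 3 + 141 / 1000 + 593 / 1000 ^+ 2.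
Proof.
have i5 : 0 <= 5^-1 :> R by rewrite invr_ge0 ler0n.
have i239 : 0 <= 239^-1 :> R by rewrite invr_ge0 ler0n.
have := atan_ge i5; have := atan_le i5; have := atan_ge i239; have := atan_le i239; have := machin.
move: (atan 5^-1) (atan 239^-1) => a b Hm; rewrite !exprVn => h1 h2 h3 h4.
have e1 : pi = 16 * a - 4 * b :> R by lra.
have h1' : b <= 4 / 1000 + 184 / 1000 ^+ 2 + 77 / 1000 ^+ 3 by apply: (le_trans h1); lra.
have h2' : 4 / 1000 + 184 / 1000 ^+ 2 + 76 / 1000 ^+ 3 <= b by apply: le_trans h2; lra.
have h3' : a <= 197 / 1000 + 395 / 1000 ^+ 2 + 562 / 1000 ^+ 3 by apply: (le_trans h3); lra.
have h4' : 197 / 1000 + 395 / 1000 ^+ 2 + 504 / 1000 ^+ 3 <= a by apply: le_trans h4; lra.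
by rewrite e1; clear -h1' h2' h3' h4'; apply/andP; split; lra.
Qed.

(** Horner form of the exponential series from its k-th term on, divided by that term; [c] stands
    for the tail after [j] terms, 0 in lower bounds and 2 in upper ones. *)
Fixpoint exp_trunc x (k j : nat) (c : R) : R := if j is j'.+1 then 1 + x / k.+1%:R * exp_trunc x k.+1 j' c else c.

Let psum x (K : nat) := series (exp_coeff x) K.

Lemma psumS x K : psum x K.+1 = psum x K + x ^+ K / K`!%:R.
Proof. by rewrite /psum /series /= big_nat_recr. Qed.

Lemma exp_truncE x k j c : x ^+ k / k`!%:R * exp_trunc x k j c =
  \sum_(k <= i < k + j) x ^+ i / i`!%:R + x ^+ (k + j) / (k + j)`!%:R * c.
Proof.
elim: j k => [|j IH] k /=; first by rewrite addn0 big_geq // add0r.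
rewrite mulrDr mulr1 addnS -addSn [in RHS]big_ltn ?leq_addr // -addrA -IH; congr (_ + _).
by rewrite mulrA factS natrM exprSr invfM; congr (_ * _); ring.
Qed.

Lemma expR_ge_trunc x K : 0 <= x -> exp_trunc x 0 K 0 <= expR x.
Proof.
move=> x0; have := exp_truncE x 0 K 0; rewrite expr0 fact0 divr1 mul1r mulr0 addr0 add0n => ->.
apply: nondecreasing_cvgn_le; last exact: is_cvg_series_exp_coeff.
by apply: nondecreasing_series => n _ _; exact: exp_coeff_ge0.
Qed.

(* The tail of the series from K on is dominated by twice its first term. *)
Lemma expR_le_trunc x K : 0 <= x -> 2 * x <= K.+1%:R -> expR x <= exp_trunc x 0 K 2.
Proof.
move=> x0 xK; have := exp_truncE x 0 K 2; rewrite expr0 fact0 divr1 mul1r add0n => ->.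
have H j : psum x (K + j) + x ^+ (K + j) / (K + j)`!%:R * 2 <= psum x K + x ^+ K / K`!%:R * 2.
  elim: j => [|j]; first by rewrite addn0.
  apply: le_trans; rewrite addnS psumS -addrA lerD2l.
  set i := (K + j)%N; have i0 : 0 < i`!%:R :> R by rewrite ltr0n fact_gt0.
  have j0 : 0 < i.+1%:R :> R by rewrite ltr0n.
  have xi : 2 * x <= i.+1%:R by apply: (le_trans xK); rewrite ler_nat ltnS leq_addr.
  have p0 : 0 <= x ^+ i / i`!%:R by rewrite divr_ge0 ?exprn_ge0 // ltW.
  set p := x ^+ i / _ in p0 *.
  have -> : x ^+ i.+1 / i.+1`!%:R * 2 = p * (2 * x / i.+1%:R) by rewrite factS natrM invfM exprSr /p; ring.
  have -> : p * 2 = p + p * 1 by ring.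
  by rewrite lerD2l ler_wpM2l // ler_pdivrMr // mul1r.
apply: limr_le; first exact: is_cvg_series_exp_coeff.
near=> n; have Kn : (K <= n)%N by near: n; exists K.
rewrite -/(psum x n) -(subnKC Kn); apply: le_trans (H (n - K)%N).
by rewrite lerDl mulr_ge0 // divr_ge0 ?exprn_ge0.
Unshelve. all: by end_near. Qed.

Let dln_ratio (s : R) : 0 <= s < 1 -> is_derive s 1 (fun s => ln (1 + s) - ln (1 - s)) (2 / (1 - s ^+ 2)).
Proof.
move=> /andP[s0 s1]; have p1 : 0 < 1 - s by lra.
have p2 : 0 < 1 + s by lra.
have d1 := @is_derive1_comp R (@ln R) (fun s => 1 + s) s _ _ (is_derive1_ln p2) (is_deriveD (is_derive_cst (1 : R) s 1) (is_derive_id s 1)).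
have d2 := @is_derive1_comp R (@ln R) (fun s => 1 - s) s _ _ (is_derive1_ln p1) (is_deriveB (is_derive_cst (1 : R) s 1) (is_derive_id s 1)).
apply: (@is_derive_eq _ _ _ _ _ _ _ _ (is_deriveB d1 d2)).
have q1 : 1 - s != 0 by rewrite gt_eqF.
have q2 : 1 + s != 0 by rewrite gt_eqF.
rewrite (_ : 1 - s ^+ 2 = (1 - s) * (1 + s)); last by ring.
by field; rewrite q1 q2.
Qed.

Let ratio_lnE (t : R) : 0 <= t < 1 -> ln ((1 + t) / (1 - t)) = ln (1 + t) - ln (1 - t).
Proof. by move=> /andP[t0 t1]; rewrite ln_div ?posrE ?subr_gt0 // ltr_wpDr. Qed.

(** Two terms of the series 2 (t + t^3 / 3 + t^5 / 5 + ...). In [ln_ratio_le] the terms from t^3 on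
    are replaced by a geometric series. *)
Lemma ln_ratio_ge (t : R) : 0 <= t < 1 -> 2 * t + 2 / 3 * t ^+ 3 <= ln ((1 + t) / (1 - t)).
Proof.
move=> t01; have [t0 t1] := andP t01; rewrite ratio_lnE // -subr_ge0.
pose f (t : R) := ln (1 + t) - ln (1 - t) - (2 * t + 2 / 3 * t ^+ 3).
have f0 : 0 = f 0 by rewrite /f addr0 subr0 ln1 expr0n /=; ring.
rewrite [X in X <= _]f0; apply: (@le_from0 f (fun t => 2 / (1 - t ^+ 2) - (2 + 2 * t ^+ 2)) t t0) => s /andP[s0 st].
  apply: is_deriveB; first by apply: dln_ratio; rewrite s0 (le_lt_trans st).
  by apply: is_derive_eq; rewrite /GRing.scale /=; field.
have s1 : 0 < 1 - s ^+ 2 by nra.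
by rewrite subr_ge0 ler_pdivlMr //; have := sqr_ge0 (s ^+ 2); nra.
Qed.

Lemma ln_ratio_le (t : R) : 0 <= t < 1 -> ln ((1 + t) / (1 - t)) <= 2 * t + 2 / 3 * (t ^+ 3 / (1 - t ^+ 2)).
Proof.
move=> t01; have [t0 t1] := andP t01; rewrite ratio_lnE // -subr_ge0.
pose f (t : R) := 2 * t + 2 / 3 * (t ^+ 3 / (1 - t ^+ 2)) - (ln (1 + t) - ln (1 - t)).
have f0 : 0 = f 0 by rewrite /f addr0 subr0 ln1 expr0n /=; ring.
rewrite [X in X <= _]f0; apply: (@le_from0 f (fun t => 2 + 2 / 3 * ((3 * t ^+ 2 - t ^+ 4) / (1 - t ^+ 2) ^+ 2) - 2 / (1 - t ^+ 2)) t t0) => s /andP[s0 st];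
  have s1 : 0 < 1 - s ^+ 2 by nra.
  apply: is_deriveB; last by apply: dln_ratio; rewrite s0 (le_lt_trans st).
  have n0 : 1 - s ^+ 2 != 0 by rewrite gt_eqF.
  have dq : is_derive s 1 (fun t : R => 1 - t ^+ 2) (- (2 * s)).
    by apply: is_derive_eq; rewrite /GRing.scale /=; ring.
  have dV := is_deriveV (f := fun t : R => 1 - t ^+ 2) n0 dq.
  by apply: is_derive_eq; rewrite /GRing.scale /=; field.
have -> : 2 + 2 / 3 * ((3 * s ^+ 2 - s ^+ 4) / (1 - s ^+ 2) ^+ 2) - 2 / (1 - s ^+ 2) = 4 / 3 * s ^+ 4 / (1 - s ^+ 2) ^+ 2.
  by field; rewrite gt_eqF.
by rewrite divr_ge0 ?sqr_ge0 // mulr_ge0 // exprn_ge0.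
Qed.

End ElementaryBounds.

(** * Digamma bounds from the recurrence; [P] stands for the digamma function *)

Section DigammaBounds.
Context {R : realType}.
Variable P : R -> R.
Hypotheses (P_rec : forall y, 0 < y -> P (y + 1) = P y + y^-1) (P_le : forall y, 0 < y -> P y <= ln y)
  (P_ge : forall y, 0 < y -> ln y - y^-1 <= P y).

Lemma P_sum y N : 0 < y -> P (y + N%:R) = P y + \sum_(k < N) (y + k%:R)^-1.
Proof.
move=> y0; elim: N => [|N IH]; first by rewrite addr0 big_ord0 addr0.
by rewrite big_ord_recr /= addrA -IH -P_rec ?natr1 -?addrA ?natr1 // ltr_wpDr.
Qed.

(* Comparison principle: a difference that is monotone along y + N and tends to 0 has a sign. *)
Lemma compare_at_infinity (f : R -> R) (c y : R) : 0 < y -> 0 <= c -> (forall z, y <= z -> f z <= f (z + 1)) ->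
  (forall z, y <= z -> f z <= c / z) -> f y <= 0.
Proof.
move=> y0 c0 fS fc; have fN N : f y <= f (y + N%:R).
  elim: N => [|N IH]; first by rewrite addr0.
  by apply: (le_trans IH); rewrite -natr1 addrA; apply: fS; rewrite lerDl.
apply/ler_addgt0Pr => e e0; rewrite add0r.
have [N NE] : exists N : nat, c / e < N%:R.
  by exists (Num.truncn (c / e)).+1; rewrite truncnS_gt.
apply: (le_trans (fN N)); apply: (le_trans (fc _ _)); first by rewrite lerDl.
rewrite ler_pdivrMr; last by rewrite ltr_wpDr.
rewrite ltr_pdivrMr // in NE; have := mulr_gt0 e0 y0; rewrite mulrDr [e * N%:R]mulrC; lra.
Qed.

(** The start of the asymptotic expansion. Comparing z with z + 1 turns the claim into a lower bound
    for ln((z + 1) / z). *)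
Lemma digamma_ge y : 0 < y -> ln y - (2 * y)^-1 - (12 * y ^+ 2)^-1 <= P y.
Proof.
move=> y0; rewrite -subr_le0; pose f z := ln z - (2 * z)^-1 - (12 * z ^+ 2)^-1 - P z.
rewrite -/(f y); apply: (@compare_at_infinity f 1 y) => // z yz; have z0 : 0 < z by exact: lt_le_trans yz.
  (* For this [t] one has (1 + t) / (1 - t) = (z + 1) / z, so that the series in [t] converges
     fast. *)
  rewrite /f P_rec //; pose t := (2 * z + 1)^-1.
  have d0 : 0 < 2 * z + 1 by lra.
  have t0 : 0 < t by rewrite invr_gt0.
  have t1 : t < 1 by rewrite invf_lt1 //; lra.
  have zE : z = (1 - t) / (2 * t) by rewrite /t; field; rewrite gt_eqF.
  have := @ln_ratio_ge R t; rewrite (ltW t0) t1 => /(_ isT).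
  have -> : (1 + t) / (1 - t) = (z + 1) / z by rewrite /t; field; rewrite !gt_eqF //; lra.
  rewrite ln_div ?posrE ?ltr_wpDr //.
  suff E : z^-1 <= 2 * t + 2 / 3 * t ^+ 3 + (2 * z)^-1 + (12 * z ^+ 2)^-1 - (2 * (z + 1))^-1 - (12 * (z + 1) ^+ 2)^-1 by lra.
  rewrite -subr_ge0.
  have -> : 2 * t + 2 / 3 * t ^+ 3 + (2 * z)^-1 + (12 * z ^+ 2)^-1 - (2 * (z + 1))^-1 - (12 * (z + 1) ^+ 2)^-1 - z^-1 =
     (2 / 3) * t ^+ 5 * (1 + t ^+ 2) / (1 - t ^+ 2) ^+ 2.
    by rewrite zE; field; rewrite !gt_eqF //; nra.
  by rewrite divr_ge0 ?sqr_ge0 // !mulr_ge0 ?exprn_ge0 ?ltW // ltr_wpDr // sqr_ge0.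
have := P_ge z0; rewrite /f mul1r; have : 0 < (2 * z)^-1 by rewrite invr_gt0 mulr_gt0.
have : 0 < (12 * z ^+ 2)^-1 by rewrite invr_gt0 mulr_gt0 ?exprn_gt0.
by lra.
Qed.

(** Centred at y + 1 / 2, the expansion has no term in 1 / y. *)
Lemma digamma_half_le y : 1 <= y -> P (y + 2^-1) <= ln y + (24 * y ^+ 2)^-1.
Proof.
move=> y1; rewrite -subr_le0; pose f z := P (z + 2^-1) - (ln z + (24 * z ^+ 2)^-1).
have y0 : 0 < y by lra.
rewrite -/(f y); apply: (@compare_at_infinity f 1 y) => // z yz; have z0 : 0 < z by exact: lt_le_trans yz.
  rewrite /f addrAC P_rec; last by rewrite addr_gt0.
  pose t := (2 * z + 1)^-1.
  have d0 : 0 < 2 * z + 1 by lra.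
  have t0 : 0 < t by rewrite invr_gt0.
  have t1 : t < 1 by rewrite invf_lt1 //; lra.
  have zE : z = (1 - t) / (2 * t) by rewrite /t; field; rewrite gt_eqF.
  have := @ln_ratio_le R t; rewrite (ltW t0) t1 => /(_ isT).
  have -> : (1 + t) / (1 - t) = (z + 1) / z by rewrite /t; field; rewrite !gt_eqF //; lra.
  rewrite ln_div ?posrE ?ltr_wpDr //.
  suff E : 2 * t + 2 / 3 * (t ^+ 3 / (1 - t ^+ 2)) + (24 * (z + 1) ^+ 2)^-1 <= (z + 2^-1)^-1 + (24 * z ^+ 2)^-1 by lra.
  rewrite -subr_ge0.
  have -> : (z + 2^-1)^-1 + (24 * z ^+ 2)^-1 - (2 * t + 2 / 3 * (t ^+ 3 / (1 - t ^+ 2)) + (24 * (z + 1) ^+ 2)^-1) =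
     (2 / 3) * t ^+ 5 / (1 - t ^+ 2) ^+ 2.
    by rewrite zE; field; rewrite !gt_eqF //; nra.
  by rewrite divr_ge0 ?sqr_ge0 // !mulr_ge0 ?exprn_ge0 ?ltW.
have z2 : 0 < z + 2^-1 by rewrite addr_gt0.
have h1 := P_le z2; rewrite /f mul1r; have : 0 < (24 * z ^+ 2)^-1 by rewrite invr_gt0 mulr_gt0 ?exprn_gt0.
suff : ln (z + 2^-1) - ln z <= z^-1 by lra.
rewrite -ln_div ?posrE // (_ : (z + 2^-1) / z = 1 + (2 * z)^-1); last by field; rewrite gt_eqF.
have w0 : 0 < (2 * z)^-1 by rewrite invr_gt0 mulr_gt0.
apply: (le_trans (le_ln1Dx _)); first by lra.
by rewrite lef_pV2 ?posrE ?mulr_gt0 //; lra.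
Qed.

End DigammaBounds.

(** * Numerical bounds at 1/4 and 1/2 *)

Section DigammaValues.

(** Iterated successors, so that simplification turns the denominators of the ten-term sums below
    into numerals. *)
Let iter4 k : (iter k (fun n => n.+4) 1 = 4 * k + 1)%N.
Proof. by elim: k => //= k ->; lia. Qed.

Let iter2 k : (iter k (fun n => n.+2) 1 = 2 * k + 1)%N.
Proof. by elim: k => //= k ->; lia. Qed.

Context {R : realType}.

Lemma exp_trunc_le (x : R) k j c C D : 0 <= x -> exp_trunc x k.+1 j c <= C -> 1 + x / k.+1%:R * C <= D ->
  exp_trunc x k j.+1 c <= D.
Proof. by move=> x0 h; apply: le_trans; rewrite /= lerD2l ler_wpM2l // divr_ge0. Qed.

Lemma exp_trunc_ge (x : R) k j c C D : 0 <= x -> C <= exp_trunc x k.+1 j c -> D <= 1 + x / k.+1%:R * C ->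
  D <= exp_trunc x k j.+1 c.
Proof. by move=> x0 h H; apply: (le_trans H); rewrite /= lerD2l ler_wpM2l // divr_ge0. Qed.

(** An upper bound for the sum of 4 / (4 k + 1) over k < 10 plus the two corrections of [digamma_ge]
    at 10 + 1 / 4. Likewise [qb] is a lower bound for the sum of 2 / (2 k + 1) minus the correction
    of [digamma_half_le] at 10. *)
Let qa : R := 6 + 554 / 1000 + 731 / 1000 ^+ 2 + 991 / 1000 ^+ 3.
Let qb : R := 4 + 266 / 1000 + 94 / 1000 ^+ 2 + 393 / 1000 ^+ 3.

(** Horner's scheme, listed from the outermost level inwards, with every intermediate value rounded
    up to nine decimals. *)
Let expR_qa : expR qa <= (702 + 560 / 1000 + 873 / 1000 ^+ 2 + 812 / 1000 ^+ 3).
Proof.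
have q0 : 0 <= qa by rewrite /qa; lra.
apply: (le_trans (@expR_le_trunc R qa 24 q0 _)); first by rewrite /qa; lra.
apply: (@exp_trunc_le qa 0 23 2 (107 + 31 / 1000 + 206 / 1000 ^+ 2 + 581 / 1000 ^+ 3) (702 + 560 / 1000 + 873 / 1000 ^+ 2 + 812 / 1000 ^+ 3) q0); last by rewrite /qa; lra.
apply: (@exp_trunc_le qa 1 22 2 (32 + 352 / 1000 + 568 / 1000 ^+ 2 + 107 / 1000 ^+ 3) (107 + 31 / 1000 + 206 / 1000 ^+ 2 + 581 / 1000 ^+ 3) q0); last by rewrite /qa; lra.
apply: (@exp_trunc_le qa 2 21 2 (14 + 349 / 1000 + 588 / 1000 ^+ 2 + 122 / 1000 ^+ 3) (32 + 352 / 1000 + 568 / 1000 ^+ 2 + 107 / 1000 ^+ 3) q0); last by rewrite /qa; lra.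
apply: (@exp_trunc_le qa 3 20 2 (8 + 146 / 1000 + 534 / 1000 ^+ 2 + 833 / 1000 ^+ 3) (14 + 349 / 1000 + 588 / 1000 ^+ 2 + 122 / 1000 ^+ 3) q0); last by rewrite /qa; lra.
apply: (@exp_trunc_le qa 4 19 2 (5 + 451 / 1000 + 431 / 1000 ^+ 2 + 761 / 1000 ^+ 3) (8 + 146 / 1000 + 534 / 1000 ^+ 2 + 833 / 1000 ^+ 3) q0); last by rewrite /qa; lra.
apply: (@exp_trunc_le qa 5 18 2 (4 + 74 / 1000 + 703 / 1000 ^+ 2 + 680 / 1000 ^+ 3) (5 + 451 / 1000 + 431 / 1000 ^+ 2 + 761 / 1000 ^+ 3) q0); last by rewrite /qa; lra.
apply: (@exp_trunc_le qa 6 17 2 (3 + 283 / 1000 + 570 / 1000 ^+ 2 + 676 / 1000 ^+ 3) (4 + 74 / 1000 + 703 / 1000 ^+ 2 + 680 / 1000 ^+ 3) q0); last by rewrite /qa; lra.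
apply: (@exp_trunc_le qa 7 16 2 (2 + 787 / 1000 + 80 / 1000 ^+ 2 + 453 / 1000 ^+ 3) (3 + 283 / 1000 + 570 / 1000 ^+ 2 + 676 / 1000 ^+ 3) q0); last by rewrite /qa; lra.
apply: (@exp_trunc_le qa 8 15 2 (2 + 453 / 1000 + 757 / 1000 ^+ 2 + 697 / 1000 ^+ 3) (2 + 787 / 1000 + 80 / 1000 ^+ 2 + 453 / 1000 ^+ 3) q0); last by rewrite /qa; lra.
apply: (@exp_trunc_le qa 9 14 2 (2 + 217 / 1000 + 875 / 1000 ^+ 2 + 114 / 1000 ^+ 3) (2 + 453 / 1000 + 757 / 1000 ^+ 2 + 697 / 1000 ^+ 3) q0); last by rewrite /qa; lra.
apply: (@exp_trunc_le qa 10 13 2 (2 + 43 / 1000 + 809 / 1000 ^+ 2 + 917 / 1000 ^+ 3) (2 + 217 / 1000 + 875 / 1000 ^+ 2 + 114 / 1000 ^+ 3) q0); last by rewrite /qa; lra.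
apply: (@exp_trunc_le qa 11 12 2 (1 + 910 / 1000 + 942 / 1000 ^+ 2 + 966 / 1000 ^+ 3) (2 + 43 / 1000 + 809 / 1000 ^+ 2 + 917 / 1000 ^+ 3) q0); last by rewrite /qa; lra.
apply: (@exp_trunc_le qa 12 11 2 (1 + 806 / 1000 + 673 / 1000 ^+ 2 + 189 / 1000 ^+ 3) (1 + 910 / 1000 + 942 / 1000 ^+ 2 + 966 / 1000 ^+ 3) q0); last by rewrite /qa; lra.
apply: (@exp_trunc_le qa 13 10 2 (1 + 722 / 1000 + 942 / 1000 ^+ 2 + 244 / 1000 ^+ 3) (1 + 806 / 1000 + 673 / 1000 ^+ 2 + 189 / 1000 ^+ 3) q0); last by rewrite /qa; lra.
apply: (@exp_trunc_le qa 14 9 2 (1 + 654 / 1000 + 397 / 1000 ^+ 2 + 718 / 1000 ^+ 3) (1 + 722 / 1000 + 942 / 1000 ^+ 2 + 244 / 1000 ^+ 3) q0); last by rewrite /qa; lra.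
apply: (@exp_trunc_le qa 15 8 2 (1 + 597 / 1000 + 374 / 1000 ^+ 2 + 765 / 1000 ^+ 3) (1 + 654 / 1000 + 397 / 1000 ^+ 2 + 718 / 1000 ^+ 3) q0); last by rewrite /qa; lra.
apply: (@exp_trunc_le qa 16 7 2 (1 + 549 / 1000 + 319 / 1000 ^+ 2 + 29 / 1000 ^+ 3) (1 + 597 / 1000 + 374 / 1000 ^+ 2 + 765 / 1000 ^+ 3) q0); last by rewrite /qa; lra.
apply: (@exp_trunc_le qa 17 6 2 (1 + 508 / 1000 + 489 / 1000 ^+ 2 + 214 / 1000 ^+ 3) (1 + 549 / 1000 + 319 / 1000 ^+ 2 + 29 / 1000 ^+ 3) q0); last by rewrite /qa; lra.
apply: (@exp_trunc_le qa 18 5 2 (1 + 473 / 1000 + 942 / 1000 ^+ 2 + 41 / 1000 ^+ 3) (1 + 508 / 1000 + 489 / 1000 ^+ 2 + 214 / 1000 ^+ 3) q0); last by rewrite /qa; lra.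
apply: (@exp_trunc_le qa 19 4 2 (1 + 446 / 1000 + 106 / 1000 ^+ 2 + 542 / 1000 ^+ 3) (1 + 473 / 1000 + 942 / 1000 ^+ 2 + 41 / 1000 ^+ 3) q0); last by rewrite /qa; lra.
apply: (@exp_trunc_le qa 20 3 2 (1 + 429 / 1000 + 232 / 1000 ^+ 2 + 712 / 1000 ^+ 3) (1 + 446 / 1000 + 106 / 1000 ^+ 2 + 542 / 1000 ^+ 3) q0); last by rewrite /qa; lra.
apply: (@exp_trunc_le qa 21 2 2 (1 + 440 / 1000 + 656 / 1000 ^+ 2 + 868 / 1000 ^+ 3) (1 + 429 / 1000 + 232 / 1000 ^+ 2 + 712 / 1000 ^+ 3) q0); last by rewrite /qa; lra.
apply: (@exp_trunc_le qa 22 1 2 (1 + 546 / 1000 + 227 / 1000 ^+ 2 + 666 / 1000 ^+ 3) (1 + 440 / 1000 + 656 / 1000 ^+ 2 + 868 / 1000 ^+ 3) q0); last by rewrite /qa; lra.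
apply: (@exp_trunc_le qa 23 0 2 2 (1 + 546 / 1000 + 227 / 1000 ^+ 2 + 666 / 1000 ^+ 3) q0); last by rewrite /qa; lra.
by [].
Qed.

(** The same scheme with the tail dropped and rounding downwards. *)
Let expR_qb : (71 + 242 / 1000 + 801 / 1000 ^+ 2 + 15 / 1000 ^+ 3) <= expR qb.
Proof.
have q0 : 0 <= qb by rewrite /qb; lra.
apply: (le_trans _ (@expR_ge_trunc R qb 18 q0)).
apply: (@exp_trunc_ge qb 0 17 0 (16 + 465 / 1000 + 364 / 1000 ^+ 2 + 932 / 1000 ^+ 3) (71 + 242 / 1000 + 801 / 1000 ^+ 2 + 15 / 1000 ^+ 3) q0); last by rewrite /qb; lra.
apply: (@exp_trunc_ge qb 1 16 0 (7 + 250 / 1000 + 362 / 1000 ^+ 2 + 279 / 1000 ^+ 3) (16 + 465 / 1000 + 364 / 1000 ^+ 2 + 932 / 1000 ^+ 3) q0); last by rewrite /qb; lra.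
apply: (@exp_trunc_ge qb 2 15 0 (4 + 395 / 1000 + 375 / 1000 ^+ 2 + 515 / 1000 ^+ 3) (7 + 250 / 1000 + 362 / 1000 ^+ 2 + 279 / 1000 ^+ 3) q0); last by rewrite /qb; lra.
apply: (@exp_trunc_ge qb 3 14 0 (3 + 183 / 1000 + 591 / 1000 ^+ 2 + 550 / 1000 ^+ 3) (4 + 395 / 1000 + 375 / 1000 ^+ 2 + 515 / 1000 ^+ 3) q0); last by rewrite /qb; lra.
apply: (@exp_trunc_ge qb 4 13 0 (2 + 559 / 1000 + 239 / 1000 ^+ 2 + 610 / 1000 ^+ 3) (3 + 183 / 1000 + 591 / 1000 ^+ 2 + 550 / 1000 ^+ 3) q0); last by rewrite /qb; lra.
apply: (@exp_trunc_ge qb 5 12 0 (2 + 192 / 1000 + 974 / 1000 ^+ 2 + 839 / 1000 ^+ 3) (2 + 559 / 1000 + 239 / 1000 ^+ 2 + 610 / 1000 ^+ 3) q0); last by rewrite /qb; lra.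
apply: (@exp_trunc_ge qb 6 11 0 (1 + 957 / 1000 + 486 / 1000 ^+ 2 + 897 / 1000 ^+ 3) (2 + 192 / 1000 + 974 / 1000 ^+ 2 + 839 / 1000 ^+ 3) q0); last by rewrite /qb; lra.
apply: (@exp_trunc_ge qb 7 10 0 (1 + 795 / 1000 + 528 / 1000 ^+ 2 + 761 / 1000 ^+ 3) (1 + 957 / 1000 + 486 / 1000 ^+ 2 + 897 / 1000 ^+ 3) q0); last by rewrite /qb; lra.
apply: (@exp_trunc_ge qb 8 9 0 (1 + 678 / 1000 + 293 / 1000 ^+ 2 + 585 / 1000 ^+ 3) (1 + 795 / 1000 + 528 / 1000 ^+ 2 + 761 / 1000 ^+ 3) q0); last by rewrite /qb; lra.
apply: (@exp_trunc_ge qb 9 8 0 (1 + 589 / 1000 + 963 / 1000 ^+ 2 + 848 / 1000 ^+ 3) (1 + 678 / 1000 + 293 / 1000 ^+ 2 + 585 / 1000 ^+ 3) q0); last by rewrite /qb; lra.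
apply: (@exp_trunc_ge qb 10 7 0 (1 + 521 / 1000 + 204 / 1000 ^+ 2 + 582 / 1000 ^+ 3) (1 + 589 / 1000 + 963 / 1000 ^+ 2 + 848 / 1000 ^+ 3) q0); last by rewrite /qb; lra.
apply: (@exp_trunc_ge qb 11 6 0 (1 + 466 / 1000 + 84 / 1000 ^+ 2 + 529 / 1000 ^+ 3) (1 + 521 / 1000 + 204 / 1000 ^+ 2 + 582 / 1000 ^+ 3) q0); last by rewrite /qb; lra.
apply: (@exp_trunc_ge qb 12 5 0 (1 + 420 / 1000 + 291 / 1000 ^+ 2 + 800 / 1000 ^+ 3) (1 + 466 / 1000 + 84 / 1000 ^+ 2 + 529 / 1000 ^+ 3) q0); last by rewrite /qb; lra.
apply: (@exp_trunc_ge qb 13 4 0 (1 + 379 / 1000 + 267 / 1000 ^+ 2 + 466 / 1000 ^+ 3) (1 + 420 / 1000 + 291 / 1000 ^+ 2 + 800 / 1000 ^+ 3) q0); last by rewrite /qb; lra.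
apply: (@exp_trunc_ge qb 14 3 0 (1 + 333 / 1000 + 541 / 1000 ^+ 2 + 51 / 1000 ^+ 3) (1 + 379 / 1000 + 267 / 1000 ^+ 2 + 466 / 1000 ^+ 3) q0); last by rewrite /qb; lra.
apply: (@exp_trunc_ge qb 15 2 0 (1 + 250 / 1000 + 946 / 1000 ^+ 2 + 729 / 1000 ^+ 3) (1 + 333 / 1000 + 541 / 1000 ^+ 2 + 51 / 1000 ^+ 3) q0); last by rewrite /qb; lra.
apply: (@exp_trunc_ge qb 16 1 0 (1) (1 + 250 / 1000 + 946 / 1000 ^+ 2 + 729 / 1000 ^+ 3) q0); last by rewrite /qb; lra.
apply: (@exp_trunc_ge qb 17 0 0 0 (1) q0); last by rewrite /qb; lra.
by [].
Qed.

Variable P : R -> R.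
Hypotheses (P_rec : forall y, 0 < y -> P (y + 1) = P y + y^-1) (P_le : forall y, 0 < y -> P y <= ln y)
  (P_ge : forall y, 0 < y -> ln y - y^-1 <= P y).
Let A : R := 44 + 763 / 1000.
Let B : R := 215 + 333 / 1000.
Let A0 : 0 < A. Proof. by rewrite /A; lra. Qed.
Let B0 : 0 < B. Proof. by rewrite /B; lra. Qed.

(** For the digamma function the left side is ln(8 pi e^(gamma + pi/2)), about ln 215.3325. The
    margin is small, hence ten steps of the recurrence before the asymptotic bound. *)
Lemma digamma_quarter_le : ln pi - P 4^-1 <= ln B.
Proof.
have [_ piu] := andP (@pi_bounds R).
have y0 : 0 < 4^-1 :> R by rewrite invr_gt0.
have z0 : 0 < 10 + 4^-1 :> R by rewrite addr_gt0.
have S := @P_sum R P P_rec 4^-1 10 y0; rewrite addrC in S.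
have G := digamma_ge P_rec P_ge z0.
have E k : (4^-1 + k%:R)^-1 = 4 / (iter k (fun n => n.+4) 1%N)%:R :> R.
  by rewrite iter4 natrD natrM; field; rewrite -natrM natr1 pnatr_eq0.
rewrite (eq_bigr (fun k : 'I_10 => 4 / (iter k (fun n => n.+4) 1%N)%:R) (fun k _ => E k)) !big_ord_recr big_ord0 /= in S.
have Q : - P 4^-1 <= qa - ln (10 + 4^-1).
  have w1 : (2 * (10 + 4^-1))^-1 = 2 / 41 :> R by field.
  have w2 : (12 * (10 + 4^-1) ^+ 2)^-1 = 4 / 3 / 41 / 41 :> R by field.
  rewrite w1 w2 in G; move: S G; rewrite /qa; move: (P _) (P _) (ln _) => a b c; rewrite add0r => -> G; lra.
apply: (@le_trans _ _ (ln (pi * expR qa) - ln (10 + 4^-1))).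
  by rewrite lnM ?posrE ?pi_gt0 ?expR_gt0 // expRK; lra.
rewrite -ln_div ?posrE ?mulr_gt0 ?pi_gt0 ?expR_gt0 // ler_ln ?posrE ?divr_gt0 ?mulr_gt0 ?pi_gt0 ?expR_gt0 //.
rewrite ler_pdivrMr // (le_trans (ler_pM (pi_ge0 R) (expR_ge0 _) piu expR_qa)) // /B; lra.
Qed.

(** The other narrow bound: for the digamma function the right side is ln(8 pi e^gamma), about ln
    44.7632. *)
Lemma digamma_half_ge : ln A <= ln pi + ln 2 - P 2^-1.
Proof.
have [pil _] := andP (@pi_bounds R).
have y0 : 0 < 2^-1 :> R by rewrite invr_gt0.
have ten : 1 <= 10 :> R by rewrite ler1n.
have S := @P_sum R P P_rec 2^-1 10 y0; rewrite addrC in S.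
have G := digamma_half_le P_rec P_le ten.
have E k : (2^-1 + k%:R)^-1 = 2 / (iter k (fun n => n.+2) 1%N)%:R :> R.
  by rewrite iter2 natrD natrM; field; rewrite -natrM natr1 pnatr_eq0.
rewrite (eq_bigr (fun k : 'I_10 => 2 / (iter k (fun n => n.+2) 1%N)%:R) (fun k _ => E k)) !big_ord_recr big_ord0 /= in S.
have Q : qb - ln 10 <= - P 2^-1.
  have w1 : (24 * 10 ^+ 2)^-1 = 24^-1 / 10 / 10 :> R by field.
  rewrite w1 in G; move: S G; rewrite /qb; move: (P _) (P _) (ln _) => a b c; rewrite add0r => -> G; lra.
apply: (@le_trans _ _ (ln (pi * 2 * expR qb) - ln 10)); last first.
  by rewrite !lnM ?posrE ?mulr_gt0 ?pi_gt0 ?expR_gt0 // expRK; lra.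
have p0 : 0 < pi * 2 * expR qb :> R by rewrite !mulr_gt0 ?pi_gt0 ?expR_gt0.
rewrite -ln_div ?posrE // ler_ln ?posrE ?divr_gt0 // ler_pdivlMr //.
have l0 : 0 <= 3 + 141 / 1000 + 591 / 1000 ^+ 2 :> R by lra.
have e0 : 0 <= (71 + 242 / 1000 + 801 / 1000 ^+ 2 + 15 / 1000 ^+ 3) :> R by lra.
have := ler_pM l0 e0 pil expR_qb; rewrite /A; move: (pi) (expR qb) => a b.
by rewrite mulrAC; move: (a * b) => ab; lra.
Qed.

(** Far from sharp, since the right side is about ln 215.3: one step of the recurrence, pi >= 3 and
    e^4 >= 20 suffice. *)
Lemma digamma_quarter_ge : ln A <= ln pi - P 4^-1.
Proof.
have y0 : 0 < 4^-1 :> R by rewrite invr_gt0.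
have z0 : 0 < 4^-1 + 1 :> R by rewrite addr_gt0.
have := P_le z0; rewrite P_rec // invrK => H.
have [pil _] := andP (@pi_bounds R).
have p4 : 0 <= 4 :> R by exact: ler0n.
have e4 : 20 <= expR 4 :> R.
  by apply: (le_trans _ (@expR_ge_trunc R 4 4 p4)); rewrite /=; lra.
apply: (@le_trans _ _ (ln (pi * expR 4) - ln (4^-1 + 1))); last first.
  by rewrite lnM ?posrE ?pi_gt0 ?expR_gt0 // expRK; lra.
have q0 : 0 < pi * expR 4 :> R by rewrite mulr_gt0 ?pi_gt0 ?expR_gt0.
rewrite -ln_div ?posrE // ler_ln ?posrE ?divr_gt0 // ler_pdivlMr //.
have l0 : 0 <= 3 :> R by exact: ler0n.
have l1 : 3 <= pi :> R by lra.
have l2 : 0 <= 20 :> R by exact: ler0n.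
have := ler_pM l0 l2 l1 e4; rewrite /A; move: (pi * expR 4) => ab; lra.
Qed.

(** The left side is about ln 44.8, so one step is enough; 8 / 3 is the recurrence term 2 plus the
    loss 2 / 3 in [P_ge] at 3 / 2. *)
Lemma digamma_half_upper : ln pi + ln 2 - P 2^-1 <= ln B.
Proof.
have y0 : 0 < 2^-1 :> R by rewrite invr_gt0.
have z0 : 0 < 2^-1 + 1 :> R by rewrite addr_gt0.
have := P_ge z0; rewrite P_rec // invrK => H.
have [_ piu] := andP (@pi_bounds R).
have p0 : 0 <= 8 / 3 :> R by rewrite divr_ge0.
have p1 : 2 * (8 / 3) <= 6 :> R by lra.
have e4 : expR (8 / 3) <= 20 :> R.
  by apply: (le_trans (@expR_le_trunc R (8 / 3) 5 p0 p1)); rewrite /=; lra.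
have w : (2^-1 + 1)^-1 = 2 / 3 :> R by field.
rewrite w in H; apply: (@le_trans _ _ (ln (pi * 2 * expR (8 / 3)) - ln (2^-1 + 1))).
  by rewrite !lnM ?posrE ?mulr_gt0 ?pi_gt0 ?expR_gt0 // expRK; lra.
have q0 : 0 < pi * 2 * expR (8 / 3) :> R by rewrite !mulr_gt0 ?pi_gt0 ?expR_gt0.
rewrite -ln_div ?posrE // ler_ln ?posrE ?divr_gt0 // ler_pdivrMr //.
have l1 : pi <= 4 :> R by lra.
have := ler_pM (pi_ge0 R) (expR_ge0 _) l1 e4; rewrite /B mulrAC; move: (pi * expR _) => ab; lra.
Qed.

End DigammaValues.

Section ComplexDerivatives.
Context {R : realType}.
Local Notation C := R[i].

(** A complex derivative is determined along the real direction, so that formulas known only at real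
    points can be differentiated. *)
Lemma cdiff_uniq (f g : C -> C) (z l l' : C) (r : R) : 0 < r -> cdiff f z l -> cdiff g z l' ->
  (forall x : R, `|x| < r -> f (z + x%:C) = g (z + x%:C)) -> l = l'.
Proof.
move=> r0 Hf Hg fg; apply/eqP; rewrite -subr_eq0 -normc_eq0 -normr_le0 ger0_norm ?normc_ge0 //.
apply/ler_addgt0Pr => e e0; rewrite add0r; have e2 : 0 < e / 2 by rewrite divr_gt0.
have [r1 r10 H1] := Hf _ e2; have [r2 r20 H2] := Hg _ e2.
pose x := Num.min (Num.min r r1) r2 / 2.
have m0 : 0 < Num.min (Num.min r r1) r2 by rewrite !lt_min r0 r10.
have x0 : 0 < x by rewrite divr_gt0.
have xm : x < Num.min (Num.min r r1) r2 by rewrite /x; lra.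
have := xm; rewrite !lt_min => /andP[/andP[xr xr1] xr2].
have nx : normc (x%:C : C) = x by rewrite normcR gtr0_norm.
have := H1 x%:C; have := H2 x%:C; rewrite nx => /(_ xr2) h2 /(_ xr1) h1.
have fz : f z = g z by have := fg 0; rewrite normr0 addr0 => /(_ r0).
rewrite fg ?gtr0_norm // fz in h1.
set A := g _ - g z in h1 h2.
have : normc ((l - l') * x%:C) <= e * x.
  rewrite (_ : (l - l') * x%:C = (A - l' * x%:C) - (A - l * x%:C)); last by ring.
  by apply: (le_trans (normc_triB _ _)); lra.
by rewrite normcM nx ler_pM2r.
Qed.

Lemma cexp_cdiff (z : C) : cdiff (@cexp R) z (cexp z).
Proof.
move=> e e0; pose M := 4 * expR 1 * expR (Re z).
have M0 : 0 < M by rewrite !mulr_gt0 ?expR_gt0.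
exists (Num.min 1 (e / M)); first by rewrite lt_min ltr01 divr_gt0.
move=> h; rewrite lt_min ltr_pdivlMr // => /andP[h1 hM].
rewrite cexpD (_ : _ - _ = cexp z * (cexp h - 1 - h)); last by ring.
rewrite normcM normc_cexp; have nh := normc_ge0 h.
have e1 : expR `|Re h| <= expR 1 by rewrite ler_expR (le_trans (Re_le_normc h)) // ltW.
apply: (@le_trans _ _ (expR (Re z) * (4 * normc h ^+ 2 * expR 1))).
  by rewrite ler_wpM2l ?expR_ge0 // (le_trans (cexp_dist h)) // ler_wpM2l // mulr_ge0 // sqr_ge0.
rewrite (_ : expR (Re z) * _ = normc h * M * normc h); last by rewrite /M; ring.
by rewrite ler_wpM2r // ltW.
Qed.

Lemma real_complex2 : 2 = (2 : R)%:C :> C. Proof. by rewrite rmorph_nat. Qed.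

Lemma cdiff_scale (k z : C) : cdiff (fun w => k * w) z k.
Proof. by rewrite -[X in cdiff _ _ X]mulr1; apply: cdiffZ; exact: cdiff_id. Qed.

Lemma cexp_scale_cdiff (k z : C) : cdiff (fun w => cexp (k * w)) z (cexp (k * z) * k).
Proof. by apply: (cdiff_comp (cdiff_scale k z)); exact: cexp_cdiff. Qed.

End ComplexDerivatives.

(** * The local factors and their recurrence *)

Section LocalCalculus.
Context {R : realType}.
Local Notation C := R[i].
Local Notation mu := (@lebesgue_measure R).
Implicit Types (m : nat) (s t : R).

Definition local_factor m : C -> C := lap mu (local_density m) (fun y => m%:R * y).
Definition local_factor' m : C -> C := lap' mu (local_density m) (fun y => m%:R * y).
Definition local_moment m s : R := (\int[mu]_y (local_density m y * (m%:R * y) * expR (s * (m%:R * y))))%R.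

Lemma local_density_ge0 m t : 0 <= local_density m t. Proof. exact: expR_ge0. Qed.

Lemma measurable_scale (k : R) : measurable_fun setT (fun t : R => k * t).
Proof. exact: measurable_funM. Qed.

Lemma local_factor_cdiff m z : (0 < m)%N -> 0 < Re z -> cdiff (local_factor m) z (local_factor' m z).
Proof.
move=> m0 z0; apply: (@lap_cdiff _ _ _ mu (local_density m) (fun y => m%:R * y) _ _ _ (Re z) (Re z / 2)) => //.
- exact: local_density_ge0.
- exact: measurable_local_density.
- exact: measurable_scale.
- by rewrite divr_gt0.
- by apply: local_fin => //; lra.
- by apply: local_fin => //; lra.
Qed.

Lemma local_factor_real m s : local_factor m s%:C = (local_integral m s)%:C.
Proof. exact: lap_real. Qed.

Lemma local_factor'_real m s : local_factor' m s%:C = (local_moment m s)%:C.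
Proof. exact: lap_real. Qed.

Lemma local_integral_ge0E m s : (0 < m)%N -> 0 < s ->
  (\int[mu]_y (local_density m y * expR (s * (m%:R * y)))%:E)%E = (local_integral m s)%:E.
Proof.
move=> m0 s0; rewrite /local_integral /Rintegral fineK // ge0_fin_numE; first exact: local_fin.
by apply: integral_ge0 => y _; rewrite lee_fin mulr_ge0 ?expR_ge0.
Qed.

Lemma local_integral_gt0 m s : (0 < m)%N -> 0 < s -> 0 < local_integral m s.
Proof.
move=> m0 s0; pose c := expR (- (pi * m%:R * expR 2)) : R.
have c0 : 0 < c by exact: expR_gt0.
apply: (lt_le_trans c0); rewrite -lee_fin -local_integral_ge0E //.
apply: (@le_trans _ _ (\int[mu]_y (c * \1_`[0, 1] y)%:E)%E).
  under eq_integral do rewrite EFinM.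
  rewrite ge0_integralZl_EFin ?(ltW c0) //; last by apply/measurable_EFinP; exact: measurable_indic.
  have E : mu `[0, 1]%classic = 1%E by rewrite lebesgue_measure_itv /= lte_fin ltr01 oppr0 adde0.
  have -> : (\int[mu]_y (\1_`[0%R, 1%R] y)%:E = 1)%E by rewrite integral_indic // setIT; exact: E.
  by rewrite mule1.
apply: ge0_le_integral => //.
- by move=> y _; rewrite lee_fin mulr_ge0 ?(ltW c0) // indicE.
- by apply/measurable_EFinP; apply: measurable_funM => //; exact: measurable_indic.
- by apply/measurable_EFinP; exact: measurable_local.
move=> y _; rewrite lee_fin indicE; case: (boolP (y \in `[0, 1]%classic)) => [|_]; last first.
  by rewrite mulr0 mulr_ge0 ?expR_ge0.
rewrite inE /= in_itv /= => /andP[y0 y1]; rewrite -[X in X <= _]mulr1 mulr1 ler_pM ?(ltW c0) //.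
  rewrite ler_expR lerN2 ler_wpM2l // ?ler_expR; first by rewrite mulr_ge0 ?pi_ge0.
  by lra.
by rewrite -expR0 ler_expR mulr_ge0 ?(ltW s0) // mulr_ge0.
Qed.

Let w s (t : R) := expR (s * t).

Lemma local_integral1E s : local_integral 1 s = (\int[mu]_y (expR (- (pi * expR (2 * y))) * expR (s * y)))%R.
Proof. by apply: eq_Rintegral => y _; rewrite /local_density mulr1 mul1r. Qed.

Let theta_lap_fin s (c : R) : 0 < s -> c < 0 -> lap_fin mu (w s) (fun t => expR (2 * t)) c.
Proof.
move=> s0 c0; have := @exp_exp_fin R (- c) s; rewrite oppr_gt0 => /(_ c0 s0).
by congr (_ < _)%E; apply: eq_integral => t _; rewrite /w mulNr opprK addrC expRD.
Qed.

(** The integral of e^(s t) e^(c e^(2 t)) is read as a Laplace transform in c; moving c from - pi to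
    - pi e^(2 h) amounts to translating t by [h]. *)
Let lap_translate s (h : R) : 0 < s ->
  lap mu (w s) (fun t => expR (2 * t)) (- (pi * expR (2 * h)))%:C = (expR (- (s * h)) * local_integral 1 s)%:C.
Proof.
move=> s0; rewrite lap_real; congr (_%:C); rewrite local_integral1E /Rintegral.
pose f (y : R) := (expR (- (pi * expR (2 * y))) * expR (s * y))%:E.
have f0 y : (0 <= f y)%E by rewrite lee_fin mulr_ge0 ?expR_ge0.
have mf : measurable_fun setT f.
  apply/measurable_EFinP; have := @measurable_local R 1 s; congr (measurable_fun _ _).
  by apply/funext => y; rewrite /local_density mulr1 mul1r.
have fs : (\int[mu]_y f y = (local_integral 1 s)%:E)%E.
  rewrite -(local_integral_ge0E (ltn0Sn 0) s0); apply: eq_integral => y _.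
  by rewrite /f /local_density mulr1 mul1r.
have -> : (\int[mu]_y (w s y * expR (- (pi * expR (2 * h)) * expR (2 * y)))%:E =
    (expR (- (s * h)))%:E * \int[mu]_y f (y + h)%R)%E.
  rewrite -ge0_integralZl_EFin ?expR_ge0 //; last by apply: measurableT_comp => //; exact: measurable_addl.
  apply: eq_integral => y _; rewrite /f /w -EFinM; congr EFin; rewrite -!expRD; congr expR.
  by rewrite [2 * (y + h)]mulrDr expRD; ring.
by rewrite (ge0_integral_shift h mf f0) fs.
Qed.

(** This is Gamma(x + 1) = x Gamma(x). In place of an integration by parts, both sides of
    [lap_translate] are differentiated in [h] at 0. *)
Lemma local_integral_rec s : 0 < s -> local_integral 1 (s + 2) = s / (2 * pi) * local_integral 1 s.
Proof.
move=> s0; have p0 : 0 < pi / 2 :> R by rewrite divr_gt0 ?pi_gt0.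
pose F := lap mu (w s) (fun t => expR (2 * t)).
have dF : cdiff F (- pi)%:C (local_integral 1 (s + 2))%:C.
  rewrite (_ : (local_integral 1 (s + 2))%:C = lap' mu (w s) (fun t => expR (2 * t)) (- pi)%:C).
    apply: (@lap_cdiff _ _ _ mu (w s) (fun t => expR (2 * t)) _ _ _ (- pi) (pi / 2)) => //.
    - by move=> t; exact: expR_ge0.
    - by apply: measurableT_comp => //; exact: measurable_scale.
    - by apply: measurableT_comp => //; exact: measurable_scale.
    - by apply: theta_lap_fin => //; lra.
    - by apply: theta_lap_fin => //; lra.
  rewrite /lap' lap_real local_integral1E; congr (_%:C); apply: eq_Rintegral => y _.
  by rewrite /w -!expRD; congr expR; ring.
have dE : cdiff (fun h : C => - pi%:C * cexp (2 * h)) 0 (- (2 * pi)%:C).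
  rewrite (_ : - (2 * pi)%:C = - pi%:C * (cexp (2 * 0) * 2)); first by apply: cdiffZ; exact: cexp_scale_cdiff.
  by rewrite mulr0 cexp0 mul1r rmorphM /= mulNr mulrC; congr (- (_ * _)); rewrite rmorph_nat.
have dA : cdiff (F \o fun h : C => - pi%:C * cexp (2 * h)) 0 ((local_integral 1 (s + 2))%:C * - (2 * pi)%:C).
  by apply: (cdiff_comp dE); rewrite mulr0 cexp0 mulr1 -rmorphN.
have dB : cdiff (fun h : C => (local_integral 1 s)%:C * cexp (- s%:C * h)) 0 ((local_integral 1 s)%:C * - s%:C).
  have := cdiffZ (local_integral 1 s)%:C (cexp_scale_cdiff (- s%:C) 0).
  by rewrite mulr0 cexp0 mul1r.
have {dA dB dE dF} E := cdiff_uniq ltr01 dA dB.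
have {}E : local_integral 1 (s + 2) * - (2 * pi) = local_integral 1 s * - s.
  apply: (@complexI R); rewrite !rmorphM !rmorphN /=; apply: E => x _ /=.
  have e1 : 2 * x%:C = (2 * x)%:C :> C by rewrite real_complex2 -rmorphM.
  have e2 : - s%:C * x%:C = (- s * x)%:C :> C by rewrite -rmorphN -rmorphM.
  have e3 : - pi%:C * (expR (2 * x))%:C = (- (pi * expR (2 * x)))%:C :> C by rewrite -rmorphN -rmorphM mulNr.
  by rewrite add0r e1 e2 !cexpR e3 /F (lap_translate x s0) -rmorphM mulNr mulrC.
have pi0 : 2 * pi != 0 :> R by rewrite mulf_neq0 // gt_eqF // pi_gt0.
by apply: (mulIf pi0); rewrite mulrAC (divfK pi0); apply: oppr_inj; rewrite -mulrN E; ring.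
Qed.

Lemma local_moment_rec s : 0 < s ->
  local_moment 1 (s + 2) = (2 * pi)^-1 * local_integral 1 s + s / (2 * pi) * local_moment 1 s.
Proof.
move=> s0; have c1 (z : C) : 0 < Re z -> cdiff (local_factor 1) z (local_factor' 1 z) by exact: local_factor_cdiff.
have d2 : cdiff (fun z : C => z + 2) s%:C 1.
  by rewrite -[X in cdiff _ _ X]addr0; apply: cdiffD; [exact: cdiff_id|exact: cdiff_cst].
have dA : cdiff (local_factor 1 \o fun z : C => z + 2) s%:C (local_factor' 1 (s%:C + 2) * 1).
  by apply: (cdiff_comp d2); apply: c1; rewrite real_complex2 -rmorphD /=; lra.
have dB := cdiffM (cdiff_scale (2 * pi)^-1%:C s%:C) (c1 s%:C s0).
have E := cdiff_uniq s0 dA dB.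
apply: (@complexI R); rewrite -local_factor'_real rmorphD /= -real_complex2 -[LHS]mulr1 E.
  by rewrite local_factor_real local_factor'_real -!rmorphM -rmorphD /=; congr (_%:C); ring.
move=> x; rewrite ltr_norml => /andP[x1 x2] /=.
rewrite -rmorphD real_complex2 -rmorphD !local_factor_real -!rmorphM local_integral_rec; last by lra.
by congr (_%:C); ring.
Qed.

Let integrable_local s : 0 < s -> mu.-integrable setT (EFin \o (fun y => local_density 1 y * expR (s * (1%:R * y)))).
Proof.
move=> s0; apply/integrableP; split; first by apply/measurable_EFinP; exact: measurable_local.
apply: le_lt_trans (local_fin (ltn0Sn 0) s0); rewrite le_eqVlt; apply/orP; left; apply/eqP.
by apply: eq_integral => y _ /=; rewrite ger0_norm // mulr_ge0 ?expR_ge0.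
Qed.

Let integrable_moment s : 0 < s ->
  mu.-integrable setT (EFin \o (fun y => local_density 1 y * (1%:R * y) * expR (s * (1%:R * y)))).
Proof.
move=> s0; pose r := s / 2; have r0 : 0 < r by rewrite divr_gt0.
have s1 : 0 < s + r by rewrite addr_gt0.
have s2 : 0 < s - r by rewrite /r; lra.
have I := integrableZl measurableT r^-1 (integrableD measurableT (integrable_local s1) (integrable_local s2)).
apply: le_integrable I => //.
  apply/measurable_EFinP; apply: measurable_funM; last first.
    by apply: measurableT_comp => //; apply: measurable_funM => //; exact: measurable_scale.
  by apply: measurable_funM; [exact: measurable_local_density|exact: measurable_scale].
move=> y _ /=; rewrite lee_fin; apply: le_trans (ler_norm _); rewrite mul1r.
have h1 : r * `|y| <= expR (r * y) + expR (- (r * y)).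
  have := expR_ge1Dx (r * y); have := expR_ge1Dx (- (r * y)); have := expR_ge0 (r * y); have := expR_ge0 (- (r * y)).
  by case: (ger0P y) => _; lra.
rewrite !normrM (ger0_norm (expR_ge0 _)) (ger0_norm (local_density_ge0 _ _)) -mulrDr mulrCA -mulrA.
rewrite ler_wpM2l ?local_density_ge0 //.
rewrite ler_pdivlMl // mulrA (le_trans (ler_wpM2r (expR_ge0 (s * y)) h1)) //.
by rewrite mulrDl -!expRD le_eqVlt; apply/orP; left; apply/eqP; congr (expR _ + expR _); ring.
Qed.

Let linear_integral s a b : 0 < s ->
  (\int[mu]_y (local_density 1 y * expR (s * (1%:R * y)) * (a + b * y)) = a * local_integral 1 s + b * local_moment 1 s)%R.
Proof.
move=> s0; have I1 := integrable_local s0; have I2 := integrable_moment s0.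
have -> : (\int[mu]_y (local_density 1 y * expR (s * (1%:R * y)) * (a + b * y)) =
   \int[mu]_y (a * (local_density 1 y * expR (s * (1%:R * y))) + b * (local_density 1 y * (1%:R * y) * expR (s * (1%:R * y)))))%R.
  by apply: eq_Rintegral => y _; ring.
have J1 : mu.-integrable setT (EFin \o (fun y => a * (local_density 1 y * expR (s * (1%:R * y))))).
  by apply: eq_integrable (integrableZl measurableT a I1).
have J2 : mu.-integrable setT (EFin \o (fun y => b * (local_density 1 y * (1%:R * y) * expR (s * (1%:R * y))))).
  by apply: eq_integrable (integrableZl measurableT b I2).
by rewrite (RintegralD measurableT J1 J2) !RintegralZl.
Qed.

Let linear_integrable s a b : 0 < s ->
  mu.-integrable setT (EFin \o (fun y => local_density 1 y * expR (s * (1%:R * y)) * (a + b * y))).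
Proof.
move=> s0; have I := integrableD measurableT (integrableZl measurableT a (integrable_local s0)) (integrableZl measurableT b (integrable_moment s0)).
apply: eq_integrable I => // y _ /=; rewrite -!EFinM -EFinD; congr EFin; ring.
Qed.

Lemma expR_tangent (c t : R) : expR c * (1 - c + t) <= expR t.
Proof.
have h := expR_ge1Dx (t - c); rewrite (_ : expR t = expR c * expR (t - c)); last by rewrite -expRD addrC subrK.
by rewrite ler_wpM2l ?expR_ge0 // (le_trans _ h) // le_eqVlt; apply/orP; left; apply/eqP; ring.
Qed.

(* Jensen's inequality for the densities proportional to local_density 1 y * expR (s * y). *)
Lemma local_jensen s : 0 < s -> local_moment 1 s / local_integral 1 s <= ln (s / (2 * pi)) / 2 <=
  local_moment 1 (s + 2) / local_integral 1 (s + 2).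
Proof.
move=> s0; have s2 : 0 < s + 2 by lra.
have g0 := local_integral_gt0 (ltn0Sn 0) s0; have g2 := local_integral_gt0 (ltn0Sn 0) s2.
have R2 := local_integral_rec s0; have p0 : 0 < s / (2 * pi) by rewrite divr_gt0 // mulr_gt0 // pi_gt0.
set a := _ / local_integral 1 s; set b := _ / local_integral 1 (s + 2).
apply/andP; split.
  rewrite ler_pdivlMr // mulrC -ler_expR lnK ?posrE //.
  have : expR (2 * a) * local_integral 1 s <= local_integral 1 (s + 2).
    have E : expR (2 * a) * local_integral 1 s = expR (2 * a) * (1 - 2 * a) * local_integral 1 s + expR (2 * a) * 2 * local_moment 1 s.
      by rewrite -[local_moment 1 s](divfK (lt0r_neq0 g0)) -/a; ring.
    rewrite E -(linear_integral _ _ s0); apply: le_Rintegral => //; [exact: linear_integrable|exact: integrable_local|].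
    move=> y _; rewrite !mul1r -mulrA ler_wpM2l ?local_density_ge0 //.
    rewrite (_ : expR ((s + 2) * y) = expR (s * y) * expR (2 * y)); last by rewrite -expRD; congr expR; ring.
    by rewrite ler_wpM2l ?expR_ge0 // -mulrA -mulrDr expR_tangent.
  by rewrite R2 (ler_pM2r g0).
rewrite ler_pdivrMr // -ler_expR lnK ?posrE //.
have : expR (- (2 * b)) * local_integral 1 (s + 2) <= local_integral 1 s.
  have E : expR (- (2 * b)) * local_integral 1 (s + 2) =
      expR (- (2 * b)) * (1 + 2 * b) * local_integral 1 (s + 2) + (- (expR (- (2 * b)) * 2)) * local_moment 1 (s + 2).
    by rewrite -[local_moment 1 (s + 2)](divfK (lt0r_neq0 g2)) -/b; ring.
  rewrite E -(linear_integral _ _ s2); apply: le_Rintegral => //; [exact: linear_integrable|exact: integrable_local|].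
  move=> y _; rewrite !mul1r -mulrA ler_wpM2l ?local_density_ge0 //.
  rewrite (_ : expR (s * y) = expR ((s + 2) * y) * expR (- (2 * y))); last by rewrite -expRD; congr expR; ring.
  rewrite ler_wpM2l ?expR_ge0 //; apply: le_trans (expR_tangent (- (2 * b)) (- (2 * y))).
  by rewrite le_eqVlt; apply/orP; left; apply/eqP; ring.
by rewrite R2 mulrA -[X in _ <= X -> _]mul1r (ler_pM2r g0) expRN [_^-1 * _]mulrC ler_pdivrMr ?expR_gt0 // mul1r (mulrC 2 b).
Qed.

End LocalCalculus.

(** * Logarithmic derivatives of the local factors at 1/2 *)

Section LocalDigamma.
Context {R : realType}.
Local Notation C := R[i].
Local Notation mu := (@lebesgue_measure R).

Let between (a b c d : R) : c <= (a - b) / 2 -> (a - b) / 2 <= d -> 2 * c + b <= a <= 2 * d + b.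
Proof. by move=> h1 h2; apply/andP; split; lra. Qed.

Let bracket1 (a b c d : R) : a <= c - (2 * d + c) -> c - (2 * d + c) <= b -> a <= - 2 * d <= b.
Proof. by move=> h1 h2; apply/andP; split; lra. Qed.

Let bracket2 (a b c p d : R) : c + p - (2 * d + c) <= b -> a <= c + p - (2 * d + c) -> 2 * a <= - 2 * (- p + 2 * d) <= 2 * b.
Proof. by move=> h1 h2; apply/andP; split; lra. Qed.

(** The digamma function: [local_integral 1 s] is pi^(- s / 2) Gamma(s / 2) / 2, whose logarithmic
    derivative at 2 y is (digamma(y) - ln pi) / 2. *)
Let psi (y : R) := 2 * (local_moment 1 (2 * y) / local_integral 1 (2 * y)) + ln pi.

Let psi_rec y : 0 < y -> psi (y + 1) = psi y + y^-1.
Proof.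
move=> y0; have s0 : 0 < 2 * y by rewrite mulr_gt0.
have g0 := local_integral_gt0 (ltn0Sn 0) s0.
rewrite /psi mulrDr mulr1 local_integral_rec // local_moment_rec //.
move: (local_integral _ _) (local_moment _ _) g0 => I M I0; have p0 : 0 < pi :> R by exact: pi_gt0.
move: (pi : R) p0 => p p0.
by field; rewrite ?(gt_eqF p0) ?(gt_eqF y0) ?(gt_eqF I0).
Qed.

Let psi_ln y : 0 < y -> psi y <= ln y <= psi (y + 1).
Proof.
move=> y0; have s0 : 0 < 2 * y by rewrite mulr_gt0.
have /andP[h1 h2] := local_jensen s0.
have E : ln (2 * y / (2 * pi)) = ln y - ln pi.
  by rewrite -mulf_div divff // mul1r ln_div ?posrE ?pi_gt0.
rewrite /psi mulrDr mulr1; rewrite E in h1 h2.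
exact: between.
Qed.

Let psi_le y : 0 < y -> psi y <= ln y. Proof. by move=> /psi_ln/andP[]. Qed.
Let psi_ge y : 0 < y -> ln y - y^-1 <= psi y.
Proof. by move=> y0; have /andP[_] := psi_ln y0; rewrite psi_rec // lerBlDr. Qed.

Let A : R := 44 + 763 / 1000.
Let B : R := 215 + 333 / 1000.

(** Translating y by ln 2 / 2 doubles e^(2 y), which turns the density for m = 2 into the one for m
    = 1. *)
Lemma local_integral2 (s : R) : local_integral 2 s = expR (- (s * ln 2)) * local_integral 1 (2 * s).
Proof.
rewrite /local_integral /Rintegral; pose h : R := ln 2 / 2.
have e2 : expR (2 * h) = 2 by rewrite /h mulrC divfK ?pnatr_eq0 // lnK // posrE.
pose f y : \bar R := (local_density 1 y * expR (2 * s * (1%:R * y)))%:E.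
have f0 y : (0 <= f y)%E by rewrite lee_fin mulr_ge0 ?expR_ge0.
have mf : measurable_fun setT f by apply/measurable_EFinP; exact: measurable_local.
rewrite -(ge0_integral_shift h mf f0) -[X in _ = X * _]/(fine (expR (- (s * ln 2)))%:E).
transitivity (fine ((expR (- (s * ln 2)))%:E * \int[mu]_y f (y + h)%R)%E); last first.
  (* An infinite integral is covered as well: both sides are then 0, the value of [fine] there. *)
  by case: (integral _ _ _) => [z||] //=; rewrite ?mulr0 // /mule /= ?gt_eqF ?lte_fin ?expR_gt0 ?mulr0.
rewrite -ge0_integralZl_EFin ?expR_ge0 //; last by apply: measurableT_comp => //; exact: measurable_addl.
congr fine; apply: eq_integral => y _; rewrite /f -EFinM; congr EFin.
have E : expR (2 * (y + h)) = expR (2 * y) * 2 by rewrite mulrDr expRD e2.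
by rewrite /local_density E -!expRD; congr expR; rewrite /h; field.
Qed.

(** The middle term is ln pi - digamma(1/4). *)
Lemma local_psi1 : ln A <= - 2 * (local_moment 1 (1 / 2) / local_integral 1 (1 / 2)) <= ln B.
Proof.
have : ln pi - psi 4^-1 <= ln B := digamma_quarter_le psi_rec psi_ge.
have : ln A <= ln pi - psi 4^-1 := digamma_quarter_ge psi_rec psi_le.
rewrite /psi (_ : 2 * 4^-1 = 1 / 2); last by field.
exact: bracket1.
Qed.

(** Differentiating [local_integral2] expresses the middle term through the real factor at 1; it is
    2 (ln pi + ln 2 - digamma(1/2)). *)
Lemma local_psi2 : 2 * ln A <= - 2 * (local_moment 2 (1 / 2) / local_integral 2 (1 / 2)) <= 2 * ln B.
Proof.
have h0 : 0 < 1 / 2 :> R by lra.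
have g1 := local_integral_gt0 (ltn0Sn 0) (@ltr01 R).
have E : local_moment 2 (1 / 2 : R) / local_integral 2 (1 / 2) = - ln 2 + 2 * (local_moment 1 1 / local_integral 1 1).
  have d1 := @local_factor_cdiff R 2 (1 / 2)%:C isT h0.
  have d2 : cdiff (fun z : C => local_factor 1 (2 * z)) (1 / 2)%:C (local_factor' 1 (2 * (1 / 2)%:C) * 2).
    apply: (@cdiff_comp _ (local_factor 1) _ _ _ _ (cdiff_scale 2 (1 / 2)%:C)); apply: local_factor_cdiff => //.
    by rewrite real_complex2 -rmorphM /=; lra.
  have d3 := cdiffM (cexp_scale_cdiff (- ln 2)%:C (1 / 2)%:C) d2.
  have E2 : local_moment 2 (1 / 2 : R) = expR (- ln 2 * (1 / 2)) * - ln 2 * local_integral 1 1 + expR (- ln 2 * (1 / 2)) * (local_moment 1 1 * 2).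
    apply: (@complexI R); rewrite -local_factor'_real (cdiff_uniq h0 d1 d3) => [|x _].
      have -> : 2 * (1 / 2)%:C = 1%:C :> C by rewrite real_complex2 -rmorphM; congr (_%:C); field.
      by rewrite /= local_factor_real local_factor'_real -!rmorphM cexpR real_complex2 -!rmorphM -rmorphD.
    rewrite -rmorphD local_factor_real local_integral2 /= real_complex2 -!rmorphM cexpR local_factor_real -rmorphM.
    by congr (expR _ * _)%:C; ring.
  rewrite E2 local_integral2 (_ : 2 * (1 / 2) = 1); last by field.
  rewrite (_ : - (1 / 2 * ln 2) = - ln 2 * (1 / 2)); last by ring.
  by field; rewrite !gt_eqF // expR_gt0.
rewrite E; have : ln A <= ln pi + ln 2 - psi 2^-1 := digamma_half_ge psi_rec psi_le.
have : ln pi + ln 2 - psi 2^-1 <= ln B := digamma_half_upper psi_rec psi_ge.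
rewrite /psi (_ : 2 * 2^-1 = 1); last by field.
exact: bracket2.
Qed.

End LocalDigamma.

(** * The critical point *)

Section CriticalPoint.
Variables (R : realType) (K : fieldExtType rat) (zeta : R[i]^o -> R[i]^o).
Hypothesis zetaP : is_dedekind_zeta K zeta.
Local Notation C := R[i].
Variables (r n : nat) (m : 'I_r -> nat) (L : C -> C) (d : R).
Hypotheses (d0 : 0 < d) (n0 : (0 < n)%N) (m12 : forall i, m i = 1%N \/ m i = 2%N)
  (L_holo : forall z, cdiffable L z) (L_sym : forall s : R, L (1 - s)%:C = L s%:C).
Let N : R := n%:R.
Hypothesis L_eq : forall s : R, 1 < s -> L s%:C = ((expR (N / 2 - s * N) + expR (s * N - N / 2) - (expR (N / 2) + expR (- (N / 2)))) *
  \prod_i local_integral (m i) s * expR (s * (ln d / 2)))%:C * zeta s%:C.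

Let k0 : R := expR (N / 2) + expR (- (N / 2)).
Let p (z : C) : C := cexp ((- N)%:C * z + (N / 2)%:C) + cexp (N%:C * z + (- (N / 2))%:C) - k0%:C.
Let gam (z : C) : C := (\prod_i local_factor (m i) z) * cexp ((ln d / 2)%:C * z).
Let phi (i : 'I_r) : R := local_moment (m i) (1 / 2) / local_integral (m i) (1 / 2).
Let S : R := \sum_i phi i + ln d / 2.
Let h : C := (1 / 2 : R)%:C.

Let m_gt0 i : (0 < m i)%N. Proof. by have [->|->] := m12 i. Qed.

Let N0 : 0 < N. Proof. by rewrite /N ltr0n. Qed.

Let affine_cdiff (a b : R) (z : C) : cdiff (fun w : C => cexp (a%:C * w + b%:C)) z (cexp (a%:C * z + b%:C) * a%:C).
Proof.
have D : cdiff (fun w : C => a%:C * w + b%:C) z a%:C.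
  by rewrite -[X in cdiff _ _ X]addr0; apply: cdiffD; [exact: cdiff_scale|exact: cdiff_cst].
by apply: (@cdiff_comp R (@cexp R) _ _ _ _ D); exact: cexp_cdiff.
Qed.

Let p_cdiff z : cdiff p z (cexp ((- N)%:C * z + (N / 2)%:C) * (- N)%:C + cexp (N%:C * z + (- (N / 2))%:C) * N%:C - 0).
Proof. by apply: cdiffB; [apply: cdiffD; exact: affine_cdiff|exact: cdiff_cst]. Qed.

Let p_critical : cdiff p h 0.
Proof.
have := p_cdiff h; rewrite subr0 /h -!rmorphM -!rmorphD.
rewrite (_ : - N * (1 / 2) + N / 2 = 0); last by field.
rewrite (_ : N * (1 / 2) + - (N / 2) = 0); last by field.
by rewrite -mulrDr -rmorphD addNr rmorph0 mulr0.
Qed.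

Let p_real (s : R) : p s%:C = (expR (N / 2 - s * N) + expR (s * N - N / 2) - k0)%:C.
Proof.
rewrite /p -!rmorphM -!rmorphD !cexpR -rmorphD -rmorphB.
by congr (expR _ + expR _ - _)%:C; ring.
Qed.

(** The value is 2 - (q + 1 / q) with q = e^(n/2) > 1. *)
Let p_neq0 : p h != 0.
Proof.
rewrite p_real (_ : N / 2 - 1 / 2 * N = 0); last by field.
rewrite (_ : 1 / 2 * N - N / 2 = 0); last by field.
rewrite expR0 -(rmorph0 (real_complex R)) (inj_eq (@complexI R)) lt_eqF // /k0 expRN.
have x0 : 0 < N / 2 by rewrite divr_gt0.
have := expR_gt1Dx (lt0r_neq0 x0); set e := expR _ => e1.
have e0 : 0 < e by exact: expR_gt0.
rewrite subr_lt0 -(ltr_pM2r e0) [X in _ < X]mulrDl mulVf ?gt_eqF //.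
rewrite -subr_gt0 (_ : _ - _ = (e - 1) ^+ 2); last by ring.
by rewrite exprn_gt0 // subr_gt0; lra.
Qed.

Let prod_cdiff (I : Type) (s : seq I) (f : I -> C -> C) (a : I -> C) z : (forall i, cdiff (f i) z (f i z * a i)) ->
  cdiff (fun w => \prod_(i <- s) f i w) z ((\prod_(i <- s) f i z) * \sum_(i <- s) a i).
Proof.
move=> H; elim: s => [|i s IH].
  by rewrite !big_nil mulr0; apply: cdiff_ext (cdiff_cst 1 z); exists 1 => // w _; rewrite !big_nil.
have := cdiffM (H i) IH; rewrite !big_cons (_ : _ + _ = f i z * (\prod_(j <- s) f j z) * (a i + \sum_(j <- s) a j)); last by ring.
by apply: cdiff_ext; exists 1 => // w _; rewrite !big_cons.
Qed.

Let gam_cdiffable z : 0 < Re z -> cdiffable gam z.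
Proof.
move=> z0; apply: cdiffableM; last by eexists; exact: cexp_scale_cdiff.
elim: (index_enum _) => [|i s [l IH]].
  by exists 0; apply: cdiff_ext (cdiff_cst 1 z); exists 1 => // w _; rewrite !big_nil.
have [l' H] : cdiffable (fun w => local_factor (m i) w * \prod_(j <- s) local_factor (m j) w) z.
  by apply: cdiffableM; [eexists; exact: local_factor_cdiff|exists l].
by exists l'; apply: cdiff_ext H; exists 1 => // w _; rewrite !big_cons.
Qed.

Let gam_critical : cdiff gam h (gam h * S%:C).
Proof.
have h0 : 0 < Re h by rewrite /=; lra.
have D1 : cdiff (fun w => \prod_i local_factor (m i) w) h ((\prod_i local_factor (m i) h) * \sum_i (phi i)%:C).
  apply: prod_cdiff => i.
  rewrite (_ : _ * _ = local_factor' (m i) h); first exact: local_factor_cdiff.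
  rewrite /h local_factor_real local_factor'_real -rmorphM; congr (_%:C).
  rewrite /phi mulrC divfK // gt_eqF // local_integral_gt0 //; lra.
have := cdiffM D1 (cexp_scale_cdiff (ln d / 2)%:C h); congr (cdiff _ _ _).
by rewrite /gam /S rmorphD rmorph_sum /=; ring.
Qed.

Let gam_real (s : R) : gam s%:C = (\prod_i local_integral (m i) s * expR (s * (ln d / 2)))%:C.
Proof.
rewrite /gam -rmorphM cexpR [in RHS]rmorphM rmorph_prod /= [s * _]mulrC; congr (_ * _).
by apply: eq_bigr => i _; rewrite local_factor_real.
Qed.

Let gam_neq0 : gam h != 0.
Proof.
rewrite gam_real -(rmorph0 (real_complex R)) (inj_eq (@complexI R)) gt_eqF //.
rewrite mulr_gt0 ?expR_gt0 // prodr_gt0 // => i _; rewrite local_integral_gt0 //; lra.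
Qed.

Let zeta_cdiff (z : C) : z != 1 -> cdiff zeta z (derive1 zeta z).
Proof. by have [_ H _] := zetaP => /H/derivable_cdiff. Qed.

(* The pole of zeta at 1 is removed by the factor (z - 1)^2. *)
Let pole_cdiffable : cdiffable (fun z : C => (z - 1) ^+ 2 * zeta z) 1.
Proof.
have [_ _ [c _ /cvgrPdist_le H]] := zetaP; exists c => e e0.
have /H : 0 < e%:C :> C by rewrite ltcR.
move=> /nbhs_ballP[e' /= e'0 He']; move: e'0; rewrite ltcE /= => /andP[/eqP ie re].
exists (Re e') => // u ur; rewrite subrr expr0n mul0r subr0 addrAC subrr add0r.
have [->|u0] := eqVneq u 0.
  by rewrite expr0n mul0r mulr0 subr0 ComplexField.Normc.normc0 mulr0.
have : `|c - (1 + u - 1) * zeta (1 + u)| <= e%:C.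
  apply: He'; last by rewrite -subr_eq0 addrAC subrr add0r.
  by rewrite -ball_normE /= opprD addrA subrr add0r normrN normC_normc ltcE /= ie eqxx.
rewrite addrAC subrr add0r normC_normc lecR => H1.
rewrite (_ : _ - _ = u * - (c - u * zeta (1 + u))); last by ring.
by rewrite normcM normcN mulrC ler_wpM2r ?normc_ge0.
Qed.

(** With the square, the first term is 0 at the pole whatever value [zeta] takes there; [f] is then
    holomorphic on Re z > 0, and the identity theorem can pass across 1. *)
Let f (z : C) : C := (z - 1) ^+ 2 * zeta z * (p z * gam z) - (z - 1) ^+ 2 * L z.

Let f_cdiffable z : 0 < Re z -> cdiffable f z.
Proof.
move=> z0; have q (w : C) : cdiffable (fun z : C => (z - 1) ^+ 2) w.
  by apply: cdiffableX; eexists; apply: cdiffB; [exact: cdiff_id|exact: cdiff_cst].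
have [l1 H1] : cdiffable (fun z : C => (z - 1) ^+ 2 * zeta z) z.
  have [->|z1] := eqVneq z 1; first exact: pole_cdiffable.
  by apply: cdiffableM => //; eexists; exact: zeta_cdiff.
have [l2 H2] : cdiffable (fun z => p z * gam z) z by apply: cdiffableM; [eexists; exact: p_cdiff|exact: gam_cdiffable].
have [l3 H3] := cdiffableM (q z) (L_holo z).
by eexists; exact: cdiffB (cdiffM H1 H2) H3.
Qed.

Let zeta_L x : `|x| < 1 / 4 -> zeta (h + x%:C) * (p (h + x%:C) * gam (h + x%:C)) = L (h + x%:C).
Proof.
(* The square of half side 29 / 10 about 3 stays in Re z > 0, a real interval about its centre lies
   in s > 1, and its inscribed disc contains 1 / 2 + x for |x| < 1 / 4. *)
rewrite ltr_norml => /andP[x1 x2]; pose a : R := 29 / 10; pose c : C := (3 : R)%:C.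
have a0 : 0 < a by rewrite /a; lra.
have F : f (h + x%:C) = 0.
  apply: (@identity_theorem R f c a a0).
  - move=> [u v]; rewrite /inrect /= => /andP[/andP[u1 _] _]; apply: f_cdiffable => /=; rewrite /a in u1; lra.
  - exists 1 => // y; rewrite ltr_norml => /andP[y1 y2].
    rewrite /c -rmorphD; have s1 : 1 < 3 + y by lra.
    by rewrite /f L_eq // p_real gam_real /k0; ring.
  - rewrite /h /c -rmorphD -rmorphB normcR /a ltr_norml; apply/andP; split; lra.
have n1 : (h + x%:C - 1) ^+ 2 != 0.
  rewrite expf_eq0 /= /h -rmorphD -(rmorph1 (real_complex R)) -rmorphB -(rmorph0 (real_complex R)) (inj_eq (@complexI R)).
  by rewrite lt_eqF //; lra.
by apply: (mulfI n1); apply/eqP; rewrite mulrA -subr_eq0; apply/eqP.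
Qed.

(** The symmetry makes the derivative its own negative. It is known at real points only, which is
    enough by [cdiff_uniq]. *)
Let L_critical : cdiff L h 0.
Proof.
have [l Hl] := L_holo h.
have D : cdiff (fun z : C => 1 - z) h (- 1).
  by rewrite -[- 1]add0r; apply: cdiffB; [exact: cdiff_cst|exact: cdiff_id].
have hh : 1 - h = h by rewrite /h -(rmorph1 (real_complex R)) -rmorphB; congr (_%:C); field.
have H2 : cdiff (L \o fun z : C => 1 - z) h (l * - 1) by apply: (cdiff_comp D); rewrite hh.
have : l * - 1 = l.
  apply: (cdiff_uniq ltr01 H2 Hl) => x _ /=.
  by rewrite /h -rmorphD -L_sym -(rmorph1 (real_complex R)) -rmorphB.
rewrite mulrN1 => /eqP; rewrite eq_sym -addr_eq0 -mulr2n mulrn_eq0 /= => /eqP l0.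
by rewrite l0 in Hl.
Qed.

Lemma zeta_log_derivative : derive1 zeta h + zeta h * S%:C = 0.
Proof.
have h1 : h != 1 by rewrite /h -(rmorph1 (real_complex R)) (inj_eq (@complexI R)) lt_eqF //; lra.
have q0 : 0 < 1 / 4 :> R by lra.
have := cdiff_uniq q0 (cdiffM (zeta_cdiff h1) (cdiffM p_critical gam_critical)) L_critical zeta_L.
rewrite mul0r add0r => E; have pg : p h * gam h != 0 by exact: mulf_neq0 p_neq0 gam_neq0.
by apply: (mulIf pg); rewrite mul0r -E; ring.
Qed.

End CriticalPoint.

(* The logarithmic derivative of the archimedean part at 1/2 vanishes only if d lies in the forbidden interval. *)
Theorem zeta_critical_iff (R : realType) (K : fieldExtType rat) (zeta : R[i]^o -> R[i]^o) (d := `|ratr (discriminant K) : R|) :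
  (0 < \dim {:K})%N -> d \notin `[(44 + 763 / 1000) ^+ \dim {:K}, (215 + 333 / 1000) ^+ \dim {:K}] ->
  is_dedekind_zeta K zeta -> (zeta (1 / 2) = 0 <-> derive1 zeta (1 / 2) = 0).
Proof.
move=> n0 dI zP; have [r [m [L [d0 [m12 mE] L_holo L_sym L_eq]]]] := dedekind_zeta_completed zP.
have := zeta_log_derivative zP n0 m12 L_holo L_sym L_eq; set S := (_ + _ : R) => E.
have hE : (1 / 2 : R)%:C = 1 / 2 :> R[i] by rewrite rmorphM fmorphV rmorph1 rmorph_nat.
rewrite hE in E; split=> z0; first by move: E; rewrite z0 mul0r addr0.
move: E; rewrite z0 add0r => /eqP; rewrite mulf_eq0 => /orP[/eqP //|S0]; exfalso.
have {S0} S0 : S = 0 by apply: (@complexI R); rewrite rmorph0; exact/eqP.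
move/negP: dI; apply; rewrite in_itv /=.
pose A : R := 44 + 763 / 1000; pose B : R := 215 + 333 / 1000.
have A0 : 0 < A by rewrite /A; lra.
have B0 : 0 < B by rewrite /B; lra.
(* [S = 0] says that the [q i] add up to [ln d]; each [q i] lies between m_i ln A and m_i ln B, and
   the m_i add up to the degree. *)
pose q i : R := - 2 * (local_moment (m i) (1 / 2) / local_integral (m i) (1 / 2)).
have qb i : (m i)%:R * ln A <= q i <= (m i)%:R * ln B.
  have Q1 := @local_psi1 R; have Q2 := @local_psi2 R; rewrite -/A -/B in Q1 Q2; rewrite /q.
  have [->|->] := m12 i; last exact: Q2.
  by rewrite (mul1r (ln A)) (mul1r (ln B)); exact: Q1.
have qS : \sum_i q i = ln d.
  by rewrite /q -mulr_sumr; move: S0; rewrite /S => /(canRL (addrK _)) ->; field.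
have E1 (a : R) : \sum_i (m i)%:R * ln a = ln a *+ \dim {:K}.
  by rewrite -mulr_suml -natr_sum mE mulr_natl.
apply/andP; split.
- rewrite -ler_ln ?posrE ?exprn_gt0 // lnXn // -E1 -qS; apply: ler_sum => i _; by case/andP: (qb i).
- rewrite -ler_ln ?posrE ?exprn_gt0 // lnXn // -E1 -qS; apply: ler_sum => i _; by case/andP: (qb i).
Qed.

Theorem theorem4 (R : realType) (K : fieldExtType rat) (n : nat)
    (zeta : R[i]^o -> R[i]^o) :
  \dim {:K} = n -> (3 < n)%N ->
  `|ratr (discriminant K) : R|
    \notin `[(44 + 763 / 1000) ^+ n, (215 + 333 / 1000) ^+ n] ->
  is_dedekind_zeta K zeta ->
  (zeta (1 / 2) = 0 <-> derive1 zeta (1 / 2) = 0).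
Proof. by move=> <- n3; apply: zeta_critical_iff; exact: ltn_trans n3. Qed.
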